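(* Let $L$ be a self-adjoint operator in a separable complex Hilbert space $\mathcal H$ with $\langle Lu,u\rangle\ge0$ for all $u$ in its domain and $(L+I)^{-1}\in\mathcal B^p(\mathcal H)$ for some $p\ge1$. Assume that $$\operatorname{tr}(e^{-tL})\sim\sum_{\alpha\in\mathcal A}\sum_{k=0}^{k_\alpha}A^H_{\alpha k}\,t^\alpha\log^kt,\qquad t\to0+,$$ where $\mathcal A\subset\mathbb C$ is discrete, has finite intersection with each finite vertical strip, and $+\infty$ is the only accumulation point of $\operatorname{Re}\alpha$, $\alpha\in\mathcal A$, and assume that $A^H_{-n,k}=0$ for all $n\in\mathbb Z_+$ and $k>0$. Then $\zeta(s;L+z)$ is holomorphic for $(s,z)$ in a neighbourhood of $(0,0)$, and for every integer $n>0$ $$\frac{d^n}{dz^n}\log\det\nolimits_\zeta(L+z)\Big|_{z=0}=(-1)^{n-1}(n-1)!\Bigl(\operatorname{Pf}_{s=n}\zeta(s;L)+\frac{A^H_{-n,0}}{(n-1)!}\,L_{n-1}\Bigr),$$ where $L_{n-1}=\sum_{j=1}^{n-1}\frac1j$. Therefore the Taylor expansion of $\log\det_\zeta(L+z)$ about $z=0$ reads $$\log\det\nolimits_\zeta(L+z)=\log\det\nolimits_\zeta(L)+\sum_{n=1}^\infty\frac{(-1)^{n-1}}{n}\bigl(\operatorname{Pf}_{s=n}\zeta(s;L)\bigr)z^n+\sum_{n=1}^\infty\frac{(-1)^{n-1}}{n!}L_{n-1}A^H_{-n,0}\,z^n,$$ where the last sum is in fact finite.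
   Context: $\mathbb Z_+=\{0,1,2,\dots\}$; $\mathcal B^p(\mathcal H)$ is the Schatten class of order $p$; $A^H_{\alpha k}:=0$ for all pairs $(\alpha,k)$ not occurring in the heat expansion. $\zeta(s;L)=\sum_{\lambda\in\operatorname{spec}L\setminus\{0\}}\lambda^{-s}$ and, for $z$ near $0$, $\zeta(s;L+z)=\sum_{\lambda\in\operatorname{spec}L\setminus\{0\}}(\lambda+z)^{-s}$ (eigenvalues $\lambda$ of $L$ with multiplicity, principal branch), both for $\operatorname{Re}s>p$ and then continued meromorphically in $s$. $\log\det_\zeta(L+z):=-\partial_s\zeta(s;L+z)|_{s=0}$ for $z$ near $0$ (in particular $\log\det_\zeta(L)=-\zeta'(0;L)$). $\operatorname{Pf}_{s=n}F(s)$ is the constant term in the Laurent expansion of $F$ at $s=n$. The numbers $L_{n-1}$ are not to be confused with the operator $L$. *)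

(* Defs.v *)
(* MathComp / MathComp-Analysis *)
From HB Require Import structures.
From mathcomp Require Import all_boot all_order all_algebra.
From mathcomp Require Import sesquilinear complex finmap.
From mathcomp Require Import all_classical all_reals all_analysis.
From mathcomp Require showcase.summability.

Set Implicit Arguments.
Unset Strict Implicit.
Unset Printing Implicit Defensive.

Import Order.TTheory GRing.Theory Num.Theory Num.Def.
Import numFieldNormedType.Exports.

Local Open Scope classical_set_scope.
Local Open Scope ring_scope.
Local Open Scope complex_scope.

(* The topology and the C-normed space structure of C = R[i]; derivatives of
   functions on R[i] are therefore complex derivatives. *)
#[warning="-redundant-canonical-projection"]
HB.instance Definition _ (R : rcfType) := NormedModule.copy R[i] R[i]^o.

Section ComplexFunctions.
Context {R : realType}.
Local Notation C := R[i].

Definition cmod (w : C) : R := complex.Re `|w|.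

(* principal argument, in ]-pi, pi] *)
Definition carg (w : C) : R :=
  let a := acos (complex.Re w / cmod w) in
  if 0 <= complex.Im w then a else - a.

Definition clog (w : C) : C := ln (cmod w) +i* carg w.

Definition cexp (w : C) : C :=
  (expR (complex.Re w))%:C * (cos (complex.Im w) +i* sin (complex.Im w)).

(* principal branch, for w != 0 *)
Definition cpow (w s : C) : C := cexp (s * clog w).

(* unordered summation over D: limit along the net of finite subsets *)
Definition has_sum (I : choiceType) (D : set I) (f : I -> C) (l : C) :=
  (\sum_(i <- J) (f \_ D) i) @[J --> @summability.totally I] --> l.

(* F(s) = \sum_(k >= 0) a_k (s - s0)^(k - m) for s != s0 near s0 *)
Definition has_laurent (F : C -> C) (s0 : C) (m : nat) (a : nat -> C) :=
  \forall s \near s0^',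
    (series (fun k : nat => a k * (s - s0) ^ (k%:Z - m%:Z)%R) : nat -> C)
      @ \oo --> F s.

(* Meromorphic functions on C are total functions: the value at a pole is
   irrelevant, the value at a point that is not a pole is the constant term of
   the expansion, so that F is holomorphic there. *)
Definition meromorphic (F : C -> C) :=
  forall s0 : C, exists m a, has_laurent F s0 m a /\
    ((forall k, (k < m)%N -> a k = 0) -> F s0 = a m).

Definition Pf (F : C -> C) (s0 : C) : C :=
  get [set c | exists m a, has_laurent F s0 m a /\ c = a m].

(* \sum_(a in A) \sum_(k <= d a) c a k t^a log^k t is an asymptotic expansion
   of h(t) as t -> 0+ *)
Definition heat_expansion (h : R -> C) (A : set C) (d : C -> nat)
    (c : C -> nat -> C) :=
  forall N : R,
    (h t - \sum_(a \in A `&` [set a | complex.Re a <= N])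
             \sum_(k < (d a).+1) c a k * cpow t%:C a * ((ln t)%:C) ^+ k)
      / (t `^ N)%:C @[t --> 0^'+] --> (0 : C).

Definition exponent_set (A : set C) :=
  [/\ A `<=` isolated A,
      forall x y : R, finite_set (A `&` [set a | x <= complex.Re a <= y]) &
      limit_point [set (complex.Re a)%:E | a in A] = [set +oo%E]].

End ComplexFunctions.

Section HilbertSpace.
Context {R : realType} {H : completeNormedModType R[i]}.
Local Notation C := R[i].

Definition separable_space := exists S : set H, countable S /\ dense S.

(* number of eigenvalues with multiplicity: (l, j) is an index iff the
   eigenspace of l has dimension > j, so that every eigenvalue l occurs
   exactly dim ker(T - l) times *)
Definition eigen_index (D : set H) (T : H -> H) : set (C * nat) :=
  [set x | exists f : 'I_x.2.+1 -> H,
    (forall i, D (f i) /\ T (f i) = x.1 *: f i) /\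
    (forall c : 'I_x.2.+1 -> C, \sum_i c i *: f i = 0 -> forall i, c i = 0)].

Definition nonzero_eigen_index (D : set H) (T : H -> H) : set (C * nat) :=
  eigen_index D T `&` [set x : C * nat | x.1 != 0].

(* (possibly unbounded) operators in H; the values outside the domain are
   irrelevant *)
Record operator := Operator {
  dom : set H;
  op :> H -> H;
  dom0 : dom 0;
  dom_linear : forall (a : C) u v, dom u -> dom v -> dom (a *: u + v);
  op_linear : forall (a : C) u v, dom u -> dom v ->
    op (a *: u + v) = a *: op u + op v }.

(* (L + z)^{-1} *)
Definition resolvent (L : operator) (z : C) (v : H) : H :=
  get [set u | dom L u /\ L u + z *: u = v].

(* U t = e^{-tL}: contraction semigroup with generator -L *)
Definition is_heat_semigroup (L : operator) (U : R -> H -> H) :=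
  [/\ U 0 = id,
      forall s t : R, 0 <= s -> 0 <= t -> U (s + t) = U s \o U t,
      forall t : R, 0 <= t -> linear (U t) /\ (forall u, `|U t u| <= `|u|),
      forall u, U t u @[t --> 0^'+] --> u &
      forall u v : H, (t^-1)%:C *: (U t u - u) @[t --> 0^'+] --> v <->
        dom L u /\ v = - L u].

Definition heat (L : operator) : R -> H -> H :=
  get [set U | is_heat_semigroup L U].

Variable dot : {dot H for conjC}.

Definition selfadjoint (L : operator) :=
  dense (dom L) /\
  (* the graph of the adjoint of L is the graph of L *)
  forall v w, (forall u, dom L u -> dot (L u) v = dot u w) <->
    dom L v /\ w = L v.

Definition nonneg_operator (L : operator) :=
  forall u, dom L u -> 0 <= dot (L u) u.

Definition adjoint (T : H -> H) (v : H) : H :=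
  get [set w | forall u, dot (T u) v = dot u w].

Definition compact_operator (T : H -> H) :=
  linear T /\ compact (closure [set T u | u in [set u | `|u| <= 1]]).

(* the singular values of T are the square roots of the nonzero eigenvalues of
   T^* T, repeated according to multiplicity *)
Definition schatten (p : R) (T : H -> H) :=
  compact_operator T /\
  (\esum_(x in nonzero_eigen_index setT (adjoint T \o T))
     (Num.sqrt (complex.Re x.1) `^ p)%R%:E < +oo)%E.

Definition orthonormal_basis (E : set H) :=
  (forall e e', E e -> E e' -> dot e e' = (e == e')%:R) /\
  (forall u, (forall e, E e -> dot u e = 0) -> u = 0).

Definition trace (T : H -> H) : C :=
  get [set c | forall E, orthonormal_basis E ->
    has_sum E (fun e => dot (T e) e) c].

(* F is s |-> zeta(s; L + z): the meromorphic continuation to C of the sum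
   over the nonzero eigenvalues of L, which converges for Re s > p *)
Definition is_zeta (p : R) (L : operator) (z : C) (F : C -> C) :=
  meromorphic F /\
  forall s, p < complex.Re s ->
    has_sum (nonzero_eigen_index (dom L) L)
      (fun x => cpow (x.1 + z) (- s)) (F s).

Definition zeta (p : R) (L : operator) (z : C) : C -> C :=
  get [set F | is_zeta p L z F].

Definition logdet (p : R) (L : operator) (z : C) : C :=
  - derive1 (zeta p L z) 0.

End HilbertSpace.

Arguments operator {R} H.
Arguments separable_space {R} H.

(* L_m = \sum_(1 <= j <= m) 1/j *)
Definition harmonic_number {R : realType} (m : nat) : R[i] :=
  \sum_(1 <= j < m.+1) j%:R^-1.

(* Main.v *)
Require Import Defs.
From HB Require Import structures.
From mathcomp Require Import all_boot all_order all_algebra.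
From mathcomp Require Import sesquilinear complex finmap.
From mathcomp Require Import all_classical all_reals all_analysis.
From mathcomp Require Import measurable_realfun ring lra.
From mathcomp Require showcase.summability.

Set Implicit Arguments.
Unset Strict Implicit.
Unset Printing Implicit Defensive.

Import Order.TTheory GRing.Theory Num.Theory Num.Def.
Import numFieldNormedType.Exports.

Local Open Scope classical_set_scope.
Local Open Scope ring_scope.
Local Open Scope complex_scope.

(* The resolvent T = (L + 1)^{-1} is compact, so L has an orthonormal eigenbasis and
   tr e^{-tL} is the sum of e^{-t l} over the eigenvalues l with multiplicity. With
   theta(t) the part of this sum coming from l != 0, Gamma(s) zeta(s; L) is the Mellin
   transform of theta, for t = e^x an integral over x in R. Subtracting the heat expansion
   on x < 0 continues it meromorphically: the term A t^a log^k t contributes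
   A (-1)^k k! / (s + a)^{k+1}. Since there are no logarithms at a = -n, zeta(s; L) is
   holomorphic at 0 and has at s = n at most a simple pole, with residue A_{-n,0} / (n-1)!.

   Expanding (l + z)^{-s} by the binomial series gives, for small z,
     zeta(s; L + z) = sum_n binom(-s, n) z^n zeta(s + n; L).
   The factor binom(-s, n) vanishes at s = 0 for n > 0 and cancels the pole, so each
   coefficient is holomorphic near s = 0 and the double series converges absolutely near
   (0, 0). As binom(-s, n) = ((-1)^n / n) s (1 + L_{n-1} s + O(s^2)), its derivative at
   s = 0 is ((-1)^n / n) (Pf_{s=n} zeta(s; L) + L_{n-1} Res_{s=n} zeta(s; L)).

   Complex analysis is based on power series whose coefficients satisfy
   sum |a_k| r^k <= M: this class is stable under sums, products, inverses and
   absolutely convergent series, by interchanging sums. *)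

(** The objects of the statement are choices made by [get]: [zeta], [resolvent], [heat], [adjoint],
    [trace] and [Pf] are total functions with a default value. Each is tied to an explicit
    construction by existence and by whatever uniqueness its specification gives. A heat semigroup
    is known only through its axioms, so its action on eigenvectors is derived from them. [trace]
    demands one value for all orthonormal bases, so the trace formula is proved for every basis. A
    meromorphic function is determined only off its poles; hence functions are compared on punctured
    neighbourhoods, and [Pf] serves to normalise values.

    Gamma is itself one of the continued Mellin transforms, that of e^(-t). The quotient by Gamma is
    taken among meromorphic functions; the values entering the result are its residue 1 at s = 0,
    which makes zeta holomorphic there, and Gamma(n) = (n - 1)!, which gives the residue at n. The
    multiplicity of the eigenvalue 0 adds a constant kappa to the heat trace; the term -kappa,
    appended to the expansion, has exponent 0 and leaves A_{-n,0} unchanged for n > 0. *)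

Section ComplexModulus.
Context {R : realType}.
Local Notation C := R[i].
Implicit Types w z : C.

Lemma cmodE w : `|w| = (cmod w)%:C.
Proof. by rewrite /cmod normc_def. Qed.

Lemma cmod_def w : cmod w = Num.sqrt (complex.Re w ^+ 2 + complex.Im w ^+ 2).
Proof. by rewrite /cmod normc_def. Qed.

Lemma cmod_ge0 w : 0 <= cmod w.
Proof. by rewrite cmod_def sqrtr_ge0. Qed.

Lemma cmodM w z : cmod (w * z) = cmod w * cmod z.
Proof. by apply: (@complexI R); rewrite rmorphM /= -!cmodE normrM. Qed.

Lemma cmodD w z : cmod (w + z) <= cmod w + cmod z.
Proof. by rewrite -lecR rmorphD /= -!cmodE ler_normD. Qed.

Lemma cmodN w : cmod (- w) = cmod w.
Proof. by rewrite /cmod normrN. Qed.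

Lemma cmodC w z : cmod (w - z) = cmod (z - w).
Proof. by rewrite /cmod distrC. Qed.

Lemma cmodB w z : cmod (w - z) <= cmod w + cmod z.
Proof. by rewrite -(cmodN z) cmodD. Qed.

Lemma cmod0 : cmod (0 : C) = 0.
Proof. by rewrite /cmod normr0. Qed.

Lemma cmod1 : cmod (1 : C) = 1.
Proof. by rewrite /cmod normr1. Qed.

Lemma cmod_eq0 w : (cmod w == 0) = (w == 0).
Proof. by rewrite -(normr_eq0 w) cmodE -(inj_eq (@complexI R)). Qed.

Lemma cmod_gt0 w : (0 < cmod w) = (w != 0).
Proof. by rewrite lt_def cmod_eq0 cmod_ge0 andbT. Qed.

Lemma cmodX w n : cmod (w ^+ n) = cmod w ^+ n.
Proof. by elim: n => [|n IH]; rewrite ?expr0 ?cmod1// !exprS cmodM IH. Qed.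

Lemma cmodV w : cmod w^-1 = (cmod w)^-1.
Proof.
have [->|w0] := eqVneq w 0; first by rewrite invr0 cmod0 invr0.
apply: (@mulfI _ (cmod w)); first by rewrite cmod_eq0.
by rewrite -cmodM divff// mulfV ?cmod_eq0// cmod1.
Qed.

Lemma cmod_real (x : R) : cmod x%:C = `|x|.
Proof. by rewrite cmod_def /= expr0n/= addr0 sqrtr_sqr. Qed.

Lemma cmod_nat n : cmod (n%:R : C) = n%:R.
Proof. by rewrite -(rmorph_nat (@real_complex R)) cmod_real normr_nat. Qed.

Lemma cmod_sum (I : Type) (r : seq I) (P : pred I) (F : I -> C) :
  cmod (\sum_(i <- r | P i) F i) <= \sum_(i <- r | P i) cmod (F i).
Proof.
elim/big_rec2: _ => [|i y1 y2 _ IH]; first by rewrite cmod0.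
by apply: le_trans (cmodD _ _) _; rewrite lerD2l.
Qed.

Lemma normr_Re w : `|complex.Re w| <= cmod w.
Proof. by rewrite cmod_def -sqrtr_sqr ler_wsqrtr// lerDl sqr_ge0. Qed.

Lemma normr_Im w : `|complex.Im w| <= cmod w.
Proof. by rewrite cmod_def -sqrtr_sqr ler_wsqrtr// lerDr sqr_ge0. Qed.

Lemma cmod_le w : cmod w <= `|complex.Re w| + `|complex.Im w|.
Proof.
rewrite cmod_def -[leRHS]ger0_norm ?addr_ge0// -sqrtr_sqr ler_wsqrtr//.
rewrite sqrrD !real_normK ?num_real// -subr_ge0.
have -> : forall a b c : R, a + b + c - (a + c) = b by move=> a b c; ring.
by rewrite mulrn_wge0// mulr_ge0.
Qed.

Lemma ReD w z : complex.Re (w + z) = complex.Re w + complex.Re z.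
Proof. by case: w; case: z. Qed.

Lemma ImD w z : complex.Im (w + z) = complex.Im w + complex.Im z.
Proof. by case: w; case: z. Qed.

Lemma ReN w : complex.Re (- w) = - complex.Re w.
Proof. by case: w. Qed.

Lemma ImN w : complex.Im (- w) = - complex.Im w.
Proof. by case: w. Qed.

Lemma ReB w z : complex.Re (w - z) = complex.Re w - complex.Re z.
Proof. by rewrite ReD ReN. Qed.

Lemma ImB w z : complex.Im (w - z) = complex.Im w - complex.Im z.
Proof. by rewrite ImD ImN. Qed.

Lemma Re_sum (I : Type) (r : seq I) (P : pred I) (F : I -> C) :
  complex.Re (\sum_(i <- r | P i) F i) = \sum_(i <- r | P i) complex.Re (F i).
Proof. by apply: (big_morph (@complex.Re R)) => // w z; rewrite ReD. Qed.

Lemma Im_sum (I : Type) (r : seq I) (P : pred I) (F : I -> C) :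
  complex.Im (\sum_(i <- r | P i) F i) = \sum_(i <- r | P i) complex.Im (F i).
Proof. by apply: (big_morph (@complex.Im R)) => // w z; rewrite ImD. Qed.

Lemma ReM w z : complex.Re (w * z) =
  complex.Re w * complex.Re z - complex.Im w * complex.Im z.
Proof. by case: w; case: z. Qed.

Lemma ImM w z : complex.Im (w * z) =
  complex.Re w * complex.Im z + complex.Im w * complex.Re z.
Proof. by case: w; case: z. Qed.

Lemma Re_natr n : complex.Re (n%:R : C) = n%:R.
Proof. by rewrite -(rmorph_nat (@real_complex R)). Qed.

Lemma complex_eqP w z :
  complex.Re w = complex.Re z -> complex.Im w = complex.Im z -> w = z.
Proof. by case: w => a b; case: z => c d /= -> ->. Qed.

(** * Neighbourhoods and limits in the complex plane, through the real modulus *)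

Lemma nearC_P (s0 : C) (P : set C) :
  (\forall s \near s0, P s) <->
  exists2 r : R, 0 < r & forall s, cmod (s - s0) < r -> P s.
Proof.
split=> [/nbhs_ballP [e /= e0 eP]|[r r0 rP]].
  exists (complex.Re e); first by move: e0; rewrite ltcE => /andP[].
  move=> s ss0; apply: eP; rewrite -ball_normE/= distrC cmodE.
  by move: e0; rewrite !ltcE /= => /andP[/eqP -> _]; rewrite eqxx.
apply/nbhs_ballP; exists r%:C => /=; first by rewrite ltcR.
by move=> s; rewrite -ball_normE/= distrC cmodE ltcR; exact: rP.
Qed.

Lemma dnearC_P (s0 : C) (P : set C) :
  (\forall s \near s0^', P s) <->
  exists2 r : R, 0 < r & forall s, s != s0 -> cmod (s - s0) < r -> P s.
Proof.
rewrite near_withinE; split=> [/nearC_P|] [r r0 rP].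
  by exists r => // s s_s0 ss0; apply: rP.
by apply/nearC_P; exists r => // s ss0 s_s0; apply: rP.
Qed.

Lemma cvgC_P (T : Type) (F : set_system T) {FF : Filter F} (f : T -> C) (l : C) :
  f @ F --> l <-> forall e : R, 0 < e -> \forall x \near F, cmod (f x - l) < e.
Proof.
split=> [fl e e0|fl].
  have /fl : \forall s \near l, cmod (s - l) < e by apply/nearC_P; exists e.
  by [].
by move=> P /nearC_P [r r0 rP]; near=> x; apply: rP; near: x; exact: fl.
Unshelve. all: by end_near. Qed.

Lemma cvgC_Re (T : Type) (F : set_system T) {FF : Filter F} (f : T -> C) (l : C) :
  f @ F --> l -> (fun x => complex.Re (f x)) @ F --> complex.Re l.
Proof.
move=> /cvgC_P fl; apply/cvgrPdist_lt => e e0; near=> x.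
rewrite distrC -ReB; apply: le_lt_trans (normr_Re _) _.
by near: x; exact: fl.
Unshelve. all: by end_near. Qed.

Lemma cvgC_Im (T : Type) (F : set_system T) {FF : Filter F} (f : T -> C) (l : C) :
  f @ F --> l -> (fun x => complex.Im (f x)) @ F --> complex.Im l.
Proof.
move=> /cvgC_P fl; apply/cvgrPdist_lt => e e0; near=> x.
rewrite distrC -ImB; apply: le_lt_trans (normr_Im _) _.
by near: x; exact: fl.
Unshelve. all: by end_near. Qed.

Lemma cvgC_pair (T : Type) (F : set_system T) {FF : Filter F} (f : T -> C)
    (a b : R) : (fun x => complex.Re (f x)) @ F --> a -> (fun x => complex.Im (f x)) @ F --> b ->
  f @ F --> (a +i* b : C).
Proof.
move=> /cvgrPdist_lt fa /cvgrPdist_lt fb; apply/cvgC_P => e e0; near=> x.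
apply: le_lt_trans (cmod_le _) _; rewrite ReB ImB /= (splitr e).
rewrite ltrD// distrC; near: x; [apply: fa|apply: fb]; exact: divr_gt0.
Unshelve. all: by end_near. Qed.

Lemma cvgC_real (T : Type) (F : set_system T) {FF : Filter F} (f : T -> R) (l : R) :
  f @ F --> l -> (fun x => (f x)%:C) @ F --> (l%:C : C).
Proof.
move=> fl; apply: (cvgC_pair (f := fun x => (f x)%:C)) => //.
exact: cvg_cst.
Qed.

Lemma cvgC_cmod (T : Type) (F : set_system T) {FF : Filter F} (f : T -> C) (l : C) :
  f @ F --> l -> (fun x => cmod (f x)) @ F --> cmod l.
Proof.
move=> /cvgC_P fl; apply/cvgrPdist_lt => e e0; near=> x.
have : cmod (f x - l) < e by near: x; exact: fl.
apply: le_lt_trans; rewrite ler_norml; apply/andP; split.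
  rewrite lerBrDr addrC lerBlDr; apply: le_trans (cmodD _ _).
  by rewrite addrC subrK.
rewrite lerBlDr cmodC; apply: le_trans (cmodD _ _); by rewrite subrK.
Unshelve. all: by end_near. Qed.

End ComplexModulus.

(** * Absolutely convergent complex series *)

Section ComplexSeries.
Context {R : realType}.
Local Notation C := R[i].
Implicit Types (a b : nat -> C) (M : R) (g : nat -> R).

(** Bounds on all partial sums are carried instead of convergence: for nonnegative terms they give
    convergence with an explicit bound on the sum, and they pass through comparison, finite sums and
    exchanges without mentioning limits. *)
Definition psum_le g M := forall n, \sum_(0 <= k < n) g k <= M.

Definition asum a M := psum_le (fun k => cmod (a k)) M.

Definition csum a : C := limn (series a).

Lemma psum_le_tail g M : (forall k, 0 <= g k) -> psum_le g M ->
  forall e : R, 0 < e -> exists N, forall n, \sum_(N <= k < n) g k <= e.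
Proof.
move=> g0 gM e e0.
have ndg : nondecreasing_seq (series g).
  by apply/nondecreasing_seqP => n; rewrite /series/= big_nat_recr//= lerDl.
have cg : cvgn (series g).
  apply: nondecreasing_is_cvgn => //.
  by exists M => _ [n _ <-]; exact: gM.
have /cvgrPdist_le/(_ _ e0) [N _ NP] := cg.
exists N => n; have [nN|Nn] := leqP n N; first by rewrite big_geq// ltW.
apply: (@le_trans _ _ (limn (series g) - series g N)).
  rewrite lerBrDl /series /= -big_cat_nat ?leq0n ?(ltnW Nn)//=.
  exact: (nondecreasing_cvgn_le ndg cg n).
by apply: le_trans (NP N (leqnn _)); exact: ler_norm.
Qed.

Lemma psum_le_ge0 g M : psum_le g M -> 0 <= M.
Proof. by move=> /(_ 0%N); rewrite big_geq. Qed.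

Lemma psum_le_dom g g' M :
  (forall k, g k <= g' k) -> psum_le g' M -> psum_le g M.
Proof. by move=> gg' g'M n; apply: le_trans (g'M n); exact: ler_sum. Qed.

Lemma psum_leW g M M' : M <= M' -> psum_le g M -> psum_le g M'.
Proof. by move=> MM' gM n; exact: le_trans (gM n) MM'. Qed.

Lemma asum_dom a g M : (forall k, cmod (a k) <= g k) -> psum_le g M -> asum a M.
Proof. by move=> ag; exact: psum_le_dom. Qed.

Lemma asum_ge0 a M : asum a M -> 0 <= M.
Proof. exact: psum_le_ge0. Qed.

Lemma psum_le_real_cvg g (h : nat -> R) M : (forall k, `|h k| <= g k) -> psum_le g M ->
  cvgn (series h).
Proof.
move=> hg gM; apply: normed_cvg.
rewrite /normed_series_of /series /=.
apply: nondecreasing_is_cvgn.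
  by apply/nondecreasing_seqP => n; rewrite big_nat_recr//= lerDl.
by exists M => _ [n _ <-]; apply: le_trans (gM n); exact: ler_sum.
Qed.

Lemma asum_is_cvg a M : asum a M -> cvgn (series a).
Proof.
move=> aM; apply/cvg_ex.
pose u := series (fun k => complex.Re (a k)).
pose v := series (fun k => complex.Im (a k)).
exists (limn u +i* limn v); apply: cvgC_pair.
  under eq_fun do rewrite /series/= Re_sum.
  exact: (psum_le_real_cvg (fun k => normr_Re (a k)) aM).
under eq_fun do rewrite /series/= Im_sum.
exact: (psum_le_real_cvg (fun k => normr_Im (a k)) aM).
Qed.

Lemma csum_cvg a M : asum a M -> series a @ \oo --> csum a.
Proof. exact: asum_is_cvg. Qed.

Lemma csum_unique a (l : C) : series a @ \oo --> l -> csum a = l.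
Proof. by move=> ?; exact/cvg_lim. Qed.

Lemma cmod_cvg_le (T : Type) (F : set_system T) {FF : ProperFilter F}
    (f : T -> C) (l : C) (M : R) :
  f @ F --> l -> (\forall x \near F, cmod (f x) <= M) -> cmod l <= M.
Proof.
move=> fl fM.
have cl : (fun x => cmod (f x)) @ F --> cmod l by exact: cvgC_cmod.
by rewrite -(cvg_lim _ cl)//; apply: limr_le => //; exact: (cvgP _ cl).
Qed.

Lemma csum_le a M : asum a M -> cmod (csum a) <= M.
Proof.
move=> aM; apply: (cmod_cvg_le (csum_cvg aM)); near=> n.
by apply: le_trans (aM n); exact: cmod_sum.
Unshelve. all: by end_near. Qed.

Lemma csum_tail_le a M (e : R) N : asum a M ->
  (forall n, \sum_(N <= k < n) cmod (a k) <= e) ->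
  cmod (csum a - \sum_(0 <= k < N) a k) <= e.
Proof.
move=> aM ae.
have aN : (fun n => series a n - \sum_(0 <= k < N) a k) @ \oo -->
    csum a - \sum_(0 <= k < N) a k.
  by apply: cvgB; [exact: csum_cvg aM | exact: cvg_cst].
apply: (cmod_cvg_le aN); near=> n.
have Nn : (N <= n)%N by near: n; exact: nbhs_infty_ge.
rewrite /series /= (big_cat_nat _ Nn)//= addrAC subrr add0r.
by apply: le_trans (ae n); exact: cmod_sum.
Unshelve. all: by end_near. Qed.

Lemma eq_csum a b : a =1 b -> csum a = csum b.
Proof. by move=> /funext ->. Qed.

Lemma csum0 : csum (fun=> 0) = 0.
Proof.
apply: csum_unique; rewrite (_ : series _ = fun=> 0); first exact: cvg_cst.
by apply/funext => n; rewrite /series/= big1.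
Qed.

Lemma csum_finite a N : (forall k, (N <= k)%N -> a k = 0) ->
  csum a = \sum_(0 <= k < N) a k.
Proof.
move=> aN; apply: csum_unique; apply: cvg_near_cst; near=> n.
have Nn : (N <= n)%N by near: n; exact: nbhs_infty_ge.
rewrite /series/= (big_cat_nat _ Nn)//= [X in _ + X]big1_seq ?addr0// => k.
by rewrite mem_index_iota => /andP[_ /andP[/aN]].
Unshelve. all: by end_near. Qed.

Lemma asumD a b M M' : asum a M -> asum b M' -> asum (fun k => a k + b k) (M + M').
Proof.
move=> aM bM' n; apply: le_trans (lerD (aM n) (bM' n)).
by rewrite -big_split; apply: ler_sum => k _; exact: cmodD.
Qed.

Lemma csumD a b M M' : asum a M -> asum b M' ->
  csum (fun k => a k + b k) = csum a + csum b.
Proof.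
move=> aM bM'; apply: csum_unique.
rewrite (_ : series _ = series a \+ series b).
  by apply: cvgD; [exact: csum_cvg aM | exact: csum_cvg bM'].
by apply/funext => n; rewrite /series /= big_split.
Qed.

Lemma asumZ a M (c : C) : asum a M -> asum (fun k => c * a k) (cmod c * M).
Proof.
move=> aM n; under eq_bigr do rewrite cmodM.
by rewrite -mulr_sumr ler_wpM2l ?cmod_ge0.
Qed.

Lemma csumZ a M (c : C) : asum a M -> csum (fun k => c * a k) = c * csum a.
Proof.
move=> aM; apply: csum_unique.
rewrite (_ : series _ = fun n => c * series a n); last first.
  by apply/funext => n; rewrite /series /= mulr_sumr.
by apply: cvgM; [exact: cvg_cst | exact: csum_cvg aM].
Qed.

Lemma asumN a M : asum a M -> asum (fun k => - a k) M.
Proof. by move=> aM n; under eq_bigr do rewrite cmodN; exact: aM. Qed.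

Lemma csumN a M : asum a M -> csum (fun k => - a k) = - csum a.
Proof.
move=> aM; rewrite -mulN1r -(csumZ _ aM); apply: eq_csum => k.
by rewrite mulN1r.
Qed.

Lemma csumB a b M M' : asum a M -> asum b M' ->
  csum (fun k => a k - b k) = csum a - csum b.
Proof. by move=> aM bM'; rewrite (csumD aM (asumN bM')) (csumN bM'). Qed.

Lemma asumS a M : asum a M -> asum (fun k => a k.+1) M.
Proof.
move=> aM n; apply: le_trans (aM n.+1).
by rewrite [leRHS]big_nat_recl//= lerDr cmod_ge0.
Qed.

Lemma csumS a M : asum a M -> csum a = a 0%N + csum (fun k => a k.+1).
Proof.
move=> aM; apply: csum_unique.
rewrite -(cvg_shiftS (series a)).
rewrite (_ : (fun n => _) = fun n => a 0%N + series (fun k => a k.+1) n); last first.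
  by apply/funext => n; rewrite /series /= big_nat_recl.
by apply: cvgD; [exact: cvg_cst | exact: csum_cvg (asumS aM)].
Qed.

Lemma cvg_bigsum (K : numFieldType) (V : normedModType K) (I T : Type)
    (F : set_system T) {FF : Filter F} (r : seq I) (b : T -> I -> V) (c : I -> V) :
  (forall i, b^~ i @ F --> c i) ->
  (fun x => \sum_(i <- r) b x i) @ F --> \sum_(i <- r) c i.
Proof.
move=> bc; elim: r => [|i r IH].
  rewrite big_nil (_ : (fun _ => _) = fun=> 0); first exact: cvg_cst.
  by apply/funext => x; rewrite big_nil.
rewrite big_cons (_ : (fun _ => _) = fun x => b x i + \sum_(j <- r) b x j).
  exact: cvgD (bc i) IH.
by apply/funext => x; rewrite big_cons.
Qed.

(** Tannery's theorem: the dominating sequence makes all tails beyond some [N] small at once, and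
    the sums up to [N] converge termwise. *)
Lemma csum_dominated (T : Type) (F : set_system T) {FF : ProperFilter F}
    (b : T -> nat -> C) (c : nat -> C) g M :
  (\forall x \near F, forall k, cmod (b x k) <= g k) -> psum_le g M ->
  (forall k, b^~ k @ F --> c k) ->
  (fun x => csum (b x)) @ F --> csum c.
Proof.
move=> bg gM bc.
have cg k : cmod (c k) <= g k.
  by apply: (cmod_cvg_le (bc k)); apply: filterS bg => x.
have g0 k : 0 <= g k by exact: le_trans (cmod_ge0 _) (cg k).
apply/cvgC_P => e e0.
have e4 : 0 < e / 4 by rewrite divr_gt0.
have [N NP] := psum_le_tail g0 gM e4.
have /cvgC_P/(_ _ e4) bN :
    (fun x => \sum_(0 <= k < N) b x k) @ F --> \sum_(0 <= k < N) c k.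
  exact: cvg_bigsum.
near=> x.
have bxg : forall k, cmod (b x k) <= g k by near: x.
have h1 : cmod (csum (b x) - \sum_(0 <= k < N) b x k) <= e / 4.
  apply: (csum_tail_le (asum_dom bxg gM)) => n.
  by apply: le_trans (NP n); exact: ler_sum.
have h2 : cmod (csum c - \sum_(0 <= k < N) c k) <= e / 4.
  apply: (csum_tail_le (asum_dom cg gM)) => n.
  by apply: le_trans (NP n); exact: ler_sum.
have h3 : cmod (\sum_(0 <= k < N) b x k - \sum_(0 <= k < N) c k) < e / 4.
  by near: x; exact: bN.
rewrite (_ : csum (b x) - csum c = (csum (b x) - \sum_(0 <= k < N) b x k)
  + (\sum_(0 <= k < N) b x k - \sum_(0 <= k < N) c k)
  + - (csum c - \sum_(0 <= k < N) c k)); last by ring.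
apply: le_lt_trans (cmodD _ _) _; rewrite cmodN.
apply: (@le_lt_trans _ _ (e / 4 + e / 4 + e / 4)); last by lra.
rewrite lerD//; apply: le_trans (cmodD _ _) _; exact/lerD/ltW.
Unshelve. all: by end_near. Qed.

Lemma psum_le_sum (I : Type) (r : seq I) (h : I -> nat -> R) (M : I -> R) :
  (forall i, psum_le (h i) (M i)) ->
  psum_le (fun k => \sum_(i <- r) h i k) (\sum_(i <- r) M i).
Proof. by move=> hM n; rewrite exchange_big; apply: ler_sum => i _; exact: hM. Qed.

Lemma csum_bigsum (I : Type) (r : seq I) (h : I -> nat -> C) (M : I -> R) :
  (forall i, asum (h i) (M i)) ->
  csum (fun k => \sum_(i <- r) h i k) = \sum_(i <- r) csum (h i).
Proof.
move=> hM; elim: r => [|i r IH].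
  by rewrite big_nil -[RHS]csum0; apply: eq_csum => k; rewrite big_nil.
rewrite big_cons -IH.
have hr : asum (fun k => \sum_(j <- r) h j k) (\sum_(j <- r) M j).
  by apply: asum_dom (psum_le_sum r hM) => k; exact: cmod_sum.
by rewrite -(csumD (hM i) hr); apply: eq_csum => k; rewrite big_cons.
Qed.

Lemma asum_col (a : nat -> nat -> C) (M : nat -> R) M' :
  (forall i, asum (a i) (M i)) -> psum_le M M' -> forall j, asum (a^~ j) M'.
Proof.
move=> aM MM' j; apply: asum_dom MM' => i; apply: le_trans (aM i j.+1).
rewrite big_nat_recr//= lerDr; apply: sumr_ge0 => k _; exact: cmod_ge0.
Qed.

(** The partial sums over [i] are sums over [j] of finite sums, dominated by the absolute column
    sums [g j]. These add up to at most [M'], so the limit may be taken under the sum over [j]. *)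
Lemma csum_exchange (a : nat -> nat -> C) (M : nat -> R) M' :
  (forall i, asum (a i) (M i)) -> psum_le M M' ->
  csum (fun i => csum (a i)) = csum (fun j => csum (a^~ j)).
Proof.
move=> aM MM'.
have ac j : asum (a^~ j) M' := asum_col aM MM' j.
pose s j n := \sum_(0 <= i < n) cmod (a i j).
pose g j := limn (s j).
have cs j : cvgn (s j).
  apply: nondecreasing_is_cvgn.
    apply/nondecreasing_seqP => n.
    by rewrite /s big_nat_recr//= lerDl cmod_ge0.
  by exists M' => _ [n _ <-]; exact: ac.
have sg j n : s j n <= g j.
  apply: nondecreasing_cvgn_le => //; apply/nondecreasing_seqP => m.
  by rewrite /s big_nat_recr//= lerDl cmod_ge0.
have gM : psum_le g M'.
  move=> m; rewrite (_ : \sum_(0 <= k < m) g k = limn (fun n => \sum_(0 <= j < m) s j n)).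
    apply: limr_le.
      by apply: cvgP; apply: cvg_bigsum => j; exact: cs.
    near=> n; rewrite exchange_big/=; apply: le_trans (MM' n).
    by apply: ler_sum => i _; exact: aM.
  by apply/esym/cvg_lim => //; apply: cvg_bigsum => j; exact: cs.
apply: csum_unique.
rewrite (_ : series _ = fun n => csum (fun j => \sum_(0 <= i < n) a i j)).
  apply: (csum_dominated (g := g) (M := M')) => //.
    near=> n => j; apply: le_trans (sg j n); exact: cmod_sum.
  by move=> j; exact: csum_cvg (ac j).
apply/funext => n; rewrite /series /=.
by rewrite (csum_bigsum _ (M := M)).
Unshelve. all: by end_near. Qed.

(** The Cauchy product as an exchange of sums: in the triangular array [d], row [i] adds up to
    [a i * csum b] and column [k] to [c k]. *)
Lemma csum_mul a b M M' : asum a M -> asum b M' ->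
  let c k := \sum_(0 <= i < k.+1) a i * b (k - i)%N in
  asum c (M * M') /\ csum c = csum a * csum b.
Proof.
move=> aM bM' c.
pose d i k := if (i <= k)%N then a i * b (k - i)%N else 0.
have dS i j : d i (i + j)%N = a i * b j by rewrite /d leq_addr addKn.
have sd i n : \sum_(0 <= k < n) cmod (d i k) <= cmod (a i) * M'.
  have [ni|iN] := leqP n i.
    rewrite big1_seq; first by rewrite mulr_ge0 ?cmod_ge0//; exact: asum_ge0 bM'.
    move=> k; rewrite mem_index_iota => /andP[_ /andP[_ kn]].
    by rewrite /d leqNgt (leq_trans kn ni) cmod0.
  rewrite (big_cat_nat _ (ltnW iN))//= big1_seq ?add0r.
    rewrite -{1}(add0n i) big_addn; under eq_bigr do rewrite addnC dS cmodM.
    by rewrite -mulr_sumr ler_wpM2l ?cmod_ge0.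
  move=> k; rewrite mem_index_iota => /andP[_ /andP[_ ki]].
  by rewrite /d leqNgt ki cmod0.
have sM : psum_le (fun i => cmod (a i) * M') (M * M').
  by move=> n; rewrite -mulr_suml ler_wpM2r//; exact: asum_ge0 bM'.
have dc k : csum (d^~ k) = c k.
  rewrite (csum_finite (N := k.+1)) => [|i ki]; last first.
    by rewrite /d leqNgt ki.
  by apply: eq_big_nat => i; rewrite ltnS /d => /andP[_ ->].
have Ed := csum_exchange sd sM.
split.
  move=> n; apply: (@le_trans _ _ (\sum_(0 <= i < n) \sum_(0 <= k < n) cmod (d i k))).
    rewrite exchange_big /= big_nat [leRHS]big_nat; apply: ler_sum => k /andP[_ kn].
    rewrite [leRHS](big_cat_nat _ (n := k.+1))//=.
    rewrite -[leLHS]addr0 lerD//; last by apply: sumr_ge0 => *; exact: cmod_ge0.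
    rewrite (_ : c k = \sum_(0 <= i < k.+1) d i k); first exact: cmod_sum.
    by apply: eq_big_nat => i; rewrite ltnS /d => /andP[_ ->].
  by apply: le_trans (sM n); apply: ler_sum => i _; exact: sd.
transitivity (csum (fun k => csum (d^~ k))); first by apply: eq_csum => k; rewrite dc.
rewrite -Ed mulrC -(csumZ _ aM); apply: eq_csum => i.
rewrite mulrC -(csumZ _ bM').
apply: csum_unique.
rewrite -(@cvg_shiftn i); rewrite (_ : (fun n => _) = series (fun k => a i * b k)).
  exact: (csum_cvg (asumZ (a i) bM')).
apply/funext => n; rewrite /series /= (big_cat_nat _ (leq_addl n i))//=.
rewrite big1_seq ?add0r.
  rewrite -{1}(add0n i) big_addn addnK.
  by apply: eq_bigr => k _; rewrite addnC dS.
move=> k; rewrite mem_index_iota => /andP[_ /andP[_ ki]].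
by rewrite /d leqNgt ki.
Qed.

Lemma psum_le_geom (K q : R) : 0 <= K -> 0 <= q -> q < 1 ->
  psum_le (fun k => K * q ^+ k) (K / (1 - q)).
Proof.
move=> K0 q0 q1 n; rewrite -mulr_sumr ler_wpM2l//.
rewrite -[leRHS]mul1r ler_pdivlMr ?subr_gt0// big_mkord.
by rewrite mulrC -opprB mulNr -subrX1 opprB lerBlDr lerDl exprn_ge0.
Qed.

End ComplexSeries.

(** * Power series and meromorphic functions *)

Section PowerSeries.
Context {R : realType}.
Local Notation C := R[i].
Implicit Types (a b : nat -> C) (F G : C -> C) (r M : R) (s w : C).

(* The bound on the coefficients is a quantitative (Wiener algebra) norm. *)
Definition has_pseries r M (s0 : C) a F :=
  asum (fun k => a k * r%:C ^+ k) M /\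
  forall s, cmod (s - s0) <= r -> F s = csum (fun k => a k * (s - s0) ^+ k).

Definition analytic_at F (s0 : C) :=
  exists r M a, 0 < r /\ has_pseries r M s0 a F.

Definition cauchy_prod a b (k : nat) : C := \sum_(0 <= i < k.+1) a i * b (k - i)%N.

Lemma cmod_realX r k : 0 <= r -> cmod ((r%:C : C) ^+ k) = r ^+ k.
Proof. by move=> r0; rewrite cmodX cmod_real ger0_norm. Qed.

Lemma asum_disc r M a w : asum (fun k => a k * r%:C ^+ k) M -> cmod w <= r ->
  asum (fun k => a k * w ^+ k) M.
Proof.
move=> aM wr; apply: asum_dom aM => k; rewrite !cmodM cmod_realX.
  by rewrite ler_wpM2l ?cmod_ge0// cmodX lerXn2r// nnegrE ?(le_trans _ wr) ?cmod_ge0.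
by rewrite (le_trans _ wr)// cmod_ge0.
Qed.

Lemma asum_radius r r' M a : 0 <= r' -> r' <= r ->
  asum (fun k => a k * r%:C ^+ k) M -> asum (fun k => a k * r'%:C ^+ k) M.
Proof. by move=> r'0 r'r aM; apply: asum_disc aM _; rewrite cmod_real ger0_norm. Qed.

Lemma has_pseriesW r r' M M' s0 a F : 0 <= r' -> r' <= r -> M <= M' ->
  has_pseries r M s0 a F -> has_pseries r' M' s0 a F.
Proof.
move=> r'0 r'r MM' [aM aF]; split=> [|s sr].
  exact: psum_leW MM' (asum_radius r'0 r'r aM).
by apply: aF; exact: le_trans r'r.
Qed.

Lemma eq_has_pseries r M s0 a F G : has_pseries r M s0 a F ->
  (forall s, cmod (s - s0) <= r -> F s = G s) -> has_pseries r M s0 a G.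
Proof. by move=> [aM aF] FG; split=> // s sr; rewrite -FG// aF. Qed.

Lemma has_pseries0 r M s0 a F : 0 <= r -> has_pseries r M s0 a F -> F s0 = a 0%N.
Proof.
move=> r0 [aM aF]; rewrite aF ?subrr ?cmod0// (csum_finite (N := 1%N)).
  by rewrite big_nat1 expr0 mulr1.
by move=> k k0; rewrite expr0n eqn0Ngt k0 mulr0.
Qed.

Lemma has_pseries_cst r s0 (c : C) :
  has_pseries r (cmod c) s0 (fun k => if k is 0%N then c else 0) (fun=> c).
Proof.
split=> [n|s sr].
  case: n => [|n]; first by rewrite big_geq ?cmod_ge0.
  rewrite big_nat_recl//= expr0 mulr1 big1 ?addr0// => k _.
  by rewrite mul0r cmod0.
rewrite (csum_finite (N := 1%N)) ?big_nat1 ?expr0 ?mulr1//.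
by case=> // k _; rewrite mul0r.
Qed.

Lemma has_pseries_shift r s0 (c : C) : 0 <= r ->
  has_pseries r (cmod (s0 + c) + r) s0
    (fun k => match k with 0%N => s0 + c | 1%N => 1 | _ => 0 end) (fun s => s + c).
Proof.
move=> r0; split=> [n|s sr].
  case: n => [|[|n]]; first by rewrite big_geq ?addr_ge0 ?cmod_ge0.
    by rewrite big_nat1 expr0 mulr1 lerDl.
  rewrite big_nat_recl//= big_nat_recl//= expr0 mulr1 expr1 mul1r big1 ?addr0.
    by rewrite cmod_real ger0_norm.
  by move=> k _; rewrite mul0r cmod0.
rewrite (csum_finite (N := 2%N)) ?big_nat_recl//= ?big_geq//.
  by rewrite expr0 mulr1 expr1 mul1r addr0; ring.
by case=> [|[|k]]// _; rewrite mul0r.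
Qed.

Lemma has_pseriesD r M M' s0 a b F G :
  has_pseries r M s0 a F -> has_pseries r M' s0 b G ->
  has_pseries r (M + M') s0 (fun k => a k + b k) (fun s => F s + G s).
Proof.
move=> [aM aF] [bM bG]; split=> [|s sr].
  by move: (asumD aM bM); congr asum; apply/funext => k; rewrite mulrDl.
rewrite aF// bG// -(csumD (asum_disc aM sr) (asum_disc bM sr)).
by apply: eq_csum => k; rewrite mulrDl.
Qed.

Lemma has_pseriesM r M M' s0 a b F G :
  has_pseries r M s0 a F -> has_pseries r M' s0 b G ->
  has_pseries r (M * M') s0 (cauchy_prod a b) (fun s => F s * G s).
Proof.
move=> [aM aF] [bM bG].
have E w k : \sum_(0 <= i < k.+1) (a i * w ^+ i) * (b (k - i)%N * w ^+ (k - i)) =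
    cauchy_prod a b k * w ^+ k.
  rewrite /cauchy_prod mulr_suml; apply: eq_big_nat => i; rewrite ltnS => /andP[_ ik].
  by rewrite -[in RHS](subnKC ik) exprD addKn; ring.
split=> [|s sr].
  have [+ _] := csum_mul aM bM; congr asum; apply/funext => k; exact: E.
have [_] := csum_mul (asum_disc aM sr) (asum_disc bM sr).
rewrite aF// bG// => <-; apply: eq_csum => k; exact: E.
Qed.

Lemma has_pseriesZ r M s0 a F (c : C) : has_pseries r M s0 a F ->
  has_pseries r (cmod c * M) s0 (fun k => c * a k) (fun s => c * F s).
Proof.
move=> [aM aF]; split=> [|s sr].
  by move: (asumZ c aM); congr asum; apply/funext => k; rewrite mulrA.
rewrite aF// -(csumZ _ (asum_disc aM sr)).
by apply: eq_csum => k; rewrite mulrA.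
Qed.

Lemma has_pseries_translate r M s0 a F (c : C) :
  has_pseries r M (s0 + c) a F -> has_pseries r M s0 a (fun s => F (s + c)).
Proof.
have E s : s + c - (s0 + c) = s - s0 by ring.
by move=> [aM aF]; split=> // s sr; rewrite aF E.
Qed.

(** For finitely many columns the bound holds with the rows truncated at [N], and it survives the
    limit in [N]. *)
Lemma asum_csum_col (a : nat -> nat -> C) (M : nat -> R) M' :
  (forall i, asum (a i) (M i)) -> psum_le M M' -> asum (fun j => csum (a^~ j)) M'.
Proof.
move=> aM MM' n.
have cj : (fun N => \sum_(0 <= j < n) cmod (\sum_(0 <= i < N) a i j)) @ \oo -->
    \sum_(0 <= j < n) cmod (csum (a^~ j)).
  apply: cvg_bigsum => j.
  by apply: cvgC_cmod; exact: csum_cvg (asum_col aM MM' j).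
rewrite -(cvg_lim _ cj)//; apply: limr_le; first exact: cvgP cj.
near=> N; apply: le_trans (MM' N).
apply: (@le_trans _ _ (\sum_(0 <= j < n) \sum_(0 <= i < N) cmod (a i j))).
  by apply: ler_sum => j _; exact: cmod_sum.
by rewrite exchange_big; apply: ler_sum => i _; exact: aM.
Unshelve. all: by end_near. Qed.

Lemma has_pseries_csum r (M : nat -> R) M' s0 (a : nat -> nat -> C) (F : nat -> C -> C) :
  0 < r -> (forall i, has_pseries r (M i) s0 (a i) (F i)) -> psum_le M M' ->
  has_pseries r M' s0 (fun k => csum (a^~ k)) (fun s => csum (F^~ s)).
Proof.
move=> r0 aF MM'.
have aM i := (aF i).1.
have rC0 k : (r%:C : C) ^+ k != 0.
  by rewrite expf_neq0// -cmod_eq0 cmod_real normr_eq0 gt_eqF.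
(* The hypothesis bounds [a i k * r ^+ k], so column [k] itself is summable with the factor [r ^+ k]
   divided out. *)
have ca k : asum (a^~ k) (cmod ((r%:C : C) ^+ k)^-1 * M').
  have := asumZ (((r%:C : C) ^+ k)^-1) (asum_col aM MM' k).
  by congr asum; apply/funext => i; rewrite mulrCA mulVf ?mulr1.
split=> [|s sr].
  have := asum_csum_col aM MM'; congr asum; apply/funext => k.
  by rewrite mulrC -(csumZ _ (ca k)); apply: eq_csum => i; rewrite mulrC.
transitivity (csum (fun i => csum (fun k => a i k * (s - s0) ^+ k))).
  by apply: eq_csum => i; rewrite (aF i).2.
rewrite (csum_exchange (fun i => asum_disc (aM i) sr) MM').
apply: eq_csum => k; rewrite mulrC -(csumZ _ (ca k)).
by apply: eq_csum => i; rewrite mulrC.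
Qed.

(** The same factorisation of [r ^+ k - rho ^+ k] has terms dominating those of the sum here. It
    replaces the usual bound [k * rho ^+ k.-1] by one that is summable against the norm on the
    larger disc. *)
Lemma cmod_subX (u v : C) (rho r : R) k : rho < r -> cmod u <= rho -> cmod v <= rho ->
  cmod (u ^+ k - v ^+ k) <= cmod (u - v) * (r ^+ k / (r - rho)) /\
  cmod (\sum_(i < k) u ^+ (k.-1 - i) * v ^+ i) <= r ^+ k / (r - rho).
Proof.
move=> rhor ur vr.
have rho0 : 0 <= rho by exact: le_trans (cmod_ge0 _) ur.
have r0 : 0 <= r by exact: le_trans rho0 (ltW rhor).
have h : cmod (\sum_(i < k) u ^+ (k.-1 - i) * v ^+ i) <= r ^+ k / (r - rho).
  rewrite ler_pdivlMr ?subr_gt0//.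
  apply: (@le_trans _ _ (r ^+ k - rho ^+ k)); last by rewrite lerBlDr lerDl exprn_ge0.
  rewrite subrXX mulrC; apply: ler_wpM2l; first by rewrite subr_ge0 ltW.
  apply: le_trans (cmod_sum _ _ _) _; apply: ler_sum => i _.
  rewrite cmodM !cmodX ler_pM ?exprn_ge0 ?cmod_ge0//.
    by rewrite lerXn2r ?nnegrE ?cmod_ge0//; apply: le_trans ur (ltW rhor).
  by rewrite lerXn2r ?nnegrE ?cmod_ge0.
by split=> //; rewrite subrXX cmodM ler_wpM2l ?cmod_ge0.
Qed.

Lemma has_pseries_lipschitz r M s0 a F (rho : R) : rho < r ->
  has_pseries r M s0 a F ->
  forall s s', cmod (s - s0) <= rho -> cmod (s' - s0) <= rho ->
  cmod (F s - F s') <= M / (r - rho) * cmod (s - s').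
Proof.
move=> rhor [aM aF] s s' sr s'r.
have r0 : 0 <= r by apply: le_trans (cmod_ge0 _) (le_trans sr (ltW rhor)).
have sr1 := le_trans sr (ltW rhor); have s'r1 := le_trans s'r (ltW rhor).
rewrite !aF// -(csumB (asum_disc aM sr1) (asum_disc aM s'r1)).
apply: csum_le => n.
apply: (@le_trans _ _ (\sum_(0 <= k < n)
  cmod (a k * r%:C ^+ k) * (cmod (s - s') / (r - rho)))).
  apply: ler_sum => k _; rewrite -mulrBr !cmodM -mulrA ler_wpM2l ?cmod_ge0//.
  have [+ _] := cmod_subX k rhor sr s'r.
  rewrite (_ : s - s0 - (s' - s0) = s - s'); last by ring.
  by move=> /le_trans; apply; rewrite cmod_realX// mulrCA.
rewrite -mulr_suml [leRHS]mulrAC -mulrA ler_wpM2r//.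
by rewrite divr_ge0 ?cmod_ge0// subr_ge0 ltW.
Qed.

Lemma has_pseries_continuous r M s0 a F s : has_pseries r M s0 a F ->
  cmod (s - s0) < r -> F s' @[s' --> s] --> F s.
Proof.
move=> aF sr; pose rho := (cmod (s - s0) + r) / 2.
have r1 : cmod (s - s0) < rho by rewrite /rho; lra.
have r2 : rho < r by rewrite /rho; lra.
have K0 : 0 <= M / (r - rho).
  by apply: divr_ge0; [exact: asum_ge0 aF.1 | rewrite subr_ge0 ltW].
apply/(cvgC_P (F := nbhs s)) => e e0; apply/nearC_P.
pose d := e / (M / (r - rho) + 1).
have d0 : 0 < d by rewrite divr_gt0// ltr_wpDl.
exists (Num.min d (rho - cmod (s - s0))) => [|s'].
  by rewrite lt_min d0 subr_gt0.
rewrite lt_min => /andP[s'd s'r].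
have s'r0 : cmod (s' - s0) <= rho.
  rewrite (_ : s' - s0 = (s' - s) + (s - s0)); last by ring.
  by apply: le_trans (cmodD _ _) _; rewrite -lerBrDr ltW.
apply: le_lt_trans (has_pseries_lipschitz r2 aF s'r0 (ltW r1)) _.
apply: (@le_lt_trans _ _ (M / (r - rho) * d)); first by rewrite ler_wpM2l// ltW.
by rewrite /d mulrCA gtr_pMr// ltr_pdivrMr ?ltr_wpDl// mul1r ltrDl.
Qed.

Lemma cvgC_X (T : Type) (FT : set_system T) {FF : Filter FT} (f : T -> C) (l : C) n :
  f @ FT --> l -> (fun x => f x ^+ n) @ FT --> l ^+ n.
Proof.
move=> fl; elim: n => [|n IH].
  rewrite (_ : (fun _ => _) = fun=> 1); first exact: cvg_cst.
  by apply/funext => x; rewrite expr0.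
rewrite exprS (_ : (fun _ => _) = fun x => f x * f x ^+ n).
  exact: (cvgM fl IH).
by apply/funext => x; rewrite exprS.
Qed.

Definition dcoef a k : C := k.+1%:R * a k.+1.

(** The difference quotient is the series with terms [a k * q h k]. By [cmod_subX] it is dominated
    uniformly in [h], so the limit is taken term by term. *)
Lemma has_pseries_quotient_cvg r M s0 a F s : has_pseries r M s0 a F ->
  cmod (s - s0) < r ->
  (fun h : C => h^-1 * (F (h + s) - F s)) @ 0^' -->
    csum (fun k => dcoef a k * (s - s0) ^+ k).
Proof.
(* Increments stay within [rho], strictly between [|s - s0|] and [r]; the gap [r - rho] enters the
   dominating sequence. *)
move=> [aM aF] sr; pose rho := (cmod (s - s0) + r) / 2.
have r1 : cmod (s - s0) < rho by rewrite /rho; lra.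
have r2 : rho < r by rewrite /rho; lra.
have r0 : 0 <= r by apply: le_trans (cmod_ge0 _) (ltW sr).
set w := s - s0.
pose q (h : C) k : C := \sum_(i < k) (w + h) ^+ (k.-1 - i) * w ^+ i.
have qE (h : C) k : h * q h k = (w + h) ^+ k - w ^+ k.
  by rewrite subrXX addrAC subrr add0r.
have near_rho : \forall h \near (0 : C)^', h != 0 /\ cmod (w + h) <= rho.
  apply/dnearC_P; exists (rho - cmod w) => [|h h0]; first by rewrite subr_gt0.
  rewrite subr0 => hr; split=> //; apply: le_trans (cmodD _ _) _.
  by rewrite addrC -lerBrDr ltW.
have cl : (fun h : C => csum (fun k => a k * q h k)) @ 0^' -->
    csum (fun k => a k * (k%:R * w ^+ k.-1)).
  apply: (csum_dominated (g := fun k => cmod (a k * r%:C ^+ k) / (r - rho))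
     (M := M / (r - rho))).
  - near=> h => k; rewrite !cmodM -mulrA ler_wpM2l ?cmod_ge0// cmod_realX//.
    have [h0 hr] : h != 0 /\ cmod (w + h) <= rho by near: h.
    by have [] := cmod_subX k r2 hr (ltW r1).
  - by move=> n; rewrite -mulr_suml ler_wpM2r// invr_ge0 subr_ge0 ltW.
  - move=> k; apply: cvgM; first exact: cvg_cst.
    rewrite (_ : k%:R * w ^+ k.-1 = \sum_(i < k) (w ^+ (k.-1 - i) * w ^+ i)).
      apply: cvg_bigsum => i; apply: cvgM; last exact: cvg_cst.
      apply: cvgC_X; rewrite -[X in _ --> X]addr0.
      by apply: cvgD; [exact: cvg_cst | exact: nbhs_dnbhs].
    rewrite (eq_bigr (fun=> w ^+ k.-1)) => [|i _].
      by rewrite sumr_const card_ord -[RHS]mulr_natl.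
    by rewrite -exprD subnK//; case: k i => [[]|k i]//=; rewrite -ltnS ltn_ord.
have aM' h : h != 0 -> cmod (w + h) <= rho -> asum (fun k => a k * q h k) (M / (r - rho)).
  move=> h0 hr; apply: (asum_dom (g := fun k => cmod (a k * r%:C ^+ k) / (r - rho))).
    move=> k; rewrite !cmodM -mulrA ler_wpM2l ?cmod_ge0// cmod_realX//.
    by have [] := cmod_subX k r2 hr (ltW r1).
  by move=> n; rewrite -mulr_suml ler_wpM2r// invr_ge0 subr_ge0 ltW.
have -> : csum (fun k => dcoef a k * w ^+ k) = csum (fun k => a k * (k%:R * w ^+ k.-1)).
  have ad : asum (fun k => a k * (k%:R * w ^+ k.-1)) (M / (r - rho)).
    apply: (asum_dom (g := fun k => cmod (a k * r%:C ^+ k) / (r - rho))).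
      move=> k; rewrite !cmodM -mulrA ler_wpM2l ?cmod_ge0// cmod_realX//.
      have [_] := cmod_subX k r2 (ltW r1) (ltW r1).
      rewrite (eq_bigr (fun=> w ^+ k.-1)) => [|i _].
        by rewrite sumr_const card_ord -[w ^+ _ *+ _]mulr_natl cmodM.
      by rewrite -exprD subnK//; case: k i => [[]|k i]//=; rewrite -ltnS ltn_ord.
    by move=> n; rewrite -mulr_suml ler_wpM2r// invr_ge0 subr_ge0 ltW.
  rewrite (csumS ad) mul0r mulr0 add0r; apply: eq_csum => k.
  by rewrite /dcoef /= mulrA [_ * a _]mulrC.
apply: cvg_trans cl; apply: near_eq_cvg; near=> h.
have [h0 hr] : h != 0 /\ cmod (w + h) <= rho by near: h.
have hs : h + s - s0 = w + h by rewrite /w; ring.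
rewrite !aF ?hs ?(le_trans hr (ltW r2)) ?(ltW sr)//.
rewrite -(csumB (asum_disc aM (le_trans hr (ltW r2))) (asum_disc aM (ltW sr))).
rewrite -[LHS](mulKf h0) -(csumZ _ (aM' h h0 hr)); congr (_ * _).
by apply: eq_csum => k; rewrite mulrCA qE mulrBr.
Unshelve. all: by end_near. Qed.

Lemma quotient_cvg_derivable F s (l : C) :
  (fun h : C => h^-1 * (F (h + s) - F s)) @ 0^' --> l ->
  derivable F s 1 /\ derive1 F s = l.
Proof.
move=> Fl; split; last first.
  by rewrite /derive1; apply/cvg_lim => //.
rewrite /derivable; apply/cvg_ex; exists l.
rewrite (_ : (fun h : C => _) = fun h : C => h^-1 * (F (h + s) - F s))//.
by apply/funext => h /=; rewrite /GRing.scale /= mulr1.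
Qed.

Lemma has_pseries_derive r M s0 a F s : has_pseries r M s0 a F ->
  cmod (s - s0) < r ->
  derivable F s 1 /\ derive1 F s = csum (fun k => dcoef a k * (s - s0) ^+ k).
Proof.
by move=> aF sr; apply: quotient_cvg_derivable; exact: has_pseries_quotient_cvg aF sr.
Qed.

Lemma has_pseries_derive1 r M s0 a F (rho : R) : 0 < rho -> rho < r ->
  has_pseries r M s0 a F ->
  has_pseries rho (M / (r - rho)) s0 (dcoef a) (derive1 F).
Proof.
move=> rho0 rhor aF; have r0 := lt_trans rho0 rhor; split; last first.
  by move=> s sr; have [] := has_pseries_derive aF (le_lt_trans sr rhor).
move=> n; apply: (@le_trans _ _ (\sum_(0 <= k < n)
    cmod (a k.+1 * r%:C ^+ k.+1) / (r - rho))).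
  apply: ler_sum => k _; rewrite /dcoef !cmodM -mulrA mulrCA -!mulrA ler_wpM2l ?cmod_ge0//.
  have rhoC : cmod (rho%:C : C) <= rho by rewrite cmod_real gtr0_norm.
  have [_] := cmod_subX k.+1 rhor rhoC rhoC.
  rewrite (eq_bigr (fun=> rho%:C ^+ k)) => [|i _].
    by rewrite sumr_const card_ord -[_ *+ _]mulr_natl cmodM !cmod_realX ?(ltW rho0) ?(ltW r0).
  by rewrite -exprD subnK//= -ltnS ltn_ord.
rewrite -mulr_suml; apply: ler_wpM2r; first by rewrite invr_ge0 subr_ge0 ltW.
exact: asumS aF.1 n.
Qed.

End PowerSeries.

(** * Zeros and quotients of power series, Laurent expansions, identity theorem *)

Section MeromorphicFunctions.
Context {R : realType}.
Local Notation C := R[i].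
Implicit Types (a b : nat -> C) (F G : C -> C) (r M : R) (s w : C).

Definition shift_coef (m : nat) a k : C := if (k < m)%N then 0 else a (k - m)%N.

Lemma shift_coefE m a k : shift_coef m a (k + m) = a k.
Proof. by rewrite /shift_coef ltnNge leq_addl addnK. Qed.

Lemma has_pseries_mulX r M s0 a G m : 0 < r -> has_pseries r M s0 a G ->
  exists M', has_pseries r M' s0 (shift_coef m a) (fun s => G s * (s - s0) ^+ m).
Proof.
move=> r0 [aM aG].
have E (w : C) n : series (fun k => shift_coef m a k * w ^+ k) (n + m)%N =
    series (fun k => a k * w ^+ k) n * w ^+ m.
  rewrite /series /= (big_cat_nat _ (leq_addl n m))//= big1_seq ?add0r.
    rewrite -{1}(add0n m) big_addn addnK mulr_suml; apply: eq_bigr => k _.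
    by rewrite /shift_coef ltnNge leq_addl/= addnK exprD mulrA.
  by move=> k; rewrite mem_index_iota /shift_coef => /andP[_ /andP[_ ->]]; rewrite mul0r.
exists (M * r ^+ m); split=> [n|s sr].
  apply: (@le_trans _ _ (\sum_(0 <= k < n + m) cmod (shift_coef m a k * r%:C ^+ k))).
    rewrite [leRHS](big_cat_nat _ (leq_addr m n))//= lerDl.
    by apply: sumr_ge0 => k _; exact: cmod_ge0.
  rewrite (big_cat_nat _ (leq_addl n m))//= big1_seq ?add0r; last first.
    move=> k; rewrite mem_index_iota /shift_coef => /andP[_ /andP[_ ->]].
    by rewrite mul0r cmod0.
  rewrite -{1}(add0n m) big_addn addnK.
  rewrite (eq_bigr (fun k => cmod (a k * r%:C ^+ k) * r ^+ m)) => [|k _].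
    by rewrite -mulr_suml ler_wpM2r// exprn_ge0// ltW.
  by rewrite /shift_coef ltnNge leq_addl/= addnK exprD mulrA cmodM cmod_realX ?ltW.
rewrite aG//; apply/esym/csum_unique; rewrite -(@cvg_shiftn m).
under eq_fun do rewrite E.
by apply: cvgM; [exact: csum_cvg (asum_disc aM sr) | exact: cvg_cst].
Qed.

Lemma has_pseries_factor r M s0 a F m : 0 < r -> has_pseries r M s0 a F ->
  (forall k, (k < m)%N -> a k = 0) ->
  exists M' G, has_pseries r M' s0 (fun k => a (k + m)%N) G /\
    forall s, cmod (s - s0) <= r -> F s = G s * (s - s0) ^+ m.
Proof.
move=> r0 [aM aF] am.
have rm0 : (r%:C : C) ^+ m != 0.
  by rewrite expf_neq0// -cmod_eq0 cmod_real normr_eq0 gt_eqF.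
pose G s := csum (fun k => a (k + m)%N * (s - s0) ^+ k).
have aG : has_pseries r (cmod ((r%:C : C) ^+ m)^-1 * M) s0 (fun k => a (k + m)%N) G.
  split=> // n.
  rewrite (eq_bigr (fun k => cmod ((r%:C : C) ^+ m)^-1 *
      cmod (a (k + m)%N * r%:C ^+ (k + m)))) => [|k _].
    rewrite -mulr_sumr ler_wpM2l ?cmod_ge0//.
    rewrite (_ : \sum_(0 <= i < n) _ = \sum_(m <= k < n + m) cmod (a k * r%:C ^+ k)).
      apply: le_trans (aM (n + m)%N).
      rewrite [leRHS](big_cat_nat _ (leq_addl n m))//= lerDr.
      by apply: sumr_ge0 => k _; exact: cmod_ge0.
    by apply/esym; rewrite -{1}(add0n m) big_addn addnK.
  by rewrite -cmodM exprD mulrCA [_^-1 * _]mulrC mulfK.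
exists (cmod ((r%:C : C) ^+ m)^-1 * M), G; split=> // s sr.
have [M' [_ sG]] := has_pseries_mulX m r0 aG.
rewrite aF// sG//; apply: eq_csum => k; rewrite /shift_coef.
by case: ltnP => [/am ->//|mk]; rewrite subnK.
Qed.

Lemma has_pseries_cvg0 r M s0 a F : 0 < r -> has_pseries r M s0 a F ->
  F s @[s --> s0] --> a 0%N.
Proof.
move=> r0 aF; rewrite -(has_pseries0 (ltW r0) aF).
by apply: (has_pseries_continuous aF); rewrite subrr cmod0.
Qed.

Lemma cvgC_neq0 (T : Type) (FT : set_system T) {FF : Filter FT} (f : T -> C) (l : C) :
  f @ FT --> l -> l != 0 -> \forall x \near FT, f x != 0.
Proof.
move=> fl l0; have : \forall x \near FT, cmod (f x - l) < cmod l.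
  by move/cvgC_P : fl; apply; rewrite cmod_gt0.
apply: filterS => x; apply: contraTneq => ->.
by rewrite sub0r cmodN ltxx.
Qed.

Lemma near_dnbhs (s0 : C) (P : set C) :
  (\forall s \near s0, P s) -> \forall s \near s0^', P s.
Proof. exact: nbhs_dnbhs. Qed.

Lemma dnear_neq0 (f : C -> C) (s0 l : C) : f s @[s --> s0] --> l -> l != 0 ->
  \forall s \near s0^', f s != 0.
Proof.
by move=> fl l0; apply: near_dnbhs; apply: (@cvgC_neq0 _ (nbhs s0) _ f l).
Qed.

Lemma near_ball_le (s0 : C) r : 0 < r -> \forall s \near s0, cmod (s - s0) <= r.
Proof. by move=> r0; apply/nearC_P; exists r => // s sr; exact: ltW. Qed.

Lemma near_ball (s0 : C) r : 0 < r -> \forall s \near s0, cmod (s - s0) < r.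
Proof. by move=> r0; apply/nearC_P; exists r. Qed.

Lemma dnear_ball_le (s0 : C) r : 0 < r -> \forall s \near s0^', cmod (s - s0) <= r.
Proof. by move=> r0; apply: near_dnbhs; exact: near_ball_le. Qed.

Lemma dnear_ball (s0 : C) r : 0 < r -> \forall s \near s0^', cmod (s - s0) < r.
Proof. by move=> r0; apply: near_dnbhs; exact: near_ball. Qed.

Lemma near_neq (s0 : C) : \forall s \near s0^', s != s0.
Proof. by apply/(dnearC_P s0 [set s | s != s0]); exists 1. Qed.

Lemma subr_cvg (s0 : C) : (fun s => s - s0) @ s0 --> (0 : C).
Proof.
apply/(cvgC_P (F := nbhs s0)) => e e0; apply/nearC_P; exists e => // s.
by rewrite subr0.
Qed.

Lemma subr_cvg0 (s0 : C) m : (0 < m)%N -> (fun s => (s - s0) ^+ m) @ s0 --> (0 : C).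
Proof.
move=> m0; have -> : (0 : C) = 0 ^+ m by rewrite expr0n gtn_eqF.
exact: cvgC_X (@subr_cvg s0).
Qed.

Lemma punctured_spread (P : set C) (c c' : C) (rho : R) :
  (forall s, s != c -> cmod (s - c) < rho -> P s) -> cmod (c' - c) < rho ->
  \forall s \near c'^', P s.
Proof.
move=> Pc c'r; have [->|c'c] := eqVneq c' c.
  apply/dnearC_P; exists rho => //; exact: le_lt_trans (cmod_ge0 _) c'r.
(* The second radius keeps the centre [c], where [P] may fail, outside the new ball. *)
apply/dnearC_P; exists (Num.min (rho - cmod (c' - c)) (cmod (c' - c))).
  by rewrite lt_min subr_gt0 c'r cmod_gt0 subr_eq0.
move=> s _; rewrite lt_min => /andP[s1 s2]; apply: Pc.
  by apply: contraTneq s2 => ->; rewrite cmodC ltxx.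
rewrite (_ : s - c = (s - c') + (c' - c)); last by ring.
by apply: le_lt_trans (cmodD _ _) _; rewrite -ltrBrDr.
Qed.

Lemma has_pseries_neq0 r M s0 a F k : 0 < r -> has_pseries r M s0 a F ->
  a k != 0 -> \forall s \near s0^', F s != 0.
Proof.
move=> r0 aF ak.
have ex : exists k, a k != 0 by exists k.
case: (ex_minnP ex) => m am mmin.
have am0 j : (j < m)%N -> a j = 0.
  by move=> jm; apply/eqP; apply: contraTT jm => /mmin; rewrite -leqNgt.
have [M' [G [aG FG]]] := has_pseries_factor r0 aF am0.
have G0 : \forall s \near s0^', G s != 0.
  apply: dnear_neq0 am.
  by have := has_pseries_cvg0 r0 aG; rewrite add0n.
near=> s.
have sr : cmod (s - s0) <= r by near: s; exact: dnear_ball_le.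
have ss0 : s != s0 by near: s; exact: near_neq.
rewrite FG// mulf_neq0 ?expf_neq0 ?subr_eq0//.
by near: s.
Unshelve. all: by end_near. Qed.

Lemma has_pseries_eq0 r M s0 a F : 0 < r -> has_pseries r M s0 a F ->
  (\forall s \near s0^', F s = 0) -> forall k, a k = 0.
Proof.
move=> r0 aF F0 k; apply/eqP; apply: contraT => ak.
have F1 := has_pseries_neq0 r0 aF ak.
have [|s [Fs0 Fs]] := @filter_ex _ (s0^') _ [set s | F s != 0 /\ F s = 0].
  by near=> s; split; near: s.
by rewrite Fs eqxx in Fs0.
Unshelve. all: by end_near. Qed.

Lemma has_pseries_unique r r' M M' s0 a b F G : 0 < r -> 0 < r' ->
  has_pseries r M s0 a F -> has_pseries r' M' s0 b G ->
  (\forall s \near s0^', F s = G s) -> a = b.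
Proof.
move=> r0 r'0 aF bG FG; pose r1 := Num.min r r'.
have r10 : 0 < r1 by rewrite lt_min r0.
have aF1 : has_pseries r1 M s0 a F.
  by apply: has_pseriesW aF; rewrite // ?(ltW r10) ?ge_min ?lexx ?orbT.
have bG1 : has_pseries r1 M' s0 b G.
  by apply: has_pseriesW bG; rewrite // ?(ltW r10) ?ge_min ?lexx ?orbT.
have abFG := has_pseriesD aF1 (has_pseriesZ (-1) bG1).
apply/funext => k; apply/eqP; rewrite -subr_eq0 -[_ - _](_ : a k + -1 * b k = _).
  apply/eqP; apply: (has_pseries_eq0 r10 abFG); apply: filterS FG => s ->.
  by rewrite mulN1r subrr.
by rewrite mulN1r.
Qed.

Lemma has_pseries_inv r M s0 a F : 0 < r -> has_pseries r M s0 a F -> a 0%N != 0 ->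
  exists r' M' b, 0 < r' /\ has_pseries r' M' s0 b (fun s => (F s)^-1).
Proof.
move=> r0 aF a0.
have M0 : 0 <= M := asum_ge0 aF.1.
(* F = a0 (1 - H) with |H| <= 1/2 in the norm of a small disc; Neumann series *)
pose h k : C := if k is 0%N then 0 else - (a 0%N)^-1 * a k.
pose H s := 1 - (a 0%N)^-1 * F s.
pose K := cmod (a 0%N)^-1 * M.
have K0 : 0 <= K by rewrite mulr_ge0 ?cmod_ge0.
have hH : has_pseries r K s0 h H.
  have aM := aF.1; split=> [n|s sr].
    apply: (@le_trans _ _ (\sum_(0 <= k < n) cmod (- (a 0%N)^-1 * (a k * r%:C ^+ k)))).
      by apply: ler_sum => -[|k] _; rewrite /h ?mulrA// mul0r cmod0 cmod_ge0.
    by have := asumZ (- (a 0%N)^-1) aM n; rewrite cmodN.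
  rewrite /H aF.2//.
  have sM := asum_disc aM sr.
  have hs : asum (fun k => h k * (s - s0) ^+ k) K.
    move=> n; apply: (@le_trans _ _ (\sum_(0 <= k < n)
        cmod (- (a 0%N)^-1 * (a k * (s - s0) ^+ k)))).
      by apply: ler_sum => -[|k] _; rewrite /h ?mulrA// mul0r cmod0 cmod_ge0.
    by have := asumZ (- (a 0%N)^-1) sM n; rewrite cmodN.
  rewrite (csumS hs) (csumS sM) /h mul0r add0r expr0 mulr1 mulrDr mulVf//.
  rewrite opprD addrA subrr add0r -(csumZ _ (asumS sM)) -(csumN (asumZ _ (asumS sM))).
  by apply: eq_csum => k; rewrite -mulrA mulNr.
have [M1 [G [hG HG]]] := @has_pseries_factor _ _ _ _ _ 1%N r0 hH
  ltac:(by case).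
have M10 : 0 <= M1 := asum_ge0 hG.1.
(* [H] has no constant term and equals [G] times [s - s0], so its norm for radius [r1] is at most
   [M1 * r1], hence at most [1/2]. *)
pose r1 := Num.min r (2 * (M1 + 1))^-1.
have r10 : 0 < r1 by rewrite lt_min r0 invr_gt0 mulr_gt0// ltr_wpDl.
have r1r : r1 <= r by rewrite ge_min lexx.
have hH1 : has_pseries r1 2^-1 s0 h H.
  split=> [n|s sr]; last by apply: hH.2; exact: le_trans r1r.
  case: n => [|n]; first by rewrite big_geq// invr_ge0.
  rewrite big_nat_recl//= mul0r cmod0 add0r.
  apply: (@le_trans _ _ (M1 * r1)); last first.
    apply: (@le_trans _ _ ((M1 + 1) * (2 * (M1 + 1))^-1)).
      by apply: ler_pM; rewrite ?(ltW r10) ?lerDl// ge_min lexx orbT.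
    by rewrite invfM mulrCA mulfV ?mulr1// gt_eqF// ltr_wpDl.
  have := asum_radius (ltW r10) r1r hG.1 n.
  move=> /(ler_wpM2r (ltW r10)); apply: le_trans; rewrite mulr_suml.
  apply: ler_sum => k _; rewrite addn1 exprS mulrCA.
  by rewrite [cmod (r1%:C * _)]cmodM cmod_real (gtr0_norm r10) mulrC.
have H1 s : cmod (s - s0) <= r1 -> cmod (H s) <= 2^-1.
  move=> sr; rewrite hH1.2//; apply: csum_le; exact: asum_disc hH1.1 sr.
pose hi := fix hi i := if i is i.+1 then cauchy_prod h (hi i)
  else fun k : nat => if k is 0%N then (1 : C) else 0.
have hiH i : has_pseries r1 (2^-1 ^+ i) s0 (hi i) (fun s => H s ^+ i).
  elim: i => [|i IH].
    rewrite expr0 -[1 in X in has_pseries _ X]cmod1.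
    apply: eq_has_pseries (has_pseries_cst _ _ _) _ => s _.
    by rewrite expr0.
  rewrite exprS; apply: eq_has_pseries (has_pseriesM hH1 IH) _ => s _.
  by rewrite exprS.
have sg : psum_le (fun i => 2^-1 ^+ i : R) (1 / (1 - 2^-1)).
  apply: psum_le_dom (psum_le_geom _ _ _); rewrite ?ler01 ?invr_ge0//; last by lra.
  by move=> k; rewrite mul1r.
have gH := has_pseriesZ (a 0%N)^-1 (has_pseries_csum r10 hiH sg).
exists r1, (cmod (a 0%N)^-1 * (1 / (1 - 2^-1))), (fun k => (a 0%N)^-1 * csum (hi^~ k)).
split=> //; apply: eq_has_pseries gH _ => s sr.
have sH : asum (fun i => H s ^+ i) (1 / (1 - 2^-1)).
  by apply: asum_dom sg => i; rewrite cmodX lerXn2r ?nnegrE ?cmod_ge0 ?invr_ge0 ?H1.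
have E : csum (fun i => H s ^+ i) * (1 - H s) = 1.
  rewrite mulrBr mulr1 {1}(csumS sH) expr0 mulrC -(csumZ _ sH).
  by rewrite (eq_csum (fun k => exprS (H s) k)) addrK.
have Fs : F s = a 0%N * (1 - H s) by rewrite /H subKr mulrA mulfV// mul1r.
have F0 : 1 - H s != 0.
  by apply: contra_eqN E => /eqP ->; rewrite mulr0 eq_sym oner_eq0.
by rewrite Fs invfM; congr (_ * _); apply: (mulIf F0); rewrite E mulVf.
Qed.

Lemma analytic_atD F G s0 : analytic_at F s0 -> analytic_at G s0 ->
  analytic_at (fun s => F s + G s) s0.
Proof.
move=> [r [M [a [r0 aF]]]] [r' [M' [b [r'0 bG]]]].
have r10 : 0 < Num.min r r' by rewrite lt_min r0.
exists (Num.min r r'), (M + M'), (fun k => a k + b k); split=> //.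
by apply: has_pseriesD; [apply: has_pseriesW aF|apply: has_pseriesW bG];
  rewrite // ?(ltW r10) ?ge_min ?lexx ?orbT.
Qed.

Lemma analytic_atM F G s0 : analytic_at F s0 -> analytic_at G s0 ->
  analytic_at (fun s => F s * G s) s0.
Proof.
move=> [r [M [a [r0 aF]]]] [r' [M' [b [r'0 bG]]]].
have r10 : 0 < Num.min r r' by rewrite lt_min r0.
exists (Num.min r r'), (M * M'), (cauchy_prod a b); split=> //.
by apply: has_pseriesM; [apply: has_pseriesW aF|apply: has_pseriesW bG];
  rewrite // ?(ltW r10) ?ge_min ?lexx ?orbT.
Qed.

Lemma analytic_at_cst (c : C) s0 : analytic_at (fun=> c) s0.
Proof. by exists 1, (cmod c); eexists; split; [|exact: has_pseries_cst]. Qed.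

Lemma analytic_at_shift (c : C) s0 : analytic_at (fun s => s + c) s0.
Proof.
exists 1, (cmod (s0 + c) + 1); eexists; split=> //.
exact: has_pseries_shift.
Qed.

Lemma analytic_atX F s0 n : analytic_at F s0 -> analytic_at (fun s => F s ^+ n) s0.
Proof.
move=> aF; elim: n => [|n IH].
  by under eq_fun do rewrite expr0; exact: analytic_at_cst.
by under eq_fun do rewrite exprS; exact: analytic_atM.
Qed.

Lemma analytic_at_inv F s0 : analytic_at F s0 -> F s0 != 0 ->
  analytic_at (fun s => (F s)^-1) s0.
Proof.
move=> [r [M [a [r0 aF]]]]; rewrite (has_pseries0 (ltW r0) aF).
exact: has_pseries_inv r0 aF.
Qed.

Lemma analytic_at_near F G s0 : analytic_at F s0 ->
  (\forall s \near s0, F s = G s) -> analytic_at G s0.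
Proof.
move=> [r [M [a [r0 aF]]]] /nearC_P[e e0 FG].
have m0 : 0 < Num.min r (e / 2) by rewrite lt_min r0 divr_gt0.
have aF1 : has_pseries (Num.min r (e / 2)) M s0 a F.
  by apply: has_pseriesW aF; rewrite ?(ltW m0) ?ge_min ?lexx.
exists (Num.min r (e / 2)), M, a; split=> //.
apply: eq_has_pseries aF1 _ => s.
rewrite le_min => /andP[_ se]; apply: FG; apply: le_lt_trans se _.
by rewrite gtr_pMr// invf_lt1// ltr1n.
Qed.

Lemma analytic_at_continuous F s0 : analytic_at F s0 -> F s @[s --> s0] --> F s0.
Proof.
move=> [r [M [a [r0 aF]]]]; apply: (has_pseries_continuous aF).
by rewrite subrr cmod0.
Qed.

(** This form is local and insensitive to the value at [s0], unlike [meromorphic], which also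
    prescribes values at regular points. Sums and products of such quotients are again of this
    form. *)
Definition mero_at F (s0 : C) := exists m G, analytic_at G s0 /\
  \forall s \near s0^', F s = G s / (s - s0) ^+ m.

Lemma analytic_mero F s0 : analytic_at F s0 -> mero_at F s0.
Proof.
move=> aF; exists 0%N, F; split=> //.
by near=> s; rewrite expr0 divr1.
Unshelve. all: by end_near. Qed.

Lemma mero_at_near F G s0 : mero_at F s0 -> (\forall s \near s0^', F s = G s) ->
  mero_at G s0.
Proof.
move=> [m [H [aH FH]]] FG; exists m, H; split=> //.
by apply: filterS2 FH FG => s <-.
Qed.

Lemma analytic_subX s0 m : analytic_at (fun s => (s - s0) ^+ m) s0.
Proof. by apply: analytic_atX; exact: analytic_at_shift. Qed.

Lemma mero_atD F G s0 : mero_at F s0 -> mero_at G s0 ->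
  mero_at (fun s => F s + G s) s0.
Proof.
move=> [m [F1 [aF FF]]] [n [G1 [aG GG]]].
exists (m + n)%N, (fun s => F1 s * (s - s0) ^+ n + G1 s * (s - s0) ^+ m); split.
  by apply: analytic_atD; apply: analytic_atM => //; exact: analytic_subX.
near=> s; have ss0 : s != s0 by near: s; exact: near_neq.
have X k : (s - s0) ^+ k != 0 by rewrite expf_neq0// subr_eq0.
rewrite (_ : F s = F1 s / (s - s0) ^+ m); last by near: s.
rewrite (_ : G s = G1 s / (s - s0) ^+ n); last by near: s.
rewrite exprD invfM mulrDl; congr (_ + _); last by rewrite mulrA mulfK.
by rewrite [(_ ^+ m)^-1 * _]mulrC mulrA mulfK.
Unshelve. all: by end_near. Qed.

Lemma mero_atM F G s0 : mero_at F s0 -> mero_at G s0 ->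
  mero_at (fun s => F s * G s) s0.
Proof.
move=> [m [F1 [aF FF]]] [n [G1 [aG GG]]].
exists (m + n)%N, (fun s => F1 s * G1 s); split; first exact: analytic_atM.
near=> s.
rewrite (_ : F s = F1 s / (s - s0) ^+ m); last by near: s.
rewrite (_ : G s = G1 s / (s - s0) ^+ n); last by near: s.
by rewrite exprD invfM mulrACA.
Unshelve. all: by end_near. Qed.

Lemma mero_at_sum (I : Type) (q : seq I) (F : I -> C -> C) s0 :
  (forall i, mero_at (F i) s0) -> mero_at (fun s => \sum_(i <- q) F i s) s0.
Proof.
move=> mF; elim: q => [|i q IH].
  by under eq_fun do rewrite big_nil; apply/analytic_mero/analytic_at_cst.
by under eq_fun do rewrite big_cons; exact: mero_atD.
Qed.

Lemma mero_atN F s0 : mero_at F s0 -> mero_at (fun s => - F s) s0.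
Proof.
move=> mF; under eq_fun do rewrite -mulN1r.
by apply: mero_atM => //; apply/analytic_mero/analytic_at_cst.
Qed.

Lemma mero_at_dichotomy F s0 : mero_at F s0 ->
  (\forall s \near s0^', F s = 0) \/
  exists m n G, [/\ analytic_at G s0, G s0 != 0 &
    \forall s \near s0^', F s = G s * (s - s0) ^+ n / (s - s0) ^+ m].
Proof.
move=> [m [G [[r [M [a [r0 aG]]]] FG]]].
have [ex|nex] := pselect (exists k, a k != 0); last first.
  left; near=> s.
  rewrite (_ : F s = G s / (s - s0) ^+ m); last by near: s.
  rewrite aG.2; last by near: s; exact: dnear_ball_le.
  rewrite (eq_csum (b := fun=> 0)) ?csum0 ?mul0r// => k.
  have [->|ak] := eqVneq (a k) 0; first by rewrite mul0r.
  by exfalso; apply: nex; exists k.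
right; case: (ex_minnP ex) => n an nmin.
have an0 j : (j < n)%N -> a j = 0.
  by move=> jm; apply/eqP; apply: contraTT jm => /nmin; rewrite -leqNgt.
have [M' [H [aH GH]]] := has_pseries_factor r0 aG an0.
exists m, n, H; split.
- by exists r, M', (fun k => a (k + n)%N).
- by rewrite (has_pseries0 (ltW r0) aH).
- near=> s; rewrite -GH; last by near: s; exact: dnear_ball_le.
  by near: s.
Unshelve. all: by end_near. Qed.

Lemma mero_at_neq0 F s0 : mero_at F s0 ->
  (\forall s \near s0^', F s = 0) \/ (\forall s \near s0^', F s != 0).
Proof.
move=> /mero_at_dichotomy [|[m [n [G [aG G0 FG]]]]]; first by left.
right.
have nG : \forall s \near s0^', G s != 0.
  by apply: dnear_neq0 G0; exact: analytic_at_continuous.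
near=> s; have ss0 : s != s0 by near: s; exact: near_neq.
rewrite (_ : F s = G s * (s - s0) ^+ n / (s - s0) ^+ m); last by near: s.
rewrite !mulf_neq0 ?invr_neq0 ?expf_neq0 ?subr_eq0//.
by near: s.
Unshelve. all: by end_near. Qed.

Lemma mero_at_inv F s0 : mero_at F s0 -> ~ (\forall s \near s0^', F s = 0) ->
  mero_at (fun s => (F s)^-1) s0.
Proof.
move=> /mero_at_dichotomy [//|[m [n [G [aG G0 FG]]]]] _.
exists n, (fun s => (G s)^-1 * (s - s0) ^+ m); split.
  by apply: analytic_atM; [exact: analytic_at_inv|exact: analytic_subX].
by apply: filterS FG => s ->; rewrite !invfM invrK mulrAC.
Qed.

Lemma mero_at_translate F s0 (c : C) : mero_at F (s0 + c) ->
  mero_at (fun s => F (s + c)) s0.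
Proof.
move=> [m [G [[r [M [a [r0 aG]]]] FG]]].
exists m, (fun s => G (s + c)); split.
  by exists r, M, a; split=> //; exact: has_pseries_translate.
have /dnearC_P[e e0 eFG] := FG; apply/dnearC_P; exists e => // s ss0 se.
have E : s + c - (s0 + c) = s - s0 by ring.
by rewrite eFG ?E// (inj_eq (addIr c)).
Qed.

(** A connectedness argument on the parameter interval. Near each point of the segment, punctured at
    it, [F] is identically zero or nowhere zero, by [mero_at_neq0]; so the parameters of the first
    kind form a set that is open and closed in the interval. Meromorphy is asked on the segment
    only. *)
Lemma mero_at_identity F (s1 s0 : C) :
  (forall t : R, 0 <= t <= 1 -> mero_at F (s1 + t%:C * (s0 - s1))) ->
  (\forall s \near s1^', F s = 0) -> \forall s \near s0^', F s = 0.
Proof.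
move=> mF F1.
pose gam (t : R) : C := s1 + t%:C * (s0 - s1).
(* [gam] is Lipschitz with constant [|s0 - s1|]; the added [1] keeps [K] positive also for
   [s0 = s1]. *)
pose K := cmod (s0 - s1) + 1.
have K0 : 0 < K by rewrite ltr_wpDl ?cmod_ge0.
have gamd t u : cmod (gam u - gam t) <= K * `|u - t|.
  rewrite (_ : gam u - gam t = (u - t)%:C * (s0 - s1)).
    by rewrite cmodM cmod_real mulrC ler_wpM2r// lerDl.
  by rewrite /gam rmorphB /=; ring.
pose A : set R := `[0%R, 1%R]%classic.
pose Z t := \forall s \near (gam t)^', F s = 0.
pose B := A `&` Z.
have spread (P : set C) t : (\forall s \near (gam t)^', P s) ->
    \forall u \near t, \forall s \near (gam u)^', P s.
  move=> /dnearC_P [rho rho0 FP].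
  apply/nbhs_ballP; exists (rho / K); first by rewrite /= divr_gt0.
  move=> u; rewrite /ball /= distrC => ut.
  apply: punctured_spread FP _; apply: le_lt_trans (gamd t u) _.
  by rewrite mulrC -ltr_pdivlMr.
have nZ t : ~ ((\forall s \near (gam t)^', F s = 0) /\
    \forall s \near (gam t)^', F s != 0).
  move=> [h1 h2].
  have [|s [Fs0 Fs]] := @filter_ex _ ((gam t)^') _ [set s | F s != 0 /\ F s = 0].
    by near=> s; split; near: s.
  by rewrite Fs eqxx in Fs0.
have AB : B = A.
  have : connected A by exact: segment_connected.
  apply.
  - exists 0; split; first by rewrite /A /= in_itv /= lexx ler01.
    by rewrite /Z /gam mul0r addr0.
  - exists ((~` A `|` B)°); first exact: open_interior.
    apply/seteqP; split=> t.
      move=> [At Zt]; split=> //; have := spread _ _ Zt.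
      apply: filterS => u Zu; have [Au|nAu] := pselect (A u); first by right.
      by left.
    by move=> [At /interior_subset [//|]].
  - exists (~` ((~` A `|` ~` Z)°)); first exact/open_closedC/open_interior.
    apply/seteqP; split=> t.
      by move=> [At Zt]; split=> // /interior_subset [].
    move=> [At nt]; split; first exact: At.
    have mt : mero_at F (gam t) by apply: mF; move: At; rewrite /A /= in_itv.
    have [Zt|Ft] := mero_at_neq0 mt; first exact: Zt.
    exfalso; apply: nt; have := spread _ _ Ft.
    by apply: filterS => u Fu; right=> Zu; apply: (nZ u).
have [_] : B 1 by rewrite AB /A /= in_itv /= lexx ler01.
by rewrite /Z /gam mul1r addrC subrK.
Unshelve. all: by end_near. Qed.

Lemma has_laurentP F G s0 m r M a : 0 < r -> has_pseries r M s0 a G ->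
  (\forall s \near s0^', F s = G s / (s - s0) ^+ m) -> has_laurent F s0 m a.
Proof.
move=> r0 aG FG; rewrite /has_laurent; near=> s.
have sr : cmod (s - s0) <= r by near: s; exact: dnear_ball_le.
have ss0 : s - s0 != 0 by rewrite subr_eq0; near: s; exact: near_neq.
rewrite (_ : F s = G s / (s - s0) ^+ m); last by near: s.
rewrite aG.2// (_ : series _ =
    fun n => series (fun k => a k * (s - s0) ^+ k) n * ((s - s0) ^+ m)^-1).
  by apply: cvgM; [exact: csum_cvg (asum_disc aG.1 sr) | exact: cvg_cst].
apply/funext => n; rewrite /series /= mulr_suml; apply: eq_bigr => k _.
by rewrite -mulrA expfzDr// -exprnN.
Unshelve. all: by end_near. Qed.

(** Abel's lemma turns mere pointwise convergence into a summability bound: convergence at one point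
    of modulus [e / 2] bounds the terms there, and a geometric series with ratio [1/2] bounds the
    terms for the radius [e / 4]. *)
Lemma laurentP F s0 m a : has_laurent F s0 m a ->
  exists r M G, [/\ 0 < r, has_pseries r M s0 a G &
    \forall s \near s0^', F s = G s / (s - s0) ^+ m].
Proof.
move=> /dnearC_P [e e0 eF].
have e2 : 0 < e / 2 by rewrite divr_gt0.
have e2e : e / 2 < e by rewrite gtr_pMr// invf_lt1// ltr1n.
pose w : C := (e / 2)%:C.
have cw : cmod w = e / 2 by rewrite cmod_real gtr0_norm.
have w0 : w != 0 by rewrite -cmod_gt0 cw.
have sE (v : C) n : v != 0 -> series (fun k => a k * v ^ (k%:Z - m%:Z)%R) n * v ^+ m =
    series (fun k => a k * v ^+ k) n.
  move=> v0; rewrite /series /= mulr_suml; apply: eq_bigr => k _.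
  by rewrite -mulrA expfzDr// -exprnP -exprnN mulfVK// expf_neq0.
have cE (v : C) : v != 0 -> cmod v < e ->
    series (fun k => a k * v ^+ k) @ \oo --> F (s0 + v) * v ^+ m.
  move=> v0 ve; have E : s0 + v - s0 = v by ring.
  have := eF (s0 + v); rewrite E => /(_ _ ve) => h.
  rewrite (_ : series _ = fun n => series (fun k => a k * v ^ (k%:Z - m%:Z)%R) n * v ^+ m).
    apply: cvgM; last exact: cvg_cst.
    by apply: h; rewrite -subr_eq0 E.
  by apply/funext => n; rewrite sE.
have [B [B0 aB]] : exists B, 0 <= B /\ forall k, cmod (a k * w ^+ k) <= B.
  have cs := cE w w0; rewrite cw in cs; have {}cs := cs e2e.
  have /cvgC_cmod c0 : (fun n => a n * w ^+ n) @ \oo --> (0 : C).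
    rewrite -[X in _ --> X](subrr (F (s0 + w) * w ^+ m)).
    rewrite (_ : (fun _ => _) = fun n => series (fun k => a k * w ^+ k) n.+1 -
       series (fun k => a k * w ^+ k) n).
      by apply: cvgB => //; rewrite (cvg_shiftS (series (fun k => a k * w ^+ k))).
    by apply/funext => n; rewrite /series /= big_nat_recr//= addrAC subrr add0r.
  have /cvg_seq_bounded [B [_ BP]] : cvgn (fun n => cmod (a n * w ^+ n)) by exact: cvgP c0.
  exists (`|B| + 1); split=> [|k]; first by rewrite addr_ge0.
  apply: le_trans (BP (`|B| + 1) _ k I); first exact: ler_norm.
  by rewrite ltr_pwDr// ler_norm.
pose r := e / 4.
have r0 : 0 < r by rewrite divr_gt0.
have ra : asum (fun k => a k * r%:C ^+ k) (B / (1 - 2^-1)).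
  apply: asum_dom (psum_le_geom B0 _ _); [| |lra]; last by rewrite invr_ge0.
  move=> k; apply: le_trans (ler_wpM2r _ (aB k)); last by rewrite exprn_ge0 ?invr_ge0.
  rewrite !cmodM -mulrA ler_wpM2l ?cmod_ge0// !cmodX cw cmod_real gtr0_norm//.
  by rewrite -exprMn (_ : e / 2 / 2 = r)// /r; lra.
pose G s := csum (fun k => a k * (s - s0) ^+ k).
exists r, (B / (1 - 2^-1)), G; split=> //.
near=> s.
have ss0 : s - s0 != 0 by rewrite subr_eq0; near: s; exact: near_neq.
have se : cmod (s - s0) < e by near: s; exact: dnear_ball.
rewrite /G (csum_unique (cE _ ss0 se)) mulfK ?expf_neq0//.
by rewrite addrC subrK.
Unshelve. all: by end_near. Qed.

Lemma laurent_mero F s0 m a : has_laurent F s0 m a -> mero_at F s0.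
Proof.
move=> /laurentP [r [M [G [r0 aG FG]]]]; exists m, G; split=> //.
by exists r, M, a.
Qed.

Lemma mero_laurent F s0 : mero_at F s0 -> exists m a, has_laurent F s0 m a.
Proof.
move=> [m [G [[r [M [a [r0 aG]]]] FG]]]; exists m, a.
exact: has_laurentP r0 aG FG.
Qed.

(** The pole orders [m] and [n] are not unique. Multiplication by [(s - s0) ^+ (m + n)] turns both
    expansions into power series, and these have the same coefficients. *)
Lemma laurent_unique F G s0 m n a b : has_laurent F s0 m a -> has_laurent G s0 n b ->
  (\forall s \near s0^', F s = G s) -> shift_coef n a = shift_coef m b.
Proof.
move=> /laurentP [r [M [F1 [r0 aF FF]]]] /laurentP [r' [M' [G1 [r'0 bG GG]]]] FG.
have [M1 h1] := has_pseries_mulX n r0 aF.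
have [M2 h2] := has_pseries_mulX m r'0 bG.
apply: (has_pseries_unique r0 r'0 h1 h2); near=> s.
have ss0 k : (s - s0) ^+ k != 0.
  by rewrite expf_neq0// subr_eq0; near: s; exact: near_neq.
have FG1 : F1 s / (s - s0) ^+ m = G1 s / (s - s0) ^+ n.
  rewrite -(_ : F s = F1 s / (s - s0) ^+ m); last by near: s.
  rewrite -(_ : G s = G1 s / (s - s0) ^+ n); last by near: s.
  by near: s.
by apply/eqP; rewrite -eqr_div//; apply/eqP.
Unshelve. all: by end_near. Qed.

Lemma laurent_unique_nth F G s0 m n a b : has_laurent F s0 m a -> has_laurent G s0 n b ->
  (\forall s \near s0^', F s = G s) -> forall j, a (m + j)%N = b (n + j)%N.
Proof.
move=> aF bG FG j; have := laurent_unique aF bG FG.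
move=> /(congr1 (fun f => f (m + j + n)%N)).
by rewrite shift_coefE addnCAC shift_coefE.
Qed.

Lemma Pf_laurent F s0 m a : has_laurent F s0 m a -> Pf F s0 = a m.
Proof.
move=> aF; rewrite /Pf; case: xgetP => [c _ [n [b [bF ->]]]|/(_ (a m)) []].
  have := laurent_unique_nth bF aF _ 0; rewrite !addn0; apply.
  by near=> s.
by exists m, a.
Unshelve. all: by end_near. Qed.

(** A removable singularity, by induction on the order: for a positive order [G] equals [P] times a
    positive power of [s - s0], so its constant coefficient is zero and one factor [s - s0] is
    divided out. *)
Lemma laurent_continuous F (P : C -> C) s0 m a : has_laurent F s0 m a ->
  (\forall s \near s0^', F s = P s) -> P s @[s --> s0] --> P s0 ->
  (forall k, (k < m)%N -> a k = 0) /\ a m = P s0.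
Proof.
move=> /laurentP [r [M [G [r0 aG FG]]]] FP cP.
have {FG FP} GP : \forall s \near s0^', G s = P s * (s - s0) ^+ m.
  near=> s; rewrite -(_ : F s = P s); last by near: s.
  rewrite (_ : F s = G s / (s - s0) ^+ m); last by near: s.
  by rewrite mulfVK// expf_neq0// subr_eq0; near: s; exact: near_neq.
have unl (f : C -> C) (l l' : C) : f s @[s --> s0^'] --> l -> f s @[s --> s0^'] --> l' -> l = l'.
  by move=> fl fl'; exact: (cvg_unique _ fl fl').
have {}cP : P s @[s --> s0^'] --> P s0 by exact: cvg_within_filter.
elim: m a M G aG GP => [|m IH] a M G aG GP.
  split=> //; apply: (unl G); first exact: cvg_within_filter (has_pseries_cvg0 r0 aG).
  apply: cvg_trans cP; apply: near_eq_cvg.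
  by apply: filterS GP => s ->; rewrite expr0 mulr1.
have a0 : a 0%N = 0.
  apply: (unl G); first exact: cvg_within_filter (has_pseries_cvg0 r0 aG).
  rewrite -(mulr0 (P s0)).
  apply: (@cvg_trans _ ((fun s => P s * (s - s0) ^+ m.+1) @ s0^')).
    by apply: near_eq_cvg; apply: filterS GP => s ->.
  have X0 : (fun s => (s - s0) ^+ m.+1) @ s0^' --> (0 : C).
    by apply: cvg_within_filter; exact: subr_cvg0.
  exact: (cvgM cP X0).
have a01 k : (k < 1)%N -> a k = 0 by case: k.
have [M' [H [aH GH]]] := has_pseries_factor r0 aG a01.
have HP : \forall s \near s0^', H s = P s * (s - s0) ^+ m.
  near=> s.
  have ss0 : s - s0 != 0 by rewrite subr_eq0; near: s; exact: near_neq.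
  apply: (mulIf ss0); rewrite -mulrA -exprSr -[s - s0 in LHS]expr1 -GH.
    by near: s.
  by near: s; exact: dnear_ball_le.
have [h1 h2] := IH _ _ _ aH HP; split; last by rewrite -h2 addn1.
by case=> // k; rewrite ltnS => /h1; rewrite addn1.
Unshelve. all: by end_near. Qed.

Lemma meromorphic_continuous_value F (P : C -> C) s0 : meromorphic F ->
  (\forall s \near s0^', F s = P s) -> P s @[s --> s0] --> P s0 -> F s0 = P s0.
Proof.
move=> /(_ s0) [m [a [aF FE]]] FP cP.
by have [a0 <-] := laurent_continuous aF FP cP; rewrite FE.
Qed.

Lemma Pf_continuous_value F (P : C -> C) s0 : mero_at F s0 ->
  (\forall s \near s0^', F s = P s) -> P s @[s --> s0] --> P s0 -> Pf F s0 = P s0.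
Proof.
move=> /mero_laurent [m [a aF]] FP cP.
by have [_ <-] := laurent_continuous aF FP cP; rewrite (Pf_laurent aF).
Qed.

Lemma Pf_near F : (forall s, mero_at F s) -> forall s0, \forall s \near s0^', Pf F s = F s.
Proof.
move=> mF s0; have [m [G [[r [M [a [r0 aG]]]] /dnearC_P [e e0 FG]]]] := mF s0.
apply/dnearC_P; exists (Num.min r e); first by rewrite lt_min r0.
move=> s ss0; rewrite lt_min => /andP[sr se].
rewrite (FG s)//; apply: (Pf_continuous_value (P := fun s => G s / (s - s0) ^+ m)) => //.
  exact: punctured_spread FG se.
have h1 := has_pseries_continuous aG sr.
have h2 : (fun s' => s' - s0) @ s --> s - s0.
  apply/(cvgC_P (F := nbhs s)) => d d0; apply/nearC_P.
  by exists d => // s'; rewrite (_ : s' - s0 - (s - s0) = s' - s)//; ring.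
have nz : (s - s0) ^+ m != 0 by rewrite expf_neq0// subr_eq0.
exact: (cvgM h1 (cvgV nz (cvgC_X h2))).
Qed.

(** A function that is locally meromorphic may take arbitrary values at isolated points; passing to
    its finite part gives the values that [meromorphic] requires. *)
Lemma meromorphic_Pf F : (forall s, mero_at F s) -> meromorphic (Pf F).
Proof.
move=> mF s0; have [m [a aF]] := mero_laurent (mF s0); exists m, a; split.
  have [r [M [G [r0 aG FG]]]] := laurentP aF.
  apply: has_laurentP r0 aG _; have := Pf_near mF s0.
  by apply: filterS2 FG => s -> ->.
by move=> _; exact: Pf_laurent.
Qed.

Lemma meromorphic_mero F s : meromorphic F -> mero_at F s.
Proof. by move=> /(_ s) [m [a [/laurent_mero]]]. Qed.

Lemma meromorphic_unique F G (s1 : C) : meromorphic F -> meromorphic G ->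
  (\forall s \near s1^', F s = G s) -> forall s0, \forall s \near s0^', F s = G s.
Proof.
move=> mF mG FG s0.
have : \forall s \near s0^', F s + - G s = 0.
  apply: (mero_at_identity (s1 := s1)).
    by move=> t _; apply: mero_atD; [|apply: mero_atN]; exact: meromorphic_mero.
  by apply: filterS FG => s ->; rewrite subrr.
by apply: filterS => s /subr0_eq.
Qed.

End MeromorphicFunctions.

(** * Exponential and binomial series *)

Section ComplexExponential.
Context {R : realType}.
Local Notation C := R[i].
Implicit Types (u v w s a : C) (r M : R).

Definition ecoef w (k : nat) : C := w ^+ k / k`!%:R.

Lemma cmod_ecoef w k : cmod (ecoef w k) = cmod w ^+ k / k`!%:R.
Proof. by rewrite cmodM cmodX cmodV cmod_nat. Qed.

Lemma ecoef_asum w : asum (ecoef w) (expR (cmod w)).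
Proof.
move=> n; apply: (@le_trans _ _ (series (exp_coeff (cmod w)) n)).
  by apply: ler_sum => k _; rewrite cmod_ecoef.
apply: nondecreasing_cvgn_le; last exact: is_cvg_series_exp_coeff.
apply/nondecreasing_seqP => m; rewrite /series /= big_nat_recr//= lerDl.
by rewrite divr_ge0 ?exprn_ge0 ?cmod_ge0.
Qed.

Definition cexps w := csum (ecoef w).

Lemma cexpsD u v : cexps (u + v) = cexps u * cexps v.
Proof.
have [_ <-] := csum_mul (ecoef_asum u) (ecoef_asum v).
apply: eq_csum => k; rewrite /ecoef addrC exprDn mulr_suml big_mkord.
apply: eq_bigr => i _; rewrite -[_ *+ _]mulr_natr.
have ik : (i <= k)%N by rewrite -ltnS.
rewrite -[X in _ / X%:R = _](bin_fact ik) !natrM.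
have nz m : (m`!%:R : C) != 0 by rewrite pnatr_eq0 -lt0n fact_gt0.
have bz : ('C(k, i)%:R : C) != 0 by rewrite pnatr_eq0 -lt0n bin_gt0.
by field; rewrite !nz bz.
Qed.

Lemma cexps_real (x : R) : cexps x%:C = (expR x)%:C.
Proof.
apply: csum_unique.
rewrite (_ : series _ = fun n => (series (exp_coeff x) n)%:C).
  by apply: cvgC_real; exact: is_cvg_series_exp_coeff.
apply/funext => n; rewrite /series /= rmorph_sum; apply: eq_bigr => k _.
by rewrite /ecoef /exp_coeff /= rmorphM fmorphV rmorph_nat rmorphXn.
Qed.

Lemma imX (y : R) k : (0 +i* y : C) ^+ k =
  ((~~ odd k)%:R * (-1) ^ k./2 * y ^+ k) +i* ((odd k)%:R * (-1) ^+ k.-1./2 * y ^+ k).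
Proof.
elim: k => [|k IH]; first by rewrite !expr0 !mul1r !mul0r.
rewrite exprS IH; apply: complex_eqP; rewrite ?ReM ?ImM /= !mul0r ?sub0r ?add0r ?addr0.
  case: k {IH} => [|k]; first by rewrite /= !mul0r mulr0 oppr0.
  rewrite /= negbK; case: (odd k) => /=; rewrite ?mul0r ?mulr0 ?oppr0//.
  by rewrite !mul1r -!exprnP !exprS; ring.
by rewrite -exprnP exprS; ring.
Qed.

Lemma cexps_im (y : R) : cexps (0 +i* y) = cos y +i* sin y.
Proof.
apply: csum_unique.
have E k : ecoef (0 +i* y) k = cos_coeff y k +i* sin_coeff y k.
  rewrite /ecoef imX -(rmorph_nat (@real_complex R)) -fmorphV.
  by apply: complex_eqP; rewrite ?ReM ?ImM /= mulr0 ?subr0 ?add0r.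
apply: cvgC_pair.
  under eq_fun do (rewrite /series/= Re_sum; under eq_bigr do rewrite E /=).
  by rewrite unlock; exact: is_cvg_series_cos_coeff.
under eq_fun do (rewrite /series/= Im_sum; under eq_bigr do rewrite E /=).
by rewrite unlock; exact: is_cvg_series_sin_coeff.
Qed.

(** The series is multiplicative by the Cauchy product, and on the real and imaginary axes it is the
    series of [expR], [cos] and [sin]; [cexp] is by definition the product of these two values. *)
Lemma cexp_series w : cexp w = csum (ecoef w).
Proof.
rewrite -/(cexps w) [in RHS](_ : w = (complex.Re w)%:C + (0 +i* complex.Im w)).
  by rewrite cexpsD cexps_real cexps_im.
by apply: complex_eqP; rewrite ?ReD ?ImD /= ?addr0 ?add0r.
Qed.

Lemma cexpD u v : cexp (u + v) = cexp u * cexp v.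
Proof. by rewrite !cexp_series; exact: cexpsD. Qed.

Lemma cexp0 : cexp (0 : C) = 1.
Proof. by rewrite /cexp /= expR0 cos0 sin0 mul1r. Qed.

Lemma cmod_cexp w : cmod (cexp w) = expR (complex.Re w).
Proof.
rewrite /cexp cmodM cmod_real ger0_norm ?expR_ge0// cmod_def /= cos2Dsin2.
by rewrite sqrtr1 mulr1.
Qed.

Lemma cexp_real (x : R) : cexp x%:C = (expR x)%:C.
Proof. by rewrite cexp_series -cexps_real. Qed.

Lemma cexpX w n : cexp (w *+ n) = cexp w ^+ n.
Proof.
elim: n => [|n IH]; first by rewrite mulr0n expr0 cexp0.
by rewrite mulrS exprS cexpD IH.
Qed.

Lemma has_pseries_cexp_lin r s0 a : 0 <= r ->
  has_pseries r (expR (complex.Re (a * s0) + cmod a * r)) s0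
    (fun k => cexp (a * s0) * ecoef a k) (fun s => cexp (a * s)).
Proof.
move=> r0; split=> [n|s sr].
  rewrite expRD -cmod_cexp -[cmod a * r](_ : cmod (a * r%:C) = _); last first.
    by rewrite cmodM cmod_real ger0_norm.
  have := asumZ (cexp (a * s0)) (ecoef_asum (a * r%:C)) n.
  apply: le_trans; apply: ler_sum => k _; rewrite -mulrA /ecoef exprMn.
  by rewrite [_ / _ * _ in leLHS]mulrAC.
rewrite [s in LHS](_ : s = s0 + (s - s0)); last by rewrite addrC subrK.
rewrite mulrDr cexpD [cexp (a * (s - s0))]cexp_series -(csumZ _ (ecoef_asum _)).
by apply: eq_csum => k; rewrite /ecoef exprMn; ring.
Qed.

(** The norm is submultiplicative, so [F ^+ i] has norm at most [M ^+ i], and the exponential series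
    of [F] converges in norm with bound [expR M]. *)
Lemma has_pseries_cexp r M s0 c (F : C -> C) : 0 < r -> has_pseries r M s0 c F ->
  exists b, has_pseries r (expR M) s0 b (fun s => cexp (F s)).
Proof.
move=> r0 cF; have M0 := asum_ge0 cF.1.
pose ci := fix ci i := if i is i.+1 then cauchy_prod c (ci i)
  else fun k : nat => if k is 0%N then (1 : C) else 0.
have ciF i : has_pseries r (M ^+ i) s0 (ci i) (fun s => F s ^+ i).
  elim: i => [|i IH].
    rewrite expr0 -[1 in X in has_pseries _ X](cmod1 (R := R)).
    apply: eq_has_pseries (has_pseries_cst _ _ _) _ => s _.
    by rewrite expr0.
  rewrite exprS; apply: eq_has_pseries (has_pseriesM cF IH) _ => s _.
  by rewrite exprS.
have ciF' i : has_pseries r (cmod (i`!%:R : C)^-1 * M ^+ i) s0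
    (fun k => (i`!%:R)^-1 * ci i k) (fun s => (i`!%:R)^-1 * F s ^+ i).
  exact: has_pseriesZ.
have sg : psum_le (fun i => cmod (i`!%:R : C)^-1 * M ^+ i) (expR M).
  move=> n; have := ecoef_asum M%:C n; rewrite cmod_real ger0_norm//.
  apply: le_trans; apply: ler_sum => i _; rewrite cmod_ecoef cmodV cmod_nat mulrC.
  by rewrite cmod_real ger0_norm.
exists (fun k => csum (fun i => (i`!%:R)^-1 * ci i k)).
apply: eq_has_pseries (has_pseries_csum r0 ciF' sg) _ => s sr.
by rewrite cexp_series; apply: eq_csum => k; rewrite mulrC.
Qed.

(** The chain rule: [cexp w - 1 = w * G w] with [G] continuous and [G 0 = 1], applied to
    [w = F (h + s) - F s]. *)
Lemma cexp_quotient_cvg (F : C -> C) s (l : C) :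
  F t @[t --> s] --> F s ->
  (fun h : C => h^-1 * (F (h + s) - F s)) @ 0^' --> l ->
  (fun h : C => h^-1 * (cexp (F (h + s)) - cexp (F s))) @ 0^' --> cexp (F s) * l.
Proof.
move=> cF Fl.
have r1 : (0 : R) < 1 by [].
have h0 := has_pseries_cexp_lin 0 1 (ltW r1).
have h1 := has_pseriesD h0 (has_pseries_cst 1 0 (-1 : C)).
have [|M [G [aG GE]]] := @has_pseries_factor _ _ _ _ _ _ 1%N r1 h1.
  by case=> // _; rewrite mulr0 cexp0 /ecoef expr0 fact0 !mul1r invr1 subrr.
have G0 : G t @[t --> (0 : C)] --> (1 : C).
  have := has_pseries_cvg0 r1 aG.
  by rewrite add0n mulr0 cexp0 /ecoef /= expr1 divr1 addr0 mul1r.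
have cd : (fun h : C => F (h + s) - F s) @ 0^' --> (0 : C).
  apply/cvgC_P => e e0; move: cF => /cvgC_P /(_ _ e0) /nearC_P [d d0 dF].
  by apply/dnearC_P; exists d => // h _; rewrite !subr0 => hd; apply: dF; rewrite addrK.
have cG : (fun h : C => G (F (h + s) - F s)) @ 0^' --> (1 : C).
  exact: (cvg_comp _ G cd G0).
have ct : (fun h : C => cexp (F s) * ((h^-1 * (F (h + s) - F s)) *
    G (F (h + s) - F s))) @ 0^' --> cexp (F s) * (l * 1).
  exact: (cvgM (cvg_cst _) (cvgM Fl cG)).
rewrite mulr1 in ct; apply: cvg_trans ct; apply: near_eq_cvg.
have /cvgC_P /(_ _ r1) n1 := cd.
near=> h; have hd : cmod (F (h + s) - F s - 0) <= 1 by rewrite ltW//; near: h.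
have := GE _ hd; rewrite expr1 subr0 mul1r => E.
rewrite -[in RHS](subrK (F s) (F (h + s))) cexpD.
transitivity (cexp (F s) * (h^-1 * (G (F (h + s) - F s) * (F (h + s) - F s)))).
  by rewrite /=; ring.
by rewrite -E; ring.
Unshelve. all: by end_near. Qed.

End ComplexExponential.

(** * The principal logarithm and the binomial series *)

Section BinomialSeries.
Context {R : realType}.
Local Notation C := R[i].
Implicit Types (u v w s a : C) (r M : R).

Lemma clog_cexp u : `|complex.Im u| < pi -> clog (cexp u) = u.
Proof.
rewrite ltr_norml => /andP[ul ur]; rewrite /clog cmod_cexp expRK.
apply: complex_eqP => //=; rewrite /carg cmod_cexp.
have -> : complex.Re (cexp u) = expR (complex.Re u) * cos (complex.Im u).
  by rewrite /cexp ReM /= mul0r subr0.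
have -> : complex.Im (cexp u) = expR (complex.Re u) * sin (complex.Im u).
  by rewrite /cexp ImM /= mul0r addr0.
rewrite mulrAC mulfV ?gt_eqF ?expR_gt0// mul1r pmulr_rge0 ?expR_gt0//.
have [u0|u0] := leP 0 (complex.Im u).
  by rewrite sin_ge0_pi ?u0 ?(ltW ur)// cosK// in_itv /= u0 ltW.
have s0 : sin (complex.Im u) < 0.
  by rewrite -oppr_gt0 -sinN; apply: sin_gt0_pi; rewrite oppr_gt0 u0 ltrNl.
by rewrite leNgt s0 /= cosKN ?opprK// (ltW u0) ltW.
Qed.

Lemma cmod_realM (l : R) w : 0 < l -> cmod (l%:C * w) = l * cmod w.
Proof. by move=> l0; rewrite cmodM cmod_real gtr0_norm. Qed.

Lemma clog_real (l : R) : 0 < l -> clog l%:C = (ln l)%:C.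
Proof.
move=> l0; rewrite /clog cmod_real gtr0_norm//.
by rewrite /carg cmod_real gtr0_norm//= lexx divff ?gt_eqF// acos1.
Qed.

Lemma clog_realM (l : R) w : 0 < l -> w != 0 -> clog (l%:C * w) = (ln l)%:C + clog w.
Proof.
move=> l0 w0; rewrite /clog cmod_realM// lnM ?posrE ?cmod_gt0//.
have Rl : complex.Re (l%:C * w) = l * complex.Re w by rewrite ReM /= mul0r subr0.
have Il : complex.Im (l%:C * w) = l * complex.Im w by rewrite ImM /= mul0r addr0.
apply: complex_eqP => //=; rewrite ?add0r /carg cmod_realM// Rl Il pmulr_rge0//.
by rewrite -mulf_div divff ?gt_eqF// mul1r.
Qed.

Lemma cpow_real (l : R) s : 0 < l -> cpow l%:C s = cexp (s * (ln l)%:C).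
Proof. by move=> l0; rewrite /cpow clog_real. Qed.

Lemma cmod_cpow_real (l : R) s : 0 < l ->
  cmod (cpow l%:C s) = expR (complex.Re s * ln l).
Proof. by move=> l0; rewrite cpow_real// cmod_cexp ReM /= mulr0 subr0. Qed.

Definition bincoef a (n : nat) : C := \prod_(0 <= j < n) ((a - j%:R) / j.+1%:R).

Lemma bincoef0 a : bincoef a 0 = 1.
Proof. by rewrite /bincoef big_geq. Qed.

Lemma bincoefS a n : bincoef a n.+1 = bincoef a n * ((a - n%:R) / n.+1%:R).
Proof. by rewrite /bincoef big_nat_recr. Qed.

(** The Taylor coefficients of log (1 + w). The series is used in place of [clog], whose analyticity
    is not visible from its definition by [acos]. *)
Definition lcoef (k : nat) : C := if k is k'.+1 then (-1) ^+ k' / k'.+1%:R else 0.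

Definition lseries w := csum (fun k => lcoef k * w ^+ k).

Lemma has_pseries_lseries : has_pseries (2^-1 : R) 1 0 lcoef lseries.
Proof.
split; last by move=> s _; rewrite subr0.
case=> [|n]; first by rewrite big_geq.
rewrite big_nat_recl//= mul0r cmod0 add0r.
have h0 : 0 <= 2^-1 :> R by rewrite invr_ge0.
have h1 : 2^-1 < 1 :> R by lra.
have := psum_le_geom h0 h0 h1 n.
rewrite (_ : 2^-1 / (1 - 2^-1) = 1 :> R); last by field.
apply: le_trans; apply: ler_sum => k _.
rewrite !cmodM [cmod ((-1) ^+ k)]cmodX cmodN cmod1 expr1n mul1r cmodV cmod_nat cmod_realX// exprS.
by rewrite ler_piMl ?mulr_ge0 ?exprn_ge0// invf_le1 ?ler1n.
Qed.

Lemma lseries_quotient_cvg s : cmod s < 2^-1 ->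
  (fun h : C => h^-1 * (lseries (h + s) - lseries s)) @ 0^' --> (1 + s)^-1.
Proof.
move=> sr; have := has_pseries_quotient_cvg has_pseries_lseries.
move=> /(_ s); rewrite subr0 => /(_ sr).
suff -> : csum (fun k => dcoef lcoef k * s ^+ k) = (1 + s)^-1 by [].
have s1 : 1 + s != 0.
  rewrite -cmod_gt0; have : cmod (1 : C) <= cmod (1 + s) + cmod s.
    by rewrite -(cmodN s); apply: le_trans (cmodD _ _); rewrite addrK.
  by rewrite cmod1; lra.
apply: (mulIf s1); rewrite mulVf//.
have E k : dcoef lcoef k * s ^+ k = (- s) ^+ k.
  rewrite /dcoef /= mulrCA mulfV ?mulr1 ?pnatr_eq0//.
  by rewrite -[- s]mulN1r exprMn.
rewrite (eq_csum E).
have sM : asum (fun k => (- s) ^+ k) (1 / (1 - 2^-1)).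
  apply: asum_dom (psum_le_geom ler01 (q := 2^-1) _ _); rewrite ?invr_ge0//; last by lra.
  by move=> k; rewrite mul1r cmodX cmodN lerXn2r ?nnegrE ?cmod_ge0 ?invr_ge0// ltW.
rewrite mulrDr mulr1 {1}(csumS sM) expr0 mulrC -(csumZ _ sM).
rewrite -addrA -(csumD (asumS sM) (asumZ s sM)) [X in _ + X = _](_ : _ = 0) ?addr0//.
by rewrite -csum0; apply: eq_csum => k; rewrite exprS mulNr addNr.
Qed.

(** The function f = exp (a log (1 + s)) solves (1 + s) f' = a f. Comparing coefficients gives the
    recursion of [bincoef]. The norm bound comes from the bound [1] on the norm of the logarithm for
    radius [1/2]. *)
Lemma has_pseries_binomial a :
  has_pseries (2^-1 : R) (expR (cmod a)) 0 (bincoef a) (fun s => cexp (a * lseries s)).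
Proof.
have r0 : 0 < 2^-1 :> R by rewrite invr_gt0.
have al := has_pseriesZ a has_pseries_lseries.
rewrite mulr1 in al.
have [b bP] := has_pseries_cexp r0 al.
suff -> : bincoef a = b by [].
have q0 : 0 < 4^-1 :> R by rewrite invr_gt0.
have qr : 4^-1 < 2^-1 :> R by rewrite ltf_pV2 ?posrE// ltr_nat.
have dP := has_pseries_derive1 q0 qr bP.
have [M1 sdP] := has_pseries_mulX 1 q0 dP.
have h1 := has_pseriesD dP sdP.
have h2 := has_pseriesZ a bP.
have ode := has_pseries_unique q0 r0 h1 h2.
have b0 : b 0%N = 1.
  rewrite -(has_pseries0 (ltW r0) bP) (has_pseries0 (ltW r0) has_pseries_lseries).
  by rewrite mulr0 cexp0.
have {}ode : (fun k => dcoef b k + shift_coef 1 (dcoef b) k) = (fun k => a * b k).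
  apply: ode; apply: near_dnbhs; apply/nearC_P; exists 2^-1 => // s.
  rewrite subr0 => sr.
  have cl : lseries t @[t --> s] --> lseries s.
    by apply: has_pseries_continuous has_pseries_lseries _; rewrite subr0.
  have c1 : a * lseries t @[t --> s] --> a * lseries s by exact: cvgM (cvg_cst _) cl.
  have c2 : (fun h : C => h^-1 * (a * lseries (h + s) - a * lseries s)) @ 0^' -->
      a * (1 + s)^-1.
    rewrite (_ : (fun _ => _) = fun h : C => a * (h^-1 * (lseries (h + s) - lseries s))).
      exact: cvgM (cvg_cst _) (lseries_quotient_cvg sr).
    by apply/funext => h; rewrite -mulrBr mulrCA.
  have [_ ->] := @quotient_cvg_derivable _ (fun t => cexp (a * lseries t)) s _
    (cexp_quotient_cvg c1 c2).
  have s1 : 1 + s != 0.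
    rewrite -cmod_gt0; have : cmod (1 : C) <= cmod (1 + s) + cmod s.
      by rewrite -(cmodN s); apply: le_trans (cmodD _ _); rewrite addrK.
    by rewrite cmod1; lra.
  by field.
apply/funext; elim=> [|k IH]; first by rewrite bincoef0.
have k0 : (k.+1%:R : C) != 0 by rewrite pnatr_eq0.
apply: (mulIf k0); rewrite bincoefS IH mulrA mulfVK//.
have := congr1 (fun f => f k) ode; rewrite /= [b k.+1 * _]mulrC -/(dcoef b k).
move=> /(canRL (addrK _)) ->; rewrite mulrBr [b k * a]mulrC; congr (_ - _).
by case: k {IH k0} => [|k]; rewrite /shift_coef /= ?mulr0// subn1 /dcoef mulrC.
Qed.

(** The exponent [1] in the binomial series, which then stops after two terms. *)
Lemma cexp_lseries s : cmod s <= 2^-1 -> cexp (lseries s) = 1 + s.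
Proof.
move=> sr; have := (has_pseries_binomial 1).2 s; rewrite subr0 mul1r => ->//.
rewrite (csum_finite (N := 2%N)).
  by rewrite !big_nat_recr//= big_geq// bincoefS bincoef0 subr0 divr1 add0r !mul1r expr0 expr1.
case=> [|[|k]]// _; rewrite /bincoef big_nat_recl//= big_nat_recl//=.
by rewrite subrr !mul0r mulr0 mul0r.
Qed.

(** On this disc the logarithmic series has modulus at most [1], which is below pi, so it is the
    principal logarithm of [1 + s]. *)
Lemma cpow1D s a : cmod s <= 2^-1 -> cpow (1 + s) a = csum (fun n => bincoef a n * s ^+ n).
Proof.
move=> sr; rewrite /cpow -cexp_lseries// clog_cexp.
  by have := (has_pseries_binomial a).2 s; rewrite subr0 => ->.
apply: le_lt_trans (normr_Im _) _; apply: (@le_lt_trans _ _ 1).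
  rewrite has_pseries_lseries.2 ?subr0//.
  by apply: csum_le; exact: asum_disc has_pseries_lseries.1 sr.
by apply: lt_le_trans (pi_ge2 R); rewrite ltr1n.
Qed.

Lemma bincoef_asum a w : cmod w <= 2^-1 ->
  asum (fun n => bincoef a n * w ^+ n) (expR (cmod a)).
Proof. by move=> wr; exact: asum_disc (has_pseries_binomial a).1 wr. Qed.

Lemma cpow_binomial (l : R) z a : 0 < l -> cmod z <= l / 2 ->
  cpow (l%:C + z) a = cpow l%:C a * csum (fun n => bincoef a n * (z / l%:C) ^+ n).
Proof.
move=> l0 zl; have lC0 : (l%:C : C) != 0 by rewrite -cmod_gt0 cmod_real gtr0_norm.
have wr : cmod (z / l%:C) <= 2^-1.
  by rewrite cmodM cmodV cmod_real gtr0_norm// ler_pdivrMr// mulrC.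
have w1 : 1 + z / l%:C != 0.
  rewrite -cmod_gt0; have : cmod (1 : C) <= cmod (1 + z / l%:C) + cmod (z / l%:C).
    by rewrite -(cmodN (z / _)); apply: le_trans (cmodD _ _); rewrite addrK.
  by rewrite cmod1; lra.
rewrite -cpow1D// (_ : l%:C + z = l%:C * (1 + z / l%:C)); last first.
  by rewrite mulrDr mulr1 mulrCA mulfV ?mulr1.
by rewrite {1}/cpow clog_realM// mulrDr cexpD cpow_real.
Qed.

Lemma cmod_bincoef_le a (K : R) n : cmod a <= K ->
  cmod (bincoef a n) <= \prod_(0 <= j < n) ((K + j%:R) / j.+1%:R).
Proof.
move=> aK; have K0 : 0 <= K by exact: le_trans (cmod_ge0 _) aK.
elim: n => [|n IH]; first by rewrite bincoef0 big_geq// cmod1.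
rewrite bincoefS big_nat_recr//= cmodM ler_pM ?cmod_ge0// cmodM cmodV cmod_nat.
rewrite ler_wpM2r ?invr_ge0//; apply: le_trans (cmodB _ _) _.
by rewrite cmod_nat lerD2r.
Qed.

(** These are the terms of the binomial series with exponent [- K] at [- 1/2]: the two signs cancel
    in every factor, so the terms equal their absolute values. *)
Lemma prod_binomial_psum (K : R) : 0 <= K ->
  psum_le (fun n => \prod_(0 <= j < n) ((K + j%:R) / j.+1%:R) * 2^-1 ^+ n) (expR K).
Proof.
move=> K0 n.
have := bincoef_asum (- K%:C) (w := (- 2^-1)%:C).
rewrite cmodN !cmod_real normrN !ger0_norm ?invr_ge0// => /(_ (lexx _) n).
apply: le_trans; apply: ler_sum => k _.
suff -> : bincoef (- K%:C) k * (- 2^-1)%:C ^+ k =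
    (\prod_(0 <= j < k) ((K + j%:R) / j.+1%:R) * 2^-1 ^+ k)%:C.
  rewrite cmod_real; exact: ler_norm.
elim: k => [|k IH]; first by rewrite bincoef0 big_geq// !expr0 !mul1r.
rewrite bincoefS exprSr mulrACA IH big_nat_recr//= exprSr [in RHS]mulrACA.
rewrite [RHS]rmorphM /=; congr (_ * _).
rewrite [RHS]rmorphM [X in _ = X * _]rmorphM rmorphN rmorphD !fmorphV !rmorph_nat.
by rewrite -opprD mulNr mulrNN.
Qed.

End BinomialSeries.

(** * Joint differentiability of a double series, and Taylor coefficients *)

Section DoubleSeries.
Context {R : realType}.
Local Notation C := R[i].

Lemma nearCC_P (s z : C) (P : set (C * C)) :
  (exists2 e : R, 0 < e & forall x, cmod (x.1 - s) < e -> cmod (x.2 - z) < e -> P x) ->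
  \forall x \near (s, z), P x.
Proof.
move=> [e e0 eP].
exists ([set t | cmod (t - s) < e], [set t | cmod (t - z) < e]).
  by split; exact: near_ball.
by case=> t u [/= ts uz]; exact: eP.
Qed.

Lemma differentiable_linear_approx (K : numFieldType) (V W : normedModType K)
    (f : V -> W) (df : {linear V -> W}) (x : V) : continuous df ->
  (forall e : K, 0 < e -> \forall h \near (0 : V),
    `|f (h + x) - f x - df h| <= e * `|h|) -> differentiable f x.
Proof.
move=> cdf fdf.
have key : f \o shift x = cst (f x) + df +o_ 0 id.
  apply/eqaddoP => e /fdf; apply: filterS => h.
  set X := (X in `|X| <= _) => hle; set Y := (Y in `|Y| <= _).
  by have -> : Y = X by rewrite /X /Y /= opprD addrA.
by apply/diff_locallyP; rewrite (diff_unique cdf key).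
Qed.

Lemma differentiable_pair (F : C * C -> C) (s z A B : C) :
  (forall e : R, 0 < e -> \forall h \near (0 : C * C),
     cmod (F (h.1 + s, h.2 + z) - F (s, z) - (A * h.1 + B * h.2))
       <= e * (cmod h.1 + cmod h.2)) ->
  differentiable F (s, z).
Proof.
move=> FAB.
pose df (h : C * C) : C := A * h.1 + B * h.2.
have lindf : linear df.
  by move=> c [u1 u2] [v1 v2]; rewrite /df /= /GRing.scale /=; ring.
pose ldf : {linear (C * C)%type -> C} :=
  HB.pack df (GRing.isLinear.Build _ _ _ _ df lindf).
have cdf : continuous ldf.
  move=> x; apply: cvgD; apply: cvgM; try exact: cvg_cst.
    exact: cvg_fst.
  exact: cvg_snd.
apply: (differentiable_linear_approx cdf) => e e0.
have e1 : 0 < complex.Re e by move: e0; rewrite ltcE => /andP[].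
have eE : e = (complex.Re e)%:C.
  by move: e0; rewrite ltcE => /andP[/eqP /= e2 _]; apply: complex_eqP.
have := FAB _ (divr_gt0 e1 (ltr0n _ 2)); apply: filterS => h.
set Y := F _ - _ - _ => hle.
rewrite -[X in `|X| <= _]/Y eE prod_normE !cmodE /=.
rewrite -[X in _ <= _ * X](_ : (Num.max (cmod h.1) (cmod h.2))%:C = _); last first.
  by case: (leP (cmod h.1) (cmod h.2)) => h12;
    [rewrite max_r ?lecR|rewrite max_l ?lecR// ltW].
rewrite -rmorphM lecR; apply: le_trans hle _.
rewrite -mulrA ler_wpM2l ?(ltW e1)// mulrC ler_pdivrMr// mulr_natr mulr2n.
by rewrite lerD// le_max lexx ?orbT.
Qed.

Lemma near0_pair (P : set (C * C)) :
  (exists2 e : R, 0 < e & forall h, cmod h.1 < e -> cmod h.2 < e -> P h) ->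
  \forall h \near (0 : C * C), P h.
Proof.
by move=> [e e0 eP]; apply/nearCC_P; exists e => // h; rewrite !subr0; exact: eP.
Qed.

Lemma cvg0_fst : (fun h : C * C => h.1) @ (0 : C * C) --> (0 : C).
Proof. by move=> P /nearC_P[e e0 eP]; apply: near0_pair; exists e => // h h1 _; apply: eP; rewrite subr0. Qed.

Lemma cvg0_snd : (fun h : C * C => h.2) @ (0 : C * C) --> (0 : C).
Proof. by move=> P /nearC_P[e e0 eP]; apply: near0_pair; exists e => // h _ h1; apply: eP; rewrite subr0. Qed.

Lemma has_pseries_slice (r rho K : R) (M : nat -> R) (s0 z : C)
    (a : nat -> nat -> C) (phi : nat -> C -> C) :
  0 < r -> cmod z <= rho -> (forall n, has_pseries r (M n) s0 (a n) (phi n)) ->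
  psum_le (fun n => M n * rho ^+ n) K ->
  has_pseries r K s0 (fun k => csum (fun n => z ^+ n * a n k))
    (fun s => csum (fun n => z ^+ n * phi n s)).
Proof.
move=> r0 zr aphi MK.
apply: (has_pseries_csum r0 (fun n => has_pseriesZ (z ^+ n) (aphi n))).
apply: psum_le_dom MK => n; rewrite mulrC cmodX ler_wpM2l ?(asum_ge0 (aphi n).1)//.
by rewrite lerXn2r ?nnegrE ?cmod_ge0 ?(le_trans _ zr) ?cmod_ge0.
Qed.

Lemma remainder_split (x y w h q b a k : C) : x - w = h * q ->
  x - y - (a * k + b * h) = h * (q - b) + (w - y - a * k).
Proof. by move=> E; rewrite mulrBr -E; ring. Qed.

(** The increment is split into a step in [z] at the moved point [h.1 + s] and a step in [s] at
    fixed [z]. The first is [h.2 * Q h], where [Q] is continuous at [0] in both variables by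
    dominated convergence; the second is a difference quotient in one variable. *)
Lemma double_series_differentiable (r rho K : R) (M : nat -> R) (s0 : C)
    (a : nat -> nat -> C) (phi : nat -> C -> C) (F : C * C -> C) :
  0 < r -> (forall n, has_pseries r (M n) s0 (a n) (phi n)) ->
  psum_le (fun n => M n * rho ^+ n) K ->
  (forall s z, cmod (s - s0) < r -> cmod z < rho ->
     F (s, z) = csum (fun n => z ^+ n * phi n s)) ->
  forall s z, cmod (s - s0) < r -> cmod z < rho -> differentiable F (s, z).
Proof.
move=> r0 aphi MK Fphi s z sr zr.
have hM n : 0 <= M n := asum_ge0 (aphi n).1.
pose rh1 := (cmod z + rho) / 2.
have zr1 : cmod z < rh1 by rewrite /rh1; lra.
have r1r : rh1 < rho by rewrite /rh1; lra.
have rho0 : 0 < rho by exact: le_lt_trans (cmod_ge0 z) zr.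
have phi_le n t : cmod (t - s0) <= r -> cmod (phi n t) <= M n.
  by move=> tr; rewrite (aphi n).2//; apply: csum_le; exact: asum_disc (aphi n).1 tr.
pose q (h : C) k : C := \sum_(i < k) (z + h) ^+ (k.-1 - i) * z ^+ i.
have qE (h : C) k : h * q h k = (z + h) ^+ k - z ^+ k.
  by rewrite subrXX addrAC subrr add0r.
have q_le (h : C) k : cmod (z + h) <= rh1 -> cmod (q h k) <= rho ^+ k / (rho - rh1).
  by move=> hr; have [] := cmod_subX k r1r hr (ltW zr1).
have gM : psum_le (fun n => M n * (rho ^+ n / (rho - rh1))) (K / (rho - rh1)).
  move=> n; under eq_bigr do rewrite mulrA.
  by rewrite -mulr_suml ler_wpM2r// invr_ge0 subr_ge0 ltW.
pose Q (h : C * C) := csum (fun n => phi n (h.1 + s) * q h.2 n).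
pose B := csum (fun n => phi n s * q 0 n).
pose d := Num.min (r - cmod (s - s0)) (rh1 - cmod z).
have d0 : 0 < d by rewrite lt_min !subr_gt0 sr.
have small (h : C * C) : cmod h.1 < d -> cmod h.2 < d ->
    cmod (h.1 + s - s0) < r /\ cmod (z + h.2) <= rh1.
  rewrite !lt_min => /andP[h1 _] /andP[_ h2]; split.
    by rewrite -addrA; apply: le_lt_trans (cmodD _ _) _; rewrite -ltrBrDr.
  by apply: le_trans (cmodD _ _) _; rewrite addrC -lerBrDr ltW.
have b_le (h : C * C) : cmod h.1 < d -> cmod h.2 < d ->
    forall n, cmod (phi n (h.1 + s) * q h.2 n) <= M n * (rho ^+ n / (rho - rh1)).
  move=> h1 h2 n; have [hs hz] := small h h1 h2.
  by rewrite cmodM ler_pM ?cmod_ge0 ?q_le// phi_le// ltW.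
have nd : \forall h \near (0 : C * C), cmod h.1 < d /\ cmod h.2 < d.
  by apply: near0_pair; exists d.
have QB : Q h @[h --> (0 : C * C)] --> B.
  apply: (csum_dominated (F := nbhs (0 : C * C)) _ gM).
    by apply: filterS nd => h [h1 h2]; exact: b_le.
  move=> k; apply: cvgM.
    have c1 : (fun h : C * C => h.1 + s) @ (0 : C * C) --> s.
      by rewrite -[X in _ --> X]add0r; apply: cvgD; [exact: cvg0_fst|exact: cvg_cst].
    exact: (cvg_comp _ (phi k) c1 (has_pseries_continuous (aphi k) sr)).
  apply: cvg_bigsum => i; apply: cvgM; last exact: cvg_cst.
  apply: cvgC_X; apply: cvgD; [exact: cvg_cst|exact: cvg0_snd].
have sF := has_pseries_slice r0 (ltW zr) aphi MK.
have := has_pseries_quotient_cvg sF sr; set A := (X in _ --> X) => FA.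
apply: (@differentiable_pair F s z A B) => e e0.
have /cvgC_P/(_ _ e0) nQ := QB.
have /cvgC_P/(_ _ e0) /dnearC_P [d1 d10 nA] := FA.
have nd1 : \forall h \near (0 : C * C), cmod h.1 < d1.
  by apply: near0_pair; exists d1.
near=> h.
have [h1 h2] : cmod h.1 < d /\ cmod h.2 < d by near: h.
have [hs hz] := small h h1 h2.
have hA : cmod h.1 < d1 by near: h.
have hQ : cmod (Q h - B) < e by near: h.
have zr' : cmod (h.2 + z) < rho by rewrite addrC; exact: le_lt_trans hz r1r.
have sum_asum t w : cmod (t - s0) <= r -> cmod w <= rho ->
    asum (fun n => w ^+ n * phi n t) K.
  move=> tr wr; apply: (asum_dom (g := fun n => M n * rho ^+ n)) => // n.
  rewrite cmodM mulrC cmodX ler_pM ?cmod_ge0 ?exprn_ge0 ?cmod_ge0 ?phi_le//.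
  by rewrite lerXn2r ?nnegrE ?cmod_ge0// ltW.
have E1 : F (h.1 + s, h.2 + z) - F (h.1 + s, z) = h.2 * Q h.
  rewrite !Fphi// -(csumB (sum_asum _ _ (ltW hs) (ltW zr')) (sum_asum _ _ (ltW hs) (ltW zr))).
  rewrite /Q -(csumZ _ (asum_dom (b_le _ h1 h2) gM)); apply: eq_csum => n.
  by rewrite [RHS]mulrCA qE [RHS]mulrC [RHS]mulrBl [h.2 + z]addrC.
have E2 : cmod (F (h.1 + s, z) - F (s, z) - A * h.1) <= e * cmod h.1.
  have [h0|h0] := eqVneq h.1 0.
    by rewrite h0 add0r mulr0 subr0 subrr cmod0 mulr0.
  have := nA h.1 h0; rewrite subr0 => /(_ hA) lA.
  rewrite !Fphi// (_ : _ - _ - _ = h.1 * (h.1^-1 * (csum (fun n => z ^+ n * phi n (h.1 + s)) -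
    csum (fun n => z ^+ n * phi n s)) - A)).
    rewrite cmodM mulrC; apply: ler_wpM2r; first exact: cmod_ge0.
    exact: ltW lA.
  by rewrite mulrBr mulVKf// [A * _]mulrC.
rewrite (@remainder_split _ _ _ _ _ _ _ _ E1).
apply: le_trans (cmodD _ _) _; rewrite [leRHS]mulrDr [leRHS]addrC lerD//.
by rewrite cmodM mulrC ler_wpM2r ?cmod_ge0// ltW.
Unshelve. all: by end_near. Qed.

Lemma iter_dcoef (c : nat -> C) n k :
  iter n (@dcoef R) c k = ((k + n)`!%:R / k`!%:R) * c (k + n)%N.
Proof.
elim: n k => [|n IH] k.
  by rewrite addn0 divff ?mul1r// pnatr_eq0 -lt0n fact_gt0.
rewrite iterS {1}/dcoef IH addSnnS mulrA; congr (_ * _).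
rewrite factS natrM; field.
by rewrite addrC natr1 !pnatr_eq0 -lt0n fact_gt0.
Qed.

Lemma has_pseries_derive1n (rho M : R) (s0 : C) (c : nat -> C) (f : C -> C) :
  0 < rho -> has_pseries rho M s0 c f -> forall n,
  exists rho' M', 0 < rho' /\ has_pseries rho' M' s0 (iter n (@dcoef R) c) (derive1n n f).
Proof.
move=> rho0 cf; elim=> [|n [r [M' [r0 IH]]]]; first by exists rho, M.
have r2 : 0 < r / 2 by rewrite divr_gt0.
have r2r : r / 2 < r by rewrite gtr_pMr// invf_lt1// ltr1n.
exists (r / 2), (M' / (r - r / 2)); split=> //.
by rewrite derive1nS; exact: has_pseries_derive1.
Qed.

Lemma has_pseries_derivable (rho M : R) (s0 : C) (c : nat -> C) (f : C -> C) n :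
  0 < rho -> has_pseries rho M s0 c f ->
  derivable (derive1n n f) s0 1 /\ derive1n n f s0 = n`!%:R * c n.
Proof.
move=> rho0 cf; have [r [M' [r0 h]]] := has_pseries_derive1n rho0 cf n; split.
  by have [] := @has_pseries_derive _ _ _ _ _ _ s0 h; rewrite ?subrr ?cmod0.
by rewrite (has_pseries0 (ltW r0) h) iter_dcoef add0n fact0 divr1.
Qed.

End DoubleSeries.

(** * Mellin transforms and the Gamma function *)

Section ComplexIntegral.
Context d {T : measurableType d} {R : realType} (mu : {measure set T -> \bar R}).
Local Notation C := R[i].
Implicit Types (f : T -> C) (G : T -> R).

Definition cmeasurable f := measurable_fun setT (fun x => complex.Re (f x)) /\
  measurable_fun setT (fun x => complex.Im (f x)).

Definition rintegrable G := mu.-integrable setT (EFin \o G).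

Definition cint f : C := (\int[mu]_x complex.Re (f x)) +i* (\int[mu]_x complex.Im (f x)).

Lemma rintegrable_measurable G : rintegrable G -> measurable_fun setT G.
Proof. by move=> /measurable_int /measurable_EFinP. Qed.

Lemma rintegrable_dom (g G : T -> R) : measurable_fun setT g ->
  (forall x, `|g x| <= G x) -> rintegrable G -> rintegrable g.
Proof.
move=> mg gG iG; apply: le_integrable iG => //; first exact/measurable_EFinP.
by move=> x _ /=; rewrite lee_fin (le_trans (gG x))// ler_norm.
Qed.

Lemma cdom_Re f G : cmeasurable f -> (forall x, cmod (f x) <= G x) ->
  rintegrable G -> rintegrable (fun x => complex.Re (f x)).
Proof.
move=> [mf _] fG; apply: rintegrable_dom => // x.
exact: le_trans (normr_Re _) (fG x).
Qed.

Lemma cdom_Im f G : cmeasurable f -> (forall x, cmod (f x) <= G x) ->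
  rintegrable G -> rintegrable (fun x => complex.Im (f x)).
Proof.
move=> [_ mf] fG; apply: rintegrable_dom => // x.
exact: le_trans (normr_Im _) (fG x).
Qed.

(** The factor [2] comes from estimating the real and imaginary parts separately. *)
Lemma cint_le f G : cmeasurable f -> (forall x, cmod (f x) <= G x) ->
  rintegrable G -> cmod (cint f) <= 2 * \int[mu]_x G x.
Proof.
move=> mf fG iG; have iR := cdom_Re mf fG iG; have iI := cdom_Im mf fG iG.
have half (g : T -> R) : (forall x, `|g x| <= G x) -> rintegrable g ->
    `|\int[mu]_x g x| <= \int[mu]_x G x.
  move=> gG ig; apply: le_trans (le_normr_Rintegral _ ig) _ => //.
  apply: le_Rintegral => //.
  apply: rintegrable_dom iG => [|x]; last by rewrite normr_id.
  exact: measurableT_comp (rintegrable_measurable ig).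
apply: le_trans (cmod_le _) _; rewrite /= mulr_natl mulr2n lerD// half// => x.
  exact: le_trans (normr_Re _) (fG x).
exact: le_trans (normr_Im _) (fG x).
Qed.

Lemma rintegrable_sum (I : Type) (q : seq I) (g : I -> T -> R) :
  (forall i, rintegrable (g i)) -> rintegrable (fun x => \sum_(i <- q) g i x).
Proof.
move=> ig; rewrite /rintegrable.
rewrite (_ : EFin \o _ = fun x => (\sum_(i <- q) (g i x)%:E)%E).
  by apply: integrable_sum => // i _; exact: ig.
by apply/funext => x /=; rewrite sumEFin.
Qed.

Lemma Rintegral_sum (I : Type) (q : seq I) (g : I -> T -> R) :
  (forall i, rintegrable (g i)) ->
  \int[mu]_x (\sum_(i <- q) g i x) = \sum_(i <- q) \int[mu]_x g i x.
Proof.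
move=> ig; elim: q => [|i q IH].
  by under eq_Rintegral do rewrite big_nil; rewrite big_nil Rintegral_cst// mul0r.
rewrite big_cons -IH -RintegralD//; [|exact: ig|exact: (rintegrable_sum q ig)].
by apply: eq_Rintegral => x _; rewrite big_cons.
Qed.

Lemma cmeasurable_cmod f : cmeasurable f -> measurable_fun setT (fun x => cmod (f x)).
Proof.
move=> [mR mI]; under eq_fun do rewrite cmod_def.
apply: (measurableT_comp (f := @Num.sqrt R)).
  by apply: continuous_measurable_fun; exact: sqrt_continuous.
by apply: measurable_funD; exact: measurable_funX.
Qed.

(** [G] dominates all partial sums at once, so dominated convergence applies to the real and
    imaginary parts of the partial sums. *)
Lemma cint_csum (f : nat -> T -> C) G : (forall n, cmeasurable (f n)) ->
  rintegrable G -> (forall x, asum (f^~ x) (G x)) ->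
  [/\ asum (fun n => cint (f n)) (2 * \int[mu]_x G x),
     cmeasurable (fun x => csum (f^~ x)) &
     csum (fun n => cint (f n)) = cint (fun x => csum (f^~ x))].
Proof.
move=> mf iG fG.
have fG1 n x : cmod (f n x) <= G x.
  apply: le_trans (fG x n.+1); rewrite big_nat_recr//= lerDr.
  by apply: sumr_ge0 => k _; exact: cmod_ge0.
have ic n : rintegrable (fun x => cmod (f n x)).
  apply: rintegrable_dom iG => [|x]; first exact: cmeasurable_cmod.
  by rewrite ger0_norm ?cmod_ge0.
have iR n := cdom_Re (mf n) (fG1 n) iG.
have iI n := cdom_Im (mf n) (fG1 n) iG.
have sG n x (p : C -> R) : (forall w, `|p w| <= cmod w) ->
    `|\sum_(0 <= k < n) p (f k x)| <= G x.
  move=> pc; apply: le_trans (fG x n); apply: le_trans (ler_norm_sum _ _ _) _.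
  exact: ler_sum.
have cR x : (fun n => \sum_(0 <= k < n) complex.Re (f k x)) @ \oo -->
    complex.Re (csum (f^~ x)).
  rewrite (_ : (fun n => _) = fun n => complex.Re (series (f^~ x) n)).
    exact: cvgC_Re (csum_cvg (fG x)).
  by apply/funext => n; rewrite /series /= Re_sum.
have cI x : (fun n => \sum_(0 <= k < n) complex.Im (f k x)) @ \oo -->
    complex.Im (csum (f^~ x)).
  rewrite (_ : (fun n => _) = fun n => complex.Im (series (f^~ x) n)).
    exact: cvgC_Im (csum_cvg (fG x)).
  by apply/funext => n; rewrite /series /= Im_sum.
have half (g : nat -> T -> R) (l : T -> R) :
    (forall n, rintegrable (g n)) ->
    (forall n x, `|\sum_(0 <= k < n) g k x| <= G x) ->
    (forall x, (fun n => \sum_(0 <= k < n) g k x) @ \oo --> l x) ->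
    measurable_fun setT l /\
    (fun n => \sum_(0 <= k < n) \int[mu]_x g k x) @ \oo --> \int[mu]_x l x.
  move=> ig gG gl.
  have ml : measurable_fun setT l.
    apply/measurable_EFinP.
    apply: (emeasurable_fun_cvg (fun n x => (\sum_(0 <= k < n) g k x)%:E)).
      by move=> n; apply/measurable_EFinP/rintegrable_measurable/rintegrable_sum.
    by move=> x _; apply: cvg_EFin; [near=> n|exact: gl].
  split=> //.
  have lG x : `|l x| <= G x.
    have cl : (fun n => `|\sum_(0 <= k < n) g k x|) @ \oo --> `|l x| by exact: cvg_norm.
    rewrite -(cvg_lim _ cl)//; apply: limr_le; first exact: cvgP cl.
    by near=> n; exact: gG.
  have il : rintegrable l by exact: rintegrable_dom iG.
  under eq_fun do rewrite -Rintegral_sum//.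
  apply: fine_cvg; rewrite fineK; last exact: integrable_fin_num il.
  apply: (@dominated_cvg _ _ _ mu setT measurableT
    (fun n x => (\sum_(0 <= k < n) g k x)%:E) _ (EFin \o G)) => //.
  - by move=> n; apply/measurable_EFinP/rintegrable_measurable/rintegrable_sum.
  - by move=> x _; apply: cvg_EFin; [near=> n|exact: gl].
  - by move=> n x _ /=; rewrite lee_fin.
have [mR hR] := half _ _ iR (fun n x => sG n x _ normr_Re) cR.
have [mI hI] := half _ _ iI (fun n x => sG n x _ normr_Im) cI.
split; [|by split|].
  move=> n; apply: (@le_trans _ _ (\sum_(0 <= k < n) 2 * \int[mu]_x cmod (f k x))).
    by apply: ler_sum => k _; apply: (cint_le (mf k)).
  rewrite -mulr_sumr ler_wpM2l// -Rintegral_sum//; apply: le_Rintegral => //.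
    exact: rintegrable_sum.
  by move=> x _; exact: fG.
apply: csum_unique; apply: (cvgC_pair (f := series _)).
  by under eq_fun do rewrite /series /= Re_sum.
by under eq_fun do rewrite /series /= Im_sum.
Unshelve. all: by end_near. Qed.

Lemma cmeasurableD f1 f2 : cmeasurable f1 -> cmeasurable f2 ->
  cmeasurable (fun x => f1 x + f2 x).
Proof.
move=> [R1 I1] [R2 I2]; split.
  by under eq_fun do rewrite ReD; exact: measurable_funD.
by under eq_fun do rewrite ImD; exact: measurable_funD.
Qed.

Lemma cmeasurableM f1 f2 : cmeasurable f1 -> cmeasurable f2 ->
  cmeasurable (fun x => f1 x * f2 x).
Proof.
move=> [R1 I1] [R2 I2]; split.
  under eq_fun do rewrite ReM.
  by apply: measurable_funB; exact: measurable_funM.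
under eq_fun do rewrite ImM.
by apply: measurable_funD; exact: measurable_funM.
Qed.

Lemma cmeasurable_cst (c : C) : cmeasurable (fun=> c).
Proof. by split; exact: measurable_cst. Qed.

Lemma cmeasurable_real (g : T -> R) : measurable_fun setT g ->
  cmeasurable (fun x => (g x)%:C).
Proof. by move=> mg; split=> //=; exact: measurable_cst. Qed.

Lemma cmeasurableX f n : cmeasurable f -> cmeasurable (fun x => f x ^+ n).
Proof.
move=> mf; elim: n => [|n IH].
  by under eq_fun do rewrite expr0; exact: cmeasurable_cst.
by under eq_fun do rewrite exprS; exact: cmeasurableM.
Qed.

Lemma cmeasurable_sum (I : Type) (q : seq I) (f : I -> T -> C) :
  (forall i, cmeasurable (f i)) -> cmeasurable (fun x => \sum_(i <- q) f i x).
Proof.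
move=> mf; elim: q => [|i q IH].
  by under eq_fun do rewrite big_nil; exact: cmeasurable_cst.
by under eq_fun do rewrite big_cons; exact: cmeasurableD.
Qed.

Lemma cmeasurable_cexp f : cmeasurable f -> cmeasurable (fun x => cexp (f x)).
Proof.
move=> [mR mI].
have me : measurable_fun setT (fun x => expR (complex.Re (f x))).
  exact: measurableT_comp.
have mc : measurable_fun setT (fun x => cos (complex.Im (f x))).
  apply: measurableT_comp mI; apply: continuous_measurable_fun.
  exact: continuous_cos.
have ms : measurable_fun setT (fun x => sin (complex.Im (f x))).
  apply: measurableT_comp mI; apply: continuous_measurable_fun.
  exact: continuous_sin.
apply: cmeasurableM; first exact: cmeasurable_real.
by split.
Qed.

Definition cintegrable f := cmeasurable f /\ rintegrable (fun x => cmod (f x)).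

Lemma cintegrable_dom f G : cmeasurable f -> (forall x, cmod (f x) <= G x) ->
  rintegrable G -> cintegrable f.
Proof.
move=> mf fG iG; split=> //; apply: rintegrable_dom iG => [|x].
  exact: cmeasurable_cmod.
by rewrite ger0_norm ?cmod_ge0.
Qed.

Lemma cintegrable_Re f : cintegrable f -> rintegrable (fun x => complex.Re (f x)).
Proof. by move=> [mf]; exact: cdom_Re. Qed.

Lemma cintegrable_Im f : cintegrable f -> rintegrable (fun x => complex.Im (f x)).
Proof. by move=> [mf]; exact: cdom_Im. Qed.

Lemma cintegrableD f1 f2 : cintegrable f1 -> cintegrable f2 ->
  cintegrable (fun x => f1 x + f2 x).
Proof.
move=> [m1 i1] [m2 i2].
apply: (cintegrable_dom (G := fun x => cmod (f1 x) + cmod (f2 x))).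
- exact: cmeasurableD.
- by move=> x; exact: cmodD.
- exact: (integrableD measurableT i1 i2).
Qed.

Lemma cintD f1 f2 : cintegrable f1 -> cintegrable f2 ->
  cint (fun x => f1 x + f2 x) = cint f1 + cint f2.
Proof.
move=> i1 i2; apply: complex_eqP => /=.
  rewrite -RintegralD//; try exact: cintegrable_Re.
  by apply: eq_Rintegral => x _; rewrite ReD.
rewrite -RintegralD//; try exact: cintegrable_Im.
by apply: eq_Rintegral => x _; rewrite ImD.
Qed.

Lemma cintegrableZ (c : C) f : cintegrable f -> cintegrable (fun x => c * f x).
Proof.
move=> [mf iF].
apply: (cintegrable_dom (G := fun x => cmod c * cmod (f x))).
- by apply: cmeasurableM => //; exact: cmeasurable_cst.
- by move=> x; rewrite cmodM.
- exact: (integrableZl measurableT (cmod c) iF).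
Qed.

Lemma cintZ (c : C) f : cintegrable f -> cint (fun x => c * f x) = c * cint f.
Proof.
move=> iF; have iR := cintegrable_Re iF; have iI := cintegrable_Im iF.
have Z r (g : T -> R) : rintegrable g -> rintegrable (fun x => r * g x).
  by move=> ig; exact: (integrableZl measurableT r ig).
apply: complex_eqP => /=.
  rewrite ReM /= -!RintegralZl// -RintegralB//; try exact: Z.
  by apply: eq_Rintegral => x _; rewrite ReM.
rewrite ImM /= -!RintegralZl// -RintegralD//; try exact: Z.
by apply: eq_Rintegral => x _; rewrite ImM.
Qed.

Lemma eq_cint f1 f2 : f1 =1 f2 -> cint f1 = cint f2.
Proof. by move=> /funext ->. Qed.

Lemma cint0 : cint (fun=> 0) = 0.
Proof. by apply: complex_eqP; rewrite /= Rintegral_cst// mul0r. Qed.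

Lemma cint_real (g : T -> R) : rintegrable g ->
  cint (fun x => (g x)%:C) = (\int[mu]_x g x)%:C.
Proof. by move=> ig; apply: complex_eqP => //=; rewrite Rintegral_cst// mul0r. Qed.

End ComplexIntegral.

(** * Integrals depending analytically on an exponent *)

Section MellinSeries.
Context {R : realType}.
Local Notation C := R[i].
Local Notation T := (measurableTypeR R).
Local Notation mu := (@lebesgue_measure R).

(** The factor e^((s - s0) v) is expanded in its exponential series, whose terms add up in modulus
    to at most e^(r |v|), and the sum is exchanged with the integral. The choice [v x = x] gives
    Mellin transforms, [v x = expR x] the functional equation of Gamma. *)
Lemma exp_moment_pseries (v : T -> R) (f : T -> C) (s0 : C) (r : R) :
  0 < r -> measurable_fun setT v -> cmeasurable f ->
  rintegrable mu (fun x => expR (complex.Re s0 * v x + r * `|v x|) * cmod (f x)) ->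
  (exists M, has_pseries r M s0
    (fun k => cint mu (fun x => ecoef (v x)%:C k * (cexp (s0 * (v x)%:C) * f x)))
    (fun s => cint mu (fun x => cexp (s * (v x)%:C) * f x))) /\
  forall k, cintegrable mu (fun x => ecoef (v x)%:C k * (cexp (s0 * (v x)%:C) * f x)).
Proof.
move=> r0 mv mf iF; pose h (x : T) := cexp (s0 * (v x)%:C) * f x.
pose G (x : T) := expR (complex.Re s0 * v x + r * `|v x|) * cmod (f x).
have mx : cmeasurable (fun x : T => (v x)%:C).
  exact: cmeasurable_real.
have mh : cmeasurable h.
  apply: cmeasurableM => //; apply: cmeasurable_cexp.
  by apply: cmeasurableM => //; exact: cmeasurable_cst.
have me k : cmeasurable (fun x : T => ecoef (v x)%:C k).
  apply: cmeasurableM; last exact: cmeasurable_cst.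
  exact: cmeasurableX.
have hG x : cmod (h x) = expR (complex.Re s0 * v x) * cmod (f x).
  by rewrite /h cmodM cmod_cexp ReM /= mulr0 subr0.
have termE (w : C) (x : R) k : ecoef (w * (v x)%:C) k * h x = w ^+ k * (ecoef (v x)%:C k * h x).
  by rewrite /ecoef exprMn -!mulrA.
have bound (w : C) : cmod w <= r -> forall x, asum (fun k => ecoef (w * (v x)%:C) k * h x) (G x).
  move=> wr x n; under eq_bigr do rewrite cmodM.
  rewrite -mulr_suml hG /G expRD mulrCA -[leRHS]mulrA ler_wpM2l ?expR_ge0//.
  rewrite ler_wpM2r ?cmod_ge0//.
  apply: le_trans (ecoef_asum (w * (v x)%:C) n) _.
  by rewrite ler_expR cmodM cmod_real ler_wpM2r.
have mt (w : C) k : cmeasurable (fun x : T => ecoef (w * (v x)%:C) k * h x).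
  under eq_fun do rewrite termE.
  by apply: cmeasurableM; [exact: cmeasurable_cst|exact: cmeasurableM].
have rC0 : (r%:C : C) != 0 by rewrite -cmod_gt0 cmod_real gtr0_norm.
have ik k : cintegrable mu (fun x => ecoef (v x)%:C k * h x).
  have i1 : cintegrable mu (fun x => ecoef (r%:C * (v x)%:C) k * h x).
    apply: (@cintegrable_dom _ _ R mu _ G) => [|x|]; [exact: mt| |exact: iF].
    have rr : cmod (r%:C : C) <= r by rewrite cmod_real gtr0_norm.
    apply: le_trans (bound _ rr x k.+1); rewrite big_nat_recr//= lerDr.
    by apply: sumr_ge0 => j _; exact: cmod_ge0.
  have := cintegrableZ (r%:C ^+ k)^-1 i1.
  congr (cintegrable mu); apply/funext => x.
  by rewrite termE mulKf// expf_neq0.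
have E (w : C) : cmod w <= r ->
    asum (fun k => cint mu (fun x => ecoef (v x)%:C k * h x) * w ^+ k) (2 * \int[mu]_x G x) /\
    csum (fun k => cint mu (fun x => ecoef (v x)%:C k * h x) * w ^+ k) =
      cint mu (fun x => cexp ((s0 + w) * (v x)%:C) * f x).
  move=> wr; have [h1 _ h2] := cint_csum (mt w) iF (bound w wr).
  have e1 k : cint mu (fun x => ecoef (w * (v x)%:C) k * h x) =
      cint mu (fun x => ecoef (v x)%:C k * h x) * w ^+ k.
    by rewrite mulrC -cintZ//; apply: eq_cint => x; rewrite termE.
  rewrite (funext e1) in h1 h2; split=> //.
  rewrite h2; apply: eq_cint => x.
  transitivity (csum (fun k => h x * ecoef (w * (v x)%:C) k)).
    by apply: eq_csum => k; rewrite mulrC.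
  by rewrite (csumZ _ (ecoef_asum _)) -cexp_series /h mulrAC -cexpD mulrDl.
split=> //; exists (2 * \int[mu]_x G x); split.
  by have [] := E r%:C; rewrite ?cmod_real ?gtr0_norm.
move=> s sr; have [_ ->] := E _ sr.
by apply: eq_cint => x; rewrite addrC subrK.
Qed.

Lemma mellin_pseries (f : T -> C) (s0 : C) (r : R) : 0 < r -> cmeasurable f ->
  rintegrable mu (fun x => expR (complex.Re s0 * x + r * `|x|) * cmod (f x)) ->
  (exists M, has_pseries r M s0
    (fun k => cint mu (fun x => ecoef x%:C k * (cexp (s0 * x%:C) * f x)))
    (fun s => cint mu (fun x => cexp (s * x%:C) * f x))) /\
  forall k, cintegrable mu (fun x => ecoef x%:C k * (cexp (s0 * x%:C) * f x)).
Proof.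
move=> r0 mf; have mid : measurable_fun setT (fun x : T => x : R) by exact: measurable_id.
exact: (@exp_moment_pseries (fun x => x) f s0 r r0 mid mf).
Qed.

(** In the variable x = log t, [neg] cuts out t <= 1 and [pos] cuts out t > 1. *)
Definition neg (x : R) : R := (x <= 0)%R%:R.
Definition pos (x : R) : R := (0 < x)%R%:R.

Lemma measurable_neg : measurable_fun setT neg.
Proof.
rewrite (_ : neg = \1_(`]-oo, 0%R]%classic)); first exact: measurable_indic.
by apply/funext => x; rewrite indicE mem_setE in_itv.
Qed.

Lemma posE x : pos x = 1 - neg x.
Proof. by rewrite /pos /neg; case: leP => _; rewrite ?subrr ?subr0. Qed.

Lemma measurable_pos : measurable_fun setT pos.
Proof.
rewrite (_ : pos = fun x => 1 - neg x); last by apply/funext => x; rewrite posE.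
by apply: measurable_funB; [exact: measurable_cst|exact: measurable_neg].
Qed.

Lemma rintegrable_pos (c : R) : 0 < c -> rintegrable mu (fun x => pos x * expR (- c * x)).
Proof.
move=> c0.
have ie : rintegrable mu (exponential_pdf c).
  apply/integrableP; split.
    by apply/measurable_EFinP; exact: measurable_exponential_pdf.
  under eq_integral do rewrite gee0_abs ?lee_fin ?exponential_pdf_ge0 ?ltW//.
  by rewrite integral_exponential_pdf// ltry.
apply: (@rintegrable_dom _ _ _ mu _ (fun x => c^-1 * exponential_pdf c x)).
- apply: measurable_funM; first exact: measurable_pos.
  apply: measurableT_comp => //; apply: measurable_funM => //.
- move=> x; rewrite /pos; case: ltP => x0.
    rewrite mul1r ger0_norm ?expR_ge0// exponential_pdfE ?(ltW x0)//.
    by rewrite mulrA mulVf ?gt_eqF// mul1r.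
  rewrite mul0r normr0 mulr_ge0 ?invr_ge0 ?(ltW c0)//.
  by apply: exponential_pdf_ge0; exact: ltW.
- exact: (integrableZl measurableT c^-1 ie).
Qed.

(** The reflection of [x] turns the integrand into the exponential density divided by its rate [c],
    and that density has total mass [1]. *)
Lemma neg_exp_integral (c : R) : 0 < c ->
  rintegrable mu (fun x => neg x * expR (c * x)) /\
  \int[mu]_x (neg x * expR (c * x)) = c^-1.
Proof.
move=> c0.
have cont (b : R) : continuous (fun x : R => expR (b * x)).
  move=> x; apply: continuous_comp; last exact: continuous_expR.
  by apply: continuousM; [exact: cst_continuous|].
have I1 : (\int[mu]_x (neg x * expR (c * x))%:E = (c^-1)%:E)%E.
  transitivity (\int[mu]_(x in `]-oo, 0%R]) (expR (c * x))%:E)%E.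
    rewrite [RHS]integral_mkcond; apply: eq_integral => x _.
    rewrite patchE mem_setE in_itv /= /neg; case: (x <= 0); rewrite ?mul1r ?mul0r//.
  rewrite -[X in `]-oo, X]%classic]oppr0 ge0_integration_by_substitutionNy; last 2 first.
    by rewrite oppr0; exact: continuous_subspaceT (cont c).
    by move=> x _; exact: expR_ge0.
  have : (\int[mu]_(x in `[0%R, +oo[) (c^-1%:E * (exponential_pdf c x)%:E) = (c^-1)%:E)%E.
    rewrite ge0_integralZl//; last 3 first.
    - apply/measurable_EFinP/measurable_funTS; exact: measurable_exponential_pdf.
    - by move=> x _; rewrite lee_fin exponential_pdf_ge0// ltW.
    - by rewrite lee_fin invr_ge0 ltW.
    rewrite -[RHS]mule1; congr (_ * _)%E; rewrite -(integral_exponential_pdf c0).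
    rewrite [LHS]integral_mkcond; apply: eq_integral => x _.
    rewrite /exponential_pdf !patchE; by case: ifP => xD //; rewrite xD.
  move=> <-; apply: eq_integral => x; rewrite mem_setE in_itv /= andbT => x0.
  rewrite -EFinM exponential_pdfE// mulrA mulVf ?gt_eqF// mul1r.
  by rewrite mulrN mulNr.
split; last by rewrite /Rintegral I1.
apply/integrableP; split.
  apply/measurable_EFinP; apply: measurable_funM; first exact: measurable_neg.
  by apply: continuous_measurable_fun; exact: cont.
under eq_integral do rewrite gee0_abs ?lee_fin ?mulr_ge0 ?expR_ge0//.
by rewrite I1 ltry.
Qed.

End MellinSeries.

(** * Continuation of a Mellin transform by means of an asymptotic expansion *)

Section MellinTransform.
Context {R : realType}.
Local Notation C := R[i].
Local Notation T := (measurableTypeR R).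
Local Notation mu := (@lebesgue_measure R).
Implicit Types (s w : C) (r M : R).

(** Zeros on a real segment ending at [s0] accumulate there. Identities between analytic functions
    can thus be verified at real arguments, where real integration applies. *)
Lemma has_pseries_eq0_real r M s0 a (F : C -> C) (e : R) : 0 < r -> 0 < e ->
  has_pseries r M s0 a F -> (forall t : R, 0 < t < e -> F (s0 + t%:C) = 0) ->
  forall k, a k = 0.
Proof.
move=> r0 e0 aF F0 k; apply/eqP; apply: contraT => ak.
have /dnearC_P [d d0 dF] := has_pseries_neq0 r0 aF ak.
pose t := Num.min d e / 2.
have t0 : 0 < t by rewrite divr_gt0// lt_min d0.
have tm : t < Num.min d e by rewrite gtr_pMr ?lt_min ?d0// invf_lt1// ltr1n.
move: tm; rewrite lt_min => /andP[td te].
have := dF (s0 + t%:C); rewrite F0 ?t0// eqxx => /(_ _ _)/negP []//.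
  by rewrite -subr_eq0 addrAC subrr add0r -cmod_gt0 cmod_real gtr0_norm.
by rewrite addrAC subrr add0r cmod_real gtr0_norm.
Qed.

Lemma csum_geom (q : C) : cmod q < 1 ->
  asum (fun k => q ^+ k) (1 - cmod q)^-1 /\ csum (fun k => q ^+ k) = (1 - q)^-1.
Proof.
move=> q1.
have sM : asum (fun k => q ^+ k) (1 - cmod q)^-1.
  rewrite -[X in asum _ X]mul1r.
  apply: asum_dom (psum_le_geom ler01 (cmod_ge0 q) q1) => k.
  by rewrite mul1r cmodX.
split=> //.
have q0 : 1 - q != 0.
  by rewrite subr_eq0; apply: contraTneq q1 => <-; rewrite cmod1 ltxx.
apply: (mulIf q0); rewrite mulVf// mulrBr mulr1 {1}(csumS sM) expr0.
by rewrite mulrC -(csumZ _ sM) (eq_csum (fun k => exprS q k)) addrK.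
Qed.

Lemma has_pseries_invr r w : 0 <= r -> r < cmod w ->
  has_pseries r (cmod w^-1 * (1 - r / cmod w)^-1) w
    (fun k => (-1) ^+ k / w ^+ k.+1) (fun s => s^-1).
Proof.
move=> r0 rw; have w0 : w != 0 by rewrite -cmod_gt0; exact: le_lt_trans rw.
have cw0 : 0 < cmod w by rewrite cmod_gt0.
have E (u : C) k : (-1) ^+ k / w ^+ k.+1 * u ^+ k = w^-1 * (- (u / w)) ^+ k.
  by rewrite exprS invfM [in RHS]exprNn exprMn exprVn; ring.
have q1 (u : C) : cmod u <= r -> cmod (- (u / w)) < 1.
  by move=> ur; rewrite cmodN cmodM cmodV ltr_pdivrMr// mul1r; exact: le_lt_trans rw.
split.
  have rr : cmod (r%:C : C) <= r by rewrite cmod_real ger0_norm.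
  have [h _] := csum_geom (q1 _ rr).
  have := asumZ w^-1 h; rewrite cmodN cmodM cmodV cmod_real ger0_norm//.
  by congr asum; apply/funext => k; rewrite E.
move=> s sr; have [h1 h2] := csum_geom (q1 _ sr).
rewrite (eq_csum (E (s - w))) (csumZ _ h1) h2 opprK mulrBl divff//.
by rewrite addrC subrK invfM invrK mulrCA mulVf ?mulr1.
Qed.

Definition negint s := cint mu (fun x : T => cexp (s * x%:C) * (neg x)%:C).

Lemma neg_integrable (s0 : C) r : r < complex.Re s0 ->
  rintegrable mu (fun x : T => expR (complex.Re s0 * x + r * `|x|) * cmod ((neg x)%:C : C)).
Proof.
move=> rs; have c0 : 0 < complex.Re s0 - r by rewrite subr_gt0.
have [+ _] := neg_exp_integral c0; congr rintegrable; apply/funext => x.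
rewrite cmod_real /neg; case: leP => x0; rewrite ?normr0 ?mulr0 ?mul0r//.
by rewrite normr1 mulr1 mul1r ler0_norm// mulrN -mulrBl.
Qed.

Lemma cmeasurable_neg : cmeasurable (fun x : T => (neg x)%:C : C).
Proof. by apply: cmeasurable_real; exact: measurable_neg. Qed.

Lemma negint_real (c : R) : 0 < c -> negint c%:C = (c%:C)^-1.
Proof.
move=> c0; have [i1 i2] := neg_exp_integral c0.
have -> : (c%:C)^-1 = (c^-1)%:C :> C by rewrite fmorphV.
rewrite /negint -i2 -(cint_real i1); apply: eq_cint => x.
by rewrite -rmorphM cexp_real -rmorphM mulrC.
Qed.

(** Known for positive real [s]. Both sides have power series on a disc that contains [s] and is
    centred at a real point [w], and they agree at real points just beyond [w]. *)
Lemma negintE s : 0 < complex.Re s -> negint s = s^-1.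
Proof.
move=> s0.
(* The condition |s - w| < w amounts to |s|^2 < 2 w Re s, and here w Re s = |s|^2. *)
pose w : R := ((complex.Re s) ^+ 2 + (complex.Im s) ^+ 2) / complex.Re s.
have w0 : 0 < w by rewrite divr_gt0// ltr_pwDl ?exprn_gt0// sqr_ge0.
have sw : cmod (s - w%:C) < w.
  rewrite cmod_def ReB ImB /= subr0 -[ltRHS](gtr0_norm w0) -sqrtr_sqr ltr_sqrt ?exprn_gt0//.
  have : w * complex.Re s = (complex.Re s) ^+ 2 + (complex.Im s) ^+ 2.
    by rewrite /w mulfVK// gt_eqF.
  have := mulr_gt0 w0 s0; nra.
pose r := (cmod (s - w%:C) + w) / 2.
have r0 : 0 < r by rewrite divr_gt0// ltr_wpDl// cmod_ge0.
have rw : r < w by rewrite /r; lra.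
have sr : cmod (s - w%:C) <= r by rewrite /r; lra.
have [[M h1] _] := mellin_pseries r0 cmeasurable_neg (@neg_integrable w%:C r rw).
have rw' : r < cmod (w%:C : C) by rewrite cmod_real gtr0_norm.
have h2 := has_pseries_invr (ltW r0) rw'.
have h3 := has_pseriesD h1 (has_pseriesZ (-1) h2).
have h4 := has_pseries_eq0_real r0 ltr01 h3.
apply/eqP; rewrite -subr_eq0 -mulN1r; apply/eqP.
have := h3.2 s sr => /= ->.
rewrite (eq_csum (b := fun=> 0)) ?csum0// => k; rewrite h4 ?mul0r// => t /andP[t0 _].
have wt : 0 < w + t by rewrite addr_gt0.
by rewrite -rmorphD -/(negint _) negint_real// mulN1r subrr.
Qed.

(** Up to the factor k! the integral is the Taylor coefficient of order [k] of [negint] at [w], to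
    be compared with that of 1/s. *)
Lemma neg_power_integral w k : 0 < complex.Re w ->
  cintegrable mu (fun x : T => cexp (w * x%:C) * ((neg x)%:C * x%:C ^+ k)) /\
  cint mu (fun x : T => cexp (w * x%:C) * ((neg x)%:C * x%:C ^+ k)) =
    (-1) ^+ k * k`!%:R / w ^+ k.+1.
Proof.
move=> w0; pose r := complex.Re w / 2.
have r0 : 0 < r by rewrite divr_gt0.
have rw : r < complex.Re w by rewrite gtr_pMr// invf_lt1// ltr1n.
have [[M h1] i1] := mellin_pseries r0 cmeasurable_neg (neg_integrable rw).
have rw' : r < cmod w by apply: lt_le_trans rw (le_trans (ler_norm _) (normr_Re w)).
have h2 := has_pseries_invr (ltW r0) rw'.
have kf : (k`!%:R : C) != 0 by rewrite pnatr_eq0 -lt0n fact_gt0.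
have E : (fun x : T => cexp (w * x%:C) * ((neg x)%:C * x%:C ^+ k)) =
    fun x : T => k`!%:R * (ecoef x%:C k * (cexp (w * x%:C) * (neg x)%:C)).
  by apply/funext => x; rewrite /ecoef; field.
rewrite E; split; first exact: cintegrableZ (i1 k).
rewrite cintZ//.
have := has_pseries_unique r0 r0 h1 h2.
have nE : \forall s \near w^', negint s = s^-1.
  apply: near_dnbhs; apply/nearC_P; exists r => // s sw; apply: negintE.
  have : complex.Re w - complex.Re s <= cmod (s - w).
    by rewrite cmodC -ReB; exact: le_trans (ler_norm _) (normr_Re _).
  by move: sw rw r0; rewrite /r; lra.
by move=> /(_ nE) /(congr1 (fun f => f k)) ->; rewrite mulrCA mulrA.
Qed.

(* A term (a, k, c) stands for c t^a log^k t, with x = log t. *)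
Definition term := (C * nat * C)%type.
Definition term_val (t : term) (x : R) : C := t.2 * (cexp (t.1.1 * x%:C) * x%:C ^+ t.1.2).
Definition term_pole (t : term) (s : C) : C :=
  t.2 * ((-1) ^+ t.1.2 * t.1.2`!%:R / (s + t.1.1) ^+ t.1.2.+1).

Lemma term_integral (t : term) s : 0 < complex.Re (s + t.1.1) ->
  cintegrable mu (fun x : T => cexp (s * x%:C) * ((neg x)%:C * term_val t x)) /\
  cint mu (fun x : T => cexp (s * x%:C) * ((neg x)%:C * term_val t x)) = term_pole t s.
Proof.
move=> st; have [i1 e1] := neg_power_integral t.1.2 st.
have E : (fun x : T => cexp (s * x%:C) * ((neg x)%:C * term_val t x)) =
    fun x : T => t.2 * (cexp ((s + t.1.1) * x%:C) * ((neg x)%:C * x%:C ^+ t.1.2)).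
  by apply/funext => x; rewrite /term_val mulrDl cexpD; ring.
by rewrite E; split; [exact: cintegrableZ|rewrite cintZ// e1].
Qed.

Lemma cmeasurable_term (t : term) : cmeasurable (fun x : T => term_val t x).
Proof.
have mx : cmeasurable (fun x : T => x%:C : C).
  by apply: cmeasurable_real; exact: measurable_id.
apply: cmeasurableM; first exact: cmeasurable_cst.
apply: cmeasurableM; last exact: cmeasurableX.
by apply: cmeasurable_cexp; apply: cmeasurableM => //; exact: cmeasurable_cst.
Qed.

Definition terms_val (q : seq term) (x : R) := \sum_(t <- q) term_val t x.

(** The function is written in x = log t. [md_terms N] lists the terms of its expansion as x tends
    to minus infinity, with remainder O(e^(N x)). The terms added from order N to N + 1 have
    exponents beyond N, so their integrals over x <= 0 converge for Re s > - N and the continuations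
    of both orders agree there. *)
Record mellin_data := MellinData {
  md_fun : T -> C;
  md_terms : nat -> seq term;
  md_measurable : cmeasurable md_fun;
  md_pos : forall N : nat, exists K : R, forall x : R, 0 < x ->
    cmod (md_fun x) <= K * expR (- N%:R * x);
  md_step : forall N : nat, exists X, perm_eq (md_terms N.+1) (md_terms N ++ X) /\
    forall t, t \in X -> N%:R < complex.Re t.1.1;
  md_neg : forall N : nat, exists K : R, forall x : R, x <= 0 ->
    cmod (md_fun x - terms_val (md_terms N) x) <= K * expR (N%:R * x) }.

Variable D : mellin_data.
Local Notation g := (md_fun D).
Local Notation E := (md_terms D).

Definition mellin_pos s := cint mu (fun x : T => cexp (s * x%:C) * ((pos x)%:C * g x)).
Definition mellin_neg N s :=
  cint mu (fun x : T => cexp (s * x%:C) * ((neg x)%:C * (g x - terms_val (E N) x))).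
Definition mellin_poles N s := \sum_(t <- E N) term_pole t s.
Definition mellin_at N s := mellin_pos s + mellin_neg N s + mellin_poles N s.
(** The order is picked pointwise so that [0 < Re s + N]; by [mellinE] every such order gives the
    same value, so a fixed order may be used near a given point. *)
Definition mellin s := mellin_at (Num.truncn `|complex.Re s|).+1 s.

Lemma mellin_pos_series s0 :
  (exists M, has_pseries 1 M s0
    (fun k => cint mu (fun x : T => ecoef x%:C k * (cexp (s0 * x%:C) * ((pos x)%:C * g x))))
    mellin_pos) /\
  forall k, cintegrable mu
    (fun x : T => ecoef x%:C k * (cexp (s0 * x%:C) * ((pos x)%:C * g x))).
Proof.
have mf : cmeasurable (fun x : T => (pos x)%:C * g x).
  apply: cmeasurableM; last exact: md_measurable.
  by apply: cmeasurable_real; exact: measurable_pos.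
(* One unit pays for the radius [1] of the disc, and another leaves the integrable factor e^(-x). *)
pose N := (Num.truncn `|complex.Re s0|).+3.
have [K gK] := md_pos D N.
have NE : complex.Re s0 + 1 + 1 <= N%:R.
  have : `|complex.Re s0| < (Num.truncn `|complex.Re s0|).+1%:R by exact: truncnS_gt.
  have := ler_norm (complex.Re s0).
  by rewrite /N -!natr1; lra.
have iF : rintegrable mu (fun x : T => expR (complex.Re s0 * x + 1 * `|x|) *
    cmod ((pos x)%:C * g x)).
  apply: (@rintegrable_dom _ _ R mu _ (fun x : T => `|K| * (pos x * expR (- 1 * x)))).
  - apply: measurable_funM; last exact: cmeasurable_cmod.
    by apply: measurableT_comp => //; apply: measurable_funD; apply: measurable_funM.
  - move=> x; rewrite normrM (ger0_norm (expR_ge0 _)) ger0_norm ?cmod_ge0// cmodM cmod_real.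
    rewrite /pos; case: (ltP 0 x) => x0; last by rewrite normr0 !mul0r !mulr0.
    rewrite normr1 !mul1r (gtr0_norm x0).
    apply: (@le_trans _ _ (expR (complex.Re s0 * x + x) * (`|K| * expR (- N%:R * x)))).
      rewrite ler_wpM2l ?expR_ge0//; apply: le_trans (gK x x0) _.
      by rewrite ler_wpM2r ?expR_ge0// ler_norm.
    rewrite mulrCA ler_wpM2l// -expRD ler_expR.
    rewrite -[X in _ + X + _]mul1r -!mulrDl; apply: ler_wpM2r; first exact: ltW.
    by move: NE; lra.
  - exact: (integrableZl measurableT `|K| (rintegrable_pos ltr01)).
exact: mellin_pseries ltr01 mf iF.
Qed.

Lemma mellin_pos_analytic s0 : analytic_at mellin_pos s0.
Proof.
by have [[M h] _] := mellin_pos_series s0; exists 1, M; eexists; split; [|exact: h].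
Qed.

Lemma cmeasurable_remainder N :
  cmeasurable (fun x : T => (neg x)%:C * (g x - terms_val (E N) x)).
Proof.
apply: cmeasurableM; first exact: cmeasurable_neg.
apply: cmeasurableD; first exact: md_measurable.
under eq_fun do rewrite -mulN1r.
apply: cmeasurableM; first exact: cmeasurable_cst.
by apply: cmeasurable_sum => t; exact: cmeasurable_term.
Qed.

Lemma remainder_integrable N s r : r < complex.Re s + N%:R ->
  rintegrable mu (fun x : T => expR (complex.Re s * x + r * `|x|) *
    cmod ((neg x)%:C * (g x - terms_val (E N) x))).
Proof.
move=> rN; have [K gK] := md_neg D N.
have c0 : 0 < complex.Re s + N%:R - r by rewrite subr_gt0.
have [i1 _] := neg_exp_integral c0.
apply: (@rintegrable_dom _ _ R mu _
  (fun x : T => `|K| * (neg x * expR ((complex.Re s + N%:R - r) * x)))).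
- apply: measurable_funM; last exact: cmeasurable_cmod (cmeasurable_remainder N).
  by apply: measurableT_comp => //; apply: measurable_funD; apply: measurable_funM.
- move=> x; rewrite normrM (ger0_norm (expR_ge0 _)) ger0_norm ?cmod_ge0// cmodM cmod_real.
  rewrite /neg; case: (leP x 0) => x0; last by rewrite normr0 !mul0r !mulr0.
  rewrite normr1 !mul1r (ler0_norm x0).
  apply: (@le_trans _ _ (expR (complex.Re s * x + r * - x) * (`|K| * expR (N%:R * x)))).
    rewrite ler_wpM2l ?expR_ge0//; apply: le_trans (gK x x0) _.
    by rewrite ler_wpM2r ?expR_ge0// ler_norm.
  rewrite mulrCA ler_wpM2l// -expRD ler_expR.
  by rewrite mulrN -mulNr -!mulrDl addrAC.
- exact: (integrableZl measurableT `|K| i1).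
Qed.

Lemma remainder_cintegrable N s : 0 < complex.Re s + N%:R ->
  cintegrable mu (fun x : T => cexp (s * x%:C) * ((neg x)%:C * (g x - terms_val (E N) x))).
Proof.
move=> sN; pose r := (complex.Re s + N%:R) / 2.
have r0 : 0 < r by rewrite divr_gt0.
have rs : r < complex.Re s + N%:R by rewrite gtr_pMr// invf_lt1// ltr1n.
have [_ /(_ 0%N)] := mellin_pseries r0 (cmeasurable_remainder N) (remainder_integrable rs).
by congr (cintegrable mu); apply/funext => x; rewrite /ecoef expr0 fact0 divr1 mul1r.
Qed.

Lemma mellin_neg_analytic N s0 : 0 < complex.Re s0 + N%:R ->
  analytic_at (mellin_neg N) s0.
Proof.
move=> sN; pose r := (complex.Re s0 + N%:R) / 2.
have r0 : 0 < r by rewrite divr_gt0.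
have rs : r < complex.Re s0 + N%:R by rewrite gtr_pMr// invf_lt1// ltr1n.
have [[M h] _] := mellin_pseries r0 (cmeasurable_remainder N) (remainder_integrable rs).
by exists r, M; eexists; split; [|exact: h].
Qed.

Lemma terms_integral (q : seq term) s :
  (forall t, t \in q -> 0 < complex.Re (s + t.1.1)) ->
  cintegrable mu (fun x : T => cexp (s * x%:C) * ((neg x)%:C * terms_val q x)) /\
  cint mu (fun x : T => cexp (s * x%:C) * ((neg x)%:C * terms_val q x)) =
    \sum_(t <- q) term_pole t s.
Proof.
elim: q => [_|t q IH tq].
  have -> : (fun x : T => cexp (s * x%:C) * ((neg x)%:C * terms_val [::] x)) = fun=> 0.
    by apply/funext => x; rewrite /terms_val big_nil !mulr0.
  rewrite big_nil cint0; split=> //.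
  apply: (@cintegrable_dom _ _ R mu _ (fun=> 0)); first exact: cmeasurable_cst.
    by move=> x; rewrite cmod0.
  exact: integrable0.
have [|i1 e1] := IH; first by move=> u uq; apply: tq; rewrite inE uq orbT.
have [|i2 e2] := @term_integral t s; first by apply: tq; rewrite inE eqxx.
have -> : (fun x : T => cexp (s * x%:C) * ((neg x)%:C * terms_val (t :: q) x)) =
    fun x : T => cexp (s * x%:C) * ((neg x)%:C * term_val t x) +
      cexp (s * x%:C) * ((neg x)%:C * terms_val q x).
  by apply/funext => x; rewrite /terms_val big_cons !mulrDr.
by rewrite big_cons cintD// e1 e2; split=> //; exact: cintegrableD.
Qed.

(** The additional terms leave the remainder integral and reappear, integrated exactly, as poles. *)
Lemma mellin_at_step N s : 0 < complex.Re s + N%:R -> mellin_at N.+1 s = mellin_at N s.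
Proof.
move=> sN; have [X [EX XN]] := md_step D N.
have sX t : t \in X -> 0 < complex.Re (s + t.1.1).
  by move=> /XN tN; rewrite ReD; apply: lt_trans sN _; rewrite ltrD2l.
have [i1 e1] := terms_integral sX.
have sN1 : 0 < complex.Re s + N.+1%:R by rewrite -natr1 addrA addr_gt0.
have i2 := remainder_cintegrable sN1.
rewrite /mellin_at /mellin_poles (perm_big _ EX) big_cat /= -e1.
have -> : mellin_neg N s = mellin_neg N.+1 s +
    cint mu (fun x : T => cexp (s * x%:C) * ((neg x)%:C * terms_val X x)).
  rewrite /mellin_neg -cintD//; apply: eq_cint => x.
  have -> : terms_val (E N.+1) x = terms_val (E N) x + terms_val X x.
    by rewrite /terms_val (perm_big _ EX) big_cat.
  by ring.
by ring.
Qed.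

Lemma mellin_at_eq N N' s : 0 < complex.Re s + N%:R -> (N <= N')%N ->
  mellin_at N' s = mellin_at N s.
Proof.
move=> sN; elim: N' => [|N' IH]; first by rewrite leqn0 => /eqP ->.
rewrite leq_eqVlt => /predU1P[->//|]; rewrite ltnS => NN'.
by rewrite mellin_at_step ?IH//; apply: lt_le_trans sN _; rewrite lerD2l ler_nat.
Qed.

Lemma mellinE N s : 0 < complex.Re s + N%:R -> mellin s = mellin_at N s.
Proof.
move=> sN; rewrite /mellin; set N' := (_).+1.
have sN' : 0 < complex.Re s + N'%:R.
  have : `|complex.Re s| < N'%:R by exact: truncnS_gt.
  by rewrite ltr_norml => /andP[+ _]; lra.
have [NN'|N'N] := leqP N N'; first exact: mellin_at_eq.
by apply/esym/mellin_at_eq => //; exact: ltnW.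
Qed.

Lemma near_mellinE N s0 : 0 < complex.Re s0 + N%:R ->
  \forall s \near s0, mellin s = mellin_at N s.
Proof.
move=> sN; apply/nearC_P; exists (complex.Re s0 + N%:R) => // s ss0.
apply: mellinE; have : complex.Re s0 - complex.Re s <= cmod (s - s0).
  by rewrite cmodC -ReB; exact: le_trans (ler_norm _) (normr_Re _).
by move: ss0; lra.
Qed.

Lemma term_pole_analytic (t : term) s0 : s0 + t.1.1 != 0 ->
  analytic_at (term_pole t) s0.
Proof.
move=> st; apply: analytic_atM; first exact: analytic_at_cst.
apply: analytic_atM; first exact: analytic_at_cst.
apply: analytic_at_inv; last by rewrite expf_neq0.
by apply: analytic_atX; exact: analytic_at_shift.
Qed.

Lemma term_pole_mero (t : term) s0 : mero_at (term_pole t) s0.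
Proof.
have [st|st] := eqVneq (s0 + t.1.1) 0; last exact/analytic_mero/term_pole_analytic.
exists t.1.2.+1, (fun=> t.2 * ((-1) ^+ t.1.2 * t.1.2`!%:R)); split.
  exact: analytic_at_cst.
near=> s; rewrite /term_pole mulrA; congr (_ / (_ ^+ _)).
by rewrite -[t.1.1]opprK; congr (_ - _); apply/eqP; rewrite eq_sym -addr_eq0 st.
Unshelve. all: by end_near. Qed.

Lemma mellin_mero s0 : mero_at mellin s0.
Proof.
pose N := (Num.truncn `|complex.Re s0|).+1.
have sN : 0 < complex.Re s0 + N%:R.
  have : `|complex.Re s0| < N%:R by exact: truncnS_gt.
  by rewrite ltr_norml => /andP[+ _]; lra.
apply: (mero_at_near (F := mellin_at N)).
  apply: mero_atD; last by apply: mero_at_sum => t; exact: term_pole_mero.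
  apply/analytic_mero/analytic_atD; first exact: mellin_pos_analytic.
  exact: mellin_neg_analytic.
by apply: near_dnbhs; apply: filterS (near_mellinE sN) => s ->.
Qed.

(** A term with exponent [- s0] and logarithmic power [k] has a pole of order [k + 1] at [s0], so
    only [k = 0] may survive; all other exponents give functions analytic at [s0]. *)
Lemma poles_simple (q : seq term) s0 :
  (forall t, t \in q -> t.1.1 = - s0 -> (0 < t.1.2)%N -> t.2 = 0) ->
  exists H, analytic_at H s0 /\ forall s, \sum_(t <- q) term_pole t s =
    H s + (\sum_(t <- q | (t.1.1 == - s0) && (t.1.2 == 0%N)) t.2) / (s - s0).
Proof.
elim: q => [_|t q IH tq].
  exists (fun=> 0); split; first exact: analytic_at_cst.
  by move=> s; rewrite !big_nil mul0r addr0.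
have [|H [aH HE]] := IH; first by move=> u uq; apply: tq; rewrite inE uq orbT.
have [ts|ts] := eqVneq t.1.1 (- s0); last first.
  exists (fun s => term_pole t s + H s); split.
    by apply: analytic_atD => //; apply: term_pole_analytic; rewrite addrC addr_eq0.
  by move=> s; rewrite !big_cons (negbTE ts) /= HE addrA.
exists H; split=> // s; rewrite !big_cons ts eqxx /= HE.
case: eqP => [k0|/eqP k0].
  rewrite /term_pole k0 expr0 fact0 mul1r expr1 ts mulrDl mul1r.
  by rewrite addrCA.
by rewrite /term_pole tq ?inE ?eqxx ?lt0n// mul0r add0r.
Qed.

Lemma mellin_simple_pole N s0 : 0 < complex.Re s0 + N%:R ->
  (forall t, t \in E N -> t.1.1 = - s0 -> (0 < t.1.2)%N -> t.2 = 0) ->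
  exists H, analytic_at H s0 /\ \forall s \near s0^', mellin s =
    H s + (\sum_(t <- E N | (t.1.1 == - s0) && (t.1.2 == 0%N)) t.2) / (s - s0).
Proof.
move=> sN /poles_simple [H [aH HE]].
exists (fun s => mellin_pos s + mellin_neg N s + H s); split.
  apply: analytic_atD => //; apply: analytic_atD; first exact: mellin_pos_analytic.
  exact: mellin_neg_analytic.
apply: near_dnbhs; apply: filterS (near_mellinE sN) => s ->.
by rewrite /mellin_at /mellin_poles HE addrA.
Qed.

Lemma mellin_integral s : 0 < complex.Re s ->
  (forall t, t \in E 0 -> 0 < complex.Re (s + t.1.1)) ->
  cintegrable mu (fun x : T => cexp (s * x%:C) * g x) /\
  mellin s = cint mu (fun x : T => cexp (s * x%:C) * g x).
Proof.
move=> s0 sE.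
have s00 : 0 < complex.Re s + 0%:R by rewrite addr0.
have [i1 e1] := terms_integral sE.
have i2 := remainder_cintegrable s00.
have i3 : cintegrable mu (fun x : T => cexp (s * x%:C) * ((pos x)%:C * g x)).
  have [_ /(_ 0%N)] := mellin_pos_series s.
  by congr (cintegrable mu); apply/funext => x; rewrite /ecoef expr0 fact0 divr1 mul1r.
have -> : (fun x : T => cexp (s * x%:C) * g x) = fun x : T =>
   cexp (s * x%:C) * ((pos x)%:C * g x) +
   cexp (s * x%:C) * ((neg x)%:C * (g x - terms_val (E 0) x)) +
   cexp (s * x%:C) * ((neg x)%:C * terms_val (E 0) x).
  by apply/funext => x; rewrite posE rmorphB rmorph1; ring.
have i12 := cintegrableD i3 i2.
split; first exact: cintegrableD.
by rewrite (mellinE s00) cintD// cintD// e1.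
Qed.

End MellinTransform.

(** * The Gamma integral and its scaling law *)

Section GammaFunction.
Context {R : realType}.
Local Notation C := R[i].
Local Notation T := (measurableTypeR R).
Local Notation mu := (@lebesgue_measure R).
Implicit Types (s w : C) (r M : R).

Definition gfun (l : R) (x : T) : C := (expR (- l * expR x))%:C.

Lemma cmeasurable_gfun l : cmeasurable (gfun l).
Proof.
apply: cmeasurable_real; apply: measurableT_comp => //.
by apply: measurable_funM => //; exact: measurableT_comp.
Qed.

Lemma cmod_gfun l x : cmod (gfun l x) = expR (- l * expR x).
Proof. by rewrite cmod_real ger0_norm ?expR_ge0. Qed.

Lemma expR_decay (N : nat) (t : R) : 1 <= t -> expR (- t) <= (N.+1)`!%:R * t ^- N.
Proof.
move=> t1; have t0 : 0 < t by exact: lt_le_trans t1.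
have := expR_ge1Dxn N (ltW t0) => h.
have h2 : t ^+ N.+1 / N.+1`!%:R <= expR t.
  by apply: le_trans h; rewrite lerDr.
have f0 : 0 < N.+1`!%:R :> R by rewrite ltr0n fact_gt0.
rewrite expRN ler_pdivlMr ?exprn_gt0// mulrC ler_pdivrMr ?expR_gt0//.
rewrite -ler_pdivrMl//; apply: le_trans h2; rewrite mulrC ler_wpM2r ?invr_ge0 ?(ltW f0)//.
by rewrite exprS ler_peMl// exprn_ge0// ltW.
Qed.

(** A term of the Taylor expansion of e^(-t), which serves as the asymptotic expansion that
    continues Gamma. *)
Definition gamma_term (n : nat) : term := (n%:R, 0%N, (-1) ^+ n / n`!%:R) : C * nat * C.

Lemma gamma_termE n (x : R) : term_val (gamma_term n) x = ecoef (- (expR x)%:C) n.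
Proof.
rewrite /term_val /gamma_term /ecoef /= expr0 mulr1.
have -> : cexp (n%:R * x%:C) = (expR x)%:C ^+ n by rewrite -cexp_real -cexpX mulr_natl.
by rewrite [in RHS]exprNn; ring.
Qed.

Lemma gamma_pos (N : nat) : exists K : R, forall x : R, 0 < x ->
  cmod (gfun 1 x) <= K * expR (- N%:R * x).
Proof.
exists (N.+1)`!%:R => x x0; rewrite cmod_gfun mulN1r.
apply: le_trans (expR_decay N _) _; first by rewrite -expR0 ler_expR ltW.
by rewrite mulNr expRN expRM_natl.
Qed.

Lemma gamma_step (N : nat) : exists X,
  perm_eq [seq gamma_term n | n <- iota 0 N.+2]
    ([seq gamma_term n | n <- iota 0 N.+1] ++ X) /\
  forall t, t \in X -> N%:R < complex.Re t.1.1.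
Proof.
exists [:: gamma_term N.+1]; rewrite -addn1 iotaD map_cat; split=> // t.
by rewrite inE => /eqP -> /=; rewrite Re_natr ltr_nat.
Qed.

Lemma gamma_neg (N : nat) : exists K : R, forall x : R, x <= 0 ->
  cmod (gfun 1 x - terms_val [seq gamma_term n | n <- iota 0 N.+1] x)
    <= K * expR (N%:R * x).
Proof.
exists (expR 1) => x x0.
have -> : gfun 1 x = csum (ecoef (- (expR x)%:C)).
  by rewrite -cexp_series -rmorphN cexp_real /gfun mulN1r.
have -> : terms_val [seq gamma_term n | n <- iota 0 N.+1] x =
    \sum_(0 <= k < N.+1) ecoef (- (expR x)%:C) k.
  rewrite /terms_val big_map /index_iota subn0; apply: eq_bigr => n _.
  exact: gamma_termE.
apply: csum_tail_le; first exact: ecoef_asum.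
move=> n; apply: (@le_trans _ _ (\sum_(N.+1 <= k < n) (k`!%:R^-1 * expR (N%:R * x)))).
  rewrite big_nat [leRHS]big_nat; apply: ler_sum => k /andP[Nk _].
  rewrite cmod_ecoef cmodN cmod_real ger0_norm ?expR_ge0// mulrC ler_wpM2l ?invr_ge0//.
  by rewrite -expRM_natl ler_expR ler_wnM2r// ler_nat ltnW.
rewrite -mulr_suml ler_wpM2r ?expR_ge0//.
have := ecoef_asum (1 : C) n; rewrite cmod1; apply: le_trans.
have [nN|Nn] := leqP n N.+1; first by rewrite big_geq// sumr_ge0// => k _; exact: cmod_ge0.
rewrite [leRHS](big_cat_nat _ (ltnW Nn))//= ler_wpDl ?sumr_ge0// => [k _|].
  exact: cmod_ge0.
by apply: ler_sum => k _; rewrite cmod_ecoef cmod1 expr1n mul1r.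
Qed.

Definition gamma_data := MellinData (cmeasurable_gfun 1) gamma_pos gamma_step gamma_neg.

Definition cGamma : C -> C := mellin gamma_data.

(** The right half-plane is covered by discs with real centres, which carry identities over from the
    positive axis. *)
Lemma right_half_disc s : 0 < complex.Re s ->
  exists w r : R, [/\ 0 < r, r < w & cmod (s - w%:C) <= r].
Proof.
move=> s0.
pose w : R := ((complex.Re s) ^+ 2 + (complex.Im s) ^+ 2) / complex.Re s.
have w0 : 0 < w by rewrite divr_gt0// ltr_pwDl ?exprn_gt0// sqr_ge0.
have sw : cmod (s - w%:C) < w.
  rewrite cmod_def ReB ImB /= subr0 -[ltRHS](gtr0_norm w0) -sqrtr_sqr ltr_sqrt ?exprn_gt0//.
  have : w * complex.Re s = (complex.Re s) ^+ 2 + (complex.Im s) ^+ 2.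
    by rewrite /w mulfVK// gt_eqF.
  have := mulr_gt0 w0 s0; nra.
exists w, ((cmod (s - w%:C) + w) / 2); split; last by lra.
  by rewrite divr_gt0// ltr_wpDl// cmod_ge0.
by lra.
Qed.

Lemma gfun_decay l (N : nat) : 0 < l -> exists K : R, forall x : R, 0 < x ->
  expR (- l * expR x) <= K * expR (- N%:R * x).
Proof.
(* The first summand serves when [l * expR x >= 1]; otherwise [x < - ln l], and the second summand
   compensates [expR (- N * x)]. *)
move=> l0; exists ((N.+1)`!%:R * l ^- N + expR (N%:R * `|ln l|)) => x x0.
have [lx|lx] := leP 1 (l * expR x).
  apply: (@le_trans _ _ ((N.+1)`!%:R * (l * expR x) ^- N)).
    by rewrite mulNr; exact: expR_decay.
  rewrite exprMn invfM mulrA mulrDl mulNr expRN expRM_natl.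
  by rewrite lerDl mulr_ge0 ?expR_ge0 ?invr_ge0 ?exprn_ge0 ?expR_ge0.
apply: (@le_trans _ _ 1).
  by rewrite -expR0 ler_expR mulNr oppr_le0 mulr_ge0 ?expR_ge0// ltW.
rewrite mulrDl -expRD ler_wpDl ?mulr_ge0 ?invr_ge0 ?exprn_ge0 ?expR_ge0 ?(ltW l0)//.
rewrite -[leLHS]expR0 ler_expR mulNr -mulrBr mulr_ge0// subr_ge0.
have : x < - ln l.
  rewrite -ltr_expR expRN lnK ?posrE// -(ltr_pM2l l0) mulfV// ?gt_eqF//.
by move=> /ltW /le_trans; apply; rewrite -normrN ler_norm.
Qed.

Lemma gfun_integrable l s r : 0 < l -> 0 <= r -> r < complex.Re s ->
  rintegrable mu (fun x : T => expR (complex.Re s * x + r * `|x|) * cmod (gfun l x)).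
Proof.
move=> l0 r0 rs.
pose N := (Num.truncn (complex.Re s + r)).+2.
have [K gK] := gfun_decay N l0.
have NE : complex.Re s + r + 1 <= N%:R.
  by rewrite /N -natr1 lerD2r ltW// truncnS_gt.
have c0 : 0 < complex.Re s - r by rewrite subr_gt0.
have [i1 _] := neg_exp_integral c0.
have i2 := integrableZl measurableT `|K| (rintegrable_pos ltr01).
apply: (@rintegrable_dom _ _ R mu _ (fun x : T =>
    neg x * expR ((complex.Re s - r) * x) + `|K| * (pos x * expR (- 1 * x)))).
- apply: measurable_funM; last exact: cmeasurable_cmod (cmeasurable_gfun l).
  by apply: measurableT_comp => //; apply: measurable_funD; apply: measurable_funM.
- move=> x; rewrite normrM (ger0_norm (expR_ge0 _)) ger0_norm ?cmod_ge0// cmod_gfun.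
  rewrite posE /neg; case: (leP x 0) => x0.
    rewrite subrr mul1r mul0r mulr0 addr0 (ler0_norm x0) mulrN -mulrBl.
    rewrite ler_piMr ?expR_ge0// -expR0 ler_expR mulNr oppr_le0.
    by rewrite mulr_ge0 ?expR_ge0// ltW.
  rewrite subr0 mul0r add0r mul1r (gtr0_norm x0).
  apply: (@le_trans _ _ (expR (complex.Re s * x + r * x) * (`|K| * expR (- N%:R * x)))).
    rewrite ler_wpM2l ?expR_ge0//; apply: le_trans (gK x x0) _.
    by rewrite ler_wpM2r ?expR_ge0// ler_norm.
  rewrite mulrCA ler_wpM2l// -expRD ler_expR -!mulrDl; apply: ler_wpM2r; first exact: ltW.
  by move: NE; lra.
- exact: (integrableD measurableT i1 i2).
Qed.

Definition gint l s := cint mu (fun x : T => cexp (s * x%:C) * gfun l x).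

Lemma gint_pseries l s r : 0 < l -> 0 < r -> r < complex.Re s ->
  exists M, has_pseries r M s
    (fun k => cint mu (fun x => ecoef x%:C k * (cexp (s * x%:C) * gfun l x))) (gint l).
Proof.
move=> l0 r0 rs.
by have [] := mellin_pseries r0 (cmeasurable_gfun l) (gfun_integrable l0 (ltW r0) rs).
Qed.

Lemma cintegrable_gfun l s : 0 < l -> 0 < complex.Re s ->
  cintegrable mu (fun x : T => cexp (s * x%:C) * gfun l x).
Proof.
move=> l0 s0; have r0 : 0 < complex.Re s / 2 by rewrite divr_gt0.
have rs : complex.Re s / 2 < complex.Re s by rewrite gtr_pMr// invf_lt1// ltr1n.
have [_ /(_ 0%N)] :=
  mellin_pseries r0 (cmeasurable_gfun l) (gfun_integrable l0 (ltW r0) rs).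
by congr (cintegrable mu); apply/funext => x; rewrite /ecoef expr0 fact0 divr1 mul1r.
Qed.

Lemma cGammaE s : 0 < complex.Re s -> cGamma s = gint 1 s.
Proof.
move=> s0; have [|_ E] := @mellin_integral _ gamma_data s s0; last exact: E.
by move=> t; rewrite /= inE => /eqP -> /=; rewrite addr0.
Qed.

Lemma cGamma_mero s : mero_at cGamma s.
Proof. exact: mellin_mero. Qed.

(** The substitution t -> l t in the Gamma integral, which is the translation of [x] by [ln l]. *)
Lemma gint_scale_real l (c : R) : 0 < l -> 0 < c ->
  gint l c%:C = cpow l%:C (- c%:C) * gint 1 c%:C.
Proof.
move=> l0 c0.
have re (b : R) : (fun x : T => cexp (c%:C * x%:C) * gfun b x) =
    fun x : T => (expR (c * x) * expR (- b * expR x))%:C.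
  by apply/funext => x; rewrite -rmorphM cexp_real /gfun rmorphM.
have ib (b : R) : 0 < b -> rintegrable mu (fun x : T => expR (c * x) * expR (- b * expR x)).
  move=> b0; have [_] := cintegrable_gfun (s := c%:C) b0 c0.
  congr rintegrable; apply/funext => x.
  by rewrite cmodM cmod_gfun cmod_cexp ReM /= mulr0 subr0.
have I : \int[mu]_x (expR (c * x) * expR (- 1 * expR x)) =
    expR (c * ln l) * \int[mu]_x (expR (c * x) * expR (- l * expR x)).
  rewrite -RintegralZl//; last exact: ib.
  congr fine.
  have cg : continuous (fun x : R => expR (c * x) * expR (- 1 * expR x)).
    move=> x; apply: cvgM; apply: continuous_comp; try exact: continuous_expR.
      by apply: continuousM; [exact: cst_continuous|].
    by apply: continuousM; [exact: cst_continuous|exact: continuous_expR].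
  pose F (x : R) := x + ln l.
  have dF : F^`()%classic = fun=> 1.
    by apply/funext => x; rewrite /F derive1E deriveD// derive_id derive_cst addr0.
  rewrite (@increasing_ge0_integration_by_substitutionT _ F) //.
  - apply: eq_integral => x _; congr EFin.
    transitivity (expR (c * F x) * expR (- 1 * expR (F x)) * F^`()%classic x) => //.
    rewrite dF mulr1 /F mulrDr !expRD lnK ?posrE// mulrA [_ * expR (c * ln l)]mulrC.
    by congr (_ * expR _); rewrite mulN1r mulNr [_ * l]mulrC.
  - by move=> x y xy; rewrite /F ltrD2r.
  - by rewrite dF => x; exact: cst_continuous.
  - by rewrite dF; exact: is_cvg_cst.
  - by rewrite dF; exact: is_cvg_cst.
  - apply/cvgrNyPle => A; near=> x; rewrite /F -lerBrDr; near: x.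
    by apply: nbhs_ninfty_le; exact: num_real.
  - apply/cvgryPge => A; near=> x; rewrite /F -lerBlDr; near: x.
    by apply: nbhs_pinfty_ge; exact: num_real.
rewrite /gint !re (cint_real (ib _ l0)) (cint_real (ib _ ltr01)) I.
rewrite cpow_real// -rmorphN -rmorphM cexp_real -rmorphM mulrA -expRD.
by rewrite mulNr addNr expR0 mul1r.
Unshelve. all: by end_near. Qed.

(** Both sides are power series on a disc with real centre that contains [s]; they agree at the real
    points to the right of the centre. *)
Lemma gint_scale l s : 0 < l -> 0 < complex.Re s ->
  gint l s = cpow l%:C (- s) * gint 1 s.
Proof.
move=> l0 s0; have [w [r [r0 rw sr]]] := right_half_disc s0.
have [M1 h1] := @gint_pseries l w%:C r l0 r0 rw.
have [M2 h2] := @gint_pseries 1 w%:C r ltr01 r0 rw.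
have h3 := has_pseries_cexp_lin w%:C (- (ln l)%:C) (ltW r0).
have h4 := has_pseriesD h1 (has_pseriesZ (-1) (has_pseriesM h3 h2)).
have h5 := has_pseries_eq0_real r0 ltr01 h4.
have := h4.2 s sr; rewrite [X in _ = X -> _](_ : _ = 0) => [|].
  rewrite mulN1r cpow_real// => /subr0_eq ->; congr (cexp _ * _).
  by rewrite !mulNr mulrC.
rewrite -csum0; apply: eq_csum => k; rewrite h5 ?mul0r// => t /andP[t0 _].
have wt : 0 < w + t by rewrite addr_gt0// (lt_trans r0).
rewrite -rmorphD gint_scale_real// cpow_real// mulN1r.
by rewrite [- (ln l)%:C * _]mulrC mulrN mulNr subrr.
Qed.

End GammaFunction.

(** * Functional equation, values and zeros of Gamma *)

Section GammaValues.
Context {R : realType}.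
Local Notation C := R[i].
Local Notation T := (measurableTypeR R).
Local Notation mu := (@lebesgue_measure R).
Implicit Types (s w : C) (r M : R).

Lemma has_pseries_opp r M a (F : C -> C) : has_pseries r M 0 a F ->
  has_pseries r M 0 (fun k => a k * (-1) ^+ k) (fun s => F (- s)).
Proof.
move=> [aM aF]; split=> [n|s].
  apply: le_trans (aM n); apply: ler_sum => k _.
  by rewrite !cmodM [cmod ((-1) ^+ k)]cmodX cmodN cmod1 expr1n mulr1.
rewrite subr0 => sr; rewrite aF ?subr0 ?cmodN//; apply: eq_csum => k.
by rewrite -mulrA -exprMn mulN1r.
Qed.

(** For small t > 0 the scaling law evaluates the integral of e^(s x) e^(-(1 - t) e^x) as (1 -
    t)^(-s) Gamma(s). Both sides are power series in t, and their coefficients of order 1 are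
    Gamma(s + 1) and s Gamma(s). *)
Lemma gintS s : 0 < complex.Re s -> gint 1 (s + 1) = s * gint 1 s.
Proof.
move=> s0; have r0 : 0 < 2^-1 :> R by rewrite invr_gt0.
pose f (x : T) : C := cexp (s * x%:C) * gfun 1 x.
have mf : cmeasurable f.
  apply: cmeasurableM; last exact: cmeasurable_gfun.
  apply: cmeasurable_cexp; apply: cmeasurableM; first exact: cmeasurable_cst.
  by apply: cmeasurable_real; exact: measurable_id.
have mv : measurable_fun setT (fun x : T => expR x) by exact: measurable_expR.
have gE (x : T) (t : R) : gfun 1 x * cexp (t%:C * (expR x)%:C) = gfun (1 - t) x.
  rewrite -rmorphM cexp_real /gfun -rmorphM -expRD; congr (expR _)%:C.
  by rewrite -mulrDl opprB addrC.
have iF : rintegrable mu (fun x : T => expR (complex.Re 0 * expR x + 2^-1 * `|expR x|) *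
    cmod (f x)).
  have [_] := @cintegrable_gfun _ (2^-1) s r0 s0.
  congr rintegrable; apply/funext => x /=.
  have e2 : 2^-1 + - 1 = - 2^-1 :> R by lra.
  rewrite mul0r add0r (ger0_norm (expR_ge0 _)) /f [in LHS]cmodM [in RHS]cmodM !cmod_gfun.
  by rewrite [RHS]mulrCA -expRD -mulrDl e2.
have [[M h1] _] := exp_moment_pseries r0 mv mf iF.
have h2 := has_pseriesZ (gint 1 s) (has_pseries_opp (has_pseries_binomial (- s))).
have h3 := has_pseriesD h1 (has_pseriesZ (-1) h2).
have h4 := has_pseries_eq0_real r0 r0 h3.
have : cint mu (fun x => ecoef (expR x)%:C 1 * (cexp (0 * (expR x)%:C) * f x)) +
    -1 * (gint 1 s * (bincoef (- s) 1 * (-1) ^+ 1)) = 0.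
  apply: h4 => t /andP[t0 t1]; rewrite add0r.
  have t1' : 0 < 1 - t by lra.
  have -> : cint mu (fun x => cexp (t%:C * (expR x)%:C) * f x) = gint (1 - t) s.
    by apply: eq_cint => x; rewrite /f -gE mulrCA [cexp _ * gfun _ _]mulrC.
  have st : cmod (- t%:C : C) <= 2^-1 by rewrite cmodN cmod_real gtr0_norm// ltW.
  rewrite gint_scale// mulN1r (_ : cpow _ _ = cexp (- s * lseries (- t%:C))).
    by rewrite mulrC subrr.
  have := (has_pseries_binomial (- s)).2 (- t%:C); rewrite subr0 => -> //.
  by rewrite -cpow1D// rmorphB rmorph1.
move=> /eqP; rewrite mulN1r subr_eq0 => /eqP; rewrite expr1 bincoefS bincoef0.
rewrite subr0 divr1 mul1r mulrN1 opprK mulrC => <-; apply: eq_cint => x.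
rewrite mul0r cexp0 mul1r /ecoef expr1 divr1 /f mulrDl cexpD mul1r cexp_real.
by rewrite mulrCA mulrA.
Qed.

Lemma cGammaS s : 0 < complex.Re s -> cGamma (s + 1) = s * cGamma s.
Proof.
move=> s0; rewrite !cGammaE ?gintS// ReD /= addr_gt0//.
Qed.

Lemma cGamma_analytic s : 0 < complex.Re s -> analytic_at (@cGamma R) s.
Proof.
move=> s0; have r0 : 0 < complex.Re s / 2 by rewrite divr_gt0.
have rs : complex.Re s / 2 < complex.Re s by rewrite gtr_pMr// invf_lt1// ltr1n.
have [M h] := gint_pseries ltr01 r0 rs.
apply: (analytic_at_near (F := gint 1)); first by exists (complex.Re s / 2), M; eexists; split; [|exact: h].
apply/nearC_P; exists (complex.Re s) => // t ts; rewrite cGammaE//.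
have : complex.Re s - complex.Re t <= cmod (t - s).
  by rewrite cmodC -ReB; exact: le_trans (ler_norm _) (normr_Re _).
by move: ts; lra.
Qed.

Lemma cGamma_pole0 : exists H, analytic_at H 0 /\
  \forall s \near (0 : C)^', cGamma s = H s + 1 / s.
Proof.
have p1 : 0 < complex.Re (0 : C) + 1%:R by rewrite add0r.
have [|H [aH HE]] := @mellin_simple_pole _ gamma_data 1 0 p1.
  by move=> t /mapP [n _ ->].
exists H; split=> //; apply: filterS HE => s E; apply: (etrans E).
by rewrite subr0 /= !big_cons big_nil /= oppr0 !eqxx oner_eq0 /= expr0 fact0 divr1 addr0.
Qed.

(** The functional equation gives Gamma(1 + t) = t Gamma(t) for t > 0, and the right side tends to
    the residue [1] of Gamma at [0]. *)
Lemma cGamma1 : cGamma (1 : C) = 1.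
Proof.
have [H [aH HE]] := cGamma_pole0.
have aG : analytic_at (fun s => cGamma (s + 1)) (0 : C).
  have [|r [M [a [r0 h]]]] := @cGamma_analytic (1 : C); first by rewrite /= ltr01.
  exists r, M, a; split=> //; apply: has_pseries_translate; by rewrite add0r.
have aK : analytic_at (fun s => cGamma (s + 1) + -1 * (s * H s + 1)) (0 : C).
  apply: analytic_atD => //; apply: analytic_atM; first exact: analytic_at_cst.
  apply: analytic_atD; last exact: analytic_at_cst.
  apply: analytic_atM => //.
  by have := analytic_at_shift 0 (0 : C); under eq_fun do rewrite addr0.
have [r [M [a [r0 h]]]] := aK.
have := has_pseries0 (ltW r0) h.
have /dnearC_P [e e0 eH] := HE.
rewrite (has_pseries_eq0_real r0 e0 h) => [|t /andP[t0 te]].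
  by move/eqP; rewrite mul0r !add0r mulr1 subr_eq0 => /eqP.
have tC0 : (t%:C : C) != 0 by rewrite -cmod_gt0 cmod_real gtr0_norm.
rewrite add0r cGammaS// (eH _ tC0); last by rewrite subr0 cmod_real gtr0_norm.
by rewrite mulrDr mulrCA mulfV// mulr1 mulN1r subrr.
Qed.

Lemma cGamma_nat n : cGamma (n.+1%:R : C) = n`!%:R.
Proof.
elim: n => [|n IH]; first by rewrite cGamma1.
rewrite -natr1 cGammaS ?IH ?factS ?natrM// Re_natr ltr0n//.
Qed.

(** Vanishing around [s] would spread along a segment to the point [1], where Gamma is continuous
    with value [1]. *)
Lemma cGamma_neq0 (s : C) : ~ (\forall t \near s^', cGamma t = 0).
Proof.
move=> G0; have G1 : \forall t \near (1 : C)^', cGamma t = 0.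
  by apply: (mero_at_identity _ G0) => t _; exact: cGamma_mero.
have a1 : analytic_at (@cGamma R) 1 by apply: cGamma_analytic; rewrite /= ltr01.
have := dnear_neq0 (analytic_at_continuous a1); rewrite cGamma1 => /(_ (oner_neq0 _)) G2.
have [|t [t0 t1]] := @filter_ex _ ((1 : C)^') _ [set t | cGamma t != 0 /\ cGamma t = 0].
  by near=> t; split; near: t.
by rewrite t1 eqxx in t0.
Unshelve. all: by end_near. Qed.

End GammaValues.

(** * Continuation of the Dirichlet series *)

Section DirichletSeries.
Context {R : realType}.
Local Notation C := R[i].
Local Notation T := (measurableTypeR R).
Local Notation mu := (@lebesgue_measure R).
Implicit Types (s w z : C) (r M : R).

(** In the application [e] is the indicator of the indices that carry a nonzero eigenvalue, and
    [lam] is filled up with [lam1] elsewhere; thus finite and infinite spectra are treated alike. *)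
Variables (e lam : nat -> R) (lam1 p K0 : R).
Hypothesis e_ge0 : forall n, 0 <= e n.
Hypothesis lam1_gt0 : 0 < lam1.
Hypothesis lam_ge : forall n, lam1 <= lam n.
Hypothesis p_gt0 : 0 < p.
Hypothesis e_sum : psum_le (fun n => e n * expR (- p * ln (lam n))) K0.

Let lam_gt0 n : 0 < lam n. Proof. exact: lt_le_trans (lam_ge n). Qed.

Let ln_lam n : ln lam1 <= ln (lam n).
Proof. by rewrite ler_ln ?posrE. Qed.

Let K0_ge0 : 0 <= K0. Proof. exact: psum_le_ge0 e_sum. Qed.

Definition dterm s n : C := (e n)%:C * cpow (lam n)%:C (- s).
Definition dseries s := csum (dterm s).

(** Here [x] is the logarithm of an eigenvalue. For [0 <= x] the assumption on [sg - r] suffices;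
    eigenvalues below [1] have negative [x] bounded by [ln lam1], which costs a constant. *)
Lemma dterm_le (sg r x : R) : p <= sg - r -> 0 <= r -> ln lam1 <= x ->
  - sg * x + r * `|x| <= - p * x + (sg + r - p) * `|ln lam1|.
Proof.
move=> psr r0 lx; have [x0|x0] := leP 0 x.
  rewrite ger0_norm//; have : 0 <= (sg + r - p) * `|ln lam1| by rewrite mulr_ge0//; lra.
  by have : 0 <= (sg - r - p) * x by [rewrite mulr_ge0//; lra]; lra.
have l0 : ln lam1 < 0 by exact: le_lt_trans x0.
rewrite !ltr0_norm//; have : (sg + r - p) * - x <= (sg + r - p) * - ln lam1.
  by apply: ler_wpM2l; [lra|rewrite lerN2].
lra.
Qed.

Definition dconst (sg r : R) := K0 * expR ((sg + r - p) * `|ln lam1|).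

Lemma dseries_pseries s0 r : 0 < r -> p <= complex.Re s0 - r ->
  exists a, has_pseries r (dconst (complex.Re s0) r) s0 a dseries.
Proof.
move=> r0 pr.
have h n := has_pseriesZ (e n)%:C (has_pseries_cexp_lin s0 (- (ln (lam n))%:C) (ltW r0)).
have sM : psum_le (fun n => cmod (e n)%:C * expR (complex.Re (- (ln (lam n))%:C * s0)
    + cmod (- (ln (lam n))%:C : C) * r)) (dconst (complex.Re s0) r).
  move=> n; apply: (@le_trans _ _ (\sum_(0 <= k < n) (e k * expR (- p * ln (lam k))) *
      expR ((complex.Re s0 + r - p) * `|ln lam1|))).
    apply: ler_sum => k _; rewrite cmod_real ger0_norm// -mulrA ler_wpM2l// -expRD ler_expR.
    rewrite mulNr ReN ReM /= mul0r subr0 cmodN cmod_real.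
    have := dterm_le pr (ltW r0) (ln_lam k); rewrite [r * _]mulrC mulNr.
    by rewrite [_ * ln (lam k)]mulrC.
  by rewrite -mulr_suml ler_wpM2r ?expR_ge0.
eexists; apply: eq_has_pseries (has_pseries_csum r0 h sM) _ => s _.
apply: eq_csum => n; rewrite /dterm cpow_real//; congr (_ * cexp _).
by rewrite !mulNr mulrC.
Qed.

Lemma dterm_asum s : p <= complex.Re s -> asum (dterm s) (dconst (complex.Re s) 0).
Proof.
move=> ps n.
apply: (@le_trans _ _ (\sum_(0 <= k < n) (e k * expR (- p * ln (lam k))) *
    expR ((complex.Re s + 0 - p) * `|ln lam1|))).
  apply: ler_sum => k _; rewrite cmodM cmod_real ger0_norm// -mulrA ler_wpM2l//.
  rewrite cmod_cpow_real// -expRD ler_expR ReN.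
  have := @dterm_le (complex.Re s) 0 (ln (lam k)) _ (lexx _) (ln_lam k).
  by rewrite subr0 mul0r addr0; apply.
by rewrite -mulr_suml ler_wpM2r ?expR_ge0.
Qed.

Lemma dseries_analytic s : p < complex.Re s -> analytic_at dseries s.
Proof.
move=> ps; have r0 : 0 < complex.Re s - p by rewrite subr_gt0.
have [|a h] := @dseries_pseries s _ r0; first by lra.
by exists (complex.Re s - p); eexists; exists a; split; [|exact: h].
Qed.

Lemma bincoef_pseries s0 r n : 0 <= r -> exists a,
  has_pseries r (\prod_(0 <= j < n) ((cmod s0 + r + j%:R) / j.+1%:R)) s0 a
    (fun s => bincoef (- s) n).
Proof.
move=> r0; elim: n => [|n [a IH]].
  eexists; rewrite big_geq// -[1 in X in has_pseries _ X](cmod1 (R := R)).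
  by apply: eq_has_pseries (has_pseries_cst r s0 (1 : C)) _ => s _; rewrite bincoef0.
have h := has_pseriesM IH (has_pseriesZ (- (n.+1%:R)^-1) (has_pseries_shift s0 n%:R r0)).
eexists; apply: (@eq_has_pseries _ _ _ _ _ _ _ (has_pseriesW r0 (lexx _) _ h)).
  rewrite big_nat_recr//= ler_wpM2l ?(asum_ge0 IH.1)// cmodN cmodV cmod_nat mulrC.
  rewrite ler_wpM2r ?invr_ge0// addrAC lerD2r.
  by apply: le_trans (cmodD _ _) _; rewrite cmod_nat.
move=> s _; rewrite bincoefS; congr (_ * _).
by rewrite mulNr -mulrN mulrC opprD.
Qed.

Definition Lambda := expR `|ln lam1|.
(** [Lambda] is at least [lam1^-1] and controls the growth of the Dirichlet series at [s + n] in
    [n]. The factor [2] brings [z / lam n] into the disc of radius [1/2] on which the binomial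
    series is bounded. *)
Definition zradius := (2 * Lambda)^-1.

Lemma zradius_gt0 : 0 < zradius.
Proof. by rewrite invr_gt0 mulr_gt0// expR_gt0. Qed.

Lemma zradius_le n : zradius <= lam n / 2.
Proof.
apply: (@le_trans _ _ (lam1 / 2)); last by rewrite ler_wpM2r ?invr_ge0.
rewrite /zradius invfM mulrC ler_wpM2r ?invr_ge0// /Lambda -expRN.
by rewrite -[leRHS](lnK (x := lam1)) ?posrE// ler_expR lerNl -normrN ler_norm.
Qed.

Definition tail_bound (s0 : C) r n :=
  \prod_(0 <= j < n) ((cmod s0 + r + j%:R) / j.+1%:R) *
    (dconst (complex.Re s0) r * Lambda ^+ n).

Lemma tail_pseries s0 r n : 0 < r -> p <= complex.Re s0 + n%:R - r -> exists a,
  has_pseries r (tail_bound s0 r n) s0 a (fun s => bincoef (- s) n * dseries (s + n%:R)).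
Proof.
move=> r0 pr; have [a1 h1] := bincoef_pseries s0 n (ltW r0).
have sn : complex.Re (s0 + n%:R) = complex.Re s0 + n%:R by rewrite ReD Re_natr.
have [|a2 h2] := @dseries_pseries (s0 + n%:R) r r0; first by rewrite sn.
have h3 := has_pseriesM h1 (has_pseries_translate h2).
eexists; apply: has_pseriesW h3 => //; first exact: ltW.
rewrite /tail_bound ler_wpM2l ?(asum_ge0 h1.1)// /dconst sn -mulrA ler_wpM2l//.
rewrite /Lambda -expRM_natl -expRD ler_expR -mulrDl ler_wpM2r//.
by rewrite le_eqVlt; apply/orP; left; apply/eqP; ring.
Qed.

Lemma tail_bound_ge0 s0 r n : 0 <= r -> 0 <= tail_bound s0 r n.
Proof.
move=> r0; rewrite /tail_bound mulr_ge0//.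
  rewrite prodr_ge0// => j _; rewrite divr_ge0// !addr_ge0// cmod_ge0//.
by rewrite mulr_ge0 ?exprn_ge0 ?expR_ge0// mulr_ge0// expR_ge0.
Qed.

Lemma tail_bound_psum s0 r : 0 <= r ->
  psum_le (fun n => tail_bound s0 r n * zradius ^+ n)
    (expR (cmod s0 + r) * dconst (complex.Re s0) r).
Proof.
move=> r0 n.
have c0 : 0 <= cmod s0 + r by rewrite addr_ge0// cmod_ge0.
have d0 : 0 <= dconst (complex.Re s0) r by rewrite mulr_ge0// expR_ge0.
apply: le_trans (ler_wpM2r d0 (prod_binomial_psum c0 n)).
rewrite mulr_suml; apply: ler_sum => k _.
rewrite /tail_bound /zradius invfM exprMn exprVn.
have L0 : Lambda ^+ k != 0 by rewrite expf_neq0// gt_eqF// expR_gt0.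
set P := \prod_(_ <= _ < _) _; rewrite exprVn.
rewrite (_ : P * (dconst (complex.Re s0) r * Lambda ^+ k) * (2 ^- k * Lambda ^- k) =
  P * 2 ^- k * dconst (complex.Re s0) r)//.
by field; rewrite L0 expf_neq0.
Qed.

(** The bound e^(-u) <= p^p u^(-p) is, after taking logarithms, a consequence of ln (u / p) <= u / p
    - 1. *)
Lemma expRN_le_power (u : R) : 0 < u -> expR (- u) <= expR (p * ln p) * expR (- p * ln u).
Proof.
move=> u0; rewrite -expRD ler_expR mulNr -mulrBr.
have up : 0 < u / p by rewrite divr_gt0.
have : ln (u / p) <= u / p - 1.
  rewrite -ler_expR lnK ?posrE//; apply: le_trans (expR_ge1Dx _); lra.
rewrite lnM ?posrE ?invr_gt0// lnV ?posrE// => h.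
have h2 : p * (ln u - ln p) <= p * (u / p - 1) by rewrite ler_wpM2l// ltW.
have h3 : p * (u / p - 1) = u - p by rewrite mulrBr mulr1 mulrCA divff ?mulr1// gt_eqF.
by have := p_gt0; move: h2; rewrite h3; lra.
Qed.

(** * The theta function and its Mellin transform *)

Definition theta_const := expR (p * ln p) * expR (p * ln 2) * K0.

(** The exponential is split into two halves: one is traded for the power (lam t / 2)^(-p), which
    makes the sum converge, and the other keeps the decay of the smallest eigenvalue. *)
Lemma theta_asum (x : T) : asum (fun n => (e n)%:C * gfun (lam n) x)
  (theta_const * (expR (- p * x) * expR (- (lam1 / 2) * expR x))).
Proof.
move=> n; apply: (@le_trans _ _ (\sum_(0 <= k < n) (e k * expR (- p * ln (lam k))) *
   (expR (p * ln p) * expR (p * ln 2) * (expR (- p * x) * expR (- (lam1 / 2) * expR x))))).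
  apply: ler_sum => k _; rewrite cmodM cmod_real ger0_norm// -mulrA ler_wpM2l// cmod_gfun.
  have l2 : 0 < lam k / 2 * expR x by rewrite mulr_gt0 ?expR_gt0// divr_gt0.
  have -> : - lam k * expR x = - (lam k / 2 * expR x) + - (lam k / 2 * expR x) by lra.
  rewrite expRD.
  apply: (@le_trans _ _ ((expR (p * ln p) * expR (- p * ln (lam k / 2 * expR x))) *
      expR (- (lam1 / 2) * expR x))).
    rewrite ler_pM ?expR_ge0 ?expRN_le_power// ler_expR -mulNr ler_wpM2r ?expR_ge0//.
    by rewrite lerN2 ler_wpM2r ?invr_ge0.
  rewrite !lnM ?posrE ?divr_gt0 ?expR_gt0 ?invr_gt0// lnV ?posrE// expRK.
  rewrite mulrA mulrA; apply: ler_wpM2r; first exact: expR_ge0.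
  by rewrite -!expRD ler_expR; lra.
rewrite -mulr_suml /theta_const.
apply: (@le_trans _ _ (K0 * (expR (p * ln p) * expR (p * ln 2) *
  (expR (- p * x) * expR (- (lam1 / 2) * expR x))))).
  by rewrite ler_wpM2r// !mulr_ge0// expR_ge0.
by rewrite le_eqVlt; apply/orP; left; apply/eqP; ring.
Qed.

Definition theta (x : T) : C := csum (fun n => (e n)%:C * gfun (lam n) x).

Lemma theta_mellin s : p < complex.Re s ->
  cmeasurable (fun x : T => cexp (s * x%:C) * theta x) /\
  cint mu (fun x : T => cexp (s * x%:C) * theta x) = gint 1 s * dseries s.
Proof.
move=> ps; have s0 : 0 < complex.Re s by exact: lt_trans ps.
pose f n (x : T) : C := (e n)%:C * (cexp (s * x%:C) * gfun (lam n) x).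
pose G (x : T) := theta_const *
  (expR (complex.Re (s - p%:C) * x) * expR (- (lam1 / 2) * expR x)).
have fE n (x : T) : f n x = cexp (s * x%:C) * ((e n)%:C * gfun (lam n) x).
  by rewrite /f mulrCA.
have l2 : 0 < lam1 / 2 by rewrite divr_gt0.
have sp : 0 < complex.Re (s - p%:C) by rewrite ReB /= subr_gt0.
have iG : rintegrable mu G.
  have [_ i1] := cintegrable_gfun l2 sp.
  have : rintegrable mu (fun x : T => theta_const *
      cmod (cexp ((s - p%:C) * x%:C) * gfun (lam1 / 2) x)).
    exact: (integrableZl measurableT theta_const i1).
  congr rintegrable; apply/funext => x.
  by rewrite /G cmodM cmod_cexp cmod_gfun ReM /= mulr0 subr0.
have mf n : cmeasurable (f n).
  apply: cmeasurableM; first exact: cmeasurable_cst.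
  by have [] := cintegrable_gfun (lam_gt0 n) s0.
have fG (x : T) : asum (f^~ x) (G x).
  move: (asumZ (cexp (s * x%:C)) (theta_asum x)).
  rewrite cmod_cexp ReM /= mulr0 subr0.
  have -> : expR (complex.Re s * x) * (theta_const *
      (expR (- p * x) * expR (- (lam1 / 2) * expR x))) = G x.
    by rewrite /G ReB /= mulrBl expRD mulNr; ring.
  by congr asum; apply/funext => n; rewrite fE.
have [_ m1 e1] := cint_csum mf iG fG.
have cE (x : T) : csum (f^~ x) = cexp (s * x%:C) * theta x.
  by rewrite -(csumZ _ (theta_asum x)); apply: eq_csum => n; rewrite fE.
rewrite (funext cE) in m1 e1; split=> //; rewrite -e1.
rewrite -(csumZ _ (dterm_asum (ltW ps))); apply: eq_csum => n.
rewrite /f cintZ; last exact: cintegrable_gfun.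
by rewrite -/(gint _ _) gint_scale// /dterm mulrA mulrC.
Qed.

(** Measurability comes with the termwise integration in [theta_mellin]; the exponential factor is
    divided out again. *)
Lemma theta_measurable : cmeasurable theta.
Proof.
have pp : p < complex.Re (p + 1)%:C by rewrite /= ltrDl.
have [m1 _] := theta_mellin pp.
have -> : theta = fun x : T => cexp (- (p + 1)%:C * x%:C) * (cexp ((p + 1)%:C * x%:C) * theta x).
  by apply/funext => x; rewrite mulrA -cexpD mulNr addNr cexp0 mul1r.
apply: cmeasurableM => //; apply: cmeasurable_cexp.
apply: cmeasurableM; first exact: cmeasurable_cst.
by apply: cmeasurable_real; exact: measurable_id.
Qed.

Lemma theta_pos (N : nat) : exists K : R, forall x : R, 0 < x ->
  cmod (theta x) <= K * expR (- N%:R * x).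
Proof.
have l2 : 0 < lam1 / 2 by rewrite divr_gt0.
have [K gK] := gfun_decay N l2.
have tc : 0 <= theta_const by rewrite !mulr_ge0// expR_ge0.
exists (theta_const * K) => x x0; apply: le_trans (csum_le (theta_asum x)) _.
rewrite -mulrA ler_wpM2l//; apply: le_trans (gK x x0).
rewrite ler_piMl ?expR_ge0// -expR0 ler_expR mulNr oppr_le0 mulr_ge0// ltW//.
Qed.

(** * Poles and values of the continued zeta function *)

Variable E : nat -> seq (term (R := R)).
Hypothesis E_step : forall N : nat, exists X, perm_eq (E N.+1) (E N ++ X) /\
  forall t, t \in X -> N%:R < complex.Re t.1.1.
Hypothesis E_neg : forall N : nat, exists K : R, forall x : R, x <= 0 ->
  cmod (theta x - terms_val (E N) x) <= K * expR (N%:R * x).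
Hypothesis E_log : forall t n, t \in E 1 -> t.1.1 = - n%:R -> (0 < t.1.2)%N -> t.2 = 0.

Let D := MellinData theta_measurable theta_pos E_step E_neg.

(** The expansion of order [1] describes the Mellin transform for Re s > -1, hence near all points n
    >= 0; this is the residue at [n] before division by Gamma. *)
Definition zresidue n : C := \sum_(t <- E 1 | (t.1.1 == - n%:R) && (t.1.2 == 0%N)) t.2.

Lemma terms_Re_bound (q : seq (term (R := R))) :
  exists B : R, forall t, t \in q -> - complex.Re t.1.1 < B.
Proof.
elim: q => [|t q [B qB]]; first by exists 0.
exists (Num.max B (- complex.Re t.1.1 + 1)) => u; rewrite inE lt_max.
by case/predU1P => [->|/qB ->//]; rewrite ltrDl ltr01 orbT.
Qed.

Lemma Pf_pseries (F P : C -> C) r M s0 a : (forall s, mero_at F s) -> has_pseries r M s0 a P ->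
  (forall s, s != s0 -> cmod (s - s0) < r -> F s = P s) ->
  forall s, cmod (s - s0) < r -> Pf F s = P s.
Proof.
move=> mF aP FP s sr; apply: Pf_continuous_value => //.
  exact: punctured_spread FP sr.
exact: has_pseries_continuous aP sr.
Qed.

Lemma Pf_analytic (F P : C -> C) s0 : (forall s, mero_at F s) -> analytic_at P s0 ->
  (\forall s \near s0^', F s = P s) -> \forall s \near s0, Pf F s = P s.
Proof.
move=> mF [r [M [a [r0 aP]]]] /dnearC_P [d d0 FP].
have m0 : 0 < Num.min r d by rewrite lt_min r0.
apply/nearC_P; exists (Num.min r d) => // s sm.
have h : has_pseries (Num.min r d) M s0 a P.
  by apply: has_pseriesW aP; rewrite ?(ltW m0) ?ge_min ?lexx.
by apply: (Pf_pseries mF h) => // u u0; rewrite lt_min => /andP[_ ud]; exact: FP.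
Qed.

Definition zquot s := mellin D s / cGamma s.

Lemma zquot_mero s : mero_at zquot s.
Proof.
apply: mero_atM; first exact: mellin_mero.
by apply: mero_at_inv; [exact: cGamma_mero|exact: cGamma_neq0].
Qed.

Definition zeta0 := Pf zquot.

Lemma zeta0_meromorphic : meromorphic zeta0.
Proof. by apply: meromorphic_Pf; exact: zquot_mero. Qed.

Lemma zeta0_near s0 : \forall s \near s0^', zeta0 s = zquot s.
Proof. by apply: Pf_near; exact: zquot_mero. Qed.

(** The Mellin integral is evaluated only to the right of all poles produced by [E 0], and that
    half-plane may be smaller than [p < Re s]. *)
Lemma mellin_dseries_large : exists s1 : R, p < s1 /\
  \forall s \near (s1%:C : C)^', mellin D s + - (cGamma s * dseries s) = 0.
Proof.
have [B EB] := terms_Re_bound (E 0).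
exists (Num.max p B + 1); split; first by rewrite ltr_pwDr// le_max lexx.
apply: near_dnbhs; apply/nearC_P; exists 1 => // s ss1.
have : Num.max p B < complex.Re s.
  have : (Num.max p B + 1) - complex.Re s <= cmod (s - (Num.max p B + 1)%:C).
    by rewrite cmodC -[X in X - _]/(complex.Re (Num.max p B + 1)%:C) -ReB;
       exact: le_trans (ler_norm _) (normr_Re _).
  by move: ss1; lra.
rewrite gt_max => /andP[ps Bs].
have s0 : 0 < complex.Re s by exact: lt_trans ps.
have [|_ ->] := @mellin_integral _ D s s0.
  by move=> t /EB tB; rewrite ReD; move: tB Bs; lra.
have [_ e1] := theta_mellin ps.
by rewrite e1 cGammaE// subrr.
Qed.

(** The segment from [s1] to [s0] stays in the half-plane where the Dirichlet series is analytic, so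
    the identity theorem applies along it. *)
Lemma mellin_dseries s0 : p < complex.Re s0 ->
  \forall s \near s0^', mellin D s + - (cGamma s * dseries s) = 0.
Proof.
move=> ps; have [s1 [ps1 h1]] := mellin_dseries_large.
apply: (mero_at_identity _ h1) => t /andP[t0 t1].
set s := _ + _.
have pst : p < complex.Re s.
  rewrite /s ReD ReM /= mul0r subr0 ReB /=.
  have [ts|ts] := leP s1 (complex.Re s0); first by nra.
  have : 0 <= (1 - t) * (s1 - complex.Re s0) by rewrite mulr_ge0 ?subr_ge0// ltW.
  by lra.
apply: mero_atD; first exact: mellin_mero.
apply: mero_atN; apply: mero_atM; first exact: cGamma_mero.
by apply: analytic_mero; exact: dseries_analytic.
Qed.

Lemma near_Re_gt (s0 : C) (b : R) : b < complex.Re s0 ->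
  \forall s \near s0, b < complex.Re s.
Proof.
move=> bs; apply/nearC_P; exists (complex.Re s0 - b); first by rewrite subr_gt0.
move=> s; have : complex.Re s0 - complex.Re s <= cmod (s - s0).
  by rewrite cmodC -ReB; exact: le_trans (ler_norm _) (normr_Re _).
by lra.
Qed.

Lemma cGamma_near_neq0 (s : C) : \forall t \near s^', cGamma t != 0.
Proof.
by have [/cGamma_neq0|] := mero_at_neq0 (cGamma_mero s).
Qed.

Lemma zeta0E s : p < complex.Re s -> zeta0 s = dseries s.
Proof.
move=> ps; apply: Pf_continuous_value; first exact: zquot_mero.
  have G0 := cGamma_near_neq0 s; apply: filterS2 G0 (mellin_dseries ps) => t t0.
  by move/subr0_eq; rewrite /zquot => ->; rewrite mulrC mulKf.
exact/analytic_at_continuous/dseries_analytic.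
Qed.

Lemma mellin_pole n : exists H, analytic_at H (n%:R : C) /\
  \forall s \near (n%:R : C)^', mellin D s = H s + zresidue n / (s - n%:R).
Proof.
have n1 : 0 < complex.Re (n%:R : C) + 1%:R by rewrite Re_natr -natrD ltr0n addn1.
have [|H [aH HE]] := @mellin_simple_pole _ D 1 n%:R n1.
  by move=> t tE; exact: E_log.
by exists H.
Qed.

Lemma analytic_id (s0 : C) : analytic_at (fun s => s) s0.
Proof. by have := analytic_at_shift 0 s0; under eq_fun do rewrite addr0. Qed.

Lemma analytic_translate (F : C -> C) (c : C) : analytic_at F c ->
  analytic_at (fun s => F (s + c)) 0.
Proof.
move=> [r [M [a [r0 h]]]]; exists r, M, a; split=> //.
by apply: has_pseries_translate; rewrite add0r.
Qed.

Lemma near_translate (P : set C) (c : C) : (\forall s \near c^', P s) ->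
  \forall s \near (0 : C)^', P (s + c).
Proof.
move=> /dnearC_P [d d0 dP]; apply/dnearC_P; exists d => // s s0; rewrite subr0 => sd.
by apply: dP; rewrite ?addrK// -subr_eq0 addrK.
Qed.

Lemma zeta0_residue n : exists W, [/\ analytic_at W 0,
  W 0 = zresidue n.+1 / n`!%:R &
  \forall s \near (0 : C)^', s * zeta0 (s + n.+1%:R) = W s].
Proof.
have [H [aH HE]] := mellin_pole n.+1.
have n0 : 0 < complex.Re (n.+1%:R : C) by rewrite Re_natr ltr0n.
have aG := analytic_translate (cGamma_analytic n0).
exists (fun s => (s * H (s + n.+1%:R) + zresidue n.+1) * (cGamma (s + n.+1%:R))^-1); split.
- apply: analytic_atM.
    apply: analytic_atD; last exact: analytic_at_cst.
    by apply: analytic_atM; [exact: analytic_id|exact: analytic_translate].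
  apply: analytic_at_inv => //; rewrite add0r cGamma_nat.
  by rewrite pnatr_eq0 -lt0n fact_gt0.
- by rewrite mul0r !add0r cGamma_nat.
- have := near_translate (zeta0_near n.+1%:R); have := near_translate HE.
  have s0 := @near_neq R 0; apply: filterS3 s0 => s s0 h1 h2.
  by rewrite h2 /zquot h1 addrK mulrA mulrDr mulrCA mulfV// mulr1.
Qed.

(** Numerator and Gamma have at most simple poles at [0]; after multiplying both by [s], the
    denominator takes the value [1], the residue of Gamma. *)
Lemma zeta0_analytic0 : analytic_at zeta0 0.
Proof.
have [H [aH HE]] := mellin_pole 0.
have [H' [aH' HE']] := @cGamma_pole0 R.
pose P s := (s * H s + zresidue 0) * (s * H' s + 1)^-1.
have aP : analytic_at P 0.
  apply: analytic_atM.
    apply: analytic_atD; last exact: analytic_at_cst.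
    by apply: analytic_atM => //; exact: analytic_id.
  apply: analytic_at_inv; last by rewrite mul0r add0r oner_neq0.
  apply: analytic_atD; last exact: analytic_at_cst.
  by apply: analytic_atM => //; exact: analytic_id.
apply: (analytic_at_near aP).
have zP : \forall s \near (0 : C)^', zquot s = P s.
  have s0 := @near_neq R 0; apply: filterS3 s0 HE HE' => s s0 h1 h2.
  have e1 (x y : C) : x + y / s = (s * x + y) / s.
    by rewrite mulrDl mulrAC mulfV// mul1r.
  by rewrite /zquot h1 h2 /P subr0 !e1 invf_div mulrA divfK.
by apply: filterS (Pf_analytic zquot_mero aP zP) => s <-.
Qed.

(* the first two coefficients at 0 determine the derivative at [s = 0] of
   [bincoef (- s) n.+1 * zeta0 (s + n.+1)], which has the harmonic number in it *)
Definition qpoly n s : C := (-1) ^+ n.+1 / n.+1%:R * \prod_(0 <= j < n) ((s + j.+1%:R) / j.+1%:R).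

Lemma bincoef_qpoly n s : bincoef (- s) n.+1 = s * qpoly n s.
Proof.
elim: n => [|n IH].
  by rewrite bincoefS bincoef0 /qpoly big_geq// subr0 expr1; ring.
have aux (a x y Q : C) : x != 0 -> y != 0 ->
    s * (a / x * Q) * ((- s - x) / y) = s * (-1 * a / y * (Q * ((s + x) / x))).
  by move=> x0 y0; field; rewrite x0 y0.
by rewrite bincoefS IH /qpoly big_nat_recr//= [in RHS]exprS aux ?pnatr_eq0.
Qed.

Lemma qpoly_pseries n : exists M q, has_pseries 1 M 0 q (qpoly n) /\
  q 0%N = (-1) ^+ n.+1 / n.+1%:R /\
  q 1%N = (-1) ^+ n.+1 / n.+1%:R * harmonic_number n.
Proof.
elim: n => [|n [M [q [h [q0 q1]]]]].
  exists (cmod (-1 : C)); eexists; split.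
    apply: eq_has_pseries (has_pseries_cst 1 0 (-1 : C)) _ => s _.
    by rewrite /qpoly big_geq// mulr1 expr1 divr1.
  by rewrite /= expr1 divr1 /harmonic_number big_geq// mulr0.
have h2 := has_pseriesM h (has_pseriesZ (- (n.+2%:R)^-1) (has_pseries_shift 0 n.+1%:R ler01)).
eexists; eexists; split.
  apply: eq_has_pseries h2 _ => s _.
  have aux (b x y Q : C) : x != 0 -> y != 0 ->
      b / x * Q * (- y^-1 * (s + x)) = -1 * b / y * (Q * ((s + x) / x)).
    by move=> x0 y0; field; rewrite x0 y0.
  by rewrite /qpoly big_nat_recr//= [in RHS]exprS aux ?pnatr_eq0.
rewrite /cauchy_prod !big_nat1 q0 big_nat_recr//= big_nat1 q0 q1.
have aux0 (b x y : C) : x != 0 -> y != 0 -> b / x * (- y^-1 * x) = -1 * b / y.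
  by move=> x0 y0; field; rewrite x0 y0.
have aux1 (b x y t : C) : x != 0 -> y != 0 ->
    b / x * (- y^-1 * 1) + b / x * t * (- y^-1 * x) = -1 * b / y * (t + x^-1).
  by move=> x0 y0; field; rewrite x0 y0.
split; first by rewrite add0r [in RHS]exprS aux0 ?pnatr_eq0.
by rewrite add0r /harmonic_number [in RHS]big_nat_recr//= [in RHS]exprS -aux1 ?pnatr_eq0//.
Qed.

Lemma phi_ex n : exists phi, analytic_at phi (0 : C) /\
  \forall s \near (0 : C)^', phi s = bincoef (- s) n * zeta0 (s + n%:R).
Proof.
case: n => [|n].
  exists zeta0; split; first exact: zeta0_analytic0.
  by near=> s; rewrite bincoef0 mul1r addr0.
have [W [aW _ WE]] := zeta0_residue n.
have [M [q [h _]]] := qpoly_pseries n.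
exists (fun s => qpoly n s * W s); split.
  by apply: analytic_atM => //; exists 1, M, q.
apply: filterS WE => s <-.
by rewrite bincoef_qpoly mulrCA mulrA.
Unshelve. all: by end_near. Qed.

(** From this index on, [p < Re (s + n)] for all |s| <= 1, so the continued function at [s + n] is
    the convergent series, with bounds explicit in [n]. *)
Definition ncut := (Num.truncn (p + 1)).+1.

Lemma ncutP : p + 1 < ncut%:R.
Proof. exact: truncnS_gt. Qed.

(** Each factor may have its own radius, and no uniform bound is available where the zeta function
    is only a continuation; for finitely many indices the smallest radius serves. *)
Lemma phi_initial N : exists r, 0 < r /\ forall n, (n < N)%N ->
  exists M a phi, has_pseries r M 0 a phi /\
    forall s, s != 0 -> cmod s < r -> phi s = bincoef (- s) n * zeta0 (s + n%:R).
Proof.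
elim: N => [|N [r [r0 IH]]]; first by exists 1.
have [phi [[r' [M [a [r'0 h]]]] /dnearC_P [d d0 dP]]] := phi_ex N.
pose m := Num.min r (Num.min r' d).
have m0 : 0 < m by rewrite !lt_min r0 r'0.
exists m; split=> // n; rewrite ltnS leq_eqVlt => /predU1P[->|nN].
  exists M, a, phi; split.
    by apply: has_pseriesW h; rewrite ?(ltW m0) // !ge_min lexx !orbT.
  move=> s s0; rewrite !lt_min => /and3P[_ _ sd].
  by apply: dP; rewrite ?subr0.
have [M' [a' [phi' [h' h'']]]] := IH n nN.
exists M', a', phi'; split.
  by apply: has_pseriesW h'; rewrite ?(ltW m0) // ge_min lexx.
by move=> s s0; rewrite !lt_min => /and3P[sr _ _]; exact: h''.
Qed.

(** Below [ncut] the norms are unspecified but finite in number; beyond it they are the explicit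
    [tail_bound], summable against [zradius]. *)
Lemma phi_family : exists r K (M : nat -> R) (a : nat -> nat -> C) (phi : nat -> C -> C),
  [/\ 0 < r, forall n, has_pseries r (M n) 0 (a n) (phi n),
    psum_le (fun n => M n * zradius ^+ n) K &
    forall n s, s != 0 -> cmod s < r -> phi n s = bincoef (- s) n * zeta0 (s + n%:R)].
Proof.
have [r' [r'0 hi]] := phi_initial ncut.
pose r := Num.min r' 1.
have r0 : 0 < r by rewrite lt_min r'0 ltr01.
have r1 : r <= 1 by rewrite ge_min lexx orbT.
have : forall n, exists y : R * (nat -> C) * (C -> C),
    [/\ has_pseries r y.1.1 0 y.1.2 y.2,
      forall s, s != 0 -> cmod s < r -> y.2 s = bincoef (- s) n * zeta0 (s + n%:R) &
      ((ncut <= n)%N -> y.1.1 = tail_bound 0 r n)].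
  move=> n; have [nN|Nn] := ltnP n ncut.
    have [M [a [phi [h1 h2]]]] := hi n nN.
    exists (M, a, phi); split=> //=.
      by apply: has_pseriesW h1; rewrite ?(ltW r0) ?ge_min ?lexx.
    by move=> s s0; rewrite lt_min => /andP[sr _]; exact: h2.
  have pn : p + 1 < n%:R by apply: lt_le_trans ncutP _; rewrite ler_nat.
  have [|a h] := @tail_pseries 0 r n r0; first by rewrite /=; lra.
  exists (tail_bound 0 r n, a, fun s => bincoef (- s) n * dseries (s + n%:R)); split=> //=.
  move=> s _ sr; rewrite zeta0E// ReD Re_natr.
  have : - complex.Re s <= cmod s.
    by rewrite -ReN -cmodN; exact: le_trans (ler_norm _) (normr_Re _).
  by lra.
move=> /choice [y yP].
exists r, (\sum_(0 <= n < ncut) (y n).1.1 * zradius ^+ n +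
  expR (cmod (0 : C) + r) * dconst (complex.Re (0 : C)) r).
exists (fun n => (y n).1.1), (fun n => (y n).1.2), (fun n => (y n).2).
have M0 n : 0 <= (y n).1.1 by have [h _ _] := yP n; exact: asum_ge0 h.1.
split=> //.
- by move=> n; have [] := yP n.
- move=> n; apply: (@le_trans _ _ (\sum_(0 <= k < ncut + n) (y k).1.1 * zradius ^+ k)).
    rewrite [leRHS](big_cat_nat _ (leq_addl ncut n))//= lerDl.
    by apply: sumr_ge0 => k _; rewrite mulr_ge0 ?exprn_ge0// ltW// zradius_gt0.
  rewrite (big_cat_nat _ (leq_addr n ncut))//= lerD2l.
  apply: le_trans (tail_bound_psum 0 (ltW r0) (ncut + n)).
  rewrite [leRHS](big_cat_nat _ (leq_addr n ncut))//= -[leLHS]add0r lerD//.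
    apply: sumr_ge0 => k _; rewrite mulr_ge0 ?exprn_ge0 ?tail_bound_ge0 ?(ltW r0)//.
    by rewrite ltW// zradius_gt0.
  rewrite big_nat [leRHS]big_nat; apply: ler_sum => k /andP[Nk _].
  by have [_ _ ->] := yP k.
- by move=> n s; have [_ h _] := yP n; exact: h.
Qed.

(** * The zeta function of the shifted spectrum *)

Definition zsum z s := csum (fun n => z ^+ n * (bincoef (- s) n * zeta0 (s + n%:R))).

Lemma tail_slice z s0 r (N : nat) : cmod z <= zradius -> 0 < r ->
  p <= complex.Re s0 + N%:R - r ->
  exists M a, has_pseries r M s0 a (fun s => csum (fun n =>
    z ^+ n * (if (n < N)%N then 0 else bincoef (- s) n * dseries (s + n%:R)))).
Proof.
move=> zr r0 pN.
have : forall n, exists a, has_pseries r (tail_bound s0 r n) s0 a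
    (fun s => if (n < N)%N then 0 else bincoef (- s) n * dseries (s + n%:R)).
  move=> n; have [nN|Nn] := ltnP n N.
    eexists; apply: has_pseriesW (has_pseries_cst r s0 0) => //; first exact: ltW.
    by rewrite cmod0 tail_bound_ge0 ?ltW.
  apply: tail_pseries => //; apply: le_trans pN _.
  by rewrite lerD2r lerD2l ler_nat.
move=> /choice [a aP].
by eexists; eexists; exact: (has_pseries_slice r0 zr aP (tail_bound_psum s0 (ltW r0))).
Qed.

(** Away from s = 0 the poles of finitely many terms persist; beyond [N] every term is given by the
    Dirichlet series, and the tail is analytic by [tail_slice]. *)
Lemma zsum_split z s N : cmod z <= zradius -> p + 1 < complex.Re s + N%:R ->
  zsum z s = \sum_(0 <= n < N) z ^+ n * (bincoef (- s) n * zeta0 (s + n%:R)) +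
    csum (fun n => z ^+ n * (if (n < N)%N then 0 else bincoef (- s) n * dseries (s + n%:R))).
Proof.
move=> zr ps.
pose u n := if (n < N)%N then z ^+ n * (bincoef (- s) n * zeta0 (s + n%:R)) else 0.
pose v n := z ^+ n * (if (n < N)%N then 0 else bincoef (- s) n * dseries (s + n%:R)).
have uM : asum u (\sum_(0 <= n < N) cmod (u n)).
  move=> n; apply: (@le_trans _ _ (\sum_(0 <= k < N + n) cmod (u k))).
    rewrite [leRHS](big_cat_nat _ (leq_addl N n))//= lerDl.
    by apply: sumr_ge0 => k _; exact: cmod_ge0.
  rewrite (big_cat_nat _ (leq_addr n N))//= [X in _ + X]big1_seq ?addr0// => k.
  by rewrite mem_index_iota /u => /andP[_ /andP[Nk _]]; rewrite ltnNge Nk /= cmod0.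
have vM : asum v (expR (cmod s + 1) * dconst (complex.Re s) 1).
  have ps1 : p <= complex.Re s + N%:R - 1 by lra.
  apply: asum_dom (tail_bound_psum s ler01) => n; rewrite cmodM cmodX mulrC.
  apply: ler_pM; rewrite ?exprn_ge0 ?cmod_ge0//.
    case: (ltnP n N) => nN; first by rewrite cmod0 tail_bound_ge0.
    have [|a [aM aE]] := @tail_pseries s 1 n ltr01.
      by apply: le_trans ps1 _; rewrite lerD2r lerD2l ler_nat.
    have ss : cmod (s - s) <= 1 by rewrite subrr cmod0.
    by rewrite aE//; apply: csum_le; exact: asum_disc aM ss.
  by rewrite lerXn2r ?nnegrE ?cmod_ge0// ltW// zradius_gt0.
transitivity (csum (fun n => u n + v n)).
  apply: eq_csum => n; rewrite /u /v; case: ltnP => nN; first by rewrite mulr0 addr0.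
  rewrite add0r zeta0E// ReD Re_natr.
  have : (N%:R : R) <= n%:R by rewrite ler_nat.
  lra.
rewrite (csumD uM vM) (csum_finite (N := N)).
  by congr (_ + _); apply: eq_big_nat => n /andP[_ nN]; rewrite /u nN.
by move=> k Nk; rewrite /u ltnNge Nk.
Qed.

Lemma zsum_mero z s0 : cmod z <= zradius -> mero_at (zsum z) s0.
Proof.
move=> zr; pose N := (Num.truncn (p + 2 + `|complex.Re s0|)).+1.
have NP : p + 2 < complex.Re s0 + N%:R.
  have : p + 2 + `|complex.Re s0| < N%:R by exact: truncnS_gt.
  have : - complex.Re s0 <= `|complex.Re s0| by rewrite -normrN ler_norm.
  by lra.
have [|M [a h]] := @tail_slice z s0 1 N zr ltr01; first by lra.
have m1 : mero_at (fun s => \sum_(0 <= n < N) z ^+ n * (bincoef (- s) n * zeta0 (s + n%:R))) s0.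
  apply: mero_at_sum => n; apply: mero_atM; first exact/analytic_mero/analytic_at_cst.
  apply: mero_atM.
    have [b hb] := bincoef_pseries s0 n ler01.
    by apply: analytic_mero; exists 1; eexists; exists b; split; [|exact: hb].
  by apply: mero_at_translate; exact: meromorphic_mero zeta0_meromorphic.
have m2 : mero_at (fun s => csum (fun n => z ^+ n *
    (if (n < N)%N then 0 else bincoef (- s) n * dseries (s + n%:R)))) s0.
  by apply: analytic_mero; exists 1, M, a.
apply: mero_at_near (mero_atD m1 m2) _.
have NP1 : p + 1 - N%:R < complex.Re s0 by lra.
apply: near_dnbhs; apply: filterS (near_Re_gt NP1) => s ps.
by rewrite (zsum_split (N := N))//; lra.
Qed.

Definition zetaz z := Pf (zsum z).

Lemma zetaz_meromorphic z : cmod z <= zradius -> meromorphic (zetaz z).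
Proof. by move=> zr; apply: meromorphic_Pf => s; exact: zsum_mero. Qed.

Lemma zetaz_zsum z s : cmod z <= zradius -> p < complex.Re s ->
  zetaz z s = csum (fun n => z ^+ n * (bincoef (- s) n * dseries (s + n%:R))).
Proof.
move=> zr ps; pose r := complex.Re s - p.
have r0 : 0 < r by rewrite subr_gt0.
have [|M [a h]] := @tail_slice z s r 0 zr r0; first by rewrite addr0 /r; lra.
apply: (Pf_pseries (fun t => zsum_mero t zr) h) => [t _ tr|]; last by rewrite subrr cmod0.
have pt : p < complex.Re t.
  have : complex.Re s - complex.Re t <= cmod (t - s).
    by rewrite cmodC -ReB; exact: le_trans (ler_norm _) (normr_Re _).
  by move: tr; rewrite /r; lra.
apply: eq_csum => n; rewrite zeta0E// ReD Re_natr.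
by have : (0 : R) <= n%:R by []; lra.
Qed.

(** In the double array [a] the sums over the eigenvalues are the terms of the expansion in [z],
    while the sums over [n] are binomial series of (lam + z)^(-s). The norms of [tail_bound] with
    radius [0] justify the exchange. *)
Lemma zetaz_sum z s : cmod z <= zradius -> p < complex.Re s ->
  (exists M, asum (fun i => (e i)%:C * cpow ((lam i)%:C + z) (- s)) M) /\
  zetaz z s = csum (fun i => (e i)%:C * cpow ((lam i)%:C + z) (- s)).
Proof.
move=> zr ps.
pose a n i := z ^+ n * (bincoef (- s) n * dterm (s + n%:R) i).
have psn n : p <= complex.Re (s + n%:R).
  by rewrite ReD Re_natr; have : (0 : R) <= n%:R by []; lra.
have aM n : asum (a n) (tail_bound s 0 n * zradius ^+ n).
  have := asumZ (z ^+ n) (asumZ (bincoef (- s) n) (dterm_asum (psn n))).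
  apply: psum_leW; rewrite cmodX mulrC; apply: ler_pM.
  - by rewrite mulr_ge0 ?cmod_ge0// mulr_ge0 ?expR_ge0.
  - by rewrite exprn_ge0 ?cmod_ge0.
  - rewrite /tail_bound; apply: ler_pM.
    + exact: cmod_ge0.
    + by rewrite mulr_ge0 ?expR_ge0.
    + by rewrite addr0; apply: cmod_bincoef_le; rewrite cmodN.
    + rewrite /dconst -mulrA ler_wpM2l// /Lambda -expRM_natl -expRD ler_expR.
      by rewrite -mulrDl ler_wpM2r// ReD Re_natr; lra.
  - by rewrite lerXn2r ?nnegrE ?cmod_ge0// ltW// zradius_gt0.
have sM := tail_bound_psum s (lexx 0).
have colE i : csum (a^~ i) = (e i)%:C * cpow ((lam i)%:C + z) (- s).
  have zl : cmod z <= lam i / 2 by exact: le_trans (zradius_le i).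
  rewrite cpow_binomial// mulrA.
  have lC : ((lam i)%:C : C) != 0 by rewrite -cmod_gt0 cmod_real gtr0_norm.
  have wr : cmod (z / (lam i)%:C) <= 2^-1.
    by rewrite cmodM cmodV cmod_real gtr0_norm// ler_pdivrMr// mulrC.
  rewrite -(csumZ _ (bincoef_asum (- s) wr)); apply: eq_csum => n.
  rewrite /a /dterm !cpow_real//.
  have -> : - (s + n%:R) * (ln (lam i))%:C = - s * (ln (lam i))%:C + n%:R * (- ln (lam i))%:C.
    by rewrite (rmorphN (real_complex R)); ring.
  rewrite cexpD.
  rewrite (_ : cexp (n%:R * (- ln (lam i))%:C) = ((lam i)%:C ^+ n)^-1).
    by rewrite exprMn exprVn; ring.
  rewrite mulr_natl cexpX cexp_real expRN lnK ?posrE//.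
  by rewrite (fmorphV (real_complex R)) exprVn.
split; first by eexists; move: (asum_csum_col aM sM); rewrite (funext colE); exact.
rewrite zetaz_zsum// -(eq_csum colE) -(csum_exchange aM sM).
apply: eq_csum => n; rewrite (csumZ _ (asumZ _ (dterm_asum (psn n)))).
by rewrite (csumZ _ (dterm_asum (psn n))).
Qed.

Lemma zetaz_phi z r (B : nat -> R) (a : nat -> nat -> C) (phi : nat -> C -> C) K : cmod z <= zradius ->
  0 < r -> (forall n, has_pseries r (B n) 0 (a n) (phi n)) ->
  psum_le (fun n => B n * zradius ^+ n) K ->
  (forall n s, s != 0 -> cmod s < r -> phi n s = bincoef (- s) n * zeta0 (s + n%:R)) ->
  forall s, cmod s < r -> zetaz z s = csum (fun n => z ^+ n * phi n s).
Proof.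
move=> zr r0 h hB hphi s sr.
have hs := has_pseries_slice r0 zr h hB.
apply: (Pf_pseries (fun t => zsum_mero t zr) hs) => [t t0|]; rewrite subr0 // => tr.
by apply: eq_csum => n; rewrite hphi.
Qed.

(** Near [0] the function is [qpoly n] times [W], where [W s] continues [s * zeta0 (s + n + 1)]. The
    coefficients of [W] of order 0 and 1 are the residue and the finite part at [n + 1], and the
    product rule combines them. *)
Lemma phi_coef1 n r M a phi : 0 < r -> has_pseries r M 0 a phi ->
  (forall s, s != 0 -> cmod s < r -> phi s = bincoef (- s) n.+1 * zeta0 (s + n.+1%:R)) ->
  a 1%N = (-1) ^+ n.+1 / n.+1%:R *
    (Pf zeta0 n.+1%:R + zresidue n.+1 / n`!%:R * harmonic_number n).
Proof.
move=> r0 h hphi.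
have [W [[r' [M' [w [r'0 hW]]]] W0 WE]] := zeta0_residue n.
have [Mq [q [hq [q0 q1]]]] := qpoly_pseries n.
have Pw : Pf zeta0 n.+1%:R = w 1%N.
  apply: (@Pf_laurent _ _ _ 1 w).
  have hW' : has_pseries r' M' n.+1%:R w (fun s => W (s - n.+1%:R)).
    by apply: has_pseries_translate; rewrite subrr.
  apply: has_laurentP r'0 hW' _; have /dnearC_P [d d0 dE] := WE.
  apply/dnearC_P; exists d => // s sn sd; rewrite expr1.
  have sn0 : s - n.+1%:R != 0 by rewrite subr_eq0.
  by rewrite -dE ?subr0// subrK mulrC mulKf.
have w0 : w 0%N = zresidue n.+1 / n`!%:R by rewrite -(has_pseries0 (ltW r'0) hW).
pose m := Num.min 1 r'.
have m0 : 0 < m by rewrite lt_min ltr01.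
have hq' : has_pseries m Mq 0 q (qpoly n).
  by apply: has_pseriesW hq; rewrite ?(ltW m0) ?ge_min ?lexx.
have hW' : has_pseries m M' 0 w W.
  by apply: has_pseriesW hW; rewrite ?(ltW m0) ?ge_min ?lexx ?orbT.
have := has_pseries_unique r0 m0 h (has_pseriesM hq' hW').
have near_phi : \forall s \near (0 : C)^', phi s = qpoly n s * W s.
  have s0 := @near_neq R 0; have sr := @dnear_ball R 0 r r0.
  apply: filterS3 s0 sr WE => s s0; rewrite subr0 => sr <-.
  by rewrite hphi// bincoef_qpoly -mulrA mulrCA.
move=> /(_ near_phi) ->.
rewrite /cauchy_prod big_nat_recr//= big_nat1 subn0 subnn q0 q1 w0 -Pw.
by ring.
Qed.

End DirichletSeries.

(** * Spectral decomposition *)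

Section InnerProduct.
Context {R : realType} {H : completeNormedModType R[i]}.
Local Notation C := R[i].
Variable dot : {dot H for conjC}.
Hypothesis norm_dot : forall u : H, `|u| ^+ 2 = dot u u.
Implicit Types (u v w : H) (c : C).

(** The norm of the space takes values in R[i]; real inequalities are stated for its real part. *)
Definition nrm u : R := complex.Re `|u|.

Lemma nrmE u : `|u| = (nrm u)%:C.
Proof.
have : 0 <= `|u| by exact: normr_ge0.
by rewrite /nrm; case: `|u| => x y; rewrite lecE /= => /andP[/eqP -> _].
Qed.

Lemma nrm_ge0 u : 0 <= nrm u.
Proof. by rewrite -lecR -nrmE; exact: normr_ge0. Qed.

Lemma nrmD u v : nrm (u + v) <= nrm u + nrm v.
Proof. by rewrite -lecR rmorphD /= -!nrmE ler_normD. Qed.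

Lemma nrmN u : nrm (- u) = nrm u.
Proof. by rewrite /nrm normrN. Qed.

Lemma nrmC u v : nrm (u - v) = nrm (v - u).
Proof. by rewrite /nrm distrC. Qed.

Lemma nrmB u v : nrm (u - v) <= nrm u + nrm v.
Proof. by rewrite -(nrmN v) nrmD. Qed.

Lemma nrmZ c u : nrm (c *: u) = cmod c * nrm u.
Proof. by apply: (@complexI R); rewrite rmorphM /= -nrmE -cmodE -nrmE normrZ. Qed.

Lemma nrm_eq0 u : (nrm u == 0) = (u == 0).
Proof. by rewrite -(normr_eq0 u) nrmE -(inj_eq (@complexI R)). Qed.

Lemma nrm0 : nrm 0 = 0.
Proof. by apply/eqP; rewrite nrm_eq0. Qed.

Lemma cvgH_P (T : Type) (F : set_system T) {FF : Filter F} (f : T -> H) u :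
  f @ F --> u <-> forall e : R, 0 < e -> \forall x \near F, nrm (f x - u) < e.
Proof.
split=> [/cvgrPdist_lt h e e0|h].
  have e0' : 0 < (e%:C : C) by rewrite ltcR.
  by apply: filterS (h _ e0') => x; rewrite nrmE ltcR nrmC.
apply/cvgrPdist_lt => e e0.
have eE : e = (complex.Re e)%:C.
  by move: e0; case: e => a b; rewrite ltcE /= => /andP[/eqP -> _].
have e0' : 0 < complex.Re e by rewrite -ltcR -eE.
by apply: filterS (h _ e0') => x; rewrite nrmE nrmC eE ltcR.
Qed.

Lemma dotDl u v w : dot (u + v) w = dot u w + dot v w.
Proof. exact: linearDl. Qed.

Lemma dotDr u v w : dot u (v + w) = dot u v + dot u w.
Proof. exact: linearDr. Qed.

Lemma dotNl u v : dot (- u) v = - dot u v.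
Proof. exact: linearNl. Qed.

Lemma dotNr u v : dot u (- v) = - dot u v.
Proof. exact: linearNr. Qed.

Lemma dotBl u v w : dot (u - v) w = dot u w - dot v w.
Proof. by rewrite dotDl dotNl. Qed.

Lemma dotBr u v w : dot u (v - w) = dot u v - dot u w.
Proof. by rewrite dotDr dotNr. Qed.

Lemma dotZl c u v : dot (c *: u) v = c * dot u v.
Proof. exact: linearZl_LR. Qed.

Lemma dotZr c u v : dot u (c *: v) = c^* * dot u v.
Proof. exact: linearZr_LR. Qed.

Lemma dot0l u : dot 0 u = 0.
Proof. exact: linear0l. Qed.

Lemma dot0r u : dot u 0 = 0.
Proof. exact: linear0r. Qed.

Lemma dotC u v : dot u v = (dot v u)^*.
Proof. by rewrite hermC expr0 mul1r. Qed.

Lemma dot_suml (I : Type) (r : seq I) (P : pred I) (f : I -> H) v :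
  dot (\sum_(i <- r | P i) f i) v = \sum_(i <- r | P i) dot (f i) v.
Proof. exact: linear_sumlz. Qed.

Lemma dot_eq0C u v : dot u v = 0 -> dot v u = 0.
Proof. by rewrite dotC => /eqP; rewrite fmorph_eq0 => /eqP. Qed.

Lemma dot_nrm u : dot u u = (nrm u ^+ 2)%:C.
Proof. by rewrite -norm_dot nrmE rmorphXn. Qed.

Lemma cmod_conj c : cmod c^* = cmod c.
Proof. by rewrite /cmod norm_conjC. Qed.

Lemma mul_conj_cmod c : c * c^* = (cmod c ^+ 2)%:C.
Proof. by rewrite -normCK cmodE rmorphXn. Qed.

Lemma cmod_dotC u v : cmod (dot u v) = cmod (dot v u).
Proof. by rewrite dotC cmod_conj. Qed.

Lemma nrm_pythagoras u v : dot u v = 0 -> nrm (u + v) ^+ 2 = nrm u ^+ 2 + nrm v ^+ 2.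
Proof.
move=> uv; apply: (@complexI R); rewrite rmorphD /= -!dot_nrm dotDl !dotDr uv.
by rewrite (dot_eq0C uv) addr0 add0r.
Qed.

Lemma cauchy_schwarz u v : cmod (dot u v) <= nrm u * nrm v.
Proof.
have [->|v0] := eqVneq v 0; first by rewrite dot0r cmod0 nrm0 mulr0.
have nv : 0 < nrm v by rewrite lt_def nrm_eq0 v0 nrm_ge0.
pose c := dot u v / dot v v.
have vv : dot v v != 0.
  by rewrite dot_nrm (fmorph_eq0 (real_complex R)) expf_neq0 ?gt_eqF.
have h : dot (u - c *: v) (c *: v) = 0.
  by rewrite dotZr dotBl dotZl /c divfK// subrr mulr0.
have := nrm_pythagoras h; rewrite subrK nrmZ => e.
have : (cmod c * nrm v) ^+ 2 <= nrm u ^+ 2 by rewrite e lerDr sqr_ge0.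
rewrite ler_sqr ?nnegrE ?mulr_ge0 ?cmod_ge0 ?nrm_ge0//.
rewrite /c cmodM cmodV dot_nrm cmod_real ger0_norm ?sqr_ge0//.
rewrite expr2 invfM mulrA mulfVK ?gt_eqF//.
by rewrite ler_pdivrMr.
Qed.

Lemma cvg_dotl (T : Type) (F : set_system T) {FF : Filter F} (f : T -> H) u v :
  f @ F --> u -> dot (f x) v @[x --> F] --> dot u v.
Proof.
move=> /cvgH_P fu; apply/(cvgC_P (F := F)) => e e0.
have n1 : 0 < nrm v + 1 by rewrite ltr_wpDl ?nrm_ge0.
apply: filterS (fu _ (divr_gt0 e0 n1)) => x xe.
rewrite -dotBl; apply: le_lt_trans (cauchy_schwarz _ _) _.
move: xe; rewrite ltr_pdivlMr//; apply: le_lt_trans.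
by rewrite ler_wpM2l ?nrm_ge0// lerDl.
Qed.

End InnerProduct.

(** * Orthonormal sequences: Bessel, Riesz-Fischer and Parseval *)

Section OrthonormalSequence.
Context {R : realType} {H : completeNormedModType R[i]}.
Local Notation C := R[i].
Variable dot : {dot H for conjC}.
Hypothesis norm_dot : forall u : H, `|u| ^+ 2 = dot u u.
Implicit Types (u v w : H) (c : C) (a : nat -> C).

(* an orthonormal family indexed by the set [b], padded with zeros *)
Definition orthosys (f : nat -> H) (b : nat -> bool) :=
  forall m n, dot (f m) (f n) = ((m == n) && b n)%:R.

Definition complete_sys (f : nat -> H) := forall u, (forall n, dot u (f n) = 0) -> u = 0.

Variables (f : nat -> H) (b : nat -> bool).
Hypothesis f_ortho : orthosys f b.

Lemma orthosys_eq0 n : ~~ b n -> f n = 0.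
Proof.
move=> /negPf bn; apply/eqP; rewrite -nrm_eq0; have := dot_nrm norm_dot (f n).
by rewrite f_ortho bn andbF => /esym/eqP; rewrite (fmorph_eq0 (real_complex R)) sqrf_eq0.
Qed.

Lemma orthosys_nrm n : nrm (f n) ^+ 2 = (b n)%:R.
Proof.
by apply: (@complexI R); rewrite -(dot_nrm norm_dot) f_ortho eqxx /= rmorph_nat.
Qed.

Lemma dot_lincomb a m n k :
  dot (\sum_(m <= i < n) a i *: f i) (f k) = if (m <= k < n)%N && b k then a k else 0.
Proof.
rewrite dot_suml; under eq_bigr do rewrite dotZl f_ortho.
rewrite -mem_index_iota; have [kmn|kmn] := boolP (k \in index_iota m n); last first.
  rewrite big_seq big1// => i imn; case: eqP => [ik|_]; last by rewrite mulr0.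
  by move: kmn; rewrite -ik imn.
rewrite (bigD1_seq k) ?iota_uniq//= big1 ?addr0; last first.
  by move=> i /negPf ->; rewrite mulr0.
by rewrite eqxx /=; case: (b k); rewrite ?mulr1 ?mulr0.
Qed.

Lemma nrm_lincomb a m n : nrm (\sum_(m <= i < n) a i *: f i) ^+ 2 =
  \sum_(m <= i < n) cmod (a i) ^+ 2 * (b i)%:R.
Proof.
elim: n => [|n IH]; first by rewrite !big_geq// nrm0 expr0n.
have [mn|nm] := leqP m n; last by rewrite !big_geq// nrm0 expr0n.
rewrite !big_nat_recr//= (nrm_pythagoras norm_dot) ?IH.
  by rewrite nrmZ exprMn orthosys_nrm.
by rewrite dotZr dot_lincomb ltnn andbF mulr0.
Qed.

Lemma bessel u : psum_le (fun n => cmod (dot u (f n)) ^+ 2) (nrm u ^+ 2).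
Proof.
move=> n; pose S := \sum_(0 <= i < n) dot u (f i) *: f i.
have h : dot (u - S) S = 0.
  apply: dot_eq0C; rewrite dot_suml big_nat big1// => i i0n.
  apply: (dot_eq0C (dot := dot)).
  rewrite dotZr dotBl dot_lincomb i0n /=; case: ifPn => [_|/orthosys_eq0 ->].
    by rewrite subrr mulr0.
  by rewrite dot0r subr0 mulr0.
have := nrm_pythagoras norm_dot h; rewrite subrK nrm_lincomb => ->.
apply: (@le_trans _ _ (\sum_(0 <= i < n) cmod (dot u (f i)) ^+ 2 * (b i)%:R)).
  apply: ler_sum => i _; case: (boolP (b i)) => bi; first by rewrite mulr1.
  by rewrite (orthosys_eq0 bi) dot0r cmod0 expr0n mul0r.
by rewrite lerDr sqr_ge0.
Qed.

Lemma riesz_fischer a B : psum_le (fun n => cmod (a n) ^+ 2) B ->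
  exists w, series (fun k => a k *: f k) @ \oo --> w /\
    forall n, dot w (f n) = if b n then a n else 0.
Proof.
move=> aB.
have cs : cvgn (series (fun k => a k *: f k)).
  apply: cauchy_cvg; apply/cauchy_seriesP => e e0.
  have eE : e = (complex.Re e)%:C.
    by move: e0; case: e => x y; rewrite ltcE /= => /andP[/eqP -> _].
  have e1 : 0 < complex.Re e by rewrite -ltcR -eE.
  have e2 : 0 < (complex.Re e / 2) ^+ 2 by rewrite exprn_gt0// divr_gt0.
  have [N hN] := psum_le_tail (fun k => sqr_ge0 (cmod (a k))) aB e2.
  exists ([set n | (N <= n)%N], [set: nat]).
    by split; [exact: nbhs_infty_ge|exact: filterT].
  move=> [m n] [/= Nm _]; rewrite nrmE eE ltcR.
  apply: (@le_lt_trans _ _ (complex.Re e / 2)); last by lra.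
  rewrite -ler_sqr ?nnegrE ?nrm_ge0 ?divr_ge0 ?(ltW e1)// nrm_lincomb.
  apply: le_trans (hN n); have [mn|nm] := leqP m n; last first.
    by rewrite (big_geq (ltnW nm)) sumr_ge0// => k _; exact: sqr_ge0.
  apply: (@le_trans _ _ (\sum_(m <= k < n) cmod (a k) ^+ 2)).
    by apply: ler_sum => k _; rewrite ler_piMr ?sqr_ge0//; case: (b k).
  by rewrite (big_cat_nat Nm mn)/= lerDr sumr_ge0// => k _; exact: sqr_ge0.
exists (limn (series (fun k => a k *: f k))); split=> // n.
have h : dot (series (fun k => a k *: f k) m) (f n) @[m --> \oo] -->
    dot (limn (series (fun k => a k *: f k))) (f n) by exact: (cvg_dotl norm_dot cs).
have : dot (series (fun k => a k *: f k) m) (f n) @[m --> \oo] --> (if b n then a n else 0).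
  apply: cvg_near_cst; near=> m; rewrite [series _]/series /= dot_lincomb leq0n /=.
  suff -> : (n < m)%N by [].
  by near: m; exact: nbhs_infty_gt.
by move=> h2; exact: (cvg_unique _ h h2).
Unshelve. all: by end_near. Qed.

Hypothesis f_complete : complete_sys f.

Lemma complete_expansion u : series (fun k => dot u (f k) *: f k) @ \oo --> u.
Proof.
have [w [cw wE]] := riesz_fischer (bessel u).
suff uw : u = w by move: cw; rewrite -uw.
apply/eqP; rewrite -subr_eq0; apply/eqP; apply: f_complete => n.
rewrite dotBl wE; case: ifPn => [_|/orthosys_eq0 ->]; first by rewrite subrr.
by rewrite dot0r subr0.
Qed.

Lemma parseval u w : csum (fun n => dot u (f n) * dot (f n) w) = dot u w.
Proof.
apply: csum_unique.
have : dot (series (fun k => dot u (f k) *: f k) m) w @[m --> \oo] --> dot u w.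
  exact: (cvg_dotl norm_dot (@complete_expansion u)).
apply: cvg_trans; apply: near_eq_cvg; near=> n.
by rewrite /series /= dot_suml; apply: eq_bigr => k _; rewrite dotZl.
Unshelve. all: by end_near. Qed.

Lemma parseval_nrm u : csum (fun n => (cmod (dot u (f n)) ^+ 2)%:C) = (nrm u ^+ 2)%:C.
Proof.
rewrite -(dot_nrm norm_dot) -parseval; apply: eq_csum => n.
by rewrite [X in _ * X]dotC mul_conj_cmod.
Qed.

(** Dominated convergence for the squared coefficients, dominated by those of [u]. It yields both
    the strong continuity of the heat flow and the derivative on the domain. *)
Lemma multiplier_cvg0 (T : Type) (F : set_system T) {FF : ProperFilter F}
    (g : T -> H) (m : T -> nat -> C) u :
  (\forall x \near F, forall n,
    dot (g x) (f n) = m x n * dot u (f n) /\ cmod (m x n) <= 1) ->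
  (forall n, b n -> m^~ n @ F --> (0 : C)) -> g @ F --> (0 : H).
Proof.
move=> gm m0.
have h : csum (fun n => (cmod (dot (g x) (f n)) ^+ 2)%:C) @[x --> F] --> csum (fun _ : nat => 0 : C).
  apply: csum_dominated (bessel u) _ => [|n].
    apply: filterS gm => x gmx n; have [-> mx] := gmx n.
    rewrite cmod_real ger0_norm ?sqr_ge0// cmodM exprMn.
    by rewrite ler_piMl ?sqr_ge0// exprn_ile1 ?cmod_ge0.
  have [bn|bn] := boolP (b n); last first.
    apply: cvg_near_cst; apply: nearW => x.
    by rewrite (orthosys_eq0 bn) dot0r cmod0 expr0n.
  apply/(cvgC_P (F := F)) => e e0.
  pose K := cmod (dot u (f n)) ^+ 2 + 1.
  have K0 : 0 < K by rewrite ltr_wpDl ?sqr_ge0.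
  have eK : 0 < Num.min 1 (e / K) by rewrite lt_min ltr01 divr_gt0.
  have /(cvgC_P (F := F))/(_ _ eK) := m0 n bn.
  apply: filterS2 gm => x /(_ n)[-> _].
  rewrite !subr0 cmod_real ger0_norm ?sqr_ge0// cmodM exprMn lt_min => /andP[x1]; rewrite ltr_pdivlMr// /K => x2.
  have := cmod_ge0 (m x n); have := sqr_ge0 (cmod (dot u (f n))).
  move: x1 x2; move: (cmod (m x n)) (cmod _ ^+ 2) => s t; rewrite expr2; nra.
rewrite csum0 in h; apply/(cvgH_P (F := F)) => e e0.
have /(cvgC_P (F := F))/(_ _ (exprn_gt0 2 e0)) := h.
apply: filterS => x; rewrite parseval_nrm !subr0 cmod_real ger0_norm ?sqr_ge0//.
by rewrite ltr_sqr ?nnegrE ?nrm_ge0// ltW.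
Qed.

End OrthonormalSequence.

(** * The resolvent at -1 *)

Section Resolvent.
Context {R : realType} {H : completeNormedModType R[i]}.
Local Notation C := R[i].
Variable dot : {dot H for conjC}.
Hypothesis norm_dot : forall u : H, `|u| ^+ 2 = dot u u.
Variable L : operator H.
Hypothesis saL : selfadjoint dot L.
Hypothesis nonnegL : nonneg_operator dot L.
Implicit Types (u v w : H) (c : C).

Lemma domZ c u : dom L u -> dom L (c *: u).
Proof. by move=> du; rewrite -[c *: u]addr0; exact: dom_linear (dom0 L). Qed.

Lemma domB u v : dom L u -> dom L v -> dom L (u - v).
Proof. by move=> du dv; rewrite -scaleN1r addrC; exact: dom_linear. Qed.

Lemma opD u v : dom L u -> dom L v -> L (u + v) = L u + L v.
Proof. by move=> du dv; rewrite -{1}[u]scale1r op_linear// scale1r. Qed.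

Lemma op0 : L 0 = 0.
Proof.
have := opD (dom0 L) (dom0 L); rewrite addr0 => /eqP.
by rewrite -subr_eq subrr => /eqP.
Qed.

Lemma opZ c u : dom L u -> L (c *: u) = c *: L u.
Proof. by move=> du; rewrite -{1}[c *: u]addr0 op_linear ?op0 ?addr0//; exact: dom0. Qed.

Lemma opB u v : dom L u -> dom L v -> L (u - v) = L u - L v.
Proof.
move=> du dv; rewrite -scaleN1r (opD du); last exact: domZ.
by rewrite (opZ _ dv) scaleN1r.
Qed.

Lemma op_sym u v : dom L u -> dom L v -> dot (L u) v = dot u (L v).
Proof.
move=> du dv; have [_ h] := saL; have [_ h2] := h v (L v).
exact: h2 (conj dv erefl) u du.
Qed.

Lemma op_nonneg u : dom L u -> exists2 r : R, 0 <= r & dot (L u) u = r%:C.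
Proof.
move=> /nonnegL; case: (dot _ _) => x y.
rewrite lecE /= => /andP[/eqP -> x0]; by exists x.
Qed.

Lemma nrm_le_op u : dom L u -> nrm u ^+ 2 <= complex.Re (dot u (L u + u)).
Proof.
move=> du; have [r r0 rE] := op_nonneg du.
rewrite dotDr ReD -(op_sym du du) rE /= (dot_nrm norm_dot) /= lerDr//.
Qed.

Lemma op_inj u : dom L u -> L u + u = 0 -> u = 0.
Proof.
move=> du e; have := nrm_le_op du; rewrite e dot0r /= => h.
have /eqP : nrm u ^+ 2 = 0 by apply/eqP; rewrite eq_le h sqr_ge0.
by rewrite sqrf_eq0 nrm_eq0 => /eqP.
Qed.

Local Notation T := (resolvent L 1).

Lemma resolvent_left u : dom L u -> T (L u + u) = u.
Proof.
move=> du; apply: get_unique; first by rewrite /= scale1r.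
move=> v [dv]; rewrite scale1r => e; apply/eqP; rewrite -subr_eq0; apply/eqP.
apply: op_inj; first exact: domB.
by rewrite opB// addrACA -opprD e subrr.
Qed.

Hypothesis T_linear : linear T.

(* The resolvent is a total function; if [v] were not in the range of [L + 1], it would
   take the same default value at [v] and at [v + L u + u], so that linearity gives
   [u = 0] for all [u] in the dense domain. *)
Lemma resolventP v : dom L (T v) /\ L (T v) + T v = v.
Proof.
pose P v := exists u, dom L u /\ L u + 1 *: u = v.
have PT w : P w -> dom L (T w) /\ L (T w) + T w = w.
  by move=> /getPex; rewrite /= scale1r.
apply: PT; apply: contrapT => nPv.
have Tpt w : ~ P w -> T w = point.
  by move=> nPw; rewrite /resolvent getPN// => u hu; apply: nPw; exists u.
have dom_eq0 u : dom L u -> u = 0.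
  move=> du; have nP : ~ P (v + (L u + u)).
    move=> [w [dw wE]]; apply: nPv; exists (w - u); split; first exact: domB.
    by rewrite scale1r in wE; rewrite scale1r opB// addrACA -opprD wE addrK.
  have := T_linear 1 (L u + u) v; rewrite scale1r [_ + v]addrC (Tpt _ nP) (Tpt _ nPv).
  rewrite scale1r resolvent_left// => /eqP; rewrite -subr_eq subrr => /eqP <-//.
have v0 : v = 0.
  apply: contrapT => /eqP v0; have [dL _] := saL.
  have nv : 0 < nrm v by rewrite lt_def nrm_eq0 v0 nrm_ge0.
  have ob : open [set u : H | u != 0].
    have -> : [set u : H | u != 0] = ~` [set 0].
      by apply/seteqP; split=> u /= /eqP.
    by apply: closed_openC; exact: accessible_closed_set1 (hausdorff_accessible (@norm_hausdorff _ _)) _.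
  have [u [/= /eqP u0 du]] : [set u : H | u != 0] `&` dom L !=set0.
    by apply: dL => //; exists v.
  by apply: u0; exact: dom_eq0.
by apply: nPv; exists 0; rewrite v0 scaler0 op0 addr0; split=> //; exact: dom0.
Qed.

Lemma resolvent_dom v : dom L (T v). Proof. by have [] := resolventP v. Qed.

Lemma resolventE v : L (T v) + T v = v. Proof. by have [] := resolventP v. Qed.

Lemma resolventD u v : T (u + v) = T u + T v.
Proof. by rewrite -{1}[u]scale1r T_linear scale1r. Qed.

Lemma resolvent0 : T 0 = 0.
Proof. by have := resolvent_left (dom0 L); rewrite op0 addr0. Qed.

Lemma resolventZ c u : T (c *: u) = c *: T u.
Proof. by rewrite -[X in T X]addr0 T_linear resolvent0 addr0. Qed.

Lemma resolventB u v : T (u - v) = T u - T v.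
Proof. by rewrite resolventD -scaleN1r resolventZ scaleN1r. Qed.

Lemma resolvent_sym u v : dot (T u) v = dot u (T v).
Proof.
rewrite -{2}[u]resolventE -{1}[v]resolventE dotDl dotDr.
by rewrite op_sym; [|exact: resolvent_dom..].
Qed.

Lemma resolvent_pos u : nrm (T u) ^+ 2 <= complex.Re (dot (T u) u).
Proof. by rewrite -{3}[u]resolventE; apply: nrm_le_op; exact: resolvent_dom. Qed.

Lemma nrm_resolvent u : nrm (T u) <= nrm u.
Proof.
have h : nrm (T u) ^+ 2 <= nrm (T u) * nrm u.
  apply: le_trans (resolvent_pos u) _; apply: le_trans (cauchy_schwarz norm_dot _ _).
  exact: le_trans (ler_norm _) (normr_Re _).
have [e|] := eqVneq (nrm (T u)) 0; first by rewrite e nrm_ge0.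
move=> n0; have n1 : 0 < nrm (T u) by rewrite lt_def n0 nrm_ge0.
by rewrite -(ler_pM2l n1) -expr2.
Qed.

Lemma resolvent_eq0 u : T u = 0 -> u = 0.
Proof. by move=> e; rewrite -[u]resolventE e op0 addr0. Qed.

Lemma adjoint_resolvent : adjoint dot T = T.
Proof.
apply/funext => v; rewrite /adjoint.
have : [set w | forall u, dot (T u) v = dot u w] (T v) by move=> u; exact: resolvent_sym.
move=> h; have := getPex (ex_intro _ _ h) => /= h2.
set w := get _ in h2 *.
apply/eqP; rewrite -subr_eq0 -nrm_eq0 -sqrf_eq0 -(fmorph_eq0 (real_complex R)) /=.
by rewrite -(dot_nrm norm_dot) dotBr -h2 -h subrr.
Qed.

Lemma eigen_real l u : dom L u -> L u = l *: u -> u != 0 ->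
  exists2 r : R, 0 <= r & l = r%:C.
Proof.
move=> du Lu u0; have [r r0] := op_nonneg du; rewrite Lu dotZl (dot_nrm norm_dot) => e.
have nu : nrm u ^+ 2 != 0 by rewrite sqrf_eq0 nrm_eq0.
exists (r / nrm u ^+ 2); first by rewrite divr_ge0// sqr_ge0.
have nC : ((nrm u ^+ 2)%:C : C) != 0 by rewrite (fmorph_eq0 (real_complex R)).
by apply: (mulIf nC); rewrite e rmorphM /= (fmorphV (real_complex R)) divfK.
Qed.

Lemma resolvent_eigen (r : R) u : 0 <= r -> dom L u -> L u = r%:C *: u ->
  T u = ((1 + r)^-1)%:C *: u.
Proof.
move=> r0 du Lu; have := resolvent_left du; rewrite Lu -{2}[u]scale1r -scalerDl resolventZ => e.
have r1 : ((1 + r)%:C : C) != 0 by rewrite (fmorph_eq0 (real_complex R)) gt_eqF// ltr_pwDl.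
have e2 : r%:C + 1 = ((1 + r)%:C : C) by rewrite rmorphD rmorph1 addrC.
by rewrite -{2}e e2 scalerA (fmorphV (real_complex R)) mulVf// scale1r.
Qed.

End Resolvent.

Lemma conj_realC {R : realType} (r : R) : Num.conj (r%:C : R[i]) = r%:C.
Proof. by apply/eqP; rewrite eq_complex /= oppr0 !eqxx. Qed.

(** * Orthonormal vectors in a subspace of unknown dimension *)

Section GramSchmidt.
Context {R : realType} {H : completeNormedModType R[i]}.
Local Notation C := R[i].
Variable dot : {dot H for conjC}.
Hypothesis norm_dot : forall u : H, `|u| ^+ 2 = dot u u.
Implicit Types (u v w : H) (c : C).

Definition indep n (g : 'I_n -> H) :=
  forall c : 'I_n -> C, \sum_i c i *: g i = 0 -> forall i, c i = 0.

Lemma dot_self_neq0 u : u != 0 -> dot u u != 0.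
Proof.
by move=> u0; rewrite (dot_nrm norm_dot) (fmorph_eq0 (real_complex R)) sqrf_eq0 nrm_eq0.
Qed.

Lemma indep_orthogonal n (g : 'I_n -> H) : (forall i, g i != 0) ->
  (forall i j, i != j -> dot (g i) (g j) = 0) -> indep g.
Proof.
move=> g0 go c e i; have := congr1 (dot^~ (g i)) e; rewrite dot0l dot_suml.
rewrite (bigD1 i)//= big1 ?addr0 => [|j ji]; last by rewrite dotZl go// mulr0.
by rewrite dotZl => /eqP; rewrite mulf_eq0 (negPf (dot_self_neq0 (g0 i))) orbF => /eqP.
Qed.

Variable V : set H.
Hypothesis V0 : V 0.
Hypothesis V_linear : forall c u v, V u -> V v -> V (c *: u + v).

Lemma V_lincomb n (c : 'I_n -> C) (g : 'I_n -> H) : (forall i, V (g i)) ->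
  V (\sum_i c i *: g i).
Proof.
by move=> gV; apply: big_ind => // [u v uV vV|i _];
  [rewrite -[u]scale1r|rewrite -[_ *: _]addr0]; exact: V_linear.
Qed.

Definition has_indep n := exists g : 'I_n.+1 -> H, (forall i, V (g i)) /\ indep g.

Definition gs_ok (s : seq H) u := V u /\ dot u u = 1 /\ forall x, x \in s -> dot u x = 0.

(** Any unit vector of [V] orthogonal to the previous ones is accepted. When [V] is exhausted the
    choice may be a default value, so the properties are stated under [has_indep]. *)
Fixpoint gs n : seq H := if n is m.+1 then rcons (gs m) (get (gs_ok (gs m))) else [::].

Definition gs_vec n := get (gs_ok (gs n)).

Lemma size_gs n : size (gs n) = n.
Proof. by elim: n => //= n IH; rewrite size_rcons IH. Qed.

Lemma gs_vec_mem i n : (i < n)%N -> gs_vec i \in gs n.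
Proof.
elim: n => //= n IH; rewrite ltnS leq_eqVlt mem_rcons inE => /predU1P[->|/IH ->].
  by rewrite eqxx.
by rewrite orbT.
Qed.

(** Of n + 1 independent vectors some nonzero combination is orthogonal to the n vectors already
    chosen: the matrix of inner products has more rows than columns, hence a nonzero left kernel. *)
Lemma gs_vecP n : has_indep n -> gs_ok (gs n) (gs_vec n).
Proof.
move=> [g [gV gi]]; apply: getPex.
pose M := \matrix_(i < n.+1, k < n) dot (g i) (nth 0 (gs n) k).
have : kermx M != 0.
  rewrite -mxrank_eq0 mxrank_ker -lt0n subn_gt0 ltnS; exact: rank_leq_col.
case/rowV0Pn => c /sub_kermxP cM c0.
pose u := \sum_i c 0 i *: g i.
have u0 : u != 0.
  apply: contra_neq c0 => u0; apply/rowP => i.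
  by rewrite mxE (gi (fun i => c 0 i) u0).
have nu : nrm u != 0 by rewrite nrm_eq0.
have uV : V u by exact: V_lincomb.
exists ((nrm u)^-1%:C *: u); split; [|split].
- by rewrite -[_ *: _]addr0; exact: V_linear.
- apply: etrans (_ : (nrm ((nrm u)^-1%:C *: u) ^+ 2)%:C = _); first exact: dot_nrm.
  by rewrite nrmZ cmod_real ger0_norm ?invr_ge0 ?nrm_ge0// mulVf// expr1n.
- move=> x xs; rewrite dotZl /u dot_suml.
  have ks : (index x (gs n) < n)%N by rewrite -{2}(size_gs n) index_mem.
  have := congr1 (fun A : 'M[C]_(1, n) => A 0 (Ordinal ks)) cM.
  rewrite !mxE => e; rewrite -[RHS](mulr0 ((nrm u)^-1%:C : C)); congr (_ * _).
  by rewrite -[RHS]e; apply: eq_bigr => i _; rewrite dotZl !mxE nth_index.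
Qed.

Lemma gs_vec_dot i j : has_indep i -> has_indep j ->
  dot (gs_vec i) (gs_vec j) = (i == j)%:R.
Proof.
have h k l : (l < k)%N -> has_indep k -> dot (gs_vec k) (gs_vec l) = 0.
  by move=> lk /gs_vecP[_ [_ ->]]//; exact: gs_vec_mem.
move=> hi hj; case: (ltngtP i j) => [ij|ji|->].
- exact/dot_eq0C/h.
- exact: h.
- by have [_ []] := gs_vecP hj.
Qed.

(** A nonzero vector orthogonal to the [m] chosen ones would make m + 1 orthogonal, hence
    independent, vectors of [V]. *)
Lemma gs_vec_complete m u : (forall j, (j < m)%N -> has_indep j) -> ~ has_indep m ->
  V u -> (forall j, (j < m)%N -> dot u (gs_vec j) = 0) -> u = 0.
Proof.
move=> hj hm uV uo; apply: contrapT => /eqP u0; apply: hm.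
exists (fun i : 'I_m.+1 => if (i < m)%N then gs_vec i else u); split.
  by move=> i; case: ifP => // /hj/gs_vecP[].
apply: indep_orthogonal => [i|i j ij].
  case: ifP => // /hj hi; have := gs_vec_dot hi hi; rewrite eqxx => e.
  by apply: contra_eq_neq e => ->; rewrite dot0l eq_sym oner_neq0.
case: ifP => im; case: ifP => jm.
- by move: ij; rewrite -val_eqE /= => /negPf ij; rewrite gs_vec_dot ?ij//; exact: hj.
- exact/dot_eq0C/uo.
- exact: uo.
- have e (k : 'I_m.+1) : (k < m)%N = false -> k = m :> nat.
    by move=> km; apply/eqP; rewrite eqn_leq -ltnS ltn_ord /= leqNgt km.
  by move: ij; rewrite (_ : i = j) ?eqxx//; apply/val_inj; rewrite /= (e _ im) (e _ jm).
Qed.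

End GramSchmidt.

(** * Eigenvectors of the operator and their completeness *)

Section SpectralBasis.
Context {R : realType} {H : completeNormedModType R[i]}.
Local Notation C := R[i].
Variable dot : {dot H for conjC}.
Hypothesis norm_dot : forall u : H, `|u| ^+ 2 = dot u u.
Variable L : operator H.
Hypothesis saL : selfadjoint dot L.
Hypothesis nonnegL : nonneg_operator dot L.
Variable p : R.
Hypothesis schattenL : schatten dot p (resolvent L 1).
Implicit Types (u v w : H) (c : C) (r : R).

Local Notation T := (resolvent L 1).
Local Notation I := (eigen_index (dom L) L).

Let T_linear : linear T. Proof. by have [[]] := schattenL. Qed.

Definition eigenspace l : set H := [set u | dom L u /\ L u = l *: u].

Lemma eigenspace0 l : eigenspace l 0.
Proof. by split; [exact: dom0|rewrite op0 scaler0]. Qed.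

Lemma eigenspace_linear l c u v : eigenspace l u -> eigenspace l v ->
  eigenspace l (c *: u + v).
Proof.
move=> [du Lu] [dv Lv]; split; first exact: dom_linear.
by rewrite op_linear// Lu Lv scalerDr !scalerA mulrC.
Qed.

Definition eigenvec (x : C * nat) : H := gs_vec dot (eigenspace x.1) x.2.

Lemma eigenvecP x : I x -> [/\ dom L (eigenvec x), L (eigenvec x) = x.1 *: eigenvec x &
  dot (eigenvec x) (eigenvec x) = 1].
Proof.
move=> /(gs_vecP norm_dot (@eigenspace0 x.1) (@eigenspace_linear x.1)).
by move=> [[h1 h2] [h3 _]].
Qed.

Lemma eigenvec_neq0 x : I x -> eigenvec x != 0.
Proof.
move=> /eigenvecP[_ _ e]; apply: contra_eq_neq e => ->.
by rewrite dot0l eq_sym oner_neq0.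
Qed.

Lemma eigen_index_real x : I x -> exists2 r, 0 <= r & x.1 = r%:C.
Proof.
move=> xI; have [d e _] := eigenvecP xI.
exact: (eigen_real norm_dot nonnegL d e (eigenvec_neq0 xI)).
Qed.

Lemma eigenvec_dot x y : I x -> I y -> dot (eigenvec x) (eigenvec y) = (x == y)%:R.
Proof.
case: x y => l i [m j] xI yI; rewrite xpair_eqE; have [lm|lm] /= := eqVneq l m.
  rewrite -lm in yI *.
  exact: (gs_vec_dot norm_dot (@eigenspace0 l) (@eigenspace_linear l)).
have [dx ex _] := eigenvecP xI; have [dy ey _] := eigenvecP yI.
have [r _ /= mr] := eigen_index_real yI.
have := op_sym saL dx dy; rewrite ex ey dotZl dotZr /= => /eqP.
have -> : Num.conj m = m by rewrite mr conj_realC.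
by rewrite -subr_eq0 -mulrBl mulf_eq0 subr_eq0 (negPf lm) => /eqP.
Qed.

(** This is (1 + l)^(-p), the p-th power of the singular value of the resolvent that belongs to the
    eigenvalue l. *)
Definition eigen_weight (x : C * nat) : R := expR (- p * ln (1 + complex.Re x.1)).

Definition resolvent_index (x : C * nat) : C * nat :=
  (((1 + complex.Re x.1) ^- 2)%:C, x.2).

Lemma resolvent_indexP x : I x ->
  nonzero_eigen_index setT (adjoint dot T \o T) (resolvent_index x).
Proof.
move=> xI; have [r r0 xr] := eigen_index_real xI; have [g [gV gi]] := xI.
have r1 : 1 + r != 0 by rewrite gt_eqF// ltr_pwDl.
split; last first.
  rewrite /= xr /= (fmorph_eq0 (real_complex R)) invr_eq0.
  by rewrite expf_neq0.
exists g; split=> // i; split=> //=; have [dg Lg] := gV i.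
rewrite (adjoint_resolvent norm_dot saL nonnegL T_linear).
rewrite xr in Lg; have e := resolvent_eigen norm_dot saL nonnegL T_linear r0 dg Lg.
rewrite e (resolventZ norm_dot saL nonnegL T_linear) e scalerA -rmorphM xr /=.
by rewrite -invfM -expr2.
Qed.

Lemma resolvent_index_inj x y : I x -> I y -> resolvent_index x = resolvent_index y -> x = y.
Proof.
move=> /eigen_index_real[r r0 xr] /eigen_index_real[s s0 ys].
case: x y xr ys => l i [m j] /= -> -> [+ ->] /=.
move=> /invr_inj/eqP; rewrite eqrXn2// ?addr_ge0//.
by rewrite (inj_eq (addrI _)) => /eqP ->.
Qed.

(** [resolvent_index] injects the eigenvalues with multiplicity into those of the squared resolvent,
    so finite sums of weights are bounded by the Schatten sum. *)
Lemma eigen_weight_bound : exists K, forall J : seq (C * nat), uniq J ->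
  (forall x, x \in J -> I x) -> \sum_(x <- J) eigen_weight x <= K.
Proof.
have [_ hs] := schattenL; set S := (X in (X < _)%E) in hs.
have S0 : (0 <= S)%E by apply: esum_ge0 => x _; rewrite lee_fin powR_ge0.
have SE : S = (fine S)%:E by rewrite fineK// ge0_fin_numE.
exists (fine S) => J uJ JI; rewrite -lee_fin -SE; apply: esum_ge.
exists (resolvent_index @` [set` J]).
  split; first exact/finite_image/finite_seq.
  by move=> _ [x /= xJ <-]; exact/resolvent_indexP/JI.
rewrite fsbig_image; last first.
  by move=> x y; rewrite !inE /= => /JI xI /JI yI; exact: resolvent_index_inj.
rewrite -fsbig_seq// sumEFin lee_fin.
rewrite big_seq [leRHS]big_seq; apply: ler_sum => x /JI xI.
have [r r0 xr] := eigen_index_real xI.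
have r1 : 0 < 1 + r by rewrite ltr_pwDl.
rewrite /eigen_weight /resolvent_index /= !xr /= -exprVn sqrtr_sqr ger0_norm ?invr_ge0 ?(ltW r1)//.
by rewrite /powR invr_eq0 gt_eqF// lnV ?posrE// mulrN mulNr.
Qed.

(** An infinite multiplicity would repeat one positive weight beyond any bound. *)
Lemma eigen_index_finite l : exists m, ~ I (l, m).
Proof.
apply: contrapT => /forallNP h; have {}h j : I (l, j) by exact: contrapT (h j).
have [K hK] := eigen_weight_bound; have w0 : 0 < eigen_weight (l, 0%N) by exact: expR_gt0.
pose n := (Num.truncn (K / eigen_weight (l, 0%N))).+1.
have uJ : uniq [seq (l, j) | j <- iota 0 n] by rewrite map_inj_uniq ?iota_uniq// => i j [].
have := hK _ uJ (_ : forall x, x \in _ -> I x).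
rewrite big_map (eq_bigr (fun=> eigen_weight (l, 0%N)))//.
rewrite big_const_seq count_predT size_iota iter_addr_0 -mulr_natl.
have hn : K / eigen_weight (l, 0%N) < n%:R by exact: truncnS_gt.
rewrite leNgt -ltr_pdivrMr// hn => /(_ _)/negP; apply=> //.
by move=> x /mapP[j _ ->].
Qed.

Lemma nrm_sqrB u v : nrm (u - v) ^+ 2 =
  nrm u ^+ 2 - 2 * complex.Re (dot u v) + nrm v ^+ 2.
Proof.
apply: (@complexI R); rewrite -(dot_nrm norm_dot) dotBl !dotBr [dot v u]dotC.
rewrite !(dot_nrm norm_dot); case: (dot u v) => x y; apply/eqP; rewrite eq_complex /=.
by apply/andP; split; apply/eqP; ring.
Qed.

(* An invariant closed subspace contains a maximising sequence [u n] of [|T u|] on the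
   unit ball; then [T (T (u n)) - c^2 u n] tends to zero and a cluster point [y] of
   [T (u n)] satisfies [T (T y) = c^2 y], so [T y + c y] is an eigenvector. *)
Lemma invariant_eigenvector (M : set H) : M 0 ->
  (forall c u v, M u -> M v -> M (c *: u + v)) -> (forall u, M u -> M (T u)) ->
  (forall y, (forall e, 0 < e -> exists2 u, M u & nrm (u - y) < e) -> M y) ->
  (exists2 u, M u & u != 0) -> exists (r : R) z, [/\ 0 < r, M z, z != 0 & T z = r%:C *: z].
Proof.
move=> M0 ML MT Mc [u0 u0M u00].
have MZ c u : M u -> M (c *: u) by move=> uM; rewrite -[_ *: _]addr0; exact: ML.
pose S : set R := [set nrm (T u) | u in [set u | M u /\ nrm u <= 1]].
have hS : has_sup S.
  split; first by exists (nrm (T 0)), 0 => //; split=> //; rewrite nrm0.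
  exists 1 => _ [u [_ u1] <-]; exact: le_trans (nrm_resolvent norm_dot saL nonnegL T_linear u) u1.
pose k := sup S.
have normalize u : M u -> u != 0 -> nrm (T u) <= k * nrm u.
  move=> uM un; have nu : 0 < nrm u by rewrite lt_def nrm_eq0 un nrm_ge0.
  have : S (nrm (T ((nrm u)^-1%:C *: u))).
    exists ((nrm u)^-1%:C *: u) => //; split; first exact: MZ.
    by rewrite nrmZ cmod_real ger0_norm ?invr_ge0 ?nrm_ge0// mulVf ?gt_eqF.
  move=> /(ub_le_sup hS.2); rewrite (resolventZ norm_dot saL nonnegL T_linear) nrmZ cmod_real.
  by rewrite ger0_norm ?invr_ge0 ?nrm_ge0// mulrC ler_pdivrMr.
have kT u : M u -> nrm (T u) <= k * nrm u.
  move=> uM; have [->|] := eqVneq u 0; last exact: normalize.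
  by rewrite (resolvent0 norm_dot saL nonnegL) nrm0 mulr0.
have k0 : 0 < k.
  have Tu0 : T u0 != 0.
    by apply: contra_neq u00; exact: (resolvent_eq0 norm_dot saL nonnegL T_linear).
  have := kT _ u0M; have n1 : 0 < nrm (T u0) by rewrite lt_def nrm_eq0 Tu0 nrm_ge0.
  have n2 : 0 < nrm u0 by rewrite lt_def nrm_eq0 u00 nrm_ge0.
  by move=> /(lt_le_trans n1); rewrite pmulr_lgt0.
have k1 : k <= 1.
  apply: ge_sup hS.1 _ => _ [u [_ u1] <-].
  exact: le_trans (nrm_resolvent norm_dot saL nonnegL T_linear u) u1.
have : forall n, exists u, [/\ M u, nrm u <= 1 & k - n.+1%:R^-1 < nrm (T u)].
  move=> n; have n0 : 0 < n.+1%:R^-1 :> R by rewrite invr_gt0.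
  by have [_ [u [uM u1] <-] h] := sup_adherent n0 hS; exists u.
move=> /choice [u uP].
pose rr n := T (T (u n)) - (k ^+ 2)%:C *: u n.
(* Expanding the square with |T T u| <= k |T u| and |u| <= 1 leaves k^2 (k^2 - |T u|^2), which is at
   most twice the gap k - |T u|, since k <= 1. *)
have rr_le n : nrm (rr n) ^+ 2 <= 2 * n.+1%:R^-1.
  have [uM u1 un] := uP n.
  have TT : nrm (T (T (u n))) <= k * nrm (T (u n)) by apply: kT; exact: MT.
  have Tu : nrm (T (u n)) <= k.
    by apply: le_trans (kT _ uM) _; rewrite ler_piMr// ltW.
  rewrite /rr nrm_sqrB dotZr nrmZ cmod_real ger0_norm ?sqr_ge0//.
  rewrite conj_realC.
  rewrite (resolvent_sym norm_dot saL nonnegL T_linear) (dot_nrm norm_dot) -rmorphM /=.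
  have n0 : 0 < n.+1%:R^-1 :> R by rewrite invr_gt0.
  have a0 := nrm_ge0 (T (T (u n))); have b0 := nrm_ge0 (T (u n)); have c0 := nrm_ge0 (u n).
  move: TT Tu u1 un a0 b0 c0 n0; move: (nrm (T (T (u n)))) (nrm (T (u n))) (nrm (u n)) (_^-1) => a b c d.
  move=> h1 h2 h3 h4 a0 b0 c0 d0.
  have kb : 0 <= k * b by rewrite mulr_ge0// ltW.
  have A : a ^+ 2 <= k ^+ 2 * b ^+ 2 by rewrite -exprMn ler_sqr ?nnegrE.
  have B : (k ^+ 2 * c) ^+ 2 <= k ^+ 2 * k ^+ 2.
    have kc : k ^+ 2 * c <= k ^+ 2 by exact: ler_piMr (sqr_ge0 _) h3.
    by rewrite -expr2 ler_sqr ?nnegrE ?sqr_ge0// mulr_ge0// sqr_ge0.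
  have Cc : k ^+ 2 * (k ^+ 2 - b ^+ 2) <= k ^+ 2 * (2 * d).
    apply: ler_wpM2l; first exact: sqr_ge0.
    rewrite subr_sqr; nra.
  have D : k ^+ 2 * (2 * d) <= 2 * d.
    by apply: ler_piMl; [rewrite mulr_ge0// ltW|rewrite exprn_ile1// ltW].
  lra.
have rr_small e : 0 < e -> \forall n \near \oo, nrm (rr n) < e.
  move=> e0; have e2 : 0 < e ^+ 2 / 2 by rewrite divr_gt0// exprn_gt0.
  have [N _ hN] := near_infty_natSinv_lt (PosNum e2); exists N => // n /hN /= h.
  rewrite -ltr_sqr ?nnegrE ?nrm_ge0 ?(ltW e0)//; apply: le_lt_trans (rr_le n) _.
  by move: h; rewrite ltr_pdivlMr// mulrC.
have [_ Kc] := schattenL.1.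
have yK : (T (u n) @[n --> \oo]) (closure [set T u | u in [set u : H | `|u| <= 1]]).
  exists 0%N => // n _ /=; apply: subset_closure; exists (u n) => //=.
  by have [_ u1 _] := uP n; rewrite nrmE -(rmorph1 (real_complex R)) lecR.
have [y [_ yc]] := Kc _ _ yK.
have yP e (N : nat) : 0 < e -> exists2 n, (N <= n)%N & nrm (T (u n) - y) < e.
  move=> e0; have e0' : 0 < (e%:C : C) by rewrite ltcR.
  have [|v []] := yc [set v | exists2 n, (N <= n)%N & v = T (u n)] _ _ (nbhsx_ballx y _ e0').
    by exists N => // n /= Nn; exists n.
  move=> /= [n Nn ->]; rewrite -ball_normE /= nrmE ltcR nrmC => h.
  by exists n.
have yM : M y.
  apply: Mc => e e0; have [n _ h] := yP e 0%N e0; exists (T (u n)) => //.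
  by apply: MT; have [] := uP n.
have Tle := nrm_resolvent norm_dot saL nonnegL T_linear.
have TB := resolventB norm_dot saL nonnegL T_linear.
have TZ := resolventZ norm_dot saL nonnegL T_linear.
have TD := resolventD T_linear.
(* Some [T (u n)] lies within [k / 4] of [y] and has norm above [k - k / 4]. *)
have y0 : y != 0.
  rewrite -nrm_eq0 gt_eqF//.
  have k4 : 0 < k / 4 by rewrite divr_gt0.
  have [N _ hN] := near_infty_natSinv_lt (PosNum k4).
  have [n Nn h] := yP _ N k4; have [_ _ h2] := uP n.
  have h3 : n.+1%:R^-1 < k / 4 := hN n Nn.
  have := nrmD (T (u n) - y) y; rewrite subrK.
  move: h h2 h3 k0; move: (n.+1%:R^-1) (nrm y) (nrm (T (u n))) (nrm _) => a b c d; lra.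
have TTy : T (T y) = (k ^+ 2)%:C *: y.
  apply/eqP; rewrite -subr_eq0 -nrm_eq0; apply/eqP/le_anti; rewrite nrm_ge0 andbT.
  apply/ler_addgt0Pr => e e0; rewrite add0r.
  have e3 : 0 < e / 3 by rewrite divr_gt0.
  have [N _ hN] := rr_small _ e3; have [n Nn h] := yP _ N e3; have h2 := hN n Nn.
  have -> : T (T y) - (k ^+ 2)%:C *: y =
      T (T (y - T (u n))) + (T (rr n) + (k ^+ 2)%:C *: (T (u n) - y)).
    by rewrite /rr !TB TZ scalerBr !subrKA.
  have k21 : k ^+ 2 <= 1 by rewrite exprn_ile1// ltW.
  apply: le_trans (nrmD _ _) _; apply: le_trans (lerD (lexx _) (nrmD _ _)) _.
  have a1 : nrm (T (T (y - T (u n)))) <= e / 3.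
    by apply: le_trans (Tle _) _; apply: le_trans (Tle _) _; rewrite nrmC ltW.
  have a2 : nrm (T (rr n)) <= e / 3 by apply: le_trans (Tle _) _; rewrite ltW.
  have a3 : nrm ((k ^+ 2)%:C *: (T (u n) - y)) <= e / 3.
    rewrite nrmZ cmod_real ger0_norm ?sqr_ge0//.
    by apply: le_trans (ler_piMl (nrm_ge0 _) k21) _; rewrite ltW.
  by lra.
exists k, (T y + k%:C *: y); split=> //.
- by rewrite addrC; apply: ML => //; exact: MT.
(* The real part of the inner product of [T y] with [y] is nonnegative and [k] is positive, so
   [T y + k y] pairs with [y] to zero only for [y = 0]. *)
- apply: contra_neq y0 => e; have := congr1 (fun z => complex.Re (dot z y)) e.
  rewrite dot0l dotDl dotZl (dot_nrm norm_dot) ReD -rmorphM /= => e2.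
  have h1 := resolvent_pos norm_dot saL nonnegL T_linear y.
  apply/eqP; rewrite -nrm_eq0 -sqrf_eq0; apply/eqP.
  have h2 := sqr_ge0 (nrm y); have h3 := sqr_ge0 (nrm (T y)).
  have : k * nrm y ^+ 2 <= 0 by lra.
  by rewrite pmulr_rle0// => h4; apply/le_anti; rewrite h4.
- rewrite TD TZ TTy scalerDr scalerA -rmorphM /= -expr2 addrC//.
Qed.

(** The vectors orthogonal to all [eigenvec] form a closed subspace invariant under the resolvent.
    If it were nonzero, it would contain an eigenvector of the resolvent, hence one of [L] for
    [l = r^-1 - 1]; but the finitely many Gram-Schmidt vectors of that eigenspace leave nothing
    orthogonal to them. *)
Lemma eigenvec_complete u : (forall x, I x -> dot u (eigenvec x) = 0) -> u = 0.
Proof.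
move=> uo; apply: contrapT => /eqP u0.
pose M : set H := [set v | forall x, I x -> dot v (eigenvec x) = 0].
have [||v Mv x xI|y yM x xI||r [z [r0 Mz z0 Tz]]] := @invariant_eigenvector M.
- by move=> x xI; rewrite dot0l.
- by move=> c v w Mv Mw x xI; rewrite dotDl dotZl Mv// Mw// mulr0 addr0.
- have [d e _] := eigenvecP xI; have [s s0 xs] := eigen_index_real xI; rewrite xs in e.
  rewrite (resolvent_sym norm_dot saL nonnegL T_linear).
  by rewrite (resolvent_eigen norm_dot saL nonnegL T_linear s0 d e) dotZr Mv// mulr0.
- apply/eqP; rewrite -cmod_eq0; apply/eqP/le_anti; rewrite cmod_ge0 andbT.
  have [_ _ e1] := eigenvecP xI.
  have n1 : nrm (eigenvec x) = 1.
    apply/eqP; rewrite -(@eqrXn2 _ 2%N)// ?nrm_ge0// expr1n; apply/eqP/(@complexI R).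
    by rewrite -(dot_nrm norm_dot) e1.
  apply/ler_addgt0Pr => e e0; rewrite add0r; have [v Mv vy] := yM e e0.
  have -> : y = v - (v - y) by rewrite subKr.
  rewrite dotBl Mv// sub0r cmodN; apply: le_trans (cauchy_schwarz norm_dot _ _) _.
  by rewrite n1 mulr1 ltW.
- by exists u.
have rC : (r%:C : C) != 0 by rewrite (fmorph_eq0 (real_complex R)) gt_eqF.
have Tz' : T ((r%:C)^-1 *: z) = z.
  by rewrite (resolventZ norm_dot saL nonnegL T_linear) Tz scalerA mulVf// scale1r.
pose l := (r%:C : C)^-1 - 1.
have [dz Lz] := resolventP norm_dot saL nonnegL T_linear ((r%:C)^-1 *: z).
rewrite Tz' in dz Lz.
have zV : eigenspace l z.
  by split=> //; rewrite /l scalerBl scale1r -Lz addrK.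
have [m mP] := eigen_index_finite l.
pose Q n := `[< ~ I (l, n) >].
have exQ : exists n, Q n by exists m; exact/asboolP.
have := ex_minnP exQ => -[{mP}m /asboolP mP mmin].
move: z0; apply/negP/negPn/eqP.
apply: (gs_vec_complete norm_dot (@eigenspace0 l) (@eigenspace_linear l) _ mP zV).
  move=> j jm; apply: contrapT => jI; have := mmin j; rewrite leqNgt jm => /(_ _)/negP; apply=> //.
  exact/asboolP.
move=> j jm; apply: (Mz (l, j)); apply: contrapT => jI.
by have := mmin j; rewrite leqNgt jm => /(_ _)/negP; apply=> //; exact/asboolP.
Qed.

End SpectralBasis.

(** * Enumeration of countable index sets and unordered sums *)

Section Enumeration.

(** [b] marks the numbers actually used, which covers finite and empty [D] without a case
    distinction. *)
Lemma countable_enum (I : pointedType) (D : set I) : countable D ->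
  exists (x : nat -> I) (b : nat -> bool), [/\ forall n, b n -> D (x n),
    forall i, D i -> exists2 n, b n & x n = i &
    forall m n, b m -> b n -> x m = x n -> m = n].
Proof.
move=> /countable_injP [g gI].
pose P n := [set i | D i /\ g i = n].
have Pget n : P n !=set0 -> D (get (P n)) /\ g (get (P n)) = n.
  by move=> [i Pi]; exact: (getPex (ex_intro _ i Pi)).
exists (fun n => get (P n)), (fun n => `[< P n !=set0 >]); split.
- by move=> n /asboolP/Pget[].
- move=> i Di; have Pi : P (g i) !=set0 by exists i.
  exists (g i); first exact/asboolP.
  by have [Dj] := Pget _ Pi; apply: gI; rewrite inE.
- move=> m n /asboolP/Pget[_ mE] /asboolP/Pget[_ nE] e; rewrite -mE -nE; congr g; exact: e.
Qed.

Context {R : realType}.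
Local Notation C := R[i].

Lemma has_sum_unique (I : choiceType) (D : set I) (F : I -> C) (l l' : C) :
  has_sum D F l -> has_sum D F l' -> l = l'.
Proof.
move=> h h'; have pF := @summability.totally_filter I.
exact: (cvg_unique _ h h').
Qed.

(** A finite set containing the first [N] enumerated indices differs from the partial sum up to [N]
    by a part of the absolutely small tail. *)
Lemma has_sum_csum (I : choiceType) (D : set I) (F : I -> C) (x : nat -> I) (b : nat -> bool) M :
  (forall n, b n -> D (x n)) -> (forall i, D i -> exists2 n, b n & x n = i) ->
  (forall m n, b m -> b n -> x m = x n -> m = n) ->
  asum (fun n => if b n then F (x n) else 0) M ->
  has_sum D F (csum (fun n => if b n then F (x n) else 0)).
Proof.
move=> bD Db xI aM; set a := fun n => _.
have pF := @summability.totally_filter I.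
apply/(cvgC_P (F := summability.totally)) => e e0; have e2 : 0 < e / 3 by rewrite divr_gt0.
have [N hN] := psum_le_tail (fun k => cmod_ge0 (a k)) aM e2.
exists [fset x k | k in iota 0 N]%fset => // J /= J0J.
have bound (s : seq I) : exists2 n, (N <= n)%N & forall i, i \in s -> D i -> exists2 k, (k < n)%N & b k /\ x k = i.
  elim: s => [|i s [n Nn IH]]; first by exists N.
  have [Di|nDi] := pselect (D i); last first.
    exists n => // j; rewrite inE => /predU1P[-> //|]; exact: IH.
  have [k bk ki] := Db _ Di; exists (maxn n k.+1); first by rewrite leq_max Nn.
  move=> j; rewrite inE => /predU1P[-> _|js Dj].
    by exists k => //; rewrite leq_max ltnSn orbT.
  by have [m mn h] := IH j js Dj; exists m => //; rewrite leq_max mn.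
have [n Nn Jn] := bound J.
have -> : \sum_(i <- J) (F \_ D) i = \sum_(0 <= k < n) (if x k \in J then a k else 0).
  transitivity (\sum_(i <- J) \sum_(0 <= k < n) (if b k && (x k == i) then F i else 0)).
    rewrite big_seq [RHS]big_seq; apply: eq_bigr => i iJ; rewrite patchE.
    case: ifPn => [/set_mem Di|/negP nDi]; last first.
      rewrite big1// => k _; case: ifP => // /andP[bk /eqP xk].
      by case: nDi; rewrite inE -xk; exact: bD.
    have [k kn [bk xk]] := Jn i iJ Di.
    rewrite (bigD1_seq k) ?mem_index_iota ?iota_uniq//= bk xk eqxx /= big1 ?addr0// => m mk.
    case: ifP => // /andP[bm /eqP xm]; move: mk; rewrite (xI m k) ?eqxx//.
    by rewrite xm xk.
  rewrite exchange_big /=; apply: eq_bigr => k _; rewrite /a.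
  have [bk|nbk] /= := boolP (b k); last by rewrite big1// if_same.
  case: ifPn => [xJ|xJ]; last first.
    rewrite big_seq big1// => i iJ; case: eqP => // xi.
    by move: xJ; rewrite xi iJ.
  rewrite (bigD1_seq (x k)) ?fset_uniq//= eqxx big1 ?addr0// => i.
  by rewrite eq_sym => /negPf ->.
have tE : \sum_(0 <= k < n) (if x k \in J then a k else 0) - \sum_(0 <= k < N) a k =
    \sum_(N <= k < n) (if x k \in J then a k else 0).
  rewrite (big_cat_nat _ Nn)//= [X in X + _ - _](eq_big_nat _ _ (F2 := a)).
    by rewrite addrAC subrr add0r.
  move=> k /andP[_ kN]; rewrite (fsubsetP J0J)//; apply/imfsetP; exists k => //=.
  by rewrite mem_iota.
have h1 : cmod (\sum_(0 <= k < n) (if x k \in J then a k else 0) - \sum_(0 <= k < N) a k) <= e / 3.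
  rewrite tE; apply: le_trans (cmod_sum _ _ _) _; apply: le_trans (hN n).
  by apply: ler_sum => k _; case: ifP => // _; rewrite cmod0 cmod_ge0.
have h2 := csum_tail_le aM hN.
rewrite -[X in cmod X](subrKA (\sum_(0 <= k < N) a k)); apply: le_lt_trans (cmodD _ _) _.
by rewrite [X in _ + X]cmodC; move: h1 h2; lra.
Qed.

End Enumeration.

Lemma cvgC_affine {R : realType} (T : Type) (F : set_system T) {FF : Filter F}
    (g : T -> R[i]) (l a k : R[i]) : g @ F --> l -> (g x + a) * k @[x --> F] --> (l + a) * k.
Proof.
move=> /(cvgC_P (F := F)) gl; apply/(cvgC_P (F := F)) => e e0.
have k1 : 0 < cmod k + 1 by rewrite ltr_wpDl ?cmod_ge0.
apply: filterS (gl _ (divr_gt0 e0 k1)) => x; rewrite ltr_pdivlMr// => xe.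
have -> : (g x + a) * k - (l + a) * k = (g x - l) * k by ring.
rewrite cmodM; apply: le_lt_trans xe; rewrite ler_wpM2l ?cmod_ge0// lerDl//.
Qed.

(** * The heat semigroup and its trace *)

Section HeatSemigroup.
Context {R : realType} {H : completeNormedModType R[i]}.
Local Notation C := R[i].
Variable dot : {dot H for conjC}.
Hypothesis norm_dot : forall u : H, `|u| ^+ 2 = dot u u.
Variable L : operator H.
Hypothesis saL : selfadjoint dot L.
Hypothesis nonnegL : nonneg_operator dot L.
Hypothesis T_linear : linear (resolvent L 1).
Variables (f : nat -> H) (b : nat -> bool) (lam : nat -> R).
Hypothesis f_ortho : orthosys dot f b.
Hypothesis f_complete : complete_sys dot f.
Hypothesis lam_ge0 : forall n, 0 <= lam n.
Hypothesis f_dom : forall n, dom L (f n).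
Hypothesis f_eigen : forall n, L (f n) = (lam n)%:C *: f n.
Implicit Types (u v w : H) (c : C) (t : R).

Lemma dot_ext u w : (forall n, dot u (f n) = dot w (f n)) -> u = w.
Proof.
move=> e; apply/eqP; rewrite -subr_eq0; apply/eqP; apply: f_complete => n.
by rewrite dotBl e subrr.
Qed.

Lemma multiplier_ex (m : nat -> C) u : (forall n, cmod (m n) <= 1) ->
  exists w, forall n, dot w (f n) = m n * dot u (f n).
Proof.
move=> m1; have [|w [_ wE]] := @riesz_fischer _ _ _ norm_dot f b f_ortho
    (fun n => m n * dot u (f n)) (nrm u ^+ 2).
  apply: psum_le_dom (bessel norm_dot f_ortho u) => n.
  by rewrite cmodM exprMn ler_piMl ?sqr_ge0// exprn_ile1 ?cmod_ge0.
exists w => n; rewrite wE; case: ifPn => // /(orthosys_eq0 norm_dot f_ortho) ->.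
by rewrite dot0r mulr0.
Qed.

Definition hexp t n : C := (expR (- (t * lam n)))%:C.

Lemma cmod_hexp t n : 0 <= t -> cmod (hexp t n) <= 1.
Proof.
move=> t0; rewrite cmod_real ger0_norm ?expR_ge0// -expR0 ler_expR oppr_le0.
exact: mulr_ge0.
Qed.

(** The candidate for e^(-tL), prescribed by its coefficients; the vector exists by
    Riesz-Fischer. *)
Definition hflow t u : H := get [set w | forall n, dot w (f n) = hexp t n * dot u (f n)].

Lemma hflowP t u n : 0 <= t -> dot (hflow t u) (f n) = hexp t n * dot u (f n).
Proof.
move=> t0; have [w wE] := multiplier_ex u (m := hexp t) (fun k => cmod_hexp k t0).
have := @getPex _ [set v | forall k, dot v (f k) = hexp t k * dot u (f k)].
by move=> /(_ (ex_intro _ w wE)); apply.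
Qed.

Lemma expR_taylor1 (x : R) : 0 <= x -> 1 - x <= expR (- x) <= 1 - x + x ^+ 2.
Proof.
move=> x0; rewrite expR_ge1Dx /=.
have h : 1 + x <= expR x := expR_ge1Dx x.
have e1 : expR (- x) * expR x = 1 by rewrite -expRD addNr expR0.
have e0 := expR_ge0 (- x).
have : expR (- x) * (1 + x) <= 1 by rewrite -[leRHS]e1 ler_wpM2l.
move: (expR (- x)) e0 => y y0 h2; rewrite expr2; nra.
Qed.

(** Two bounds on the error of the difference quotient: [lam n] is uniform in [t] and gives
    domination, while [t * lam n ^+ 2] gives convergence for each [n]. *)
Lemma generator_multiplier t n : 0 < t ->
  0 <= t^-1 * (expR (- (t * lam n)) - 1) + lam n <= Num.min (lam n) (t * lam n ^+ 2).
Proof.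
move=> t0; have /andP[h1 h2] := expR_taylor1 (mulr_ge0 (ltW t0) (lam_ge0 n)).
have tV : t^-1 * (t * lam n) = lam n by rewrite mulrA mulVf ?mul1r// gt_eqF.
have e1 : expR (- (t * lam n)) <= 1 by rewrite -expR0 ler_expR oppr_le0 mulr_ge0// ltW.
have ti : 0 <= t^-1 by rewrite invr_ge0 ltW.
apply/andP; split.
  rewrite -[X in _ + X]tV -mulrDr mulr_ge0//; lra.
rewrite le_min; apply/andP; split.
  by rewrite -[leRHS]add0r lerD2r mulr_ge0_le0//; lra.
rewrite -[X in _ + X]tV -mulrDr.
have -> : t * lam n ^+ 2 = t^-1 * (t * lam n) ^+ 2.
  by rewrite exprMn expr2 !mulrA mulVf ?mul1r// gt_eqF.
by apply: ler_wpM2l => //; lra.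
Qed.

Lemma dot_op_eigen u n : dom L u -> dot (L u) (f n) = (lam n)%:C * dot u (f n).
Proof. by move=> du; rewrite (op_sym saL)// f_eigen dotZr conj_realC. Qed.

Lemma near_gt0 (r : R) : 0 < r -> \forall t \near (0 : R)^'+, 0 < t < r.
Proof.
move=> r0; near=> t; apply/andP; split; first by near: t; exact: nbhs_right_gt.
by near: t; exact: nbhs_right_lt.
Unshelve. all: by end_near. Qed.

Lemma cvg_right0_le (g : R -> R) (k : R) : 0 <= k -> (forall t, 0 < t -> 0 <= g t <= t * k) ->
  (g t)%:C @[t --> 0^'+] --> (0 : C).
Proof.
move=> k0 gk; apply/(cvgC_P (F := 0^'+)) => e e0.
have k1 : 0 < k + 1 by rewrite ltr_wpDl.
apply: filterS (near_gt0 (divr_gt0 e0 k1)) => t /andP[t0 te].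
rewrite subr0 cmod_real; have /andP[g0 g1] := gk t t0; rewrite ger0_norm//.
apply: le_lt_trans g1 _; move: te; rewrite ltr_pdivlMr//; nra.
Qed.

Lemma hflow_semigroup : is_heat_semigroup L hflow.
Proof.
split.
- apply/funext => u; apply: dot_ext => n.
  by rewrite hflowP// /hexp mul0r oppr0 expR0 mul1r.
- move=> s t s0 t0; apply/funext => u; apply: dot_ext => n /=.
  by rewrite !hflowP ?addr_ge0// /hexp mulrDl opprD expRD rmorphM mulrA.
- move=> t t0; split=> [c u v|u].
    by apply: dot_ext => n; rewrite dotDl dotZl !hflowP// dotDl dotZl; ring.
  rewrite !nrmE lecR -ler_sqr ?nnegrE ?nrm_ge0//.
  have h : asum (fun n => (cmod (dot (hflow t u) (f n)) ^+ 2)%:C) (nrm u ^+ 2).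
    apply: asum_dom (bessel norm_dot f_ortho u) => n.
    rewrite cmod_real ger0_norm ?sqr_ge0// hflowP// cmodM exprMn.
    by rewrite ler_piMl ?sqr_ge0// exprn_ile1 ?cmod_ge0// cmod_hexp.
  have := csum_le h; rewrite (parseval_nrm norm_dot f_ortho f_complete).
  by rewrite cmod_real ger0_norm ?sqr_ge0.
- move=> u.
  suff h : hflow t u - u @[t --> 0^'+] --> (0 : H).
    have : hflow t u - u + u @[t --> 0^'+] --> 0 + u by apply: cvgD h _; exact: cvg_cst.
    by rewrite add0r; under eq_fun do rewrite subrK.
  apply: (multiplier_cvg0 norm_dot f_ortho f_complete
    (m := fun t n => (expR (- (t * lam n)) - 1)%:C) (u := u)).
    near=> t => n; have t0 : 0 < t by near: t; exact: nbhs_right_gt.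
    split; first by rewrite dotBl hflowP ?(ltW t0)// /hexp rmorphB rmorph1 mulrBl mul1r.
    rewrite cmod_real ler0_norm; last first.
      by rewrite subr_le0 -expR0 ler_expR oppr_le0 mulr_ge0// ltW.
    have := expR_ge0 (- (t * lam n)); lra.
  move=> n _.
  have : (1 - expR (- (t * lam n)))%:C @[t --> 0^'+] --> (0 : C).
    apply: (cvg_right0_le (lam_ge0 n)) => t t0.
    have /andP[h1 h2] := expR_taylor1 (mulr_ge0 (ltW t0) (lam_ge0 n)).
    have : expR (- (t * lam n)) <= 1 by rewrite -expR0 ler_expR oppr_le0 mulr_ge0// ltW.
    by move=> h3; apply/andP; split; lra.
  move=> h; have : - (1 - expR (- (t * lam n)))%:C @[t --> 0^'+] --> (- 0 : C) by exact: cvgN h.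
  by rewrite oppr0; under eq_fun do rewrite -rmorphN opprB.
move=> u v; split.
- move=> cv.
  have vE n : dot v (f n) = - (lam n)%:C * dot u (f n).
    have h1 : dot ((t^-1)%:C *: (hflow t u - u)) (f n) @[t --> 0^'+] --> dot v (f n).
      exact: (cvg_dotl norm_dot cv).
    have h2 : (t^-1 * (expR (- (t * lam n)) - 1) + lam n)%:C @[t --> 0^'+] --> (0 : C).
      apply: (cvg_right0_le (sqr_ge0 (lam n))) => t t0.
      by have := generator_multiplier n t0; rewrite le_min => /and3P[-> _ ->].
    have h3 : ((t^-1 * (expR (- (t * lam n)) - 1) + lam n)%:C - (lam n)%:C) * dot u (f n)
        @[t --> 0^'+] --> (0 - (lam n)%:C) * dot u (f n).
      exact: cvgC_affine h2.
    suff h4 : dot ((t^-1)%:C *: (hflow t u - u)) (f n) @[t --> 0^'+] --> - (lam n)%:C * dot u (f n).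
      exact: (cvg_unique _ h1 h4).
    rewrite sub0r in h3; apply: cvg_trans h3; apply: near_eq_cvg; near=> t.
    have t0 : 0 < t by near: t; exact: nbhs_right_gt.
    rewrite dotZl dotBl hflowP ?(ltW t0)// /hexp -rmorphB /= addrK rmorphM rmorphB rmorph1 /=.
    by ring.
  (* Convergence of the quotients determines the coefficients of [v]; they exhibit [u] as a value of
     the resolvent, which puts it in the domain. *)
  have uT : u = resolvent L 1 (u - v).
    apply: dot_ext => n; rewrite (resolvent_sym norm_dot saL nonnegL T_linear).
    rewrite (resolvent_eigen norm_dot saL nonnegL T_linear (lam_ge0 n) (f_dom n) (f_eigen n)).
    rewrite dotZr conj_realC dotBl vE (fmorphV (real_complex R)).
    rewrite (_ : dot u (f n) - - (lam n)%:C * dot u (f n) = (1 + lam n)%:C * dot u (f n)).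
      by rewrite mulKf// (fmorph_eq0 (real_complex R)) gt_eqF// ltr_pwDl.
    by rewrite rmorphD rmorph1; ring.
  have [du Lu] := resolventP norm_dot saL nonnegL T_linear (u - v).
  rewrite -uT in du Lu; split=> //.
  by move: Lu => /eqP; rewrite addrC (inj_eq (addrI u)) => /eqP ->; rewrite opprK.
- move=> [du ->].
  suff h : (t^-1)%:C *: (hflow t u - u) + L u @[t --> 0^'+] --> (0 : H).
    have : (t^-1)%:C *: (hflow t u - u) + L u - L u @[t --> 0^'+] --> 0 - L u.
      by apply: cvgB h _; exact: cvg_cst.
    by rewrite sub0r; under eq_fun do rewrite addrK.
  (* The multiplier acts on [L u + u], whose coefficients are [1 + lam n] times those of [u]; this
     division makes it bounded by [1]. *)
  pose m t n : C := ((t^-1 * (expR (- (t * lam n)) - 1) + lam n) / (1 + lam n))%:C.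
  apply: (multiplier_cvg0 norm_dot f_ortho f_complete (m := m) (u := L u + u)).
    near=> t => n; have t0 : 0 < t by near: t; exact: nbhs_right_gt.
    have := generator_multiplier n t0; rewrite le_min => /and3P[g0 g1 _].
    have l1 : 0 < 1 + lam n by rewrite ltr_pwDl.
    split.
      rewrite [LHS]dotDl dotZl dotBl hflowP ?(ltW t0)// dotDl !dot_op_eigen// /m /hexp.
      rewrite !(rmorphM, rmorphD, rmorphB, rmorphN, rmorph1, fmorphV (real_complex R)) /=.
      have : (1 + (lam n)%:C : C) != 0.
        by rewrite -(rmorph1 (real_complex R)) -rmorphD (fmorph_eq0 (real_complex R)) gt_eqF.
      have : (t%:C : C) != 0 by rewrite (fmorph_eq0 (real_complex R)) gt_eqF.
      by move: (t%:C) ((lam n)%:C) (dot _ _) (_%:C) => x y z k x0 y0; field; rewrite x0 y0.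
    rewrite cmod_real ger0_norm; last by rewrite divr_ge0// ltW.
    by rewrite ler_pdivrMr// mul1r; lra.
  move=> n _; apply: (cvg_right0_le (sqr_ge0 (lam n))) => t t0.
  have := generator_multiplier n t0; rewrite le_min => /and3P[g0 _ g1].
  have l1 : 1 <= 1 + lam n by rewrite lerDl.
  have l0 : 0 < 1 + lam n by exact: lt_le_trans l1.
  apply/andP; split; first by rewrite divr_ge0// ltW.
  rewrite ler_pdivrMr//; apply: le_trans g1 _.
  by rewrite ler_peMr// mulr_ge0 ?sqr_ge0// ltW.
Unshelve. all: by end_near. Qed.

End HeatSemigroup.

(** * The trace of the heat operator in an arbitrary basis *)

Section HeatTrace.
Context {R : realType} {H : completeNormedModType R[i]}.
Local Notation C := R[i].
Variable dot : {dot H for conjC}.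
Hypothesis norm_dot : forall u : H, `|u| ^+ 2 = dot u u.
Variable L : operator H.
Hypothesis saL : selfadjoint dot L.
Hypothesis nonnegL : nonneg_operator dot L.
Hypothesis T_linear : linear (resolvent L 1).
Implicit Types (u v w : H) (c : C) (t : R).

(* [U t v - e^{-tl} v] telescopes over the steps [t / n], each contributing [o(t / n)] *)
Lemma heat_eigen (U : R -> H -> H) (l : R) v t : is_heat_semigroup L U -> dom L v ->
  L v = l%:C *: v -> 0 <= l -> 0 <= t -> U t v = (expR (- (t * l)))%:C *: v.
Proof.
move=> [U0 UD Ulin _ Ugen] dv Lv l0; rewrite le_eqVlt => /predU1P[<-|t0].
  by rewrite U0 mul0r oppr0 expR0 scale1r.
have small e : 0 < e -> exists2 r, 0 < r & forall h, 0 < h < r ->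
    nrm (U h v - (expR (- (h * l)))%:C *: v) <= h * e.
  move=> e0; have e2 : 0 < e / 2 by rewrite divr_gt0.
  have [_ /(_ (conj dv erefl)) /(cvgH_P (F := 0^'+)) /(_ _ e2) h1] := Ugen v (- L v).
  have k0 : 0 < l ^+ 2 * nrm v + 1 by rewrite ltr_wpDl// mulr_ge0 ?sqr_ge0 ?nrm_ge0.
  have h2 := near_gt0 (divr_gt0 e2 k0).
  have [r /= r0 rP] : \forall h \near (0 : R)^'+,
      nrm (U h v - (expR (- (h * l)))%:C *: v) <= h * e.
    apply: filterS2 h1 h2 => h; rewrite opprK Lv => h1 /andP[h0]; rewrite ltr_pdivlMr// => h2.
    have hC : (h%:C : C) != 0 by rewrite (fmorph_eq0 (real_complex R)) gt_eqF.
    pose x := (h^-1)%:C *: (U h v - v) + l%:C *: v.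
    pose y := h^-1 * (expR (- (h * l)) - 1) + l.
    have yE : y%:C *: v = (h^-1)%:C *: ((expR (- (h * l)))%:C *: v - v) + l%:C *: v.
      by rewrite /y rmorphD rmorphM rmorphB rmorph1 scalerDl -scalerA scalerBl scale1r.
    have -> : U h v - (expR (- (h * l)))%:C *: v = h%:C *: (x - y%:C *: v).
      rewrite yE /x opprD addrACA subrr addr0 -scalerBr opprB subrKA scalerA.
      by rewrite (fmorphV (real_complex R)) mulfV// scale1r.
    rewrite nrmZ cmod_real gtr0_norm//; apply: ler_wpM2l; first exact: ltW.
    apply: le_trans (nrmB _ _) _; rewrite nrmZ cmod_real.
    have := generator_multiplier (lam := fun=> l) (fun=> l0) 0 h0.
    rewrite le_min => /and3P[y0 _ y1]; rewrite ger0_norm//.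
    have := ler_wpM2r (nrm_ge0 v) y1; have := nrm_ge0 v; move: h1 h2 l0 h0.
    by rewrite -/x /y; move: (nrm x) (nrm v) (_ + l) => a c d; nra.
  exists r => // h /andP[h0 hr]; apply: rP => //=.
  by rewrite sub0r normrN gtr0_norm.
apply/eqP; rewrite -subr_eq0 -nrm_eq0; apply/eqP/le_anti; rewrite nrm_ge0 andbT.
apply/ler_addgt0Pr => e e0; rewrite add0r.
have et : 0 < e / t by rewrite divr_gt0.
have [r r0 rP] := small _ et.
(* Enough steps to have [h < r]; the errors [h * (e / t)] of the n + 1 steps add up to [e]. *)
pose n := Num.truncn (t / r); pose h := t / n.+1%:R.
have h0 : 0 < h by rewrite divr_gt0.
have hr : h < r.
  rewrite /h ltr_pdivrMr// mulrC -ltr_pdivrMr//; exact: truncnS_gt.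
have hh := rP h; rewrite h0 hr in hh; have {}hh := hh isT.
have step k : nrm (U (k%:R * h) v - (expR (- (k%:R * h * l)))%:C *: v) <= k%:R * (h * (e / t)).
  elim: k => [|k IH].
    by rewrite !mul0r U0 oppr0 expR0 scale1r subrr nrm0.
  have kh : 0 <= k%:R * h by rewrite mulr_ge0// ltW.
  have [Ulk Uk1] := Ulin _ kh.
  have UB x y : U (k%:R * h) (x - y) = U (k%:R * h) x - U (k%:R * h) y.
    by rewrite -scaleN1r addrC Ulk scaleN1r addrC.
  have UZ c x : U (k%:R * h) (c *: x) = c *: U (k%:R * h) x.
    have z : U (k%:R * h) 0 = 0 by rewrite -[X in U _ X](subrr 0) UB subrr.
    by rewrite -[c *: x]addr0 Ulk z addr0.
  have -> : k.+1%:R * h = k%:R * h + h by rewrite -natr1 mulrDl mul1r.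
  rewrite UD ?(ltW h0)//= mulrDl opprD expRD.
  have -> : U (k%:R * h) (U h v) - (expR (- (k%:R * h * l)) * expR (- (h * l)))%:C *: v =
      U (k%:R * h) (U h v - (expR (- (h * l)))%:C *: v) + (expR (- (h * l)))%:C *:
        (U (k%:R * h) v - (expR (- (k%:R * h * l)))%:C *: v).
    by rewrite UB UZ scalerBr scalerA -rmorphM /= [expR _ * _]mulrC addrA subrK.
  apply: le_trans (nrmD _ _) _; rewrite -natr1 mulrDl mul1r addrC; apply: lerD.
    rewrite nrmZ; apply: le_trans IH; rewrite ler_piMl ?nrm_ge0// cmod_real.
    by rewrite ger0_norm ?expR_ge0// -expR0 ler_expR oppr_le0 mulr_ge0// ltW.
  apply: le_trans hh; rewrite -lecR -!nrmE; exact: Uk1.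
have nh : n.+1%:R * h = t by rewrite /h mulrC divfK.
have ne : n.+1%:R * (h * (e / t)) = e by rewrite mulrA nh mulrC divfK ?gt_eqF.
by have := step n.+1; rewrite ne nh.
Qed.

Variables (f : nat -> H) (b : nat -> bool) (lam : nat -> R).
Hypothesis f_ortho : orthosys dot f b.
Hypothesis f_complete : complete_sys dot f.
Hypothesis lam_ge0 : forall n, 0 <= lam n.
Hypothesis f_dom : forall n, dom L (f n).
Hypothesis f_eigen : forall n, L (f n) = (lam n)%:C *: f n.

Lemma heatP : is_heat_semigroup L (heat L).
Proof.
apply: (@getPex _ [set U | is_heat_semigroup L U]); exists (hflow dot f lam).
exact: (hflow_semigroup norm_dot saL nonnegL T_linear f_ortho).
Qed.

(** [heat L] is some semigroup satisfying the axioms: they fix it on eigenvectors by [heat_eigen],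
    and linearity and contractivity extend this along the eigenexpansion of [u]. *)
Lemma dot_heat t u : 0 <= t ->
  dot (heat L t u) u = csum (fun n => (expR (- (t * lam n)) * cmod (dot u (f n)) ^+ 2)%:C).
Proof.
move=> t0; have hP := heatP; have [_ _ Ulin _ _] := hP; have [Ul U1] := Ulin t t0.
have UZ c x : heat L t (c *: x) = c *: heat L t x.
  have z : heat L t 0 = 0.
    by have := Ul (-1) 0 0; rewrite scaler0 add0r scaleN1r addNr.
  by rewrite -[c *: x]addr0 Ul z addr0.
have UD x y : heat L t (x + y) = heat L t x + heat L t y.
  by rewrite -{1}[x]scale1r Ul scale1r.
have cU : heat L t (series (fun k => dot u (f k) *: f k) n) @[n --> \oo] --> heat L t u.
  have cE : series (fun k => dot u (f k) *: f k) @ \oo --> u.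
    exact: (complete_expansion norm_dot f_ortho f_complete).
  apply/(cvgH_P (F := \oo)) => e e0; have /(cvgH_P (F := \oo))/(_ e e0) := cE.
  apply: filterS => n; apply: le_lt_trans.
  have -> : heat L t (series (fun k => dot u (f k) *: f k) n) - heat L t u =
      heat L t (series (fun k => dot u (f k) *: f k) n - u).
    by rewrite UD -[- u]scaleN1r UZ scaleN1r.
  rewrite -lecR -!nrmE; exact: U1.
have h : dot (heat L t (series (fun k => dot u (f k) *: f k) n)) u @[n --> \oo] -->
    dot (heat L t u) u by exact: (cvg_dotl norm_dot cU).
apply/esym/csum_unique.
apply: cvg_trans h; apply: near_eq_cvg; near=> n; rewrite /series /=.
have -> : heat L t (\sum_(0 <= k < n) dot u (f k) *: f k) =
    \sum_(0 <= k < n) (dot u (f k) * (expR (- (t * lam k)))%:C) *: f k.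
  elim: {+}n => [|k IH]; first by rewrite !big_geq// -[X in heat L t X](scale0r 0) UZ scale0r.
  rewrite !big_nat_recr//= UD IH UZ.
  by rewrite (heat_eigen hP (f_dom k) (f_eigen k) (lam_ge0 k) t0) scalerA.
rewrite dot_suml; apply: eq_bigr => k _.
by rewrite dotZl [dot (f k) u]dotC mulrAC mul_conj_cmod [RHS]rmorphM [RHS]mulrC.
Unshelve. all: by end_near. Qed.

Hypothesis sepH : separable_space H.

(** Distinct basis vectors have distance sqrt 2, so points of the countable dense set within [1/2]
    of them are distinct. *)
Lemma orthonormal_countable (E : set H) : orthonormal_basis dot E -> countable E.
Proof.
move=> [Eo _]; have [S [cS dS]] := sepH.
have [g gI] := elimT (countable_injP _) cS.
have near_S e : exists s, S s /\ nrm (s - e) < 1 / 2.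
  have h0 : 0 < ((1 / 2)%:C : C) by rewrite ltcR divr_gt0.
  have [s [/= sb Ss]] : ball e ((1 / 2)%:C : C) `&` S !=set0.
    by apply: dS; [exists e; exact: ballxx|exact: ball_open].
  by exists s; split=> //; move: sb; rewrite -ball_normE /= nrmE ltcR nrmC.
have [phi phiP] := choice near_S.
apply/countable_injP; exists (g \o phi) => e e' /set_mem Ee /set_mem Ee' /= ge.
apply: contrapT => /eqP ee'.
have [Se he] := phiP e; have [Se' he'] := phiP e'.
have pe : phi e = phi e' by apply: gI => //; rewrite inE.
have n2 : nrm (e - e') ^+ 2 = 2.
  rewrite (nrm_sqrB norm_dot) Eo// (negPf ee') /=.
  have n1 x : E x -> nrm x ^+ 2 = 1.
    by move=> Ex; apply: (@complexI R); rewrite -(dot_nrm norm_dot) Eo// eqxx.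
  by rewrite !n1//; lra.
have : nrm (e - e') < 1.
  have -> : e - e' = (phi e - e') - (phi e - e) by rewrite opprB [RHS]addrC subrKA.
  by apply: le_lt_trans (nrmB _ _) _; move: he he'; rewrite -pe; lra.
move=> n3; have : nrm (e - e') ^+ 2 < 1 by rewrite exprn_ilt1// nrm_ge0.
by rewrite n2; lra.
Qed.

(** The array of e^(-t lam_n) |<g_m, f_n>|^2 is summed both ways: over n it gives the diagonal
    entries in the basis [E], over m it gives e^(-t lam_n) by Parseval in that basis. *)
Lemma heat_has_sum t K (E : set H) : 0 <= t ->
  psum_le (fun n => expR (- (t * lam n)) * (b n)%:R) K -> orthonormal_basis dot E ->
  has_sum E (fun e => dot (heat L t e) e) (csum (fun n => (expR (- (t * lam n)) * (b n)%:R)%:C)).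
Proof.
move=> t0 hK EB; have [x [bE [bD Db xI]]] := countable_enum (orthonormal_countable EB).
have [Eo Ec] := EB.
pose g m := if bE m then x m else 0.
have g_ortho : orthosys dot g bE.
  move=> m n; rewrite /g; case: ifPn => bm; last first.
    rewrite dot0l; have [mn|] /= := eqVneq m n; last by [].
    by rewrite -mn (negPf bm).
  case: ifPn => bn; last by rewrite dot0r andbF.
  rewrite (Eo _ _ (bD m bm) (bD n bn)) andbT; congr (nat_of_bool _)%:R.
  apply/eqP/eqP => [e|->//]; exact: xI.
have g_complete : complete_sys dot g.
  move=> u gu; apply: Ec => e /Db[n bn <-]; by have := gu n; rewrite /g bn.
pose a n m : C := (expR (- (t * lam n)) * cmod (dot (g m) (f n)) ^+ 2)%:C.
have aM n : asum (a n) (expR (- (t * lam n)) * (b n)%:R).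
  move=> N; rewrite -(orthosys_nrm norm_dot f_ortho).
  apply: le_trans (ler_wpM2l (expR_ge0 _) (bessel norm_dot g_ortho (f n) N)).
  rewrite mulr_sumr; apply: ler_sum => m _.
  rewrite cmod_real ger0_norm; last by rewrite mulr_ge0 ?expR_ge0 ?sqr_ge0.
  by rewrite (cmod_dotC dot) lexx.
have row k : csum (a k) = (expR (- (t * lam k)) * (b k)%:R)%:C.
  rewrite -(orthosys_nrm norm_dot f_ortho) rmorphM /= -(parseval_nrm norm_dot g_ortho g_complete).
  have h : asum (fun m => (cmod (dot (f k) (g m)) ^+ 2)%:C : C) (nrm (f k) ^+ 2).
    apply: psum_le_dom (bessel norm_dot g_ortho (f k)) => j.
    by rewrite cmod_real ger0_norm ?sqr_ge0.
  rewrite -(csumZ _ h); apply: eq_csum => j.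
  by rewrite /a rmorphM (cmod_dotC dot).
have col m : csum (a^~ m) = if bE m then dot (heat L t (x m)) (x m) else 0.
  case: ifPn => bm; first by rewrite dot_heat//; apply: eq_csum => n; rewrite /a /g bm.
  rewrite -[RHS]csum0; apply: eq_csum => n.
  by rewrite /a /g (negPf bm) dot0l cmod0 expr0n mulr0.
have hs := asum_csum_col aM hK.
have e1 : csum (fun n => (expR (- (t * lam n)) * (b n)%:R)%:C) =
    csum (fun m => if bE m then dot (heat L t (x m)) (x m) else 0).
  by rewrite -(eq_csum row) (csum_exchange aM hK); exact: eq_csum.
rewrite e1; rewrite (funext col) in hs.
exact: (has_sum_csum (F := fun e => dot (heat L t e) e) bD Db xI hs).
Qed.

Lemma eigenbasis_orthonormal : orthonormal_basis dot [set f n | n in [set n | b n]].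
Proof.
split=> [_ _ [m /= bm <-] [n /= bn <-]|u uo].
  rewrite f_ortho bn andbT; congr (nat_of_bool _)%:R; apply/eqP/eqP => [->//|e].
  have := f_ortho m n; rewrite e f_ortho eqxx bn.
  by case: eqP => // _ /eqP; rewrite oner_eq0.
apply: f_complete => n; have [bn|bn] := boolP (b n); first by apply: uo; exists n.
by rewrite (orthosys_eq0 norm_dot f_ortho bn) dot0r.
Qed.

(** All bases give the same sum, so the defining set of [trace] is inhabited; evaluating its chosen
    element in the eigenbasis identifies it. *)
Lemma heat_trace t K : 0 <= t -> psum_le (fun n => expR (- (t * lam n)) * (b n)%:R) K ->
  trace dot (heat L t) = csum (fun n => (expR (- (t * lam n)) * (b n)%:R)%:C).
Proof.
move=> t0 hK; rewrite /trace.
have h E : orthonormal_basis dot E -> _ := @heat_has_sum t K E t0 hK.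
have := @getPex _ [set c | forall E, orthonormal_basis dot E ->
  has_sum E (fun e => dot (heat L t e) e) c] (ex_intro _ _ h).
move=> /(_ _ eigenbasis_orthonormal) h2.
exact: has_sum_unique h2 (h _ eigenbasis_orthonormal).
Qed.

End HeatTrace.

(** * The spectrum as a pair of real sequences *)

Section SpectralSequences.
Context {R : realType} {H : completeNormedModType R[i]}.
Local Notation C := R[i].
Variable dot : {dot H for conjC}.
Hypothesis norm_dot : forall u : H, `|u| ^+ 2 = dot u u.
Hypothesis sepH : separable_space H.
Variable L : operator H.
Hypothesis saL : selfadjoint dot L.
Hypothesis nonnegL : nonneg_operator dot L.
Variable p : R.
Hypothesis p_gt0 : 0 < p.
Hypothesis schattenL : schatten dot p (resolvent L 1).

Local Notation I := (eigen_index (dom L) L).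

Let T_linear : linear (resolvent L 1). Proof. by have [[]] := schattenL. Qed.

(** Only finitely many indices have weight at least 1/(k + 1), since the weights have bounded finite
    sums; these sets exhaust the index set. *)
Lemma eigen_index_countable : countable I.
Proof.
have [K hK] := eigen_weight_bound norm_dot saL nonnegL schattenL.
have fin (k : nat) : finite_set (I `&` [set x | k.+1%:R^-1 <= eigen_weight p x]).
  apply: contrapT => /infinite_set_fset.
  move=> /(_ (Num.truncn (K * k.+1%:R)).+1)[B BI Bn].
  have BP x : x \in (B : seq _) -> I x /\ k.+1%:R^-1 <= eigen_weight p x.
    by move=> xB; exact: (BI x xB).
  have h1 := hK B (fset_uniq B) (fun x xB => (BP x xB).1).
  have : (#|` B|)%:R * k.+1%:R^-1 <= K.
    apply: le_trans h1; rewrite -sum1_size natr_sum mulr_suml.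
    by rewrite big_seq [leRHS]big_seq; apply: ler_sum => x /BP[_]; rewrite mul1r.
  rewrite ler_pdivrMr// leNgt => /negP; apply.
  by apply: lt_le_trans (truncnS_gt _) _; rewrite ler_nat.
have -> : I = \bigcup_(k in setT) (I `&` [set x | k.+1%:R^-1 <= eigen_weight p x]).
  apply/seteqP; split=> [x xI|x [k _ []]//].
  have w0 : 0 < eigen_weight p x by exact: expR_gt0.
  have [N _ hN] := near_infty_natSinv_lt (PosNum w0).
  by exists N => //; split=> //; rewrite /= ltW//; exact: (hN N (leqnn N)).
by apply: bigcup_countable => // k _; exact: finite_set_countable.
Qed.

Lemma psum_weight (x : nat -> C * nat) (b : nat -> bool) :
  (forall n, b n -> I (x n)) -> (forall m n, b m -> b n -> x m = x n -> m = n) ->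
  exists K, psum_le (fun n => (b n)%:R * eigen_weight p (x n)) K.
Proof.
move=> bI xI; have [K hK] := eigen_weight_bound norm_dot saL nonnegL schattenL.
exists K => n; pose s := [seq x k | k <- index_iota 0 n & b k].
have us : uniq s.
  rewrite map_inj_in_uniq ?filter_uniq ?iota_uniq// => i j.
  by rewrite !mem_filter => /andP[bi _] /andP[bj _]; exact: xI.
apply: le_trans (hK s us _); last first.
  by move=> y /mapP[k]; rewrite mem_filter => /andP[bk _] ->; exact: bI.
rewrite [leRHS]big_map [leRHS]big_filter [leRHS]big_mkcond /=; apply: ler_sum => k _.
by case: (b k); rewrite ?mul1r ?mul0r.
Qed.

(** Nonzero eigenvalues cannot accumulate at [0]: beyond some index the weight is less than 2^(-p),
    the weight of the eigenvalue [1], so the eigenvalue exceeds [1]; finitely many remain. *)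
Lemma first_eigenvalue (r : nat -> R) (b : nat -> bool) K : (forall n, 0 <= r n) ->
  psum_le (fun n => (b n)%:R * expR (- p * ln (1 + r n))) K ->
  exists2 lam1, 0 < lam1 & forall n, b n -> r n != 0 -> lam1 <= r n.
Proof.
move=> r0 hK; pose w := expR (- p * ln 2) / 2.
have w0 : 0 < w by rewrite divr_gt0// expR_gt0.
have nonneg n : 0 <= (b n)%:R * expR (- p * ln (1 + r n)).
  by rewrite mulr_ge0// expR_ge0.
have [N hN] := psum_le_tail nonneg hK w0.
have init M : exists2 m, 0 < m & forall n, (n < M)%N -> b n -> r n != 0 -> m <= r n.
  elim: M => [|M [m m0 IH]]; first by exists 1.
  have [rM|rM] := eqVneq (r M) 0.
    exists m => // n; rewrite ltnS leq_eqVlt => /predU1P[->|]; last exact: IH.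
    by rewrite rM eqxx.
  exists (Num.min m (r M)); first by rewrite lt_min m0 lt_def rM r0.
  move=> n; rewrite ltnS leq_eqVlt => /predU1P[->|nM] bn rn; first by rewrite ge_min lexx orbT.
  by rewrite ge_min IH.
have [m m0 hm] := init N.
exists (Num.min m 1); first by rewrite lt_min m0 ltr01.
move=> n bn rn; have [nN|Nn] := ltnP n N; first by rewrite ge_min hm.
rewrite ge_min; apply/orP; right.
have := hN n.+1; rewrite big_nat_recr//= bn mul1r => h.
have {h} h : expR (- p * ln (1 + r n)) < expR (- p * ln 2).
  apply: (@le_lt_trans _ _ w); last by rewrite /w ltr_pdivrMr// ltr_pMr ?expR_gt0//; lra.
  by apply: le_trans h; rewrite lerDr sumr_ge0.
have h2 : (2 : R) < 1 + r n.
  by move: h; rewrite ltr_expR !mulNr ltrN2 ltr_pM2l// ltr_ln// posrE ltr_pwDl.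
lra.
Qed.

Lemma spectral_sequences : exists (e lam : nat -> R) (lam1 K0 : R) (kappa : C),
  [/\ forall n, 0 <= e n, 0 < lam1, forall n, lam1 <= lam n &
    psum_le (fun n => e n * expR (- p * ln (lam n))) K0] /\
  (forall x : R, trace dot (heat L (expR x)) = kappa + theta e lam x) /\
  (forall (z s : C) M, asum (fun i => (e i)%:C * cpow ((lam i)%:C + z) (- s)) M ->
    has_sum (nonzero_eigen_index (dom L) L) (fun x => cpow (x.1 + z) (- s))
      (csum (fun i => (e i)%:C * cpow ((lam i)%:C + z) (- s)))).
Proof.
have [x [b [bI Ib xI]]] := countable_enum eigen_index_countable.
have [K hK] := psum_weight bI xI.
pose r n := if b n then complex.Re (x n).1 else 0.
pose f n := if b n then eigenvec dot L (x n) else 0.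
have xr n : b n -> (x n).1 = (r n)%:C.
  move=> bn; have [s _ e] := eigen_index_real norm_dot nonnegL (bI n bn).
  by rewrite /r bn e.
have r0 n : 0 <= r n.
  rewrite /r; case: ifPn => // bn.
  by have [s s0 ->] := eigen_index_real norm_dot nonnegL (bI n bn).
have {}hK : psum_le (fun n => (b n)%:R * expR (- p * ln (1 + r n))) K.
  apply: psum_le_dom hK => n; rewrite /eigen_weight /r.
  by case: (b n); rewrite ?mul0r.
have [lam1 lam1_gt0 hlam1] := first_eigenvalue r0 hK.
pose b' n := b n && (r n != 0).
pose e n : R := (b' n)%:R; pose lam n := if b' n then r n else lam1.
have lam_ge n : lam1 <= lam n by rewrite /lam; case: ifPn => // /andP[bn rn]; exact: hlam1.
have lam_gt0 n : 0 < lam n by exact: lt_le_trans (lam_ge n).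
have e0 n : 0 <= e n by [].
have f_ortho : orthosys dot f b.
  move=> m n; rewrite /f; case: ifPn => bm; last first.
    by rewrite dot0l; have [mn|] := eqVneq m n; rewrite // -mn (negPf bm).
  case: ifPn => bn; last by rewrite dot0r andbF.
  rewrite (eigenvec_dot norm_dot saL nonnegL (bI m bm) (bI n bn)) andbT.
  congr (nat_of_bool _)%:R; apply/eqP/eqP => [e1|->//]; exact: xI.
have f_complete : complete_sys dot f.
  move=> u fu; apply: (eigenvec_complete norm_dot saL nonnegL schattenL) => y /Ib[n bn <-].
  by have := fu n; rewrite /f bn.
have f_dom n : dom L (f n).
  rewrite /f; case: ifPn => [bn|_]; last exact: dom0.
  by have [] := eigenvecP norm_dot (bI n bn).
have f_eigen n : L (f n) = (r n)%:C *: f n.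
  rewrite /f; case: ifPn => [bn|_]; last by rewrite op0 scaler0.
  by have [_ -> _] := eigenvecP norm_dot (bI n bn); rewrite xr.
have psum_e : psum_le (fun n => e n * expR (- p * ln (lam n)))
    (expR (p * ln (1 + lam1^-1)) * K).
  (* On nonzero eigenvalues 1 + r <= (1 + 1/lam1) r, so the weight r^(-p) is bounded by a constant
     times the resolvent weight. *)
  have h n : e n * expR (- p * ln (lam n)) <=
      expR (p * ln (1 + lam1^-1)) * ((b n)%:R * expR (- p * ln (1 + r n))).
    rewrite /e /lam /b'; have [bn|bn] /= := boolP (b n); last first.
      by rewrite !mul0r mulr0.
    have [rn|rn] /= := eqVneq (r n) 0; first by rewrite !mul0r mulr_ge0 ?mulr_ge0 ?expR_ge0.
    have rn0 : 0 < r n by rewrite lt_def rn r0.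
    rewrite !mul1r -expRD ler_expR.
    have v0 : 0 < 1 + lam1^-1 by rewrite ltr_pwDl// invr_ge0 ltW.
    have : ln (1 + r n) <= ln (1 + lam1^-1) + ln (r n).
      have r1 : 0 < 1 + r n by rewrite ltr_pwDl.
      have vr : 0 < (1 + lam1^-1) * r n by exact: mulr_gt0.
      rewrite -lnM ?posrE// ler_ln ?posrE//.
      rewrite mulrDl mul1r addrC lerD2l mulrC ler_pdivlMr// mul1r; exact: hlam1.
    by move=> h; have := ler_wpM2l (ltW p_gt0) h; rewrite mulrDr !mulNr; lra.
  move=> n; apply: le_trans (ler_sum _ (fun k _ => h k)) _.
  by rewrite -mulr_sumr ler_wpM2l ?expR_ge0.
(* Each zero eigenvalue contributes [1] to the heat trace at all times; the sum is [kappa]. *)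
pose kap n : C := (b n && (r n == 0))%:R.
have kapM : asum kap K.
  apply: asum_dom hK => n; rewrite cmod_nat.
  have [bn|bn] /= := boolP (b n); last by rewrite mul0r.
  have [->|rn] := eqVneq (r n) 0; first by rewrite mul1r addr0 ln1 mulr0 expR0.
  by rewrite mul1r expR_ge0.
exists e, lam, lam1, (expR (p * ln (1 + lam1^-1)) * K), (csum kap); split; [by []|split].
- move=> y; pose t := expR y; have t0 : 0 < t := expR_gt0 y.
  (* Writing e^(-t r) as e^t e^(-t (1 + r)) brings in the resolvent weight; [c] collects e^t p^p
     t^(-p). *)
  pose c := expR t * expR (p * ln p) * expR (- p * ln t).
  have tM : psum_le (fun n => expR (- (t * r n)) * (b n)%:R) (c * K).
    move=> n; rewrite -[leRHS]/(c * K); apply: le_trans (ler_wpM2l _ (hK n)).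
      rewrite mulr_sumr; apply: ler_sum => k _.
      rewrite [leRHS]mulrCA mulrC ler_wpM2l//.
      have u0 : 0 < t * (1 + r k) by rewrite mulr_gt0// ltr_pwDl.
      have h := expRN_le_power p_gt0 u0.
      have -> : - (t * r k) = t + - (t * (1 + r k)) by ring.
      rewrite expRD /c -!mulrA ler_wpM2l ?expR_ge0//; apply: le_trans h _.
      rewrite ler_wpM2l ?expR_ge0// -expRD ler_expR lnM ?posrE ?ltr_pwDl// mulrDr//.
    by rewrite !mulr_ge0 ?expR_ge0.
  rewrite (heat_trace norm_dot saL nonnegL T_linear f_ortho f_complete r0 f_dom f_eigen sepH
    (ltW t0) tM).
  rewrite /theta -(csumD kapM (theta_asum e0 lam1_gt0 lam_ge p_gt0 psum_e y)).
  apply: eq_csum => n; rewrite /kap /e /lam /b' /gfun.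
  have [bn|bn] /= := boolP (b n); last by rewrite mulr0 mul0r add0r.
  have [->|rn] /= := eqVneq (r n) 0; first by rewrite mulr0 oppr0 expR0 mul1r mul0r addr0.
  by rewrite mulr1 add0r mul1r mulNr mulrC.
- move=> z s M aM.
  have aE : (fun n => if b' n then cpow ((x n).1 + z) (- s) else 0) =
      fun i => (e i)%:C * cpow ((lam i)%:C + z) (- s).
    apply/funext => n; rewrite /e /lam; case: ifPn => b'n; last by rewrite mul0r.
    by move: (b'n) => /andP[bn _]; rewrite mul1r xr.
  rewrite -aE in aM *.
  apply: (has_sum_csum (F := fun y : C * nat => cpow (y.1 + z) (- s)) _ _ _ aM).
  + move=> n /andP[bn rn]; split; first exact: bI.
    by rewrite /= xr// (fmorph_eq0 (real_complex R)).
  + move=> i [/Ib[n bn <-] /= xn]; exists n => //; rewrite /b' bn.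
    by move: xn; rewrite xr// (fmorph_eq0 (real_complex R)).
  + by move=> m n /andP[bm _] /andP[bn _]; exact: xI.
Qed.

End SpectralSequences.

(** * Expansion of the zeta function *)

Section HeatTerms.
Context {R : realType}.
Local Notation C := R[i].
Variables (A : set C) (d : C -> nat) (AH : C -> nat -> C).
Hypothesis expA : exponent_set A.
Implicit Types (a : C) (x : R).

Definition exponents_le (N : R) : set C := A `&` [set a | complex.Re a <= N].

(* if infinitely many exponents had real part at most [N], then removing finite strips
   would make [-oo] a limit point *)
Lemma exponents_le_finite N : finite_set (exponents_le N).
Proof.
have [_ strip lim] := expA; apply: contrapT => infN.
have below y : exists a, A a /\ complex.Re a < y.
  apply: contrapT => h; apply: infN; apply: sub_finite_set (strip y N) => a [Aa aN].
  split=> //=; apply/andP; split; last exact: aN.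
  by rewrite leNgt; apply/negP => ay; apply: h; exists a.
have : limit_point [set (complex.Re a)%:E | a in A] -oo%E.
  move=> U [M [Mr MU]]; have [a [Aa aM]] := below M.
  exists (complex.Re a)%:E; split=> //; first by exists a.
  by apply: MU; rewrite lte_fin.
by rewrite lim.
Qed.

Definition exponent_terms a : seq (term (R := R)) := [seq (a, k, AH a k) | k <- iota 0 (d a).+1].

(* the constant [kappa] accounts for the zero eigenvalue *)
Definition heat_terms (kappa : C) (N : nat) : seq (term (R := R)) :=
  (0, 0%N, - kappa) :: flatten [seq exponent_terms a | a <- fset_set (exponents_le N%:R)].

Lemma mem_exponent_terms N t :
  t \in flatten [seq exponent_terms a | a <- fset_set (exponents_le N)] ->
  [/\ A t.1.1, complex.Re t.1.1 <= N & t.2 = AH t.1.1 t.1.2].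
Proof.
move=> /flatten_mapP[a + /mapP[k _ ->]] /=.
by rewrite (in_fset_set (exponents_le_finite _)) => /set_mem[].
Qed.

Lemma heat_terms_step kappa (N : nat) : exists X,
  perm_eq (heat_terms kappa N.+1) (heat_terms kappa N ++ X) /\
  forall t, t \in X -> N%:R < complex.Re t.1.1.
Proof.
pose D := exponents_le N.+1%:R `\` exponents_le N%:R.
have fD : finite_set D by apply: finite_setD; exact: exponents_le_finite.
exists (flatten [seq exponent_terms a | a <- fset_set D]); split; last first.
  move=> t /flatten_mapP[a + /mapP[k _ ->]] /=.
  rewrite (in_fset_set fD) => /set_mem[[Aa aN] naN]; rewrite ltNge; apply/negP => aN'.
  by apply: naN.
rewrite /heat_terms cat_cons perm_cons -flatten_cat -map_cat; apply/perm_flatten/perm_map.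
apply: uniq_perm; first exact: fset_uniq.
  rewrite cat_uniq !fset_uniq/= andbT; apply/hasPn => a.
  rewrite (in_fset_set fD) => /set_mem[_ naN]; apply/negP.
  by rewrite (in_fset_set (exponents_le_finite _)) => /set_mem.
move=> a; rewrite mem_cat (in_fset_set fD) (in_fset_set (exponents_le_finite N.+1%:R)).
rewrite (in_fset_set (exponents_le_finite N%:R)).
apply/idP/orP => [/set_mem aN|].
  have [h|h] := pselect (exponents_le N%:R a); first by left; rewrite inE.
  by right; rewrite inE.
case=> /set_mem; last by move=> [h _]; rewrite inE.
move=> [Aa aN]; rewrite inE; split=> //=; apply: le_trans aN _.
by rewrite ler_nat.
Qed.

Lemma heat_terms_val kappa N (x : R) : terms_val (heat_terms kappa N) x =
  \sum_(a \in exponents_le N%:R) \sum_(k < (d a).+1)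
    AH a k * cpow (expR x)%:C a * ((ln (expR x))%:C) ^+ k - kappa.
Proof.
rewrite /terms_val big_cons addrC; congr (_ + _); last first.
  by rewrite /term_val /= mul0r cexp0 mul1r expr0 mulr1.
rewrite big_flatten big_map (fsbig_finite _ _ (exponents_le_finite _)) /=.
apply: eq_bigr => a _; rewrite big_map -[iota _ _]/(index_iota 0 (d a).+1) big_mkord.
apply: eq_bigr => k _; rewrite /term_val /= cpow_real ?expR_gt0// expRK mulrA//.
Qed.

Hypothesis AH0 : forall a k, ~ (A a /\ (k <= d a)%N) -> AH a k = 0.
Hypothesis AHlog : forall n k : nat, (0 < k)%N -> AH (- n%:R) k = 0.

Lemma heat_terms_log kappa (t : term (R := R)) n : t \in heat_terms kappa 1 ->
  t.1.1 = - n%:R -> (0 < t.1.2)%N -> t.2 = 0.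
Proof.
rewrite inE => /predU1P[-> //|/mem_exponent_terms[_ _ ->] ->].
exact: AHlog.
Qed.

Lemma heat_terms_residue kappa n : zresidue (heat_terms kappa) n.+1 = AH (- n.+1%:R) 0%N.
Proof.
rewrite /zresidue big_cons /= eq_sym oppr_eq0 pnatr_eq0 /=.
rewrite big_flatten big_map /=; set a0 : C := - n.+1%:R.
have blk a : \sum_(t <- exponent_terms a | (t.1.1 == a0) && (t.1.2 == 0%N)) t.2 =
    if a == a0 then AH a 0%N else 0.
  rewrite big_map big_cons /= andbT; case: eqP => [->|_]; last first.
    by rewrite big1_seq// => k /andP[].
  by rewrite big1_seq ?addr0// => k /andP[/= /eqP -> /[!mem_iota]].
under eq_bigr do rewrite blk.
have [a0A|a0A] := pselect (A a0); last first.
  rewrite AH0; last by case.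
  by rewrite big1_seq// => a _; case: eqP => // ->; apply: AH0 => -[].
have a0E : a0 \in fset_set (exponents_le 1).
  rewrite (in_fset_set (exponents_le_finite _)) inE; split=> //=.
  by rewrite ReN Re_natr; have := ler0n R n.+1; lra.
rewrite (bigD1_seq a0) ?fset_uniq//= eqxx big1 ?addr0// => a /negPf ->//.
Qed.

Variables (h : R -> C) (theta0 : R -> C) (kappa : C).
Hypothesis h_exp : heat_expansion h A d AH.
Hypothesis hE : forall x, h (expR x) = kappa + theta0 x.
Hypothesis theta0_bounded : forall X, exists B, forall x, - X <= x -> x <= 0 ->
  cmod (theta0 x) <= B.

Lemma terms_val_bounded (q : seq (term (R := R))) X : 0 <= X ->
  exists B, forall x, - X <= x -> x <= 0 -> cmod (terms_val q x) <= B.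
Proof.
move=> X0; elim: q => [|t q [B IH]]; first by exists 0 => x _ _; rewrite /terms_val big_nil cmod0.
exists (cmod t.2 * (expR (`|complex.Re t.1.1| * X) * X ^+ t.1.2) + B) => x x1 x2.
rewrite /terms_val big_cons; apply: le_trans (cmodD _ _) _; apply: lerD; last exact: IH.
have xX : `|x| <= X by rewrite ler_norml x1 (le_trans x2).
rewrite /term_val cmodM ler_wpM2l ?cmod_ge0// cmodM cmodX cmod_real cmod_cexp.
apply: ler_pM; rewrite ?expR_ge0 ?exprn_ge0//.
  rewrite ler_expR ReM /= mulr0 subr0; apply: le_trans (ler_norm _) _.
  by rewrite normrM ler_wpM2l.
by rewrite lerXn2r ?nnegrE.
Qed.

(** The expansion controls only small t = e^x. On the remaining compact range of [x] the function
    and the terms are bounded, and [expR (N * x)] is bounded below. *)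
Lemma heat_terms_neg (N : nat) : exists K : R, forall x : R, x <= 0 ->
  cmod (theta0 x - terms_val (heat_terms kappa N) x) <= K * expR (N%:R * x).
Proof.
have := h_exp N%:R => /(cvgC_P (F := 0^'+))/(_ 1 ltr01) [r /= r0 hr].
pose X := `|ln r|.
have X0 : 0 <= X by exact: normr_ge0.
have [B1 hB1] := theta0_bounded X.
have [B2 hB2] := terms_val_bounded (heat_terms kappa N) X0.
pose K2 := (B1 + B2) * expR (N%:R * X).
exists (Num.max 1 K2) => x x0; have [xr|xr] := ltP x (- X); last first.
  apply: (@le_trans _ _ (B1 + B2)).
    by apply: le_trans (cmodB _ _) _; apply: lerD; [exact: hB1|exact: hB2].
  have B0 : 0 <= B1 + B2.
    apply: le_trans (lerD (hB1 x xr x0) (hB2 x xr x0)).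
    by rewrite addr_ge0// cmod_ge0.
  apply: (@le_trans _ _ (K2 * expR (N%:R * x))); last first.
    by rewrite ler_wpM2r ?expR_ge0// le_max lexx orbT.
  rewrite /K2 -mulrA -expRD -mulrDr ler_peMr// -expR0 ler_expR mulr_ge0//.
  by move: xr; lra.
have tr : expR x < r.
  rewrite -[ltRHS](lnK (x := r)) ?posrE// ltr_expR; apply: lt_le_trans xr _.
  by rewrite /X lerNl -normrN ler_norm.
have := hr (expR x); rewrite /= sub0r normrN gtr0_norm ?expR_gt0// => /(_ tr isT).
rewrite subr0 cmodM cmodV cmod_real hE.
have -> : `|expR x `^ N%:R| = expR (N%:R * x).
  by rewrite /powR gt_eqF ?expR_gt0// expRK ger0_norm ?expR_ge0.
rewrite ltr_pdivrMr ?expR_gt0// => h1.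
apply: (@le_trans _ _ (1 * expR (N%:R * x))); last first.
  by rewrite ler_wpM2r ?expR_ge0// le_max lexx.
rewrite heat_terms_val opprB addrA [theta0 x + kappa]addrC.
exact: ltW.
Qed.

End HeatTerms.

Lemma eq_near_Pf {R : realType} (F G : R[i] -> R[i]) s0 :
  (\forall s \near s0^', F s = G s) -> Pf F s0 = Pf G s0.
Proof.
move=> FG; have h (F' G' : R[i] -> R[i]) m a : (\forall s \near s0^', F' s = G' s) ->
    has_laurent F' s0 m a -> has_laurent G' s0 m a.
  by move=> FG'; apply: filterS2 FG' => s ->.
have GF : \forall s \near s0^', G s = F s by apply: filterS FG => s ->.
have e : [set c | exists m a, has_laurent F s0 m a /\ c = a m] =
    [set c | exists m a, has_laurent G s0 m a /\ c = a m].
  apply/seteqP; split=> c; case=> m [a [FL ca]]; exists m, a.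
    by split; [exact: h FL|exact: ca].
  by split; [exact: h FL|exact: ca].
exact: (congr1 (fun X : set R[i] => get X) e).
Qed.

Lemma csum_at0 {R : realType} (g : nat -> R[i]) : csum (fun n => 0 ^+ n * g n) = g 0%N.
Proof.
rewrite (csum_finite (N := 1%N)) ?big_nat1 ?expr0 ?mul1r//.
by case=> // k _; rewrite exprS !mul0r.
Qed.

(** * Identification of the chosen zeta function with the construction *)

Section ZetaExpansion.
Context {R : realType} {H : completeNormedModType R[i]}.
Local Notation C := R[i].
Variable dot : {dot H for conjC}.
Hypothesis norm_dot : forall u : H, `|u| ^+ 2 = dot u u.
Hypothesis sepH : separable_space H.
Variable L : operator H.
Hypothesis saL : selfadjoint dot L.
Hypothesis nonnegL : nonneg_operator dot L.
Variable p : R.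
Hypothesis p_gt0 : 0 < p.
Hypothesis schattenL : schatten dot p (resolvent L 1).
Variables (A : set C) (d : C -> nat) (AH : C -> nat -> C).
Hypothesis expA : exponent_set A.
Hypothesis AH0 : forall a k, ~ (A a /\ (k <= d a)%N) -> AH a k = 0.
Hypothesis heatL : heat_expansion (fun t : R => trace dot (heat L t)) A d AH.
Hypothesis AHlog : forall n k : nat, (0 < k)%N -> AH (- n%:R) k = 0.

(** The spectral sums determine [zeta] for [p < Re s], and uniqueness of meromorphic functions
    identifies it with [zetaz] on punctured neighbourhoods of every point. The prescribed values at
    regular points turn this into equality with the continuous series for |s| < r. *)
Lemma zeta_expansion : exists (rho r K : R) (M : nat -> R) (a : nat -> nat -> C)
    (phi : nat -> C -> C),
  [/\ 0 < rho, 0 < r, forall n, has_pseries r (M n) 0 (a n) (phi n) &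
    psum_le (fun n => M n * rho ^+ n) K] /\
  (forall z, cmod z <= rho -> is_zeta p L z (zeta p L z) /\
    forall s, cmod s < r -> zeta p L z s = csum (fun n => z ^+ n * phi n s)) /\
  (forall n, a n.+1 1%N = (-1) ^+ n.+1 / n.+1%:R *
    (Pf (zeta p L 0) n.+1%:R + AH (- n.+1%:R) 0%N / n`!%:R * harmonic_number n)).
Proof.
have [e [lam [lam1 [K0 [kappa [[e0 l0 ll ps] [hE hz]]]]]]] :=
  spectral_sequences norm_dot sepH saL nonnegL p_gt0 schattenL.
have theta_bounded X : exists B, forall x, - X <= x -> x <= 0 -> cmod (theta e lam x) <= B.
  have [B hB] : exists B, forall x, asum (fun n => (e n)%:C * gfun (lam n) x)
      (B * (expR (- p * x) * expR (- (lam1 / 2) * expR x))).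
    by eexists => x; exact: (theta_asum e0 l0 ll p_gt0 ps x).
  have B0 : 0 <= B.
    have := asum_ge0 (hB 0); rewrite pmulr_lge0 ?mulr_gt0 ?expR_gt0//.
  exists (B * expR (p * X)) => x x1 x2; apply: le_trans (csum_le (hB x)) _.
  rewrite ler_wpM2l// -expRD ler_expR; have := expR_gt0 x; have := l0; have := p_gt0.
  by move: x1; rewrite !mulNr; move: (expR x) => y; nra.
pose E := heat_terms A d AH kappa.
have E_step : forall N : nat, exists X, perm_eq (E N.+1) (E N ++ X) /\
  forall t, t \in X -> N%:R < complex.Re t.1.1 := heat_terms_step d AH expA kappa.
have E_neg : forall N : nat, exists K : R, forall x : R, x <= 0 ->
    cmod (theta e lam x - terms_val (E N) x) <= K * expR (N%:R * x).
  exact: (heat_terms_neg expA heatL hE theta_bounded).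
have E_log t n : t \in E 1 -> t.1.1 = - n%:R -> (0 < t.1.2)%N -> t.2 = 0.
  exact: (heat_terms_log expA AHlog).
have [r [K [M [a [phi [r0 aP psK phiP]]]]]] := phi_family e0 l0 ll p_gt0 ps E_step E_neg E_log.
pose Z := zetaz e0 l0 ll p_gt0 ps E_step E_neg.
have rho0 := zradius_gt0 lam1.
have Zz z : cmod z <= zradius lam1 -> is_zeta p L z (Z z).
  move=> zr; split; first exact: zetaz_meromorphic.
  move=> s sp; have [[M' hM'] sE] := zetaz_sum e0 l0 ll p_gt0 ps E_step E_neg zr sp.
  by rewrite /Z sE; exact: hz hM'.
have zetaP z : cmod z <= zradius lam1 -> is_zeta p L z (zeta p L z).
  by move=> zr; exact: (getPex (ex_intro _ (Z z) (Zz z zr))).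
have zetaZ z s0 : cmod z <= zradius lam1 -> \forall s \near s0^', zeta p L z s = Z z s.
  move=> zr; have [m1 h1] := zetaP z zr; have [m2 h2] := Zz z zr.
  apply: (meromorphic_unique (s1 := (p + 1)%:C) m1 m2); apply: near_dnbhs.
  have pp : p < complex.Re ((p + 1)%:C : C) by rewrite /= ltrDl.
  by apply: filterS (near_Re_gt pp) => s sp; exact: has_sum_unique (h1 s sp) (h2 s sp).
exists (zradius lam1), r, K, M, a, phi; split; [by []|split].
- move=> z zr; split; first exact: zetaP.
  move=> s sr; have [mz _] := zetaP z zr.
  apply: (meromorphic_continuous_value (P := fun s => csum (fun n => z ^+ n * phi n s)) mz).
    have hb : \forall t \near s^', cmod t < r.
      apply: near_dnbhs; apply/nearC_P; exists (r - cmod s); first by rewrite subr_gt0.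
      by move=> t; have := cmodD (t - s) s; rewrite subrK; lra.
    apply: filterS2 hb (zetaZ z s zr) => t tr ->.
    exact: (zetaz_phi zr r0 aP psK phiP).
  have hs := has_pseries_slice r0 zr aP psK.
  by apply: (has_pseries_continuous hs); rewrite subr0.
- move=> n.
  (* At [z = 0] only the term [n = 0] of [zsum] survives, and it is [zeta0]. *)
  have PfE : Pf (zeta p L 0) n.+1%:R = Pf (zeta0 e0 l0 ll p_gt0 ps E_step E_neg) n.+1%:R.
    apply: eq_near_Pf; have c0 : cmod (0 : C) <= zradius lam1 by rewrite cmod0 ltW.
    have h2 := Pf_near (fun t => zsum_mero e0 l0 ll p_gt0 ps E_step E_neg t c0) n.+1%:R.
    have h1 := zetaZ 0 n.+1%:R c0.
    apply: filterS2 h1 h2 => s e1 e2; rewrite e1; apply: etrans e2 _.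
    apply: etrans (csum_at0 _) _.
    rewrite bincoef0 mul1r addr0; exact: erefl.
  rewrite PfE -(heat_terms_residue expA AH0 kappa n).
  exact: (phi_coef1 E_log r0 (aP n.+1) (phiP n.+1)).
Qed.

End ZetaExpansion.

Theorem proposition3p8 (R : realType) (H : completeNormedModType R[i])
    (dot : {dot H for conjC}) (norm_dot : forall u : H, `|u| ^+ 2 = dot u u)
    (sepH : separable_space H)
    (L : operator H) (saL : selfadjoint dot L) (nonnegL : nonneg_operator dot L)
    (p : R) (p1 : 1 <= p) (schattenL : schatten dot p (resolvent L 1))
    (A : set R[i]) (expA : exponent_set A)
    (d : R[i] -> nat) (AH : R[i] -> nat -> R[i])
    (AH0 : forall a k, ~ (A a /\ (k <= d a)%N) -> AH a k = 0)
    (heatL : heat_expansion (fun t : R => trace dot (heat L t)) A d AH)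
    (AHlog : forall n k : nat, (0 < k)%N -> AH (- n%:R) k = 0) :
  [/\ (* zeta(s; L + z) exists for z near 0 and is holomorphic near (0, 0) *)
      (\forall z \near (0 : R[i]), is_zeta p L z (zeta p L z)) /\
      (\forall x \near ((0, 0) : R[i] * R[i]),
        differentiable (fun y : R[i] * R[i] => zeta p L y.2 y.1) x),
      (* the n-th derivative of log det (L + z) at z = 0 exists, with value *)
      forall n : nat, (0 < n)%N ->
        derivable (derive1n n.-1 (logdet p L)) 0 1 /\
        derive1n n (logdet p L) 0 =
          (-1) ^+ n.-1 * (n.-1)`!%:R *
          (Pf (zeta p L 0) n%:R
           + AH (- n%:R) 0%N / (n.-1)`!%:R * harmonic_number n.-1),
      (* Taylor expansion *)
      \forall z \near (0 : R[i]),
        logdet p L 0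
        + \sum_(1 <= n < N.+1) (-1) ^+ n.-1 / n%:R * Pf (zeta p L 0) n%:R * z ^+ n
        + \sum_(1 <= n < N.+1)
            (-1) ^+ n.-1 / n`!%:R * harmonic_number n.-1 * AH (- n%:R) 0%N * z ^+ n
        @[N --> \oo] --> logdet p L z
    & (* finiteness of the last sum *)
      finite_set [set n : nat | (0 < n)%N /\
        (-1) ^+ n.-1 / n`!%:R * harmonic_number n.-1 * AH (- n%:R) 0%N != 0]].
Proof.
have p0 : 0 < p by exact: lt_le_trans p1.
have [rho [r [K [M [a [phi [[rho0 r0 aP psK] [zP aE]]]]]]]] :=
  zeta_expansion norm_dot sepH saL nonnegL p0 schattenL expA AH0 heatL AHlog.
have r2 : 0 < r / 2 by rewrite divr_gt0.
have r2r : r / 2 < r by lra.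
have cr : cmod (r%:C : R[i]) = r by rewrite cmod_real gtr0_norm.
(* The norm for radius [r] bounds [|a n 1| * r], which makes the first-order coefficients summable
   against [rho ^+ n]. *)
have aM n : cmod (a n 1%N) <= M n / r.
  rewrite ler_pdivlMr//; apply: le_trans ((aP n).1 2%N).
  by rewrite big_nat_recr//= big_nat1 expr1 [X in _ <= _ + X]cmodM cr lerDr cmod_ge0.
have coefM : asum (fun n => a n 1%N * rho%:C ^+ n) (K / r).
  move=> n; apply: (@le_trans _ _ (\sum_(0 <= k < n) M k * rho ^+ k / r)); last first.
    by rewrite -mulr_suml ler_wpM2r ?invr_ge0 ?(ltW r0).
  apply: ler_sum => k _; rewrite cmodM cmodX cmod_real gtr0_norm// mulrAC.
  by rewrite ler_wpM2r ?exprn_ge0 ?(ltW rho0).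
(* The derivative in [s] at [0] is read off the power series in [s], whose first-order coefficient
   is a power series in [z]. *)
have logdetP : has_pseries rho (K / r) 0 (fun n => - a n 1%N) (logdet p L).
  split=> [|z]; first by under eq_fun do rewrite mulNr; exact: asumN.
  rewrite subr0 => zr; have [_ hz] := zP z zr.
  (* The radius is halved because [hz] holds on the open disc of radius [r], while [has_pseries]
     speaks of a closed one. *)
  have hs := has_pseriesW (ltW r2) (ltW r2r) (lexx _) (has_pseries_slice r0 zr aP psK).
  have hs' : has_pseries (r / 2) K 0 (fun k => csum (fun n => z ^+ n * a n k)) (zeta p L z).
    apply: eq_has_pseries hs _ => s; rewrite subr0 => sr.
    by rewrite hz//; exact: le_lt_trans r2r.
  have [_ /= e1] := has_pseries_derivable 1 r2 hs'.
  have zM : asum (fun n => z ^+ n * a n 1%N) (K / r).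
    apply: asum_dom coefM => n; rewrite mulrC !cmodM !cmodX ler_wpM2l ?cmod_ge0//.
    by rewrite lerXn2r ?nnegrE ?cmod_ge0// cmod_real gtr0_norm.
  rewrite /logdet e1 mul1r -(csumN zM); apply: eq_csum => n.
  by rewrite mulrC mulNr.
have coefE n : - a n.+1 1%N = (-1) ^+ n / n.+1%:R *
    (Pf (zeta p L 0) n.+1%:R + AH (- n.+1%:R) 0%N / n`!%:R * harmonic_number n).
  by rewrite aE exprS !mulN1r !mulNr opprK.
split; [split| | |].
- by apply/nearC_P; exists rho => // z; rewrite subr0 => /ltW/zP[].
- apply: nearCC_P; exists (Num.min r rho); first by rewrite lt_min r0.
  move=> [s z] /=; rewrite !subr0 !lt_min => /andP[sr _] /andP[_ zr].
  apply: (double_series_differentiable r0 aP psK) => //; last by rewrite subr0.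
  by move=> s' z'; rewrite subr0 => s'r /ltW/zP[_ h]; exact: h.
- case=> // n _; have [h _] := has_pseries_derivable n rho0 logdetP.
  have [_ e1] := has_pseries_derivable n.+1 rho0 logdetP.
  split; first exact: h.
  rewrite e1 coefE /= factS natrM.
  have n0 : (n.+1%:R : R[i]) != 0 by rewrite pnatr_eq0.
  have e2 (x y u v : R[i]) : x != 0 -> x * y * (u / x * v) = u * y * v.
    by move=> x0; field.
  exact: e2.
- apply/nearC_P; exists rho => // z; rewrite subr0 => zr.
  have zM : asum (fun n => - a n 1%N * z ^+ n) (K / r).
    apply: asum_dom coefM => n; rewrite !cmodM !cmodX cmodN ler_wpM2l ?cmod_ge0//.
    by rewrite lerXn2r ?nnegrE ?cmod_ge0// cmod_real gtr0_norm// ltW.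
  have := csum_cvg zM; have -> : csum (fun n => - a n 1%N * z ^+ n) = logdet p L z.
    by rewrite logdetP.2 ?subr0 ?(ltW zr).
  rewrite -(cvg_shiftS (series _)); apply: cvg_trans; apply: near_eq_cvg; near=> N.
  rewrite /series /= big_nat_recl// expr0 mulr1 -addrA; congr (_ + _).
    by rewrite -(has_pseries0 (ltW rho0) logdetP).
  rewrite -big_split /= big_add1; apply: eq_bigr => n _ /=; rewrite coefE factS natrM.
  have n0 : (n.+1%:R : R[i]) != 0 by rewrite pnatr_eq0.
  have f0 : (n`!%:R : R[i]) != 0 by rewrite pnatr_eq0 -lt0n fact_gt0.
  have e2 (x y u P h B w : R[i]) : x != 0 -> y != 0 ->
      u / x * (P + B / y * h) * w = u / x * P * w + u / (x * y) * h * B * w.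
    by move=> x0 y0; field; rewrite x0 y0.
  exact: e2.
(* A nonzero coefficient puts [- n] among the exponents with real part at most [0], of which there
   are finitely many. *)
- have hfin := exponents_le_finite expA 0.
  apply: sub_finite_set (_ : finite_set ((fun n : nat => - n%:R) @^-1` exponents_le A 0)).
    move=> n [_ n0]; rewrite /exponents_le /=; split; last first.
      by rewrite /= ReN Re_natr oppr_le0.
    apply: contrapT => nA; move/negP: n0; apply; rewrite AH0 ?mulr0//.
    by case.
  apply: finite_preimage hfin => m n _ _ /oppr_inj/eqP.
  by rewrite eqr_nat => /eqP.
Unshelve. all: by end_near. Qed.
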